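(* Let $u_0\in L^\infty(\mathbb{R})$ satisfy $0\le u_0\le 1$. Let $V\in \mathrm{Lip}(\mathbb{R})$ satisfy $V'\le 0$ on $[0,1]$. Let $\eta\in L^1(\mathbb{R})\cap L^\infty(\mathbb{R})$ satisfy $\mathrm{supp}\,\eta\subseteq \mathbb{R}_-$, $\eta\ge 0$, $\eta$ non-decreasing on $\mathbb{R}_-$, and $\int_{\mathbb{R}_-}\eta(x)\,dx=1$. For $\varepsilon>0$ let $u_\varepsilon$ be the solution of the Cauchy problem $$\partial_t u_\varepsilon+\partial_x\big[V(u_\varepsilon*\eta_\varepsilon)u_\varepsilon\big]=0,\qquad u_\varepsilon(0,\cdot)=u_0,\qquad \eta_\varepsilon(x):=\frac1\varepsilon\,\eta\Big(\frac x\varepsilon\Big),$$ and let $w_\varepsilon:=u_\varepsilon*\eta_\varepsilon$. Consider a sequence $\varepsilon_k\to0^+$ and assume that $w_{\varepsilon_k}\to u$ in $L^1_{\mathrm{loc}}(\mathbb{R}_+\times\mathbb{R})$ for some function $u\in L^\infty(\mathbb{R}_+\times\mathbb{R})$. Then $u$ is the entropy admissible solution of the Cauchy problem $$\partial_t u+\partial_x[V(u)u]=0,\qquad u(0,\cdot)=u_0 .$$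
   Context: Notation: $\mathbb{R}_-=]-\infty,0]$, $\mathbb{R}_+=[0,+\infty[$; $\mathrm{Lip}(\mathbb{R})$ is the space of Lipschitz continuous functions; $L^1_{\mathrm{loc}}(\mathbb{R}_+\times\mathbb{R})$ is the space of functions belonging to $L^1(\Omega)$ for every open bounded $\Omega\subseteq\mathbb{R}_+\times\mathbb{R}$ (so integrability holds up to $t=0$). The symbol $*$ denotes convolution in the $x$ variable only, so that $$w_\varepsilon(t,x)=\frac1\varepsilon\int_x^{+\infty}\eta\Big(\frac{x-y}{\varepsilon}\Big)u_\varepsilon(t,y)\,dy .$$ The kernel $\eta$ is an element of $L^1\cap L^\infty$, so its value at the single point $0$ is immaterial. The solution $u_\varepsilon$ is the unique function in $L^\infty(\mathbb{R}_+\times\mathbb{R})$ solving the nonlocal Cauchy problem in the sense of distributions, i.e. $\iint_{\mathbb{R}_+\times\mathbb{R}}u_\varepsilon[\partial_t\varphi+V(u_\varepsilon*\eta_\varepsilon)\partial_x\varphi]\,dx\,dt+\int_{\mathbb{R}}u_0(x)\varphi(0,x)\,dx=0$ for every $\varphi\in C^\infty_c(\mathbb{R}_+\times\mathbb{R})$; under the stated assumptions it is known that it exists, is unique, satisfies $0\le u_\varepsilon\le 1$, and has a representative in $C^0(\mathbb{R}_+,L^1_{\mathrm{loc}}(\mathbb{R}))$, which is used. A function $u\in L^\infty(\mathbb{R}_+\times\mathbb{R})$ is the (unique, by Kruzhkov's theory) entropy admissible solution of $\partial_tu+\partial_x[V(u)u]=0$, $u(0,\cdot)=u_0$ if for every $c\in\mathbb{R}$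 and every $\phi\in C^\infty_c(\mathbb{R}_+\times\mathbb{R})$ with $\phi\ge0$, $$\iint_{\mathbb{R}_+\times\mathbb{R}}\big[|u-c|\,\partial_t\phi+\mathrm{sign}(u-c)\,(V(u)u-V(c)c)\,\partial_x\phi\big]dx\,dt+\int_{\mathbb{R}}|u_0(x)-c|\,\phi(0,x)\,dx\ge0;$$ equivalently, the analogous inequality holds with $|u-c|$ and the associated flux replaced by any convex entropy $\alpha$ and flux $\beta$ with $\beta'(u)=\alpha'(u)[V(u)+uV'(u)]$. *)

(* Defs.v *)
From HB Require Import structures.
From mathcomp Require Import all_boot all_order all_algebra.
From mathcomp Require Import all_classical all_reals all_analysis.
Set Implicit Arguments.
Unset Strict Implicit.
Unset Printing Implicit Defensive.
Import Order.TTheory GRing.Theory Num.Theory.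
Import numFieldNormedType.Exports.
Local Open Scope classical_set_scope.
Local Open Scope ring_scope.

(* Points of the plane are written z = (t, x).  Elements of L^1, L^oo, ... are
   given by (Borel measurable) representatives. *)

Notation leb := lebesgue_measure (only parsing).
Notation leb2 := (lebesgue_measure \x lebesgue_measure)%E (only parsing).

Section Defs.
Context {R : realType}.
Implicit Types (u w phi : R * R -> R) (V eta : R -> R).

Definition Qplus : set (R * R) := [set z | 0 <= z.1].

Definition Dt phi : R * R -> R := fun z => 'D_((1, 0) : R * R) phi z.
Definition Dx phi : R * R -> R := fun z => 'D_((0, 1) : R * R) phi z.

Fixpoint Ck (n : nat) phi : Prop :=
  match n with
  | 0%N => continuous phi
  | m.+1 => (forall z, differentiable phi z) /\ Ck m (Dt phi) /\ Ck m (Dx phi)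
  end.

(* C^oo_c(R_+ x R): restrictions to R_+ x R of smooth compactly supported
   functions on the plane; they need not vanish at t = 0.  Only the values on
   [Qplus] are used below. *)
Definition test_function phi : Prop :=
  (forall n, Ck n phi) /\ compact (closure [set z | phi z != 0]).

(* L^oo(R_+ x R); the values outside [Qplus] are irrelevant. *)
Definition Linfty_Qplus u : Prop := u \_ Qplus \in Lfun leb2 +oo%E.

(* The closure of Omega may meet the line t = 0: locality is up to initial time.
   Both functions are automatically in L^1_loc in the intended use, where they
   are essentially bounded on [Qplus]. *)
Definition cvg_L1loc_Qplus (w_ : nat -> R * R -> R) u : Prop :=
  forall Omega : set (R * R),
    open Omega -> bounded_set Omega -> Omega `<=` Qplus ->
    (\int[leb2]_(z in Omega) `|w_ k z - u z|%:E)%E @[k --> \oo] --> 0%E.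

Definition rescale eta (eps : R) : R -> R := fun x => eps^-1 * eta (x / eps).

(* The integrand is integrable for almost every t when u is essentially bounded
   and eta is in L^1; on the remaining null set of times the value of
   [Rintegral] is irrelevant. *)
Definition convx u eta : R * R -> R :=
  fun z => \int[leb]_y (eta (z.2 - y) * u (z.1, y)).

Definition nonlocal_solution V eta (u0 : R -> R) (eps : R) u : Prop :=
  Linfty_Qplus u /\
  forall phi, test_function phi ->
    \int[leb2]_(z in Qplus)
       (u z * (Dt phi z + V (convx u (rescale eta eps) z) * Dx phi z))
    + \int[leb]_x (u0 x * phi (0, x)) = 0.

Definition entropy_solution V (u0 : R -> R) u : Prop :=
  Linfty_Qplus u /\
  forall (c : R) phi, test_function phi -> (forall z, Qplus z -> 0 <= phi z) ->
    0 <= \int[leb2]_(z in Qplus)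
           (`|u z - c| * Dt phi z
            + Num.sg (u z - c) * (V (u z) * u z - V c * c) * Dx phi z)
         + \int[leb]_x (`|u0 x - c| * phi (0, x)).

End Defs.

(* Main.v *)
Require Import Defs.
From HB Require Import structures.
From mathcomp Require Import all_boot all_order all_algebra.
From mathcomp Require Import all_classical all_reals all_analysis.
From mathcomp Require Import measurable_realfun ess_sup_inf ring lra.
Import Order.TTheory GRing.Theory Num.Theory.
Import numFieldNormedType.Exports.
Local Open Scope classical_set_scope.
Local Open Scope ring_scope.

(** Write [w = u * eta_eps] and [kappa z = eta (- z)], a non-increasing density on
the half line.  By a layer-cake argument, [|int kappa j| <= K sup |J|] when [J] is the
primitive of [j] vanishing at 0.  Applied to the conservation law this makes [w]
Lipschitz in time and space, and applied along approximate characteristics it propagates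
[0 <= u <= 1] (the velocity is non-increasing in [w]).

For a convex entropy [alpha] put
[G p b = Phi p - Phi b - V b (alpha' p - alpha' b)] with [Phi' = alpha'' V]: since [V]
decreases, [G <= 0].  At a fixed time the entropy production of [w] against [phi] is, up
to [int kappa z |w (x + z) - w x|], an integral against [kappa] of
[z |-> - int u (x + z) d/dx (phi G (w (x + z), w x))], whose primitives in [z] have a
sign; monotonicity of [kappa] then gives Kruzhkov's inequality for [w] with that single
error term.  It vanishes as [eps -> 0] because a sequence that converges in [L^1_loc] has
a uniform [L^1_loc] modulus of continuity in [x]. *)

Set Implicit Arguments.
Unset Strict Implicit.
Unset Printing Implicit Defensive.

(** * Integrals against integrable weights *)

(** The solution is only bounded and measurable, so computations are made on the mollifications
    [vm], [gm] of the solution and of its flux, with [mm] the kernel average of [vm]. What closes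
    the argument is that [Wn] is Lipschitz at a fixed scale: [gm] and [V mm * vm] then differ by
    O(d), without any regularity of the solution itself.

    Two limits are kept apart. At a fixed scale [d] tends to 0, and constants may depend on the
    kernel bound [K], which blows up like the inverse of the scale, and on the smoothing of the
    entropy. The scale vanishes only afterwards, and the constant [Cscale] must then be free of the
    kernel. This is why the coefficient [3 * L * C] of the error term is drawn from a bound on the
    slope of the entropy and not on its second derivative.

    Nothing places the solution in [0, 1] beforehand, while [V] is monotone only there. The bounds
    are therefore propagated in an approximate form, on increments of the primitive [Um], together
    with the approximate range of [mm] that they imply. *)

Section bounded_measurable.
Context d (T : measurableType d) (R : realType).
Implicit Types F G : T -> R.

(** The bound holds everywhere, not essentially, so that sections, translates and compositions
    inherit it; [igrM] then makes every product with an integrable weight integrable. *)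
Definition bmf F := measurable_fun setT F /\ exists M, forall x, `|F x| <= M.

Lemma bmf_cst c : bmf (fun=> c).
Proof. by split => //; exists `|c|. Qed.

Lemma bmfD F G : bmf F -> bmf G -> bmf (fun x => F x + G x).
Proof.
move=> [mF [M FM]] [mG [N GN]]; split; first exact: measurable_funD.
by exists (M + N) => x; rewrite (le_trans (ler_normD _ _))// lerD.
Qed.

Lemma bmfN F : bmf F -> bmf (fun x => - F x).
Proof.
move=> [mF [M FM]]; split; first exact: measurableT_comp.
by exists M => x; rewrite normrN.
Qed.

Lemma bmfB F G : bmf F -> bmf G -> bmf (fun x => F x - G x).
Proof. by move=> bF bG; apply: bmfD => //; exact: bmfN. Qed.

Lemma bmfM F G : bmf F -> bmf G -> bmf (fun x => F x * G x).
Proof.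
move=> [mF [M FM]] [mG [N GN]]; split; first exact: measurable_funM.
by exists (M * N) => x; rewrite normrM ler_pM.
Qed.

Lemma bmf_norm F : bmf F -> bmf (fun x => `|F x|).
Proof.
move=> [mF [M FM]]; split; first exact: measurableT_comp.
by exists M => x; rewrite normr_id.
Qed.

Lemma bmf_indic (A : set T) : measurable A -> bmf (\1_A : T -> R).
Proof.
move=> mA; split => //; exists 1 => x.
by rewrite indicE; case: (_ \in _); rewrite ?normr1 ?normr0.
Qed.

End bounded_measurable.

Lemma bmf_comp d d' (T : measurableType d) (S : measurableType d') (R : realType)
    (h : S -> T) (F : T -> R) :
  measurable_fun setT h -> bmf F -> bmf (fun x => F (h x)).
Proof.
move=> mh [mF [M FM]]; split; first exact: measurableT_comp.
by exists M => x; exact: FM.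
Qed.

Section weighted_integral.
Context d (T : measurableType d) (R : realType).
Variable mu : {measure set T -> \bar R}.
Implicit Types (p F G : T -> R).

Definition igr p := mu.-integrable setT (EFin \o p).

Lemma igrM p F : igr p -> bmf F -> igr (fun x => p x * F x).
Proof.
move=> ip [mF [M FM]].
have : mu.-integrable setT ((EFin \o p) \* (EFin \o F))%E.
  apply: integrableMl => //.
  by exists M; split => [|y My x _]; [exact: num_real|apply: le_trans (FM x) (ltW My)].
by apply: eq_integrable => // x _; rewrite /= EFinM.
Qed.

Lemma igrD p F : igr p -> igr F -> igr (fun x => p x + F x).
Proof.
move=> ip iF; have := integrableD measurableT ip iF.
by apply: eq_integrable.
Qed.

Lemma igrB p F : igr p -> igr F -> igr (fun x => p x - F x).
Proof.
move=> ip iF; have := integrableB measurableT ip iF.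
by apply: eq_integrable.
Qed.

Lemma igrZ c p : igr p -> igr (fun x => c * p x).
Proof.
move=> ip; have := integrableZl measurableT c ip.
by apply: eq_integrable.
Qed.

Lemma igr_norm p : igr p -> igr (fun x => `|p x|).
Proof. exact: integrable_norm. Qed.

Lemma igr_meas p : igr p -> measurable_fun setT p.
Proof. by move=> /integrableP[/measurable_EFinP]. Qed.

Lemma igr_le p F : measurable_fun setT F -> (forall x, `|F x| <= p x) ->
  igr p -> igr F.
Proof.
move=> mF Fp; apply: le_integrable => //; first exact/measurable_EFinP.
by move=> x _; rewrite /= lee_fin (le_trans (Fp x))// ler_norm.
Qed.

Lemma RintD p F : igr p -> igr F ->
  \int[mu]_x (p x + F x) = \int[mu]_x p x + \int[mu]_x F x.
Proof. exact: RintegralD. Qed.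

Lemma RintB p F : igr p -> igr F ->
  \int[mu]_x (p x - F x) = \int[mu]_x p x - \int[mu]_x F x.
Proof. exact: RintegralB. Qed.

Lemma RintZ c p : igr p -> \int[mu]_x (c * p x) = c * \int[mu]_x p x.
Proof. by move=> ip; exact: RintegralZl. Qed.

Lemma Rint_le p F : igr p -> igr F -> (forall x, p x <= F x) ->
  \int[mu]_x p x <= \int[mu]_x F x.
Proof. by move=> ip iF pF; apply: le_Rintegral. Qed.

(** Both sides are [fine] of one extended integral, so measurability is enough. This allows
    comparisons with functions whose integrability is not yet known, such as convolutions of a raw
    solution. *)
Lemma Rint_ae_eq p F : measurable_fun setT p -> measurable_fun setT F ->
  {ae mu, forall x, p x = F x} -> \int[mu]_x p x = \int[mu]_x F x.
Proof.
move=> mp mF pF; rewrite /Rintegral; congr fine; apply: ae_eq_integral => //.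
- exact/measurable_EFinP.
- exact/measurable_EFinP.
- by apply: filterS pF => x /= -> _.
Qed.

(** The minimum of [p] and [F] equals [p] almost everywhere and lies below [F] everywhere, which
    reduces the claim to the pointwise comparison. *)
Lemma Rint_ae_le p F : igr p -> igr F -> {ae mu, forall x, p x <= F x} ->
  \int[mu]_x p x <= \int[mu]_x F x.
Proof.
move=> ip iF pF.
have mp := igr_meas ip; have mF := igr_meas iF.
have mm : measurable_fun setT (fun x => Num.min (p x) (F x)).
  exact: measurable_minr.
have im : igr (fun x => Num.min (p x) (F x)).
  apply: (igr_le mm _ (igrD (igr_norm ip) (igr_norm iF))) => x.
  rewrite minEle; case: ifP => _; first by rewrite lerDl.
  by rewrite lerDr.
rewrite (@Rint_ae_eq p (fun x => Num.min (p x) (F x)))//.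
  by apply: Rint_le => // x; rewrite ge_min lexx orbT.
by apply: filterS pF => x /= pF; rewrite min_l.
Qed.

Lemma Rint_norm p : igr p -> `|\int[mu]_x p x| <= \int[mu]_x `|p x|.
Proof. exact: le_normr_Rintegral. Qed.

Lemma Rint_wle p F c : igr p -> (forall x, 0 <= p x) -> bmf F ->
  (forall x, F x <= c) -> \int[mu]_x (p x * F x) <= c * \int[mu]_x p x.
Proof.
move=> ip p0 bF Fc; rewrite -RintZ//; apply: Rint_le; first exact: igrM.
  exact: igrZ.
by move=> x; rewrite mulrC ler_wpM2r.
Qed.

Lemma Rint_wge p F c : igr p -> (forall x, 0 <= p x) -> bmf F ->
  (forall x, c <= F x) -> c * \int[mu]_x p x <= \int[mu]_x (p x * F x).
Proof.
move=> ip p0 bF Fc; rewrite -RintZ//; apply: Rint_le; first exact: igrZ.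
  exact: igrM.
by move=> x; rewrite [leRHS]mulrC ler_wpM2r.
Qed.

Lemma Rint_wnorm p F c : igr p -> (forall x, 0 <= p x) -> bmf F ->
  (forall x, `|F x| <= c) -> `|\int[mu]_x (p x * F x)| <= c * \int[mu]_x p x.
Proof.
move=> ip p0 bF Fc; rewrite ler_norml -mulNr; apply/andP; split.
  by apply: Rint_wge => // x; have := Fc x; rewrite ler_norml => /andP[].
by apply: Rint_wle => // x; have := Fc x; rewrite ler_norml => /andP[].
Qed.

Lemma Rint_ge0 p : (forall x, 0 <= p x) -> 0 <= \int[mu]_x p x.
Proof. by move=> p0; apply: Rintegral_ge0. Qed.

Lemma Rint0 : \int[mu]_x (0 : R) = 0.
Proof. by rewrite /Rintegral integral0. Qed.

End weighted_integral.

Section differentiation.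
Context d (T : measurableType d) (R : realType).
Variable mu : {measure set T -> \bar R}.

Lemma is_derive_Rint (p : T -> R) (F F' : R -> T -> R) (M x : R) :
  igr mu p -> (forall x, bmf (F x)) ->
  (forall (x : R) y, is_derive x (1 : R) (F ^~ y) (F' x y)) ->
  (forall x y, `|F' x y| <= M) ->
  is_derive x (1 : R) (fun x => \int[mu]_y (p y * F x y)) (\int[mu]_y (p y * F' x y)).
Proof.
move=> ip bF dF F'M.
pose f x y := p y * F x y.
have dpF z y : is_derive z (1 : R) (f ^~ y) (p y * F' z y).
  by rewrite (_ : f ^~ y = p y *: (F ^~ y)) //; exact: is_deriveZ.
have pE z y : partial1of2 f z y = p y * F' z y.
  by rewrite partial1of2E; apply: derive_val.
have xI : `]x - 1, x + 1[%classic x.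
  by rewrite /= in_itv/= ltrDl ltrBlDr ltrDl ltr01.
have M0 (y : T) : 0 <= M by exact: le_trans (normr_ge0 _) (F'M x y).
have := @cvg_differentiation_under_integral _ _ _ mu f setT measurableT x (x - 1)
  (x + 1) xI _ _ (fun y => M * `|p y|) _ _ _.
move=> H.
have {}H : h^-1 *: (\int[mu]_y f (h + x) y - \int[mu]_y f x y) @[h --> 0^']
    --> \int[mu]_y partial1of2 f x y.
  apply: H.
  - by move=> z _; exact: igrM.
  - by move=> z y _ _; case: (dpF z y).
  - by move=> y; rewrite mulr_ge0// (M0 y).
  - exact/igrZ/igr_norm.
  - by move=> z y _ _; rewrite pE normrM mulrC ler_wpM2r.
rewrite (_ : \int[mu]_y partial1of2 f x y = \int[mu]_y (p y * F' x y)) in H; last first.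
  by apply: eq_Rintegral => y _; rewrite pE.
have H' : h^-1 *: (\int[mu]_y f (h *: (1:R) + x) y - \int[mu]_y f x y) @[h --> 0^']
    --> \int[mu]_y (p y * F' x y).
  by under eq_fun do rewrite [_ *: 1]mulr1.
apply: DeriveDef; first by apply/cvg_ex; exists (\int[mu]_y (p y * F' x y)).
by apply: cvg_lim => //.
Qed.

End differentiation.

Section fubini.
Context d1 d2 (T1 : measurableType d1) (T2 : measurableType d2) (R : realType).
Variables (m1 : {sigma_finite_measure set T1 -> \bar R}).
Variables (m2 : {sigma_finite_measure set T2 -> \bar R}).

(** Tonelli makes the integrals of the positive and negative parts measurable; subtraction and
    [fine] preserve this, whether or not the sections are integrable. *)
Lemma measurable_Rint (H : T1 * T2 -> R) : measurable_fun setT H ->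
  measurable_fun setT (fun a => \int[m2]_b H (a, b)).
Proof.
move=> mH; apply: measurableT_comp => //.
have mE : measurable_fun setT (EFin \o H) by exact/measurable_EFinP.
rewrite (_ : (fun a => _) = (fun a => fubini_F m2 ((EFin \o H)^\+)%E a -
   fubini_F m2 ((EFin \o H)^\-)%E a)%E); last first.
  apply/funext => a; rewrite [LHS]integralE /fubini_F /=.
  by congr (_ - _)%E; apply: eq_integral => b _; rewrite ?funeposE ?funenegE.
apply: emeasurable_funB.
  by apply: measurable_fun_fubini_tonelli_F => //; exact: measurable_funepos.
by apply: measurable_fun_fubini_tonelli_F => //; exact: measurable_funeneg.
Qed.

Lemma bmf_Rint p (F : T1 * T2 -> R) : igr m2 p -> bmf F ->
  bmf (fun a => \int[m2]_b (p b * F (a, b))).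
Proof.
move=> ip [mF [M FM]]; split.
  apply: (@measurable_Rint (fun z => p z.2 * F z)).
  apply: measurable_funM => //.
  exact: (measurableT_comp (igr_meas ip) measurable_snd).
exists (`|M| * \int[m2]_b `|p b|) => a.
have bFa : bmf (fun b => F (a, b)).
  split; last by exists M.
  exact: (measurableT_comp mF (measurable_pair1 a)).
apply: (le_trans (Rint_norm (igrM ip bFa))).
rewrite -RintZ//; last exact: igr_norm.
apply: Rint_le; first exact/igr_norm/igrM.
  exact/igrZ/igr_norm.
move=> b; rewrite normrM mulrC ler_wpM2r//.
by rewrite (le_trans (FM _))// ler_norm.
Qed.

Lemma igr_prod p1 p2 : igr m1 p1 -> igr m2 p2 ->
  igr (m1 \x m2)%E (fun z => p1 z.1 * p2 z.2).
Proof.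
move=> i1 i2; apply/integrable12ltyP.
  apply/measurable_EFinP/measurable_funM.
    exact: (measurableT_comp (igr_meas i1) measurable_fst).
  exact: (measurableT_comp (igr_meas i2) measurable_snd).
under eq_integral => x _.
  under eq_integral => y _ do rewrite /= normrM EFinM.
  rewrite ge0_integralZl//; first last.
  - by apply/measurable_EFinP/measurableT_comp => //; exact: igr_meas i2.
  over.
rewrite /= ge0_integralZr//.
- apply: lte_mul_pinfty.
  + exact: integral_ge0.
  + rewrite ge0_fin_numE; last exact: integral_ge0.
    by move/integrableP: i1 => [].
  + by move/integrableP: i2 => [].
- by apply/measurable_EFinP/measurableT_comp => //; exact: igr_meas i1.
- exact: integral_ge0.
Qed.

Section swap.
Variables (p1 : T1 -> R) (p2 : T2 -> R) (F : T1 * T2 -> R).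
Hypotheses (i1 : igr m1 p1) (i2 : igr m2 p2) (bF : bmf F).

(** Since [F] is bounded, every section of the integrand is integrable, not just almost every one,
    so [fine] can be removed at each [a]. *)
Lemma Rint_prod1 : \int[(m1 \x m2)%E]_z (p1 z.1 * p2 z.2 * F z) =
  \int[m1]_a (p1 a * \int[m2]_b (p2 b * F (a, b))).
Proof.
have iF := igrM (igr_prod i1 i2) bF.
rewrite {1}/Rintegral -integral12_prod_meas1//; congr fine.
apply: eq_integral => a _; rewrite /fubini_F.
have bFa : bmf (fun b => F (a, b)).
  by apply: (bmf_comp (h := pair a)) => //; exact: measurable_pair1.
rewrite -RintZ; last exact: igrM.
rewrite /Rintegral fineK.
  by apply: eq_integral => b _; rewrite mulrA.
by apply: integrable_fin_num => //; exact/igrZ/igrM.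
Qed.

Lemma Rint_prod2 : \int[(m1 \x m2)%E]_z (p1 z.1 * p2 z.2 * F z) =
  \int[m2]_b (p2 b * \int[m1]_a (p1 a * F (a, b))).
Proof.
have iF := igrM (igr_prod i1 i2) bF.
rewrite {1}/Rintegral -integral21_prod_meas1//; congr fine.
apply: eq_integral => b _; rewrite /fubini_G.
have bFb : bmf (fun a => F (a, b)).
  by apply: (bmf_comp (h := pair^~ b)) => //; exact: measurable_pair2.
rewrite -RintZ; last exact: igrM.
rewrite /Rintegral fineK.
  by apply: eq_integral => a _ /=; rewrite mulrA (mulrC (p2 b)).
by apply: integrable_fin_num => //; exact/igrZ/igrM.
Qed.

Lemma Rint_swap : \int[m1]_a (p1 a * \int[m2]_b (p2 b * F (a, b))) =
  \int[m2]_b (p2 b * \int[m1]_a (p1 a * F (a, b))).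
Proof. by rewrite -Rint_prod1 Rint_prod2. Qed.

End swap.
End fubini.

Section measure_preserving.
Context d (T : measurableType d) (R : realType).
Variable mu : {measure set T -> \bar R}.
Variable phi : T -> T.
Hypothesis mphi : measurable_fun setT phi.
Hypothesis phi_mu : forall A, measurable A -> mu (phi @^-1` A) = mu A.

Lemma igr_pres (F : T -> R) : igr mu F -> igr mu (fun x => F (phi x)).
Proof.
move=> iF; apply/integrableP; split.
  by apply/measurable_EFinP; apply: (measurableT_comp (igr_meas iF) mphi).
have /integrableP[mF] := iF; apply: le_lt_trans.
rewrite [leRHS](_ : _ = (\int[pushforward mu phi]_x `|(F x)%:E|)%E); last first.
  by apply: eq_measure_integral => A mA _; exact/esym/phi_mu.
by rewrite ge0_integral_pushforward//; apply: measurableT_comp.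
Qed.

Lemma Rint_pres (F : T -> R) : igr mu F -> \int[mu]_x F (phi x) = \int[mu]_x F x.
Proof.
move=> iF; rewrite /Rintegral; congr fine.
rewrite [RHS](_ : _ = (\int[pushforward mu phi]_x (F x)%:E)%E); last first.
  by apply: eq_measure_integral => A mA _; exact/esym/phi_mu.
rewrite (integral_pushforward mphi)//; last exact: igr_pres.
by have /integrableP[] := iF.
Qed.

End measure_preserving.

(** * Translations and reflections of Lebesgue measure *)

Section lebesgue_translation.
Variable R : realType.
Notation leb := (@lebesgue_measure R).
Notation leb2 := (@lebesgue_measure R \x @lebesgue_measure R)%E.
Implicit Type F : R -> R.

Lemma measurable_shift (c : R) : measurable_fun setT (fun x : R => c + x).
Proof. exact: measurable_funD. Qed.

(** Uniqueness of Lebesgue measure: the pushforward under a translation agrees with it on half-open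
    intervals. *)
Lemma lebesgue_shift (c : R) (A : set R) : measurable A ->
  leb ((fun x : R => c + x) @^-1` A) = leb A.
Proof.
move=> mA.
pose f : {mfun measurableTypeR R >-> measurableTypeR R} :=
  HB.pack (fun x : R => c + x) (isMeasurableFun.Build _ _ (measurableTypeR R)
      (measurableTypeR R) _ (measurable_shift c)).
rewrite -[LHS]/(pushforward leb f A).
apply/esym/lebesgue_measure_unique => //= _ [[a b]] _ <-.
rewrite /pushforward (_ : f @^-1` `]a, b] = `]a - c, b - c]%classic); last first.
  apply/seteqP; split => x; rewrite /f /= !in_itv/=.
    by rewrite ltrBlDl lerBrDl.
  by rewrite ltrBlDl lerBrDl.
rewrite !lebesgue_measure_itv/= !lte_fin ltrD2r; case: ifP => // _.
by rewrite -!EFinB; congr EFin; ring.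
Qed.

Lemma igr_shift c F : igr leb F -> igr leb (fun x => F (c + x)).
Proof. exact: (@igr_pres _ _ _ leb _ (measurable_shift c) (lebesgue_shift c)). Qed.

Lemma Rint_shift c F : igr leb F -> \int[leb]_x F (c + x) = \int[leb]_x F x.
Proof. exact: (@Rint_pres _ _ _ leb _ (measurable_shift c) (lebesgue_shift c)). Qed.

Lemma igr_opp F : igr leb F -> igr leb (fun x => F (- x)).
Proof.
apply: (@igr_pres _ _ _ leb -%R) => [|A mA]; first exact: oppr_measurable.
exact: lebesgue_measureN.
Qed.

Lemma Rint_opp F : igr leb F -> \int[leb]_x F (- x) = \int[leb]_x F x.
Proof.
apply: (@Rint_pres _ _ _ leb -%R) => [|A mA]; first exact: oppr_measurable.
exact: lebesgue_measureN.
Qed.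

Lemma measurable_shift2 (c : R * R) :
  measurable_fun setT (fun z : R * R => (c.1 + z.1, c.2 + z.2)).
Proof.
by apply/measurable_fun_pairP; split; apply: measurable_funD => //.
Qed.

Lemma lebesgue_shift2 (c : R * R) (A : set (R * R)) : measurable A ->
  leb2 ((fun z : R * R => (c.1 + z.1, c.2 + z.2)) @^-1` A) = leb2 A.
Proof.
move=> mA.
pose RR : measurableType _ := (measurableTypeR R * measurableTypeR R)%type.
pose f : {mfun RR >-> RR} :=
  HB.pack (fun z : R * R => (c.1 + z.1, c.2 + z.2))
    (isMeasurableFun.Build _ _ RR RR _ (measurable_shift2 c)).
rewrite -[LHS]/(pushforward leb2 f A).
apply/esym/product_measure_unique => //= B C mB mC.
rewrite /pushforward (_ : f @^-1` (B `*` C) =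
  ((fun x : R => c.1 + x) @^-1` B) `*` ((fun x : R => c.2 + x) @^-1` C))//.
have mS c' D : measurable D -> measurable ((fun x : R => c' + x) @^-1` D).
  by move=> mD; have := measurable_shift c' measurableT mD; rewrite setTI.
rewrite product_measure1E; [|exact: mS..].
congr (_ * _)%E; exact: lebesgue_shift.
Qed.

Lemma Rint_shift2 (c : R * R) (F : R * R -> R) : igr leb2 F ->
  \int[leb2]_z F (c.1 + z.1, c.2 + z.2) = \int[leb2]_z F z.
Proof. exact: (@Rint_pres _ _ _ leb2 _ (measurable_shift2 c) (lebesgue_shift2 c)). Qed.

Lemma igr_itv (a b : R) : igr leb (\1_`[a, b] : R -> R).
Proof. exact: integrable_indic_itv. Qed.

Lemma Rint_indic (A : set R) F :
  \int[leb]_x (\1_A x * F x) = \int[leb]_(x in A) F x.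
Proof.
rewrite [RHS]Rintegral_mkcond; apply: eq_Rintegral => x _.
by rewrite patchE indicE; case: ifP => _; rewrite ?mul1r ?mul0r.
Qed.

Lemma Rint_itv (a b : R) : a <= b -> \int[leb]_x (\1_`[a, b] x : R) = b - a.
Proof.
move=> ab; under eq_Rintegral do rewrite -[\1__ _]mulr1.
rewrite Rint_indic Rintegral_cst// mul1r.
rewrite [X in fine X](_ : _ = (b - a)%:E)//.
apply: etrans (lebesgue_measure_itv `[a, b]) _; rewrite /= lte_fin -EFinB.
by case: ltgtP ab => // ->; rewrite subrr.
Qed.

Lemma indic_itvE (i : interval R) (x : R) : \1_[set` i] x = (x \in i)%:R :> R.
Proof.
rewrite indicE; congr (nat_of_bool _)%:R.
by apply/idP/idP => [/set_mem|h]//; exact/mem_set.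
Qed.

Lemma mindic_itv (i : interval R) : measurable_fun setT (\1_[set` i] : R -> R).
Proof. exact: measurable_indic. Qed.

Lemma indic_itv_ge0 (a b x : R) : 0 <= \1_`[a, b] x :> R.
Proof. by rewrite indicE. Qed.

End lebesgue_translation.

Section lebesgue_fubini.
Variable R : realType.
Notation leb := (@lebesgue_measure R).
Notation leb2 := (@lebesgue_measure R \x @lebesgue_measure R)%E.

Lemma measurable_Rint_leb d (T : measurableType d) (H : T * R -> R) :
  measurable_fun setT H -> measurable_fun setT (fun a => \int[leb]_b H (a, b)).
Proof. by move=> mH; apply: measurable_Rint; exact: mH. Qed.

Lemma bmf_Rint_leb d (T : measurableType d) (p : R -> R) (F : T * R -> R) :
  igr leb p -> bmf F -> bmf (fun a => \int[leb]_b (p b * F (a, b))).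
Proof. by move=> ip bF; apply: bmf_Rint => //; exact: bF. Qed.

Lemma Rint_leb2 (p1 p2 : R -> R) (F : R * R -> R) : igr leb p1 -> igr leb p2 -> bmf F ->
  \int[leb2]_z (p1 z.1 * p2 z.2 * F z) =
  \int[leb]_a (p1 a * \int[leb]_b (p2 b * F (a, b))).
Proof. exact: Rint_prod1. Qed.

Lemma Rint_leb_swap (p1 p2 : R -> R) (F : R -> R -> R) : igr leb p1 -> igr leb p2 ->
  bmf (fun z : R * R => F z.1 z.2) ->
  \int[leb]_a (p1 a * \int[leb]_b (p2 b * F a b)) =
  \int[leb]_b (p2 b * \int[leb]_a (p1 a * F a b)).
Proof. by move=> i1 i2 bF; exact: (Rint_swap i1 i2 bF). Qed.

Lemma igr_leb2 (p1 p2 : R -> R) : igr leb p1 -> igr leb p2 ->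
  igr leb2 (fun z => p1 z.1 * p2 z.2).
Proof. exact: igr_prod. Qed.

End lebesgue_fubini.

(** * One-variable calculus with explicit derivatives *)

Section calculus.
Variable R : realType.
Notation leb := (@lebesgue_measure R).
Implicit Types f g : R -> R.

(** Carrying the derivative as a function lets the differentiation rules build it as a term, which
    [dfn_ext] then brings to the desired shape. *)
Definition dfn f f' := forall x : R, is_derive x (1 : R) f (f' x).

Lemma dfn_cts f f' : dfn f f' -> continuous f.
Proof.
move=> df x; apply/differentiable_continuous/derivable1_diffP.
by case: (df x).
Qed.

Lemma dfn_mvt f f' (a b : R) : a <= b -> dfn f f' ->
  exists c, [/\ a <= c, c <= b & f b - f a = f' c * (b - a)].
Proof.
move=> ab df; have [|x xab|c] := @MVT_segment R f f' a b ab.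
- by move=> x _; exact: df.
- exact/continuous_subspaceT/(dfn_cts df).
by rewrite in_itv/= => /andP[ac cb] E; exists c.
Qed.

Lemma dfn_lip f f' M a b : dfn f f' -> (forall x, `|f' x| <= M) ->
  `|f b - f a| <= M * `|b - a|.
Proof.
move=> df fM; wlog ab : a b / a <= b.
  move=> W; have [|/ltW] := leP a b; first exact: W.
  by rewrite distrC (distrC b); exact: W.
have [c [_ _ ->]] := dfn_mvt ab df.
by rewrite normrM ler_wpM2r.
Qed.

Lemma dfn_le f f' a b : a <= b -> dfn f f' -> (forall x, a <= x <= b -> 0 <= f' x) ->
  f a <= f b.
Proof.
move=> ab df f0; have [c [ac cb E]] := dfn_mvt ab df.
by rewrite -subr_ge0 E mulr_ge0 ?subr_ge0// f0// ac cb.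
Qed.

Lemma dfn_ext f f' g' : dfn f f' -> f' =1 g' -> dfn f g'.
Proof. by move=> df e x; rewrite -e; exact: df. Qed.

Lemma dfnM f f' g g' : dfn f f' -> dfn g g' ->
  dfn (fun x => f x * g x) (fun x => f' x * g x + f x * g' x).
Proof.
move=> df dg x; have := is_deriveM (df x) (dg x).
rewrite (_ : f x *: g' x + _ = f' x * g x + f x * g' x)//.
by rewrite addrC /GRing.scale/= (mulrC (g x)).
Qed.

Lemma dfnD f f' g g' : dfn f f' -> dfn g g' ->
  dfn (fun x => f x + g x) (fun x => f' x + g' x).
Proof. by move=> df dg x; exact: (is_deriveD (df x) (dg x)). Qed.

Lemma dfnB f f' g g' : dfn f f' -> dfn g g' ->
  dfn (fun x => f x - g x) (fun x => f' x - g' x).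
Proof. by move=> df dg x; exact: (is_deriveB (df x) (dg x)). Qed.

Lemma dfnZ c f f' : dfn f f' -> dfn (fun x => c * f x) (fun x => c * f' x).
Proof. by move=> df x; exact: (is_deriveZ c (df x)). Qed.

Lemma dfn_comp f f' g g' : dfn f f' -> dfn g g' ->
  dfn (fun x => f (g x)) (fun x => f' (g x) * g' x).
Proof. by move=> df dg x; exact: (is_derive1_comp (df (g x)) (dg x)). Qed.

Lemma dfn_cst c : dfn (fun=> c) (fun=> 0).
Proof. by move=> x; exact: is_derive_cst. Qed.

Lemma dfn_id : dfn (fun x => x) (fun=> 1).
Proof. by move=> x; exact: is_derive_id. Qed.

Lemma dfn_shift c f f' : dfn f f' -> dfn (fun x => f (c + x)) (fun x => f' (c + x)).
Proof.
move=> df; apply: (dfn_ext (dfn_comp df (dfnD (dfn_cst c) dfn_id))) => x.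
by rewrite add0r mulr1.
Qed.

Lemma continuous_igr_itv f a b : continuous f -> igr leb (fun x => \1_`[a, b] x * f x).
Proof.
move=> cf.
have : leb.-integrable `[a, b] (EFin \o f).
  apply: continuous_compact_integrable; first exact: segment_compact.
  exact: continuous_subspaceT.
rewrite integrable_mkcond//; apply: eq_integrable => // x _.
rewrite patchE/= indicE; case: ifP => _; rewrite ?mul1r ?mul0r//.
Qed.

(** The indicator weight fits the weighted integrals used throughout. The degenerate interval is
    covered because [abel] also tests its hypothesis at length 0. *)
Lemma FTC2 f f' a b : a <= b -> dfn f f' -> continuous f' ->
  \int[leb]_x (\1_`[a, b] x * f' x) = f b - f a.
Proof.
rewrite le_eqVlt => /predU1P[->|ab] df cf'.
  by rewrite Rint_indic subrr set_itv1 Rintegral_set1.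
rewrite Rint_indic /Rintegral (@continuous_FTC2 _ f' f)//.
- exact: continuous_subspaceT.
- split.
  + by move=> x _; case: (df x).
  + exact/cvg_at_right_filter/(dfn_cts df).
  + exact/cvg_at_left_filter/(dfn_cts df).
- by move=> x _; rewrite derive1E; case: (df x).
Qed.

(* The one-sided primitives based at [- N] agree, up to a constant, wherever they are defined; gluing them avoids a case split at the base point. *)
Lemma antiderivative f : continuous f -> exists F, dfn F f.
Proof.
move=> cf.
pose G (N x : R) := \int[leb]_(t in `[- N, x]) f t.
have dG (N x : R) : - N < x -> is_derive x (1 : R) (G N) (f x).
  move=> Nx; have [||||dF dFE] := @continuous_FTC1 _ f (BLeft (- N)) x (x + 1).
  - by rewrite ltrDl.
  - apply: continuous_compact_integrable; first exact: segment_compact.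
    exact: continuous_subspaceT.
  - by rewrite lte_fin.
  - exact: cf.
  by apply: DeriveDef; [exact: dF|rewrite -derive1E; exact: dFE].
have GG (N N' x : R) : - N < 0 -> - N' < 0 -> - N < x -> - N' < x ->
    G N x - G N 0 = G N' x - G N' 0.
  move=> N0 N'0 Nx N'x.
  pose D y := G N y - G N' y.
  have key (a b : R) : a <= b -> - N < a -> - N' < a -> D b = D a.
    move=> ab Na N'a.
    have dD (y : R) : a <= y -> is_derive y (1 : R) D 0.
      move=> ay; rewrite -[X in is_derive _ _ _ X](subrr (f y)).
      apply: is_deriveB; apply: dG; exact: lt_le_trans ay.
    have [y|y|c _] := @MVT_segment _ D (cst 0) a b ab.
    - by rewrite in_itv/= => /andP[/ltW ay _]; exact: dD.
    - apply: derivable_within_continuous => z.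
      by rewrite in_itv/= => /andP[az _]; case: (dD z az).
    by rewrite mul0r => /eqP; rewrite subr_eq0 => /eqP.
  have : D x = D 0.
    have [x0|/ltW x0] := leP 0 x; first by rewrite (key 0 x).
    by rewrite (key x 0).
  by rewrite /D; lra.
exists (fun x => G (`|x| + 1) x - G (`|x| + 1) 0) => x.
(* The base point in the glued definition moves with the argument; the single base point [- N]
   serves all [y] at distance less than 1 from [x]. *)
pose N := `|x| + 2.
have N0 : - N < 0 by rewrite oppr_lt0 /N ltr_wpDl.
have Nx : - N < x.
  by rewrite /N ltrNl; have := ler_norm (- x); rewrite normrN; lra.
have dN : is_derive x (1 : R) (fun y => G N y - G N 0) (f x).
  rewrite -[X in is_derive _ _ _ X]subr0; apply: is_deriveB; exact: dG.
apply: near_eq_is_derive dN.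
near=> y.
have xy : `|x - y| < 1.
  by near: y; apply: (@nbhsx_ballx _ _ x 1).
have h1 : - (`|y| + 1) < y.
  by rewrite ltrNl; have := ler_norm (- y); rewrite normrN; lra.
have h2 : `|x| <= `|y| + `|x - y|.
  by rewrite -{1}(subrK y x) addrC ler_normD.
have h3 : `|y| <= `|x| + `|x - y|.
  by rewrite -{1}(subrK x y) addrC (distrC x) ler_normD.
have h4 : - (`|y| + 1) < 0 by have := normr_ge0 y; lra.
have h5 : - N < y.
  by rewrite ltrNl /N; have := ler_norm (- y); rewrite normrN; lra.
exact: GG.
Unshelve. all: by end_near. Qed.

End calculus.

(** * Non-increasing kernels *)

Section abel.
Variable R : realType.
Notation leb := (@lebesgue_measure R).
Notation leb2 := (@lebesgue_measure R \x @lebesgue_measure R)%E.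
Variables (kap : R -> R) (K : R).
Hypotheses (ikap : igr leb kap) (kap0 : forall z, 0 <= kap z)
  (kapK : forall z, kap z <= K) (kapN : forall z, z <= 0 -> kap z = 0)
  (kapD : forall x y, 0 < x -> x <= y -> kap y <= kap x).

Let mk : measurable_fun setT kap := igr_meas ikap.

Let K0 : 0 <= K. Proof. exact: le_trans (kap0 0) (kapK 0). Qed.

(** Layer-cake integrand on pairs (level, position): integrated over the level it restores
    [kap z * j z], integrated over the position it sees a superlevel set of [kap]. *)
Let lv (j : R -> R) (w : R * R) : R :=
  \1_`]0, K] w.1 * ((w.1 < kap w.2)%R%:R * j w.2).

Let mlv j : measurable_fun setT j -> measurable_fun setT (lv j).
Proof.
move=> mj; apply: measurable_funM.
  by apply: (measurableT_comp _ measurable_fst); exact: mindic_itv.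
apply: measurable_funM; last exact: measurableT_comp.
rewrite (_ : (fun x => _) = \1_[set w : R * R | w.1 < kap w.2]); last first.
  apply/funext => w; rewrite indicE; congr (nat_of_bool _)%:R.
  by apply/idP/idP => [h|]; [exact/mem_set|move/set_mem].
apply: measurable_indic.
rewrite -[X in measurable X]setTI.
have : measurable_fun setT (fun w : R * R => w.1 < kap w.2)%R.
  by apply: measurable_fun_ltr => //; exact: measurableT_comp.
move=> /(_ measurableT [set true]); rewrite setTI => H.
exact: H.
Qed.

Let mlvl (z : R) : measurable_fun setT (fun s : R => \1_`]0, K] s * (s < kap z)%R%:R : R).
Proof.
apply: measurable_funM; first exact: mindic_itv.
rewrite (_ : (fun s : R => (s < kap z)%R%:R) = \1_`]-oo, kap z[); last first.
  by apply/funext => s; rewrite indic_itvE in_itv.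
exact: mindic_itv.
Qed.

Let lv_slice (z : R) : (\int[leb]_s (\1_`]0, K] s * (s < kap z)%R%:R)%:E = (kap z)%:E)%E.
Proof.
rewrite (_ : (fun s : R => _) = (fun s : R => (\1_(`]0%R, kap z[%classic : set R) s)%:E)); last first.
  apply/funext => s; rewrite !indic_itvE !in_itv/=; congr EFin.
  case: ltP => s0; rewrite /= ?mul0r//.
  case: ltP => h; rewrite ?mulr0 ?mulr1//.
  by rewrite (le_trans (ltW h)).
rewrite integral_indic// setIT; apply: etrans (lebesgue_measure_itv _) _ => /=.
rewrite lte_fin -EFinB subr0; by case: ltgtP (kap0 z) => // <- _.
Qed.

Let ilv j : bmf j -> igr leb2 (lv j).
Proof.
move=> bj; apply/integrable21ltyP; first by apply/measurable_EFinP; exact: mlv bj.1.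
rewrite (_ : (\int[_]_y _)%E = (\int[leb]_z (`|kap z * j z|)%:E)%E).
  by have /integrableP[] := igrM ikap bj.
apply: eq_integral => z _; rewrite /lv/=.
transitivity (\int[leb]_s (`|j z|%:E * (\1_`]0, K] s * (s < kap z)%R%:R)%:E))%E.
  apply: eq_integral => s _; rewrite -EFinM !normrM; congr EFin.
  rewrite [`|\1_ _ s|]ger0_norm ?indicE// [`|(s < _)%R%:R|]ger0_norm//; ring.
rewrite ge0_integralZl//.
- by rewrite lv_slice -EFinM normrM (ger0_norm (kap0 z)) mulrC.
- by apply/measurable_EFinP; exact: (mlvl z).
Qed.

(* Layer-cake decomposition: [kap] is an average of indicators of intervals [(0, l)]. *)
Lemma abel (j : R -> R) (c : R) : bmf j ->
  (forall z, 0 <= z -> \int[leb]_y (\1_`[0, z] y * j y) <= c) ->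
  \int[leb]_z (kap z * j z) <= K * c.
Proof.
move=> bj jc.
(* Sign obtained from [z = 0]; it settles the levels whose superlevel set is empty. *)
have c0 : 0 <= c.
  by apply: le_trans (jc 0 (lexx 0)); rewrite Rint_indic set_itv1 Rintegral_set1.
have i2 := ilv bj.
pose G s := \int[leb]_z lv j (s, z).
have -> : \int[leb]_z (kap z * j z) = \int[leb]_s G s.
  transitivity (\int[leb2]_w lv j w).
    rewrite [RHS]/Rintegral -integral21_prod_meas1//; congr fine.
    apply: eq_integral => z _; rewrite /fubini_G/= /lv/=.
    transitivity (\int[leb]_s ((j z)%:E * (\1_`]0, K] s * (s < kap z)%R%:R)%:E))%E.
      have ii : leb.-integrable setT (fun s : R => (\1_`]0, K] s * (s < kap z)%R%:R : R)%:E).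
        apply: (@igr_le _ _ _ leb (\1_`[0, K] : R -> R)) (igr_itv 0 K) => [|s].
          exact: (mlvl z).
        rewrite !indic_itvE !in_itv/= normrM !ger0_norm//.
        case: ltP => /= s0; last by rewrite mul0r.
        by rewrite (ltW s0)/= ler_piMr// lern1 leq_b1.
      by rewrite integralZl// lv_slice -EFinM mulrC.
    by apply: eq_integral => s _; rewrite -EFinM; congr EFin; ring.
  rewrite [LHS]/Rintegral -integral12_prod_meas1//.
  rewrite [RHS]/Rintegral; congr fine.
  have := ae_integrable1 i2.
  move=> ae; apply: ae_eq_integral => //.
  - exact: (measurable_fubini_F i2).
  - apply/measurable_EFinP; apply: measurable_Rint; exact: mlv bj.1.
  apply: filterS ae => s ints _.
  by rewrite /fubini_F /G /Rintegral fineK//; apply: integrable_fin_num.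
have iG : igr leb G.
  have := integrable_fubini_F i2.
  move=> iF; apply/integrableP; split.
    by apply/measurable_EFinP; apply: measurable_Rint; exact: mlv bj.1.
  have /integrableP[mF] := iF; apply: le_lt_trans.
  apply: ge0_le_integral => //.
  - apply/measurableT_comp => //; apply/measurable_EFinP; apply: measurable_Rint.
    exact: mlv bj.1.
  - exact: measurableT_comp.
  move=> s _; rewrite /fubini_F /G /Rintegral.
  (* At levels whose slice is not integrable [fine] can only lower the absolute value. *)
  suff H (x : \bar R) : (`|(fine x)%:E| <= `|x|)%E by exact: H.
  by case: x => [r| |] //=; rewrite normr0 leey.
(* [K * c] is the integral of [c] over the levels in [[0, K]], so it remains to bound each slice by
   [c]. *)
rewrite mulrC -[K in leRHS]subr0 -(Rint_itv K0) -RintZ; last exact: igr_itv.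
apply: Rint_le => //; first exact/igrZ/igr_itv.
move=> s; rewrite /G /lv/=.
have [sK|sK] := boolP (s \in `]0, K]); last first.
  rewrite (_ : (fun z => _) = (fun=> 0)) ?Rint0.
    by rewrite mulr_ge0 ?indic_itv_ge0.
  apply/funext => z; by rewrite indic_itvE (negbTE sK) mul0r.
have s0 : 0 < s by move: sK; rewrite in_itv/= => /andP[].
have -> : \1_`[0, K] s = 1 :> R.
  by rewrite indic_itvE; move: sK; rewrite !in_itv/= => /andP[/ltW -> ->].
rewrite mulr1.
(* By monotonicity this superlevel set contains []0, z]] together with each of its points [z]: up to
   endpoints it is an interval starting at 0. *)
pose E := [set z | s < kap z].
have Epos z : E z -> 0 < z by rewrite ltNge; apply: contraPN => /kapN; rewrite /E /= => ->; apply/negP; rewrite -leNgt ltW.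
have Edown y z : E z -> 0 < y -> y <= z -> E y.
  by move=> Ez y0 yz; apply: lt_le_trans Ez _; exact: kapD.
have [E0|/set0P[z0 Ez0]] := eqVneq E set0.
  rewrite (_ : (fun z => _) = (fun=> 0)) ?Rint0//.
  apply/funext => z; case: ltP => h; rewrite ?mul0r ?mulr0//.
  by have : E z := h; rewrite E0.
(* Chebyshev: [kap] exceeds [s] on []0, z]], so [s * z] is at most the mass of [kap]. *)
have Eub : has_ubound E.
  exists ((\int[leb]_z kap z) / s) => z Ez.
  rewrite ler_pdivlMr// mulrC -[z]subr0 -Rint_itv; last exact/ltW/Epos.
  rewrite -RintZ; last exact: igr_itv.
  apply: Rint_ae_le => //; first exact/igrZ/igr_itv.
  exists [set 0]; split => //; first exact: lebesgue_measure_set1.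
  move=> y /=; apply: contra_notP => y0.
  rewrite indic_itvE in_itv/=; case: (boolP (_ && _)); rewrite ?mulr0// mulr1.
  move=> /andP[y0' yz]; apply/ltW; apply: (Edown y z) => //.
  by rewrite lt_neqAle y0' andbT eq_sym; exact/eqP.
pose l := sup E.
have l0 : 0 <= l by apply: le_trans (ltW (Epos _ Ez0)) _; exact: ub_le_sup.
apply: le_trans (jc l l0).
rewrite le_eqVlt; apply/orP; left; apply/eqP.
apply: Rint_ae_eq.
- apply: (measurableT_comp (mlv bj.1) (measurable_pair1 s)).
- by apply: measurable_funM; [exact: mindic_itv|exact: bj.1].
(* The slice and the integral over [[0, l]] can differ only at the two endpoints. *)
have n2 : leb ([set 0] `|` [set l]) = 0%E.
  by rewrite measureU0//; exact: lebesgue_measure_set1.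
exists ([set 0] `|` [set l]); split => //; first exact: measurableU.
move=> y /=; apply: contra_notP => /not_orP[y0 yl].
have -> : \1_`]0, K] s = 1 :> R by rewrite indic_itvE sK.
rewrite mul1r; congr (_ * _); rewrite indic_itvE.
congr (nat_of_bool _)%:R; apply/idP/idP => [Ey|].
  by rewrite in_itv/= (ltW (Epos _ Ey))/=; exact: ub_le_sup.
rewrite in_itv/= => /andP[y0' yl'].
have {}y0 : 0 < y by rewrite lt_neqAle y0' andbT eq_sym; exact/eqP.
have {}yl : y < l by rewrite lt_neqAle yl' andbT; exact/eqP.
have [e Ee ye] := sup_adherent (eqbRL (subr_gt0 _ _) yl) (conj (ex_intro _ _ Ez0) Eub).
rewrite opprB addrC subrK in ye.
exact: Edown Ee y0 (ltW ye).
Qed.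

Lemma abel_norm (j : R -> R) (c : R) : bmf j ->
  (forall z, 0 <= z -> `|\int[leb]_y (\1_`[0, z] y * j y)| <= c) ->
  `|\int[leb]_z (kap z * j z)| <= K * c.
Proof.
move=> bj jc; rewrite ler_norml; apply/andP; split.
  rewrite lerNl -mulN1r -RintZ; last exact: igrM.
  rewrite (_ : (fun z => _) = (fun z => kap z * (- j z))); last first.
    by apply/funext => z; rewrite mulN1r mulrN.
  apply: abel; first exact: bmfN.
  move=> z z0; have := jc z z0; rewrite ler_norml => /andP[+ _].
  rewrite lerNl -mulN1r -RintZ; last exact/igrM/bj/igr_itv.
  by under eq_Rintegral do rewrite mulN1r -mulrN.
by apply: abel => // z z0; have := jc z z0; rewrite ler_norml => /andP[].
Qed.

(** The form applied to smooth data, whose primitive is known: the constant sees only the one-sided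
    bound [c], while [M] provides boundedness of the integrand. *)
Lemma abel_dfn (h h' : R -> R) (M c : R) : dfn h h' -> continuous h' ->
  (forall x, `|h' x| <= M) ->
  (forall z, 0 <= z -> h z - h 0 <= c) -> \int[leb]_z (kap z * h' z) <= K * c.
Proof.
move=> dh ch hM hc; apply: abel.
  by split; [exact: continuous_measurable_fun|exists M].
by move=> z z0; rewrite (FTC2 z0 dh)//; exact: hc.
Qed.

End abel.

(** * Lipschitz functions with nonpositive derivative *)

Section lipschitz_monotone.
Variable R : realType.
Notation leb := (@lebesgue_measure R).

Lemma is_derive_right_lt (V : R -> R) (x e : R) : derivable V x 1 -> V^`()%classic x <= 0 ->
  0 < e -> exists2 d, 0 < d & forall h, 0 < h -> h < d -> V (x + h) - V x <= e * h.
Proof.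
move=> dV V0 e0.
have : h^-1 *: (V (h *: 1 + x) - V x) @[h --> 0^'] --> V^`()%classic x.
  by rewrite derive1E; exact: dV.
move=> /cvgrPdist_lt/(_ _ e0)[d /= d0 H].
exists d => // h h0 hd.
have := H h; rewrite /= sub0r normrN gtr0_norm// => /(_ hd).
rewrite gt_eqF// => /(_ isT).
rewrite [h *: 1]mulr1 ltr_norml => /andP[+ _].
rewrite ltrBrDl => H1.
have {H1} : h^-1 * (V (h + x) - V x) <= e.
  by rewrite -[_ * _]/(h^-1 *: (V (h + x) - V x)); lra.
by rewrite mulrC ler_pdivrMr// (addrC h x).
Qed.

(** The exceptional null set is covered by an open set [U] of measure at most [e]. Subtracting from
    [V] a small slope and [L] times the measure of [U] passed so far gives a function that can be
    continued to the right from every point without increasing. *)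
Lemma lipschitz_ae_nonincreasing (V : R -> R) (L a b : R) : 0 <= L ->
  (forall x y, `|V x - V y| <= L * `|x - y|) ->
  {ae leb, forall x : R, x \in `[a, b] -> derivable V x 1 /\ V^`()%classic x <= 0} ->
  a <= b -> V b <= V a.
Proof.
move=> L0 VL [N [mN N0 NV]] ab.
apply/ler_addgt0Pr => e' e'0.
(* The final loss is [e * (b - a) + L * e], which this choice keeps below [e']; the summand 1 makes
   the denominator positive. *)
pose e := e' / (b - a + L + 1).
have D0 : 0 < b - a + L + 1 by lra.
have e0 : 0 < e by exact: divr_gt0.
have [U [oU NU Ue]] := @lebesgue_regularity_outer R N e mN
  (eq_ind_r (fun z => (z < +oo)%E) (ltry 0) N0) e0.
have mU : measurable U by exact: open_measurable.
have {}Ue : (leb U <= e%:E)%E.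
  rewrite -(setDUK NU) (le_trans (measureU2 _ _ _))//.
    exact: measurableD.
  by rewrite [X in (X + _)%E](_ : _ = 0%E)// add0e ltW.
have iU : igr leb (\1_U : R -> R).
  apply/integrableP; split; first exact/measurable_EFinP/measurable_indic.
  under eq_integral do rewrite /= ger0_norm ?indicE//.
  rewrite integral_indic// setIT.
  by rewrite (le_lt_trans Ue)// ltry.
have bU : bmf (\1_U : R -> R) by exact: bmf_indic.
(* Measure of [U] inside [[a, x]]: its growth is at most that of [x], with equality along [U]. *)
pose om (x : R) := \int[leb]_y (\1_`[a, x] y * \1_U y).
have omB x x' : a <= x -> x <= x' ->
    om x' - om x = \int[leb]_y ((\1_`[a, x'] y - \1_`[a, x] y) * \1_U y).
  move=> ax xx'; rewrite -RintB; [|exact/igrM/bU/igr_itv..].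
  by apply: eq_Rintegral => y _; rewrite mulrBl.
have ind0 x x' y : a <= x -> x <= x' -> 0 <= \1_`[a, x'] y - \1_`[a, x] y :> R.
  move=> ax xx'; rewrite subr_ge0 !indic_itvE !in_itv/= ler_nat.
  by case: (a <= y) => //=; case: (leP y x) => //= yx; rewrite (le_trans yx).
have om_ge x x' : a <= x -> x <= x' -> 0 <= om x' - om x.
  move=> ax xx'; rewrite omB//; apply: Rint_ge0 => y.
  by rewrite mulr_ge0 ?ind0// indicE.
have om_le x x' : a <= x -> x <= x' -> om x' - om x <= x' - x.
  move=> ax xx'; rewrite omB//.
  have -> : x' - x = \int[leb]_y (\1_`[a, x'] y - \1_`[a, x] y).
    by rewrite RintB ?Rint_itv ?(le_trans ax)//; [ring|exact: igr_itv..].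
  apply: Rint_le.
  - by apply: igrM; [apply: igrB; exact: igr_itv|exact: bU].
  - by apply: igrB; exact: igr_itv.
  - move=> y; apply: ler_piMr; first exact: ind0.
    by rewrite indicE; case: (_ \in _).
have om_eq x x' : a <= x -> x <= x' -> (forall y, x < y -> y <= x' -> U y) ->
    om x' - om x = x' - x.
  move=> ax xx' xU; rewrite omB//.
  have -> : x' - x = \int[leb]_y (\1_`[a, x'] y - \1_`[a, x] y).
    by rewrite RintB ?Rint_itv ?(le_trans ax)//; [ring|exact: igr_itv..].
  apply: eq_Rintegral => y _.
  have [yU|nyU] := pselect (U y); first by rewrite [\1_U y]indicE mem_set// mulr1.
  suff -> : \1_`[a, x'] y = \1_`[a, x] y :> R by rewrite subrr mul0r.
  rewrite !indic_itvE !in_itv/=; congr (nat_of_bool _)%:R.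
  case: (a <= y) => //=.
  apply/idP/idP => [yx'|yx]; last exact: le_trans xx'.
  by rewrite leNgt; apply/negP => xy; exact/nyU/xU.
have om_b : om b <= e.
  apply: (@le_trans _ _ (\int[leb]_y \1_U y)).
    apply: Rint_le => //; first exact/igrM/bU/igr_itv.
    by move=> y; apply: ler_piMl; rewrite indicE//; case: (_ \in _).
  rewrite /Rintegral integral_indic// setIT -lee_fin fineK//.
  by rewrite ge0_fin_numE// (le_lt_trans Ue)// ltry.
have om_a : om a = 0.
  by rewrite /om Rint_indic set_itv1 Rintegral_set1.
(* At a point of [N], [L * om] absorbs the Lipschitz growth of [V]; at the other points [e * x]
   absorbs increments governed by a nonpositive derivative. *)
pose P x := V x - e * x - L * om x.
have Plip x x' : a <= x -> x <= x' -> `|P x' - P x| <= (2 * L + e) * (x' - x).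
  move=> ax xx'; rewrite /P.
  have := VL x' x; rewrite [`|x' - x|]ger0_norm ?subr_ge0// ler_norml => /andP[h1 h2].
  have h3 : 0 <= L * (om x' - om x) by rewrite mulr_ge0// om_ge.
  have h4 : L * (om x' - om x) <= L * (x' - x) by rewrite ler_wpM2l// om_le.
  have h5 : 0 <= e * (x' - x) by rewrite mulr_ge0 ?subr_ge0// ltW.
  by rewrite ler_norml; apply/andP; split; lra.
have Pstep x : a <= x -> x < b -> exists2 y, x < y <= b & P y <= P x.
  move=> ax xb.
  have [xN|xN] := pselect (N x).
    have [d /= d0 xd] : \forall y \near x, U y by apply: open_nbhs_nbhs; split => //; exact: NU.
    pose y := Num.min b (x + d / 2).
    have xy : x < y by rewrite lt_min xb ltrDl divr_gt0.
    have yd : y <= x + d / 2 by rewrite ge_min lexx orbT.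
    exists y; first by rewrite xy ge_min lexx.
    have E : om y - om x = y - x.
      apply: om_eq => //; first exact: ltW.
      move=> z xz zy; apply: xd; rewrite /= ltr0_norm ?subr_lt0//; lra.
    have := VL y x; rewrite [`|y - x|]gtr0_norm ?subr_gt0// ler_norml => /andP[_ h2].
    have h5 : 0 <= e * (y - x) by rewrite mulr_ge0 ?subr_ge0 ?ltW.
    have {}E : L * om y - L * om x = L * (y - x) by rewrite -mulrBr E.
    by rewrite /P; lra.
  have : x \in `[a, b] -> derivable V x 1 /\ V^`()%classic x <= 0.
    by apply: contrapT => h; apply/xN/NV.
  rewrite in_itv/= ax ltW// => /(_ isT)[dV V0].
  have [d d0 dP] := is_derive_right_lt dV V0 e0.
  pose h := Num.min (b - x) (d / 2).
  have h0 : 0 < h by rewrite lt_min subr_gt0 xb divr_gt0.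
  have hd : h < d by rewrite gt_min; apply/orP; right; lra.
  have hb : h <= b - x by rewrite ge_min lexx.
  exists (x + h); first by rewrite ltrDl h0/=; lra.
  have := dP h h0 hd.
  have : 0 <= L * (om (x + h) - om x) by rewrite mulr_ge0// om_ge// lerDl ltW.
  by rewrite /P; lra.
(* Continuation: the supremum of the points reached belongs to [S] by [Plip], and [Pstep] excludes
   that it be less than [b]. *)
pose S := [set y | a <= y <= b /\ P y <= P a].
have Sa : S a by split; rewrite ?lexx.
have hsS : has_sup S.
  by split; [exists a|exists b => y [/andP[]]].
pose s := sup S.
have as_ : a <= s by apply: ub_le_sup => //; case: hsS.
have sb : s <= b by apply: ge_sup; [exists a|move=> y [/andP[]]].
have Ps : P s <= P a.
  apply/ler_addgt0Pr => t t0.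
  have C0 : 0 < 2 * L + e by lra.
  have [y [/andP[ay yb] Py] sy] := sup_adherent (divr_gt0 t0 C0) hsS.
  have ys : y <= s by apply: ub_le_sup; [case: hsS|split; rewrite ?ay].
  have := Plip y s ay ys; rewrite ler_norml => /andP[_ h].
  have : (2 * L + e) * (s - y) <= t.
    rewrite mulrC -ler_pdivlMr//; rewrite -/s in sy; lra.
  lra.
have {}sb : s = b.
  apply/eqP; rewrite eq_le sb/= leNgt; apply/negP => sb'.
  have [y /andP[sy yb] Py] := Pstep s as_ sb'.
  have : y <= s.
    apply: ub_le_sup; first by case: hsS.
    by split; [rewrite yb (le_trans as_ (ltW sy))|exact: le_trans Py Ps].
  by rewrite leNgt sy.
move: Ps; rewrite sb /P om_a.
have : L * om b <= L * e by rewrite ler_wpM2l.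
have : e * (b - a + L + 1) = e' by rewrite /e divfK// gt_eqF.
lra.
Qed.

End lipschitz_monotone.

(** * Smooth functions of one variable and flat functions *)

Section smooth_functions.
Variable R : realType.
Implicit Types f g : R -> R.

(** One-variable counterpart of [Ck], with derivatives as witnesses, so that products in separate
    variables become test functions by induction on [n]. *)
Fixpoint smooth (n : nat) f : Prop :=
  match n with
  | 0%N => continuous f
  | m.+1 => exists2 f', dfn f f' & smooth m f'
  end.

Lemma smoothS n f : smooth n.+1 f -> smooth n f.
Proof.
elim: n f => [|n IH] f [f' df sf']; first exact: dfn_cts df.
by exists f' => //; exact: IH.
Qed.

Lemma smoothD n f g : smooth n f -> smooth n g -> smooth n (fun x => f x + g x).
Proof.
elim: n f g => [|n IH] f g.
  by move=> cf cg x; apply: cvgD; [exact: cf|exact: cg].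
move=> [f' df sf] [g' dg sg]; exists (fun x => f' x + g' x); first exact: dfnD.
exact: IH.
Qed.

Lemma smoothZ n c f : smooth n f -> smooth n (fun x => c * f x).
Proof.
elim: n f => [|n IH] f.
  by move=> cf x; apply: cvgM; [exact: cvg_cst|exact: cf].
move=> [f' df sf]; exists (fun x => c * f' x); first exact: dfnZ.
exact: IH.
Qed.

Lemma smoothM n f g : smooth n f -> smooth n g -> smooth n (fun x => f x * g x).
Proof.
elim: n f g => [|n IH] f g.
  by move=> cf cg x; apply: cvgM; [exact: cf|exact: cg].
move=> sf sg; have [f' df sf'] := sf; have [g' dg sg'] := sg.
exists (fun x => f' x * g x + f x * g' x); first exact: dfnM.
by apply: smoothD; apply: IH => //; exact: smoothS.
Qed.

Lemma smooth_affine n a b f : smooth n f -> smooth n (fun x => f (a * x + b)).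
Proof.
elim: n f => [|n IH] f.
  move=> cf x; apply: continuous_comp; last exact: cf.
  by apply: cvgD; [apply: cvgM; [exact: cvg_cst|exact: cvg_id]|exact: cvg_cst].
move=> [f' df sf]; exists (fun x => a * f' (a * x + b)); last exact/smoothZ/IH.
have dl : dfn (fun x => a * x + b) (fun=> a).
  apply: (dfn_ext (dfnD (dfnZ a (@dfn_id R)) (dfn_cst b))) => x.
  by rewrite mulr1 addr0.
by apply: (dfn_ext (dfn_comp df dl)) => x; rewrite mulrC.
Qed.

Lemma smooth_ext n f g : f =1 g -> smooth n f -> smooth n g.
Proof. by move=> /funext ->. Qed.

Lemma is_derive_quadratic f (C : R) (x l : R) :
  (forall h, `|f (x + h) - f x - h * l| <= C * h ^+ 2) -> is_derive x (1 : R) f l.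
Proof.
move=> H.
have C0 : 0 <= C.
  by have := H 1; rewrite expr1n mulr1; apply: le_trans.
have cv : h^-1 *: (f (h *: 1 + x) - f x) @[h --> 0^'] --> l.
  apply/cvgrPdist_lt => e e0.
  have C1 : 0 < C + 1 by lra.
  exists (e / (C + 1)) => /=; first exact: divr_gt0.
  move=> h /=; rewrite sub0r normrN => he h0.
  rewrite [h *: 1]mulr1 (addrC h x).
  have -> : l - h^-1 *: (f (x + h) - f x) = - (h^-1 * (f (x + h) - f x - h * l)).
    by rewrite /GRing.scale/= (mulrBr _ _ (h * l)) mulKf// opprB.
  rewrite normrN normrM normfV.
  have h0' : 0 < `|h| by rewrite normr_gt0.
  rewrite mulrC ltr_pdivrMr//.
  apply: le_lt_trans (H h) _.
  rewrite -real_normK ?num_real// expr2 mulrA ltr_pM2r//.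
  apply: le_lt_trans (_ : (C + 1) * `|h| < _).
    by rewrite ler_wpM2r//; lra.
  by rewrite mulrC -ltr_pdivlMr.
apply: DeriveDef; first by apply/cvg_ex; exists l.
exact: cvg_lim.
Qed.

(** The inequality [z <= expR z] at [z = y / m], raised to the power [m]. *)
Lemma expR_decay (m : nat) (y : R) : 0 <= y -> y ^+ m * expR (- y) <= m%:R ^+ m.
Proof.
move=> y0; case: m => [|m].
  by rewrite !expr0 mul1r -[leRHS]expR0 ler_expR oppr_le0.
rewrite expRN ler_pdivrMr ?expR_gt0//.
have -> : y = m.+1%:R * (y / m.+1%:R) by rewrite mulrC divfK// pnatr_eq0.
rewrite exprMn expRM_natl ler_wpM2l ?exprn_ge0//.
set z := y / m.+1%:R.
have z0 : 0 <= z by rewrite divr_ge0.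
rewrite lerXn2r ?nnegrE ?expR_ge0//.
by have := expR_ge1Dx z; lra.
Qed.

(** The negative power in front of [expR (- x^-1)] makes the linear span of the family closed under
    differentiation, so that smoothness of all members follows by one induction. *)
Definition flat (n : nat) (x : R) : R :=
  if 0 < x then x^-1 ^+ n * expR (- x^-1) else 0.

Lemma flat_ge0 n x : 0 <= flat n x.
Proof.
rewrite /flat; case: ifP => // x0.
by rewrite mulr_ge0 ?expR_ge0// exprn_ge0// invr_ge0 ltW.
Qed.

Lemma dfn_flat n : dfn (flat n) (fun x => flat n.+2 x - n%:R * flat n.+1 x).
Proof.
move=> x; have [x0|x0|->] := ltgtP x 0.
- have -> : flat n.+2 x - n%:R * flat n.+1 x = 0.
    by rewrite /flat ltNge (ltW x0)/= mulr0 subr0.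
  apply: (@near_eq_is_derive _ _ _ (cst 0)).
    near=> y; rewrite /flat ltNge (_ : y <= 0)//; apply/ltW.
    by near: y; exact: lt_nbhsl.
- have -> : flat n.+2 x - n%:R * flat n.+1 x =
      (x^-1 ^+ n.+2 - n%:R * x^-1 ^+ n.+1) * expR (- x^-1).
    by rewrite /flat x0 mulrBl mulrA.
  have xn0 : x != 0 by rewrite gt_eqF.
  have dV : is_derive x (1 : R) (fun y : R => y^-1) (- x^-2).
    by have := is_deriveV xn0 (is_derive_id x (1 : R)); rewrite [_ *: _]mulr1.
  have dE := @is_derive1_comp R expR (fun y => - y^-1) x _ _
    (is_derive_expR (- x^-1)) (is_deriveN dV).
  suff H : is_derive x (1 : R) (fun y : R => y^-1 ^+ n * expR (- y^-1))
      ((x^-1 ^+ n.+2 - n%:R * x^-1 ^+ n.+1) * expR (- x^-1)).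
    apply: near_eq_is_derive H.
    near=> y; rewrite /flat (_ : 0 < y)//.
    by near: y; exact: lt_nbhsr.
  case: n => [|n].
    rewrite (_ : (fun _ => _) = expR \o (fun y => - y^-1)); last first.
      by apply/funext => y; rewrite mul1r.
    have -> : (x^-1 ^+ 2 - 0%:R * x^-1 ^+ 1) * expR (- x^-1) =
        expR (- x^-1) * - - x^-2 by rewrite opprK -exprVn; ring.
    exact: dE.
  have dX := is_deriveX n.+1 dV.
  have dM := is_deriveM dX dE.
  have XE : ((fun y : R => y^-1) ^+ n.+1) = (fun y : R => y^-1 ^+ n.+1).
    by apply/funext => y; rewrite exprfctE.
  rewrite XE in dM.
  have -> : (x^-1 ^+ n.+3 - n.+1%:R * x^-1 ^+ n.+2) * expR (- x^-1) =
      x^-1 ^+ n.+1 *: (expR (- x^-1) * - - x ^- 2) +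
      expR (- x^-1) *: ((n.+1%:R * x^-1 ^+ n) *: - x ^- 2).
    by rewrite /GRing.scale/= opprK -!exprVn !exprS; ring.
  exact: dM.
- have -> : flat n.+2 0 - n%:R * flat n.+1 0 = 0 :> R.
    by rewrite /flat ltxx mulr0 subr0.
  (* At the gluing point [flat n h] is at most a multiple of [h ^+ 2], by [expR_decay] with exponent
     [n.+2] at [h^-1]. *)
  apply: (@is_derive_quadratic _ (n.+2%:R ^+ n.+2)) => h.
  rewrite add0r mulr0 subr0 {2}/flat ltxx subr0 (ger0_norm (flat_ge0 _ _)).
  rewrite /flat; case: ltP => h0; last by rewrite mulr_ge0 ?sqr_ge0// exprn_ge0.
  have := @expR_decay n.+2 h^-1; rewrite invr_ge0 (ltW h0) => /(_ isT).
  move=> H.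
  have -> : h^-1 ^+ n * expR (- h^-1) = h^-1 ^+ n.+2 * expR (- h^-1) * h ^+ 2.
    have hV : h^-1 * h = 1 by rewrite mulVf// gt_eqF.
    have -> : h^-1 ^+ n.+2 * expR (- h^-1) * h ^+ 2 =
        h^-1 ^+ n * expR (- h^-1) * (h^-1 * h) ^+ 2 by rewrite !exprS; ring.
    by rewrite hV expr1n mulr1.
  by rewrite ler_wpM2r// sqr_ge0.
Unshelve. all: by end_near. Qed.

Lemma smooth_flat k n : smooth k (flat n).
Proof.
elim: k n => [|k IH] n; first exact: dfn_cts (dfn_flat n).
exists (fun x => flat n.+2 x - n%:R * flat n.+1 x); first exact: dfn_flat.
apply: (@smooth_ext _ (fun x => flat n.+2 x + (- n%:R) * flat n.+1 x)).
  by move=> x; rewrite mulNr.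
by apply: smoothD => //; exact: smoothZ.
Qed.

End smooth_functions.

(** * Mollifiers and test functions *)

Section mollifier.
Variable R : realType.
Implicit Types f g : R -> R.

Lemma bounded_supp f (a b : R) : continuous f -> (forall x, x < a \/ b < x -> f x = 0) ->
  exists C, forall x, `|f x| <= C.
Proof.
move=> cf f0; have [ab|ba] := leP a b; last first.
  exists 0 => x; rewrite f0 ?normr0//.
  by have [xa|ax] := ltP x a; [left|right; exact: lt_le_trans ax].
have [|c cab H] := @EVT_max R (fun x => `|f x|) a b ab.
  by apply: continuous_subspaceT => x; apply: cvg_norm; exact: cf.
exists `|f c| => x.
have [xab|] := boolP (x \in `[a, b]); first exact: H.
rewrite in_itv/= negb_and -!ltNge => /orP h; rewrite f0 ?normr0//.
Qed.

Lemma dfn_zero_outside f f' (a b : R) : dfn f f' -> (forall x, x < a \/ b < x -> f x = 0) ->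
  (forall x, x < a \/ b < x -> f' x = 0).
Proof.
move=> df f0 x xab.
have H : is_derive x (1 : R) f 0.
  apply: (@near_eq_is_derive _ _ _ (cst 0)).
  case: xab => h; near=> y; rewrite f0//.
    by left; near: y; exact: lt_nbhsl.
  by right; near: y; exact: lt_nbhsr.
by have [_ <-] := df x; have [_ <-] := H.
Unshelve. all: by end_near. Qed.

(** The bump is one-sided: the average at time [t] involves only times in []t, t + d[], all positive
    when [t >= 0]. The constant [C] precedes [d] because the comparison with averages over balls, at
    Lebesgue points, needs the bound [C / d]. The primitive [B] is a smooth step from 0 to 1. *)
Lemma mollifier_exists : exists C : R, forall d : R, 0 < d -> exists r B : R -> R,
  [/\ forall n, smooth n r, forall x, 0 <= r x <= C / d,
      forall x, x <= 0 \/ d <= x -> r x = 0, dfn B r &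
      forall x, (x <= 0 -> B x = 0) /\ (d <= x -> B x = 1)].
Proof.
(* Product of a flat function and its mirror image, positive exactly on []0, 1[]. *)
pose r0 x := flat 0 x * flat 0 (-1 * x + 1) : R.
have sr0 n : smooth n r0.
  by apply: smoothM; [|apply: smooth_affine]; exact: smooth_flat.
have r00 x : x <= 0 \/ 1 <= x -> r0 x = 0.
  rewrite /r0 /flat; case=> h; first by rewrite ltNge h mul0r.
  by rewrite [X in _ * (if X then _ else _)](_ : _ = false) ?mulr0//; apply/negbTE; rewrite -leNgt; lra.
have r0_ge0 x : 0 <= r0 x by rewrite mulr_ge0 ?flat_ge0.
have cr0 : continuous r0 := sr0 0%N.
have [B0 dB0] := antiderivative cr0.
have [C rC] : exists C, forall x, `|r0 x| <= C.
  by apply: (@bounded_supp _ 0 1) => // x [h|h]; apply: r00; [left|right]; exact: ltW.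
have B0le x y : x <= y -> B0 x <= B0 y by move=> xy; exact: dfn_le dB0 _.
have B0l x : x <= 0 -> B0 x = B0 0.
  move=> x0; apply/eqP; rewrite eq_sym -subr_eq0.
  have [c [_ c0 ->]] := dfn_mvt x0 dB0.
  by rewrite r00 ?mul0r//; left.
have B0r x : 1 <= x -> B0 x = B0 1.
  move=> x0; apply/eqP; rewrite -subr_eq0.
  have [c [c0 _ ->]] := dfn_mvt x0 dB0.
  by rewrite r00 ?mul0r//; right.
pose m := B0 1 - B0 0.
(* The mass dominates the increment of the primitive between 1/4 and 3/4, where [r0] is positive. *)
have m0 : 0 < m.
  have h : (4^-1 : R) <= 3 / 4 by lra.
  have [c [c1 c2 E]] := dfn_mvt h dB0.
  have h1 : B0 0 <= B0 4^-1 by apply: B0le.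
  have h2 : B0 (3 / 4) <= B0 1 by apply: B0le; lra.
  suff : 0 < r0 c * (3 / 4 - 4^-1) by rewrite /m; lra.
  rewrite mulr_gt0//; last by lra.
  rewrite /r0 /flat ifT; last by lra.
  rewrite ifT; last by lra.
  by rewrite !expr0 !mul1r mulr_gt0 ?expR_gt0.
exists (C / m) => d d0.
have dn0 : d != 0 by rewrite gt_eqF.
have mn0 : m != 0 by rewrite gt_eqF.
exists (fun x => (m * d)^-1 * r0 (d^-1 * x + 0)).
exists (fun x => m^-1 * (B0 (d^-1 * x + 0) - B0 0)).
have md0 : 0 < (m * d)^-1 by rewrite invr_gt0 mulr_gt0.
split.
- by move=> n; apply: smoothZ; exact: smooth_affine.
- move=> x; rewrite mulr_ge0 ?(ltW md0)//=.
  rewrite -mulrA -invfM mulrC ler_wpM2r ?(ltW md0)//.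
  by rewrite (le_trans (ler_norm _)).
- move=> x h; rewrite r00 ?mulr0// addr0; case: h => h; [left|right].
    by rewrite mulrC mulr_le0_ge0// invr_ge0 ltW.
  by rewrite mulrC ler_pdivlMr// mul1r.
- have dl : dfn (fun x : R => d^-1 * x + 0) (fun=> d^-1).
    apply: (dfn_ext (dfnD (dfnZ d^-1 (@dfn_id R)) (dfn_cst 0))) => x.
    by rewrite mulr1 addr0.
  have := dfnZ m^-1 (dfnB (dfn_comp dB0 dl) (dfn_cst (B0 0))).
  move=> H; apply: (dfn_ext H) => x.
  by rewrite subr0 invfM; ring.
- move=> x; split=> h; rewrite addr0.
    by rewrite B0l ?subrr ?mulr0// mulrC mulr_le0_ge0// invr_ge0 ltW.
  rewrite B0r; first by rewrite -/m mulVf.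
  by rewrite mulrC ler_pdivlMr// mul1r.
Qed.

End mollifier.

Section test_functions.
Variable R : realType.
Implicit Types (phi : R * R -> R) (g k : R -> R).

Lemma Dt_partial phi z : Dt phi z = 'D_1 (fun s : R => phi (s, z.2)) z.1.
Proof.
have E : (fun h : R => h^-1 *: ((phi \o shift z) (h *: ((1, 0) : R * R)) - phi z)) =
  (fun h : R => h^-1 *: (((fun s => phi (s, z.2)) \o shift z.1) (h *: (1 : R)) - phi (z.1, z.2))).
  apply/funext => h /=; case: z => a b /=.
  suff -> : h *: ((1, 0) : R * R) + (a, b) = (h *: (1 : R) + a, b) by [].
  by congr pair; rewrite /= [_ *: 0]mulr0 add0r.
by rewrite /Dt /Dx /derive E.
Qed.

Lemma Dx_partial phi z : Dx phi z = 'D_1 (fun s : R => phi (z.1, s)) z.2.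
Proof.
have E : (fun h : R => h^-1 *: ((phi \o shift z) (h *: ((0, 1) : R * R)) - phi z)) =
  (fun h : R => h^-1 *: (((fun s => phi (z.1, s)) \o shift z.2) (h *: (1 : R)) - phi (z.1, z.2))).
  apply/funext => h /=; case: z => a b /=.
  suff -> : h *: ((0, 1) : R * R) + (a, b) = (a, h *: (1 : R) + b) by [].
  by congr pair; rewrite /= [_ *: 0]mulr0 add0r.
by rewrite /Dt /Dx /derive E.
Qed.

Lemma dfn_Dt phi (x : R) : (forall z, differentiable phi z) ->
  dfn (fun t => phi (t, x)) (fun t => Dt phi (t, x)).
Proof.
move=> dphi t; apply: DeriveDef; last by rewrite Dt_partial.
apply/derivable1_diffP.
have dp : differentiable (fun s : R => (s, x)) t by exact: differentiable_pair.
exact: (differentiable_comp dp (dphi _)).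
Qed.

Lemma dfn_Dx phi (t : R) : (forall z, differentiable phi z) ->
  dfn (fun x => phi (t, x)) (fun x => Dx phi (t, x)).
Proof.
move=> dphi x; apply: DeriveDef; last by rewrite Dx_partial.
apply/derivable1_diffP.
have dp : differentiable (fun s : R => (t, s)) x by exact: differentiable_pair.
exact: (differentiable_comp dp (dphi _)).
Qed.

Lemma Dt_tensor g g' k : dfn g g' ->
  Dt (fun z : R * R => g z.1 * k z.2) = (fun z => g' z.1 * k z.2).
Proof.
move=> dg; apply/funext => z; rewrite Dt_partial /=.
have := dfnM dg (dfn_cst (k z.2)) z.1.
by case=> _ ->; rewrite mulr0 addr0.
Qed.

Lemma Dx_tensor g k k' : dfn k k' ->
  Dx (fun z : R * R => g z.1 * k z.2) = (fun z => g z.1 * k' z.2).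
Proof.
move=> dk; apply/funext => z; rewrite Dx_partial /=.
have := dfnM (dfn_cst (g z.1)) dk z.2.
by case=> _ ->; rewrite mul0r add0r.
Qed.

Lemma Ck_tensor n g k : smooth n g -> smooth n k ->
  Ck n (fun z : R * R => g z.1 * k z.2).
Proof.
elim: n g k => [|n IH] g k.
  move=> cg ck z; apply: cvgM.
    by apply: continuous_comp; [exact: cvg_fst|exact: cg].
  by apply: continuous_comp; [exact: cvg_snd|exact: ck].
move=> sg sk; have [g' dg sg'] := sg; have [k' dk sk'] := sk.
split.
  move=> z; apply: differentiableM.
    have d1 : differentiable (fst : R * R -> R) z.
      by apply: linear_differentiable => w; exact: cvg_fst.
    apply: (@differentiable_comp _ _ _ _ fst g) d1 _.
    by apply/derivable1_diffP; case: (dg z.1).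
  have d2 : differentiable (snd : R * R -> R) z.
    by apply: linear_differentiable => w; exact: cvg_snd.
  apply: (@differentiable_comp _ _ _ _ snd k) d2 _.
  by apply/derivable1_diffP; case: (dk z.2).
rewrite (Dt_tensor _ dg) (Dx_tensor _ dk).
by split; apply: IH => //; exact: smoothS.
Qed.

(** Such products suffice: the weak equation is tested only on translates of a mollifier and on
    differences of translates of its primitive. *)
Lemma test_function_tensor g k a b c d : (forall n, smooth n g) -> (forall n, smooth n k) ->
  (forall x, x < a \/ b < x -> g x = 0) -> (forall x, x < c \/ d < x -> k x = 0) ->
  test_function (fun z : R * R => g z.1 * k z.2).
Proof.
move=> sg sk g0 k0; split; first by move=> n; exact: Ck_tensor.
have cK : compact (`[a, b]%classic `*` `[c, d]%classic : set (R * R)).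
  by apply: compact_setX; exact: segment_compact.
have clK : closed (`[a, b]%classic `*` `[c, d]%classic : set (R * R)).
  by apply: compact_closed => //; exact: norm_hausdorff.
apply: (subclosed_compact _ cK); first exact: closed_closure.
rewrite [X in _ `<=` X](iffLR (closure_id _) clK).
apply: closure_subset => z /=; rewrite mulf_eq0 negb_or => /andP[gz kz].
by split; rewrite /= in_itv/=; apply/andP; split; rewrite leNgt; apply/negP => h;
  [move: gz|move: gz|move: kz|move: kz]; rewrite ?g0 ?k0 ?eqxx//; auto.
Qed.

End test_functions.

Section local_differentiation.
Context d (T : measurableType d) (R : realType).
Variable mu : {measure set T -> \bar R}.

(** The factorization of [Q] is required only near [x], so [p] may contain a cutoff around [x]. This
    makes the weight integrable when [F] is a moving compactly supported kernel or a smoothed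
    indicator. *)
Lemma is_derive_Rint_local (p : T -> R) (F F' Q : R -> T -> R) (Q' : T -> R) (M x : R) :
  igr mu p -> (forall x, bmf (F x)) ->
  (forall (x : R) y, is_derive x (1 : R) (F ^~ y) (F' x y)) ->
  (forall x y, `|F' x y| <= M) ->
  (forall x', `|x - x'| < 1 -> forall y, Q x' y = p y * F x' y) ->
  (forall y, Q' y = p y * F' x y) ->
  is_derive x (1 : R) (fun x => \int[mu]_y Q x y) (\int[mu]_y Q' y).
Proof.
move=> ip bF dF F'M QE Q'E.
have := is_derive_Rint x ip bF dF F'M.
rewrite -(eq_Rintegral _ (fun y _ => Q'E y)).
move=> H; apply: near_eq_is_derive H; near=> x'.
have xx' : `|x - x'| < 1 by near: x'; apply: (@nbhsx_ballx _ _ x 1).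
by apply: eq_Rintegral => y _; rewrite QE.
Unshelve. all: by end_near. Qed.

End local_differentiation.

(** * Mollification in the plane *)

Section kernels.
Variable R : realType.
Notation leb := (@lebesgue_measure R).
Notation leb2 := (@lebesgue_measure R \x @lebesgue_measure R)%E.
Implicit Types (r : R -> R) (a : R * R -> R).

Definition ckernel r := continuous r /\ exists b : R, forall x, b < `|x| -> r x = 0.

Lemma lt_norm (b x : R) : (b < `|x|) <-> (x < - b \/ b < x).
Proof.
have := ler_norm x; have := ler_norm (- x); rewrite normrN => h1 h2.
split=> [|[]]; [|lra..].
by have [x0|x0] := leP 0 x; [rewrite ger0_norm//; right|rewrite ltr0_norm//; left; lra].
Qed.

Lemma ckernel_igr r : ckernel r -> igr leb r.
Proof.
move=> [cr [b rb]].
rewrite (_ : r = fun x => \1_`[- b, b] x * r x); first exact: continuous_igr_itv.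
apply/funext => x; rewrite indic_itvE in_itv/= -ler_norml.
by case: leP => h; rewrite ?mul1r// mul0r rb.
Qed.

Lemma ckernel_bounded r : ckernel r -> exists C, forall x, `|r x| <= C.
Proof.
move=> [cr [b rb]]; apply: (@bounded_supp R r (- b) b cr) => x h; apply: rb.
exact/lt_norm.
Qed.

Lemma ckernel_bmf r : ckernel r -> bmf r.
Proof.
move=> kr; split; first by apply: continuous_measurable_fun; case: kr.
exact: ckernel_bounded.
Qed.

Lemma ckernel_shift c r : ckernel r -> ckernel (fun x => r (x - c)).
Proof.
move=> [cr [b rb]]; split.
  move=> x; apply: continuous_comp; last exact: cr.
  by apply: cvgD; [exact: cvg_id|exact: cvg_cst].
exists (b + `|c|) => x h; apply: rb.
have : `|x| <= `|x - c| + `|c| by rewrite -{1}(subrK c x) ler_normD.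
lra.
Qed.

Lemma ckernel_dfn r r' : ckernel r -> dfn r r' -> continuous r' -> ckernel r'.
Proof.
move=> [cr [b rb]] dr cr'; split => //; exists `|b| => x h.
have K : forall y, y < - `|b| \/ `|b| < y -> r y = 0.
  move=> y hy; apply: rb; apply: le_lt_trans (ler_norm b) _.
  exact/lt_norm.
by apply: (dfn_zero_outside dr K); exact/lt_norm.
Qed.

Lemma igr_kernel2 r1 r2 a : igr leb r1 -> igr leb r2 -> bmf a ->
  igr leb2 (fun w => r1 w.1 * r2 w.2 * a w).
Proof. by move=> i1 i2 ba; apply: igrM => //; exact: igr_prod. Qed.

Lemma igr_shiftB c r : igr leb r -> igr leb (fun x => r (x - c)).
Proof.
move=> /(igr_shift (- c)); congr (igr _ _); apply/funext => x.
by rewrite addrC.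
Qed.

Lemma Rint_tensor r1 r2 : igr leb r1 -> igr leb r2 ->
  \int[leb2]_w (r1 w.1 * r2 w.2) = \int[leb]_x r1 x * \int[leb]_x r2 x.
Proof.
move=> i1 i2.
have := Rint_prod1 i1 i2 (bmf_cst _ (1 : R)).
under eq_Rintegral do rewrite mulr1.
move=> ->.
under eq_Rintegral do (under eq_Rintegral do rewrite mulr1).
by under eq_Rintegral do rewrite mulrC; rewrite RintZ// mulrC.
Qed.

(** Kernels are evaluated at [w - z]: with one-sided bumps the values of [a] ahead of [z] are
    averaged, and a derivative in [z] changes sign when it is moved to the kernel. *)
Definition Mol a r1 r2 (z : R * R) :=
  \int[leb2]_w (r1 (w.1 - z.1) * r2 (w.2 - z.2) * a w).

Lemma Mol_shift a r1 r2 z : igr leb r1 -> igr leb r2 -> bmf a ->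
  Mol a r1 r2 z = \int[leb2]_w (r1 w.1 * r2 w.2 * a (z.1 + w.1, z.2 + w.2)).
Proof.
move=> i1 i2 ba.
rewrite /Mol -(@Rint_shift2 _ z); last first.
  by apply: (igr_kernel2 (r1 := fun x => r1 (x - z.1)) (r2 := fun x => r2 (x - z.2)));
    [exact: igr_shiftB|exact: igr_shiftB|].
apply: eq_Rintegral => w _ /=.
by rewrite [z.1 + w.1]addrC addrK [z.2 + w.2]addrC addrK.
Qed.

Lemma bmf_shift a z : bmf a -> bmf (fun w : R * R => a (z.1 + w.1, z.2 + w.2)).
Proof. by apply: (bmf_comp (h := fun w => (z.1 + w.1, z.2 + w.2))); exact: measurable_shift2. Qed.

Lemma Mol_le a r1 r2 M z : igr leb r1 -> igr leb r2 -> bmf a ->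
  (forall w, `|a w| <= M) ->
  `|Mol a r1 r2 z| <= M * (\int[leb]_x `|r1 x| * \int[leb]_x `|r2 x|).
Proof.
move=> i1 i2 ba aM; rewrite Mol_shift//.
have bas := bmf_shift z ba.
apply: (le_trans (Rint_norm (igr_kernel2 i1 i2 bas))).
have n1 := igr_norm i1; have n2 := igr_norm i2.
have -> : \int[leb]_x `|r1 x| * \int[leb]_x `|r2 x| =
    \int[leb2]_w (`|r1 w.1| * `|r2 w.2| * 1).
  by rewrite -(Rint_tensor n1 n2); apply: eq_Rintegral => w _; rewrite mulr1.
rewrite -RintZ; last by apply: (igr_kernel2 n1 n2); exact: bmf_cst.
apply: Rint_le.
- exact/igr_norm/igr_kernel2.
- by apply: igrZ; apply: (igr_kernel2 n1 n2); exact: bmf_cst.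
move=> w; rewrite !normrM mulr1 mulrC ler_wpM2r// mulr_ge0//.
Qed.

Lemma Mol_bounded a r1 r2 : igr leb r1 -> igr leb r2 -> bmf a ->
  exists C, forall z, `|Mol a r1 r2 z| <= C.
Proof.
move=> i1 i2 ba; have [_ [M aM]] := ba.
by exists (M * (\int[leb]_x `|r1 x| * \int[leb]_x `|r2 x|)) => z; exact: Mol_le.
Qed.

Lemma MolE a r1 r2 z : igr leb r1 -> igr leb r2 -> bmf a ->
  Mol a r1 r2 z = \int[leb]_s (r1 (s - z.1) * \int[leb]_y (r2 (y - z.2) * a (s, y))).
Proof.
move=> i1 i2 ba.
rewrite /Mol.
by rewrite -(Rint_leb2 (p1 := fun s => r1 (s - z.1)) (p2 := fun y => r2 (y - z.2))
  (igr_shiftB z.1 i1) (igr_shiftB z.2 i2) ba).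
Qed.

Lemma measurable_Mol a r1 r2 : igr leb r1 -> igr leb r2 -> bmf a ->
  measurable_fun setT (Mol a r1 r2).
Proof.
move=> i1 i2 ba.
rewrite (_ : Mol a r1 r2 = fun z => \int[leb]_s (r1 (s - z.1) *
  \int[leb]_y (r2 (y - z.2) * a (s, y)))); last first.
  by apply/funext => z; exact: MolE.
pose J (w : (R * R) * R) := \int[leb]_y (r2 (y - w.1.2) * a (w.2, y)).
have mJ : measurable_fun setT J.
  apply: (measurable_Rint_leb (H := fun w : ((R * R) * R) * R => r2 (w.2 - w.1.1.2) * a (w.1.2, w.2))).
  apply: measurable_funM.
    apply: (measurableT_comp (igr_meas i2)); apply: measurable_funB; first exact: measurable_snd.
    exact: (measurableT_comp measurable_snd (measurableT_comp measurable_fst measurable_fst)).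
  apply: (measurableT_comp ba.1); apply/measurable_fun_pairP; split; last exact: measurable_snd.
  exact: (measurableT_comp measurable_snd measurable_fst).
apply: (measurable_Rint_leb (H := fun w : (R * R) * R => r1 (w.2 - w.1.1) * J w)).
apply: measurable_funM => //.
apply: (measurableT_comp (igr_meas i1)); apply: measurable_funB; first exact: measurable_snd.
exact: (measurableT_comp measurable_fst measurable_fst).
Qed.

Lemma bmf_Mol a r1 r2 : igr leb r1 -> igr leb r2 -> bmf a -> bmf (Mol a r1 r2).
Proof. by move=> i1 i2 ba; split; [exact: measurable_Mol|exact: Mol_bounded]. Qed.

Lemma dfn_Mol_x a r1 r2 r2' t : igr leb r1 -> ckernel r2 -> dfn r2 r2' ->
  continuous r2' -> bmf a ->
  dfn (fun x => Mol a r1 r2 (t, x)) (fun x => - Mol a r1 r2' (t, x)).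
Proof.
move=> i1 k2 d2 c2' ba x.
have k2' := ckernel_dfn k2 d2 c2'.
have [C r2'C] := ckernel_bounded k2'.
have [_ [b r2b]] := k2; have [_ [b' r2b']] := k2'.
(* Radius containing the supports of all translates of [r2] and [r2'] by [y] with [|x - y| < 1]; the
   cutoff at [N] is put into the integrable weight. *)
pose N := Num.max b b' + `|x| + 1.
have -> : - Mol a r1 r2' (t, x) =
   \int[leb2]_w (r1 (w.1 - t) * (- r2' (w.2 - x)) * a w).
  rewrite /Mol -mulN1r -RintZ.
    by apply: eq_Rintegral => w _ /=; ring.
  by apply: (igr_kernel2 (r1 := fun x => r1 (x - t)) (r2 := fun y => r2' (y - x)));
    [exact: igr_shiftB|apply: igr_shiftB; exact: ckernel_igr|].
have Nout (c y y' : R) : c <= Num.max b b' -> `|x - y| < 1 -> ~~ (`|y'| <= N) -> c < `|y' - y|.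
  rewrite /N -ltNge => cb xy h.
  have h1 : `|y'| <= `|y' - y| + `|y| by rewrite -{1}(subrK y y') ler_normD.
  have h2 : `|y| <= `|x| + `|x - y|.
    by rewrite (distrC x) -{1}(subrK x y) addrC ler_normD.
  lra.
apply: (@is_derive_Rint_local _ _ _ leb2
  (fun w => r1 (w.1 - t) * \1_`[- N, N] w.2 * a w)
  (fun x w => r2 (w.2 - x)) (fun x w => - r2' (w.2 - x)) _ _ C).
- by apply: (igr_kernel2 (r1 := fun x => r1 (x - t)));
    [exact: igr_shiftB|exact: igr_itv|].
- by move=> y; exact: (bmf_comp measurable_snd (ckernel_bmf (ckernel_shift y k2))).
- move=> y w /=.
  have dl : dfn (fun y : R => w.2 - y) (fun=> -1).
    by apply: (dfn_ext (dfnB (dfn_cst w.2) (@dfn_id R))) => z; rewrite sub0r.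
  have := dfn_comp d2 dl y.
  by rewrite mulrN1.
- by move=> y w; rewrite normrN.
- move=> y xy w /=; rewrite indic_itvE in_itv/= -ler_norml.
  have [h|h] := boolP (`|w.2| <= N); first by rewrite mulr1; ring.
  rewrite r2b; first by rewrite !(mulr0, mul0r).
  by apply: (Nout _ y _ _ xy h); rewrite le_max lexx.
- move=> w /=; rewrite indic_itvE in_itv/= -ler_norml.
  have [h|h] := boolP (`|w.2| <= N); first by rewrite mulr1; ring.
  rewrite r2b'; first by rewrite oppr0 !(mulr0, mul0r).
  apply: (Nout _ x _ _ _ h); first by rewrite le_max lexx orbT.
  by rewrite subrr normr0.
Qed.

Lemma dfn_Mol_t a r1 r1' r2 x : igr leb r2 -> ckernel r1 -> dfn r1 r1' ->
  continuous r1' -> bmf a ->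
  dfn (fun t => Mol a r1 r2 (t, x)) (fun t => - Mol a r1' r2 (t, x)).
Proof.
move=> i2 k1 d1 c1' ba t.
have k1' := ckernel_dfn k1 d1 c1'.
have [C r1'C] := ckernel_bounded k1'.
have [_ [b r1b]] := k1; have [_ [b' r1b']] := k1'.
pose N := Num.max b b' + `|t| + 1.
have -> : - Mol a r1' r2 (t, x) =
   \int[leb2]_w ((- r1' (w.1 - t)) * r2 (w.2 - x) * a w).
  rewrite /Mol -mulN1r -RintZ.
    by apply: eq_Rintegral => w _ /=; ring.
  by apply: (igr_kernel2 (r1 := fun x => r1' (x - t)) (r2 := fun y => r2 (y - x)));
    [apply: igr_shiftB; exact: ckernel_igr|exact: igr_shiftB|].
have Nout (c y y' : R) : c <= Num.max b b' -> `|t - y| < 1 -> ~~ (`|y'| <= N) -> c < `|y' - y|.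
  rewrite /N -ltNge => cb xy h.
  have h1 : `|y'| <= `|y' - y| + `|y| by rewrite -{1}(subrK y y') ler_normD.
  have h2 : `|y| <= `|t| + `|t - y|.
    by rewrite (distrC t) -{1}(subrK t y) addrC ler_normD.
  lra.
apply: (@is_derive_Rint_local _ _ _ leb2
  (fun w => \1_`[- N, N] w.1 * r2 (w.2 - x) * a w)
  (fun t w => r1 (w.1 - t)) (fun t w => - r1' (w.1 - t)) _ _ C).
- by apply: (igr_kernel2 (r2 := fun y => r2 (y - x)));
    [exact: igr_itv|exact: igr_shiftB|].
- by move=> y; exact: (bmf_comp measurable_fst (ckernel_bmf (ckernel_shift y k1))).
- move=> y w /=.
  have dl : dfn (fun y : R => w.1 - y) (fun=> -1).
    by apply: (dfn_ext (dfnB (dfn_cst w.1) (@dfn_id R))) => z; rewrite sub0r.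
  have := dfn_comp d1 dl y.
  by rewrite mulrN1.
- by move=> y w; rewrite normrN.
- move=> y xy w /=; rewrite indic_itvE in_itv/= -ler_norml.
  have [h|h] := boolP (`|w.1| <= N); first by rewrite mul1r; ring.
  rewrite r1b; first by rewrite !(mulr0, mul0r).
  by apply: (Nout _ y _ _ xy h); rewrite le_max lexx.
- move=> w /=; rewrite indic_itvE in_itv/= -ler_norml.
  have [h|h] := boolP (`|w.1| <= N); first by rewrite mul1r; ring.
  rewrite r1b'; first by rewrite oppr0 !(mulr0, mul0r).
  apply: (Nout _ t _ _ _ h); first by rewrite le_max lexx orbT.
  by rewrite subrr normr0.
Qed.

End kernels.

(** * Nonlocal solutions and their mollifications *)

Lemma lipschitz_cts (R : realType) (V : R -> R) (L : R) : 0 <= L ->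
  (forall x y, `|V x - V y| <= L * `|x - y|) -> continuous V.
Proof.
move=> L0 VL x; apply/cvgrPdist_lt => e e0.
have L1 : 0 < L + 1 by rewrite ltr_wpDl.
have eL : 0 < e / (L + 1) by exact: divr_gt0.
near=> y.
have xy : `|x - y| < e / (L + 1).
  by near: y; exact: (@nbhsx_ballx _ _ x (e / (L + 1))).
apply: le_lt_trans (VL x y) _.
apply: (@le_lt_trans _ _ ((L + 1) * `|x - y|)); first by rewrite ler_wpM2r//; lra.
by rewrite mulrC -ltr_pdivlMr.
Unshelve. all: by end_near. Qed.

Section data.
Variable R : realType.
Notation leb := (@lebesgue_measure R).
Notation leb2 := (@lebesgue_measure R \x @lebesgue_measure R)%E.

(** With [kap y] the rescaled [eta] at [- y], this is the convolution in [x], written as an average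
    over the points to the right of [z.2]. *)
Definition convk (kap : R -> R) (a : R * R -> R) (z : R * R) :=
  \int[leb]_y (kap y * a (z.1, z.2 + y)).

Definition flux (kap V : R -> R) (a : R * R -> R) (z : R * R) :=
  (0 <= z.1)%R%:R * (V (convk kap a z) * a z).

(* A bounded solution for a fixed scale, extended to negative times by the initial datum (with zero flux there), so that the weak formulation holds on the whole plane. *)
Record nldata := NLData {
  nl_kap : R -> R; nl_K : R;
  nl_ikap : igr leb nl_kap; nl_kap0 : forall z, 0 <= nl_kap z;
  nl_kapK : forall z, nl_kap z <= nl_K;
  nl_kapN : forall z, z <= 0 -> nl_kap z = 0;
  nl_kapD : forall x y, 0 < x -> x <= y -> nl_kap y <= nl_kap x;
  nl_kap1 : \int[leb]_z nl_kap z = 1;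
  nl_V : R -> R; nl_L : R;
  nl_L0 : 0 <= nl_L; nl_VL : forall x y, `|nl_V x - nl_V y| <= nl_L * `|x - y|;
  nl_VD : forall x y, 0 <= x -> x <= y -> y <= 1 -> nl_V y <= nl_V x;
  nl_u : R * R -> R; nl_M : R; nl_u0 : R -> R;
  nl_mu : measurable_fun setT nl_u; nl_uM : forall z, `|nl_u z| <= nl_M;
  nl_mu0 : measurable_fun setT nl_u0; nl_u001 : forall x, 0 <= nl_u0 x <= 1;
  nl_uu0 : forall t x, t < 0 -> nl_u (t, x) = nl_u0 x;
  nl_weak : forall th th' ps ps' : R -> R,
    (forall n, smooth n th) -> (forall n, smooth n ps) -> dfn th th' -> dfn ps ps' ->
    ckernel th -> ckernel ps ->
    \int[leb2]_w (th' w.1 * ps w.2 * nl_u w) +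
    \int[leb2]_w (th w.1 * ps' w.2 * flux nl_kap nl_V nl_u w) = 0 }.

Record mollifier := Mollifier {
  mo_d : R; mo_r : R -> R; mo_B : R -> R;
  mo_d0 : 0 < mo_d; mo_sr : forall n, smooth n mo_r; mo_r0 : forall x, 0 <= mo_r x;
  mo_rN : forall x, x <= 0 \/ mo_d <= x -> mo_r x = 0; mo_dB : dfn mo_B mo_r;
  mo_BE : forall x, (x <= 0 -> mo_B x = 0) /\ (mo_d <= x -> mo_B x = 1) }.

End data.

Section nonlocal.
Variable R : realType.
Notation leb := (@lebesgue_measure R).
Notation leb2 := (@lebesgue_measure R \x @lebesgue_measure R)%E.
Variable D : nldata R.
Local Notation kap := (nl_kap D).
Local Notation K := (nl_K D).
Local Notation V := (nl_V D).
Local Notation L := (nl_L D).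
Local Notation uh := (nl_u D).
Local Notation M := (nl_M D).
Let ikap := nl_ikap D. Let kap0 := nl_kap0 D. Let kapK := nl_kapK D.
Let kapN := nl_kapN D. Let kapD := nl_kapD D. Let kap1 := nl_kap1 D.
Let L0 := nl_L0 D. Let VL := nl_VL D.
Let muh := nl_mu D. Let uhM := nl_uM D.
Let u001 := nl_u001 D. Let weak := nl_weak D.

Definition Wn := convk kap uh.

Definition fl := flux kap V uh.

Lemma K_ge0 : 0 <= K. Proof. exact: le_trans (kap0 0) (kapK 0). Qed.

Lemma M_ge0 : 0 <= M. Proof. exact: le_trans (normr_ge0 _) (uhM (0, 0)). Qed.

Lemma buh : bmf uh. Proof. by split => //; exists M. Qed.

Lemma V_cts : continuous V. Proof. exact: lipschitz_cts L0 VL. Qed.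

Lemma mV : measurable_fun setT V.
Proof. by apply: continuous_measurable_fun; exact: V_cts. Qed.

Lemma kap_avg (F : R -> R) c : bmf F -> (forall y, `|F y| <= c) ->
  `|\int[leb]_y (kap y * F y)| <= c.
Proof. by move=> bF Fc; rewrite -[c]mulr1 -kap1; exact: Rint_wnorm. Qed.

Lemma bmf_section (a : R * R -> R) t x : bmf a -> bmf (fun y : R => a (t, x + y)).
Proof.
apply: (bmf_comp (h := fun y : R => (t, x + y))).
by apply/measurable_fun_pairP; split; [exact: measurable_cst|exact: (measurable_shift x)].
Qed.

Lemma bmf_kap (a : R * R -> R) : bmf a -> bmf (fun z : R * R => \int[leb]_y (kap y * a (z.1, z.2 + y))).
Proof.
move=> ba; apply: (bmf_Rint_leb (F := fun zy : (R * R) * R => a (zy.1.1, zy.1.2 + zy.2))) => //.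
apply: (bmf_comp (h := fun zy : (R * R) * R => (zy.1.1, zy.1.2 + zy.2))) => //.
apply/measurable_fun_pairP; split.
  exact: (measurableT_comp measurable_fst measurable_fst).
apply: measurable_funD; last exact: measurable_snd.
exact: (measurableT_comp measurable_snd measurable_fst).
Qed.

Lemma Wn_le z : `|Wn z| <= M.
Proof. by apply: kap_avg => //; exact: bmf_section buh. Qed.

Lemma bWn : bmf Wn. Proof. exact: bmf_kap buh. Qed.

Definition MV := `|V 0| + L * M.

Definition Mf := MV * M.

Lemma V_le w : `|w| <= M -> `|V w| <= MV.
Proof.
move=> wM; have := VL w 0; rewrite subr0 => h.
have h1 : `|V w| <= `|V w - V 0| + `|V 0| by rewrite -{1}(subrK (V 0) (V w)) ler_normD.
have h2 : L * `|w| <= L * M by rewrite ler_wpM2l.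
rewrite /MV; lra.
Qed.

Lemma MV_ge0 : 0 <= MV.
Proof. by rewrite addr_ge0// mulr_ge0// M_ge0. Qed.

Lemma Mf_ge0 : 0 <= Mf.
Proof. by rewrite mulr_ge0 ?MV_ge0 ?M_ge0. Qed.

Lemma fl_le z : `|fl z| <= Mf.
Proof.
rewrite /fl /flux normrM normrM -/Wn.
have h : `|V (Wn z)| * `|uh z| <= Mf by rewrite ler_pM// V_le// Wn_le.
case: (0 <= z.1); rewrite ?normr1 ?mul1r// normr0 mul0r; exact: Mf_ge0.
Qed.

Lemma bfl : bmf fl.
Proof.
split; last by exists Mf => z; exact: fl_le.
apply: measurable_funM; last first.
  apply: measurable_funM; last exact: muh.
  exact: (measurableT_comp mV bWn.1).
rewrite (_ : (fun z : R * R => _) = (fun z => \1_`[0, +oo[ z.1)); last first.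
  by apply/funext => z; rewrite indic_itvE in_itv/= andbT.
exact: (measurableT_comp (mindic_itv `[0, +oo[) measurable_fst).
Qed.

(* Moving the base point by [x' - x] changes the primitive of [uh] by at most two intervals of that length. *)
Lemma Wn_lip_x t x x' : `|Wn (t, x') - Wn (t, x)| <= K * (2 * M * `|x' - x|).
Proof.
wlog xx' : x x' / x <= x'.
  move=> H; have [|/ltW] := leP x x'; first exact: H.
  by rewrite distrC (distrC x'); exact: H.
have b' x1 := bmf_section t x1 buh.
rewrite /Wn /convk /= -RintB; [|exact: (igrM ikap (b' _))..].
under eq_Rintegral do rewrite -mulrBr.
apply: (abel_norm ikap) => //; first exact: bmfB.
move=> z z0; rewrite [`|x' - x|]ger0_norm ?subr_ge0//.
have ruh : bmf (fun y => uh (t, y)).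
  by have := bmf_section t 0 buh; congr bmf; apply/funext => y; rewrite add0r.
have tr x1 : \int[leb]_y (\1_`[0, z] y * uh (t, x1 + y)) =
    \int[leb]_y (\1_`[x1, x1 + z] y * uh (t, y)).
  rewrite -(@Rint_shift _ x1 (fun y => \1_`[x1, x1 + z] y * uh (t, y))); last exact: (igrM (igr_itv _ _) ruh).
  apply: eq_Rintegral => y _; congr (_ * _).
  by rewrite !indic_itvE !in_itv/= lerDl lerD2l.
under eq_Rintegral do rewrite mulrBr.
rewrite RintB ?tr; [|exact: (igrM (igr_itv _ _) (b' _))..].
rewrite -RintB; [|exact: (igrM (igr_itv _ _) ruh)..].
have i1 := igr_itv x x'; have i2 := igr_itv (x + z) (x' + z).
apply: (@le_trans _ _ (\int[leb]_y (M * (\1_`[x, x'] y + \1_`[x + z, x' + z] y)))); last first.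
  rewrite RintZ ?RintD ?Rint_itv ?lerD2r//; last exact: igrD.
  by rewrite le_eqVlt; apply/orP; left; apply/eqP; ring.
apply: (le_trans (Rint_norm _)).
  by apply: igrB; exact: (igrM (igr_itv _ _) ruh).
apply: Rint_le.
- by apply/igr_norm/igrB; exact: (igrM (igr_itv _ _) ruh).
- exact/igrZ/igrD.
move=> y; rewrite -mulrBl normrM mulrC ler_pM//.
rewrite !indic_itvE !in_itv/=.
case: (leP x' y) => h1; case: (leP y (x' + z)) => h2; case: (leP x y) => h3;
  case: (leP y (x + z)) => h4; case: (leP y x') => h5; case: (leP (x + z) y) => h6;
  rewrite /= ?subrr ?subr0 ?sub0r ?normrN ?normr1 ?normr0 ?addr0 ?add0r ?lerDl ?lerDr//; lra.
Qed.

Section mollified.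
Variable mo : mollifier R.
Local Notation d := (mo_d mo).
Local Notation r := (mo_r mo).
Local Notation B := (mo_B mo).
Let d0 := mo_d0 mo. Let sr := mo_sr mo. Let r0 := mo_r0 mo.
Let rN := @mo_rN _ mo. Let dB := mo_dB mo. Let BE := mo_BE mo.

Lemma kr : ckernel r.
Proof.
split; first exact: (sr 0%N).
exists d => x dx; apply: rN.
have [x0|x0] := leP x 0; first by left.
by right; move: dx; rewrite gtr0_norm// => /ltW.
Qed.

Lemma ir : igr leb r. Proof. exact/ckernel_igr/kr. Qed.

Lemma Rint_r : \int[leb]_x r x = 1.
Proof.
have := FTC2 (ltW d0) dB (sr 0%N).
rewrite (BE 0).1// (BE d).2// subr0 => <-.
apply: eq_Rintegral => x _; rewrite indic_itvE in_itv/=.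
have [h|] := boolP (0 <= x <= d); first by rewrite mul1r.
rewrite negb_and -!ltNge => h; rewrite mul0r rN//.
by case/orP: h => /ltW; auto.
Qed.

Lemma irr : igr leb2 (fun w => r w.1 * r w.2).
Proof. exact: igr_prod ir ir. Qed.

Lemma rr_ge0 (w : R * R) : 0 <= r w.1 * r w.2.
Proof. by rewrite mulr_ge0. Qed.

Lemma Rint_rr : \int[leb2]_w (r w.1 * r w.2) = 1.
Proof.
by rewrite (Rint_tensor ir ir) Rint_r mulr1.
Qed.

(** [vm] and [gm] satisfy the conservation law classically, but [gm] is no function of [vm] and its
    average; [commutator] measures the discrepancy. *)
Definition vm := Mol uh r r.

Definition gm := Mol fl r r.

Lemma vm_avg z : vm z = \int[leb2]_w (r w.1 * r w.2 * uh (z.1 + w.1, z.2 + w.2)).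
Proof. by rewrite /vm Mol_shift//; [exact: ir|exact: ir|exact: buh]. Qed.

Lemma gm_avg z : gm z = \int[leb2]_w (r w.1 * r w.2 * fl (z.1 + w.1, z.2 + w.2)).
Proof. by rewrite /gm Mol_shift//; [exact: ir|exact: ir|exact: bfl]. Qed.

Lemma avg_le (F : R * R -> R) c : bmf F -> (forall w, `|F w| <= c) ->
  `|\int[leb2]_w (r w.1 * r w.2 * F w)| <= c.
Proof.
move=> bF Fc; rewrite -[c]mulr1 -Rint_rr.
by apply: Rint_wnorm => //; [exact: irr|move=> w; exact: rr_ge0].
Qed.

Lemma vm_le z : `|vm z| <= M.
Proof. by rewrite vm_avg; apply: avg_le => //; exact: bmf_shift buh. Qed.

Lemma gm_le z : `|gm z| <= Mf.
Proof.
rewrite gm_avg; apply: avg_le; first exact: bmf_shift bfl.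
by move=> w; exact: fl_le.
Qed.

Lemma smooth_B n : smooth n B.
Proof. by case: n => [|n]; [exact: dfn_cts dB|exists r]. Qed.

(** Smoothed signed indicator of the segment from 0 to [x]; its derivative in [x] is [r (y - x)]. *)
Definition ps (x y : R) := B y - B (y - x).

Lemma smooth_ps x n : smooth n (ps x).
Proof.
apply: (@smooth_ext _ _ (fun y => B y + (- 1) * B (1 * y + (- x)))).
  by move=> y; rewrite /ps mul1r mulN1r.
apply: smoothD; first exact: smooth_B.
by apply: smoothZ; apply: smooth_affine; exact: smooth_B.
Qed.

Lemma dfn_ps x : dfn (ps x) (fun y => r y - r (y - x)).
Proof.
apply: dfnB => //; have := dfn_shift (- x) dB.
by rewrite (_ : (fun y => B (- x + y)) = (fun y => B (y - x))) 1?(_ : (fun y => r (- x + y)) = (fun y => r (y - x)))//;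
  apply/funext => y; rewrite addrC.
Qed.

Lemma ps_out x y : d + `|x| < `|y| -> ps x y = 0.
Proof.
move=> h; have := ler_norm x; have := ler_norm (- x); rewrite normrN => h1 h2.
have d0' := d0; rewrite /ps; have [y0|y0] := leP 0 y.
  rewrite (ger0_norm y0) in h.
  by rewrite (BE y).2 ?(BE (y - x)).2 ?subrr//; lra.
rewrite (ltr0_norm y0) in h.
by rewrite (BE y).1 ?(BE (y - x)).1 ?subrr//; lra.
Qed.

Lemma ckernel_ps x : ckernel (ps x).
Proof.
split; first exact: (smooth_ps x 0%N).
by exists (d + `|x|) => y; exact: ps_out.
Qed.

(* The primitive of the closed form [v dx - g dt]. *)
Definition Um (z : R * R) :=
  \int[leb2]_w (r (w.1 - z.1) * ps z.2 w.2 * uh w) -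
  \int[leb2]_w (ps z.1 w.1 * r w.2 * fl w).

Lemma krs c : igr leb (fun x => r (x - c)).
Proof. exact/ckernel_igr/ckernel_shift/kr. Qed.

Lemma ips x : igr leb (ps x). Proof. exact/ckernel_igr/ckernel_ps. Qed.

(** The weak equation tested on [ps t] times [ps x] expresses that the form is closed: the path
    through [(0, x)] may replace the path through [(t, 0)]. The former gives the derivative in time,
    the latter the derivative in space. *)
Lemma Um_t z : Um z = Um (0, z.2) - \int[leb2]_w (ps z.1 w.1 * r (w.2 - z.2) * fl w).
Proof.
case: z => t x; rewrite /Um /=.
have ps0 y : ps 0 y = 0 by rewrite /ps subr0 subrr.
under [X in _ = _ - X - _]eq_Rintegral do rewrite ps0 !mul0r.
rewrite Rint0 subr0.
have := weak (smooth_ps t) (smooth_ps x) (@dfn_ps t) (@dfn_ps x) (ckernel_ps t) (ckernel_ps x).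
under eq_Rintegral do rewrite !mulrBl.
under [X in _ + X]eq_Rintegral do rewrite mulrBr mulrBl.
rewrite !RintB.
- move=> H.
  under [X in _ = X - _]eq_Rintegral do rewrite subr0.
  lra.
- exact: igr_kernel2 (ips t) ir bfl.
- exact: (igr_kernel2 (r2 := fun y => r (y - x)) (ips t) (krs x) bfl).
- exact: igr_kernel2 ir (ips x) buh.
- exact: (igr_kernel2 (r1 := fun y => r (y - t)) (krs t) (ips x) buh).
Qed.

Lemma r_bounded : exists C, forall x, `|r x| <= C.
Proof. exact/ckernel_bounded/kr. Qed.

Lemma bmf_ps x : bmf (ps x). Proof. exact/ckernel_bmf/ckernel_ps. Qed.

Lemma is_derive_ps x y : is_derive x (1 : R) (ps ^~ y) (r (y - x)).
Proof.
have dl : dfn (fun x : R => y - x) (fun=> -1).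
  by apply: (dfn_ext (dfnB (dfn_cst y) (@dfn_id R))) => z; rewrite sub0r.
have := dfnB (dfn_cst (B y)) (dfn_comp dB dl) x.
by rewrite mulrN1 sub0r opprK.
Qed.

Lemma ps_local x x' y : `|x - x'| < 1 ->
  ps x' y = \1_`[- (d + `|x| + 1), d + `|x| + 1] y * ps x' y.
Proof.
move=> xx'; rewrite indic_itvE in_itv/= -ler_norml.
case: leP => h; first by rewrite mul1r.
rewrite mul0r ps_out//.
have h2 : `|x'| <= `|x| + `|x - x'|.
  by rewrite (distrC x) -{1}(subrK x x') addrC ler_normD.
lra.
Qed.

Lemma r_local x y : r (y - x) = \1_`[- (d + `|x| + 1), d + `|x| + 1] y * r (y - x).
Proof.
rewrite indic_itvE in_itv/= -ler_norml.
case: leP => h; first by rewrite mul1r.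
rewrite mul0r rN//.
have := ler_norm x; have := ler_norm (- x); rewrite normrN => h1 h2; have d0' := d0.
have [y0|y0] := leP 0 y; first by rewrite (ger0_norm y0) in h; right; lra.
by rewrite (ltr0_norm y0) in h; left; lra.
Qed.

Lemma dUm_x t : dfn (fun x => Um (t, x)) (fun x => vm (t, x)).
Proof.
move=> x; rewrite /Um /vm /Mol /=.
rewrite -[X in is_derive _ _ _ X]subr0; apply: is_deriveB.
have [C rC] := r_bounded.
pose I := \1_`[- (d + `|x| + 1), d + `|x| + 1] : R -> R.
apply: (@is_derive_Rint_local _ _ _ leb2 (fun w => r (w.1 - t) * I w.2 * uh w)
  (fun x w => ps x w.2) (fun x w => r (w.2 - x)) _ _ C).
- exact: (igr_kernel2 (r1 := fun y => r (y - t)) (krs t) (igr_itv _ _) buh).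
- by move=> y; apply: (bmf_comp (h := snd)) => //; exact: bmf_ps.
- by move=> y w; exact: is_derive_ps.
- by move=> y w.
- by move=> x' xx' w; rewrite {1}(ps_local w.2 xx') /I; ring.
- by move=> w; rewrite {1}(r_local x) /I; ring.
Qed.

Lemma dUm_t x : dfn (fun t => Um (t, x)) (fun t => - gm (t, x)).
Proof.
move=> t; rewrite (_ : (fun t => Um (t, x)) = (fun t => Um (0, x) -
   \int[leb2]_w (ps t w.1 * r (w.2 - x) * fl w))); last first.
  by apply/funext => s; rewrite Um_t.
rewrite -[X in is_derive _ _ _ X]sub0r; apply: is_deriveB.
have [C rC] := r_bounded.
pose I := \1_`[- (d + `|t| + 1), d + `|t| + 1] : R -> R.
apply: (@is_derive_Rint_local _ _ _ leb2 (fun w => I w.1 * r (w.2 - x) * fl w)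
  (fun t w => ps t w.1) (fun t w => r (w.1 - t)) _ _ C).
- exact: (igr_kernel2 (r2 := fun y => r (y - x)) (igr_itv _ _) (krs x) bfl).
- by move=> y; apply: (bmf_comp (h := fst)) => //; exact: bmf_ps.
- by move=> y w; exact: is_derive_ps.
- by move=> y w.
- by move=> x' xx' w; rewrite {1}(ps_local w.1 xx') /I; ring.
- by move=> w /=; rewrite {1}r_local /I; ring.
Qed.

(** Neither constant depends on the mollifier; the regularity in time that survives as [d] tends to
    0 rests on this. *)
Lemma Um_lip t x t' x' : `|Um (t', x') - Um (t, x)| <= Mf * `|t' - t| + M * `|x' - x|.
Proof.
have h1 := dfn_lip t t' (dUm_t x') (fun t => _ : `|- gm (t, x')| <= Mf).
have h2 := dfn_lip x x' (dUm_x t) (fun x => vm_le (t, x)).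
have -> : Um (t', x') - Um (t, x) = (Um (t', x') - Um (t, x')) + (Um (t, x') - Um (t, x)) by ring.
apply: (le_trans (ler_normD _ _)); apply: lerD => //.
by apply: h1 => s; rewrite normrN gm_le.
Qed.

End mollified.
End nonlocal.

Lemma mollifiers (R : realType) : exists C : R, forall d, 0 < d ->
  exists mo : mollifier R, mo_d mo = d /\ forall x, mo_r mo x <= C / d.
Proof.
have [C H] := mollifier_exists R; exists C => d d0.
have [r [B [sr rC rN dB BE]]] := H d d0.
have r0 x : 0 <= r x by have /andP[] := rC x.
exists (Mollifier d0 sr r0 rN dB BE); split => // x.
by have /andP[] := rC x.
Qed.

Section averages.
Variable R : realType.
Notation leb := (@lebesgue_measure R).
Notation leb2 := (@lebesgue_measure R \x @lebesgue_measure R)%E.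
Variable D : nldata R.
Local Notation kap := (nl_kap D).
Local Notation K := (nl_K D).
Local Notation uh := (nl_u D).
Local Notation M := (nl_M D).
Local Notation MF := (Mf D).
Let ikap := nl_ikap D. Let kap0 := nl_kap0 D. Let kapK := nl_kapK D.
Let kapN := nl_kapN D. Let kapD := nl_kapD D.
Let L0 := nl_L0 D.
Let muh := nl_mu D. Let uhM := nl_uM D.
Let u001 := nl_u001 D.
Variable mo : mollifier R.
Local Notation d := (mo_d mo).
Local Notation r := (mo_r mo).
Let d0 := mo_d0 mo. Let sr := mo_sr mo. Let r0 := mo_r0 mo.
Let rN := @mo_rN _ mo.

(** Restricts a pointwise hypothesis to the support of the mollifier: elsewhere the weight kills the
    integrand. *)
Lemma mo_int (P : R -> Prop) : (forall s, 0 < s -> s < d -> P s) -> forall s, r s = 0 \/ P s.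
Proof.
move=> H s; have [s0|s0] := leP s 0; first by left; apply: rN; left.
have [sd|sd] := leP d s; first by left; apply: rN; right.
by right; exact: H.
Qed.

Lemma avg_iter (F : R * R -> R) : bmf F ->
  \int[leb2]_w (r w.1 * r w.2 * F w) = \int[leb]_s (r s * \int[leb]_p (r p * F (s, p))).
Proof. by move=> bF; rewrite -(Rint_leb2 (ir mo) (ir mo) bF). Qed.

Lemma bmf_avg1 (F : R * R -> R) : bmf F -> bmf (fun s => \int[leb]_p (r p * F (s, p))).
Proof. by move=> bF; apply: bmf_Rint_leb => //; exact: ir. Qed.

Lemma avg2_le (F : R * R -> R) (G : R -> R) : bmf F -> bmf G ->
  (forall s p, 0 < s -> s < d -> 0 < p -> p < d -> `|F (s, p)| <= G s) ->
  `|\int[leb2]_w (r w.1 * r w.2 * F w)| <= \int[leb]_s (r s * G s).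
Proof.
move=> bF bG FG; rewrite avg_iter//.
have b1 := bmf_avg1 bF.
apply: (le_trans (Rint_norm (igrM (ir mo) b1))).
apply: Rint_le; [exact/igr_norm/igrM/b1/ir|exact/igrM/bG/ir|].
move=> s; have [->|FGs] := mo_int (fun s s0 sd => FG s ^~ s0 ^~ sd) s.
  by rewrite !mul0r normr0.
rewrite normrM (ger0_norm (r0 s)) ler_wpM2l//.
have bs : bmf (fun p => F (s, p)).
  by apply: (bmf_comp (h := pair s)) => //; exact: measurable_pair1.
apply: (le_trans (Rint_norm (igrM (ir mo) bs))).
rewrite -[leRHS]mulr1 -(Rint_r mo) -RintZ; last exact: ir.
apply: Rint_le; [exact/igr_norm/igrM/bs/ir|exact/igrZ/ir|].
move=> p; have [->|FGp] := mo_int FGs p.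
  by rewrite !mul0r mulr0 normr0.
by rewrite normrM (ger0_norm (r0 p)) mulrC ler_wpM2r.
Qed.

Lemma avg_ae_le (G : R -> R) t c : bmf G -> {ae leb, forall s, t < s -> s < t + d -> G s <= c} ->
  \int[leb]_s (r s * G (t + s)) <= c.
Proof.
move=> bG Gc.
have irt : igr leb (fun s => r (s - t)) by exact: krs.
have -> : \int[leb]_s (r s * G (t + s)) = \int[leb]_s (r (s - t) * G s).
  rewrite -(@Rint_shift _ t (fun s => r (s - t) * G s)); last exact: igrM.
  by apply: eq_Rintegral => s _; congr (r _ * _); ring.
have -> : c = \int[leb]_s (c * r (s - t)).
  rewrite RintZ// -(@Rint_shift _ t (fun s => r (s - t)))//.
  by under eq_Rintegral do rewrite addrC addrA addNr add0r; rewrite Rint_r mulr1.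
apply: Rint_ae_le; [exact: igrM|exact: igrZ|].
have FF := ae_filter_ringOfSetsType leb.
apply: filterS Gc => s Gc; rewrite mulrC.
have GcP s' : 0 < s' -> s' < d -> s' = s - t -> G s <= c.
  by move=> s0 sd E; apply: Gc; lra.
have [->|H] := mo_int GcP (s - t); first by rewrite !mulr0.
by rewrite ler_wpM2r// H.
Qed.

Lemma avg_const c : \int[leb]_s (r s * c) = c.
Proof.
under eq_Rintegral do rewrite mulrC.
by rewrite RintZ ?Rint_r ?mulr1//; exact: ir.
Qed.

Lemma bvm : bmf (vm D mo).
Proof. by apply: bmf_Mol; [exact: ir|exact: ir|exact: buh]. Qed.

Lemma vm_iter z : vm D mo z = \int[leb]_s (r s * \int[leb]_p (r p * uh (z.1 + s, z.2 + p))).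
Proof. by rewrite vm_avg avg_iter//; exact: bmf_shift (buh D). Qed.

Definition mm := convk kap (vm D mo).

Lemma bmm : bmf mm. Proof. exact: bmf_kap bvm. Qed.

(** Fubini commutes the kernel average with the mollification in both variables; through this
    identity regularity passes between [mm] and [Wn]. *)
Lemma mm_avg z : mm z = \int[leb2]_w (r w.1 * r w.2 * Wn D (z.1 + w.1, z.2 + w.2)).
Proof.
rewrite avg_iter; last exact: bmf_shift (bWn D).
rewrite /mm /convk.
under eq_Rintegral do rewrite vm_iter /=.
have mF : measurable_fun setT (fun w : (R * R) * R => (z.1 + w.1.2, z.2 + w.1.1 + w.2)).
  apply/measurable_fun_pairP; split; apply: measurable_funD => //.
  - exact: (measurableT_comp measurable_snd measurable_fst).
  - apply: measurable_funD => //.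
    exact: (measurableT_comp measurable_fst measurable_fst).
rewrite (Rint_leb_swap (F := fun y s => \int[leb]_p (r p * uh (z.1 + s, z.2 + y + p))) ikap (ir mo)).
  apply: eq_Rintegral => s _; congr (_ * _).
  rewrite (Rint_leb_swap (F := fun y p => uh (z.1 + s, z.2 + y + p)) ikap (ir mo)).
    apply: eq_Rintegral => p _; congr (_ * _); rewrite /Wn /convk /=.
    by apply: eq_Rintegral => y _; rewrite addrAC.
  apply: (bmf_comp (h := fun w : R * R => (z.1 + s, z.2 + w.1 + w.2))); last exact: buh.
  apply/measurable_fun_pairP; split; first exact: measurable_cst.
  apply: measurable_funD; last exact: measurable_snd.
  by apply: measurable_funD.
apply: (bmf_Rint_leb (F := fun w : (R * R) * R => uh (z.1 + w.1.2, z.2 + w.1.1 + w.2))); first exact: ir.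
exact: (bmf_comp mF (buh D)).
Qed.

Lemma vm_dfn_x : exists v', [/\ forall t, dfn (fun x => vm D mo (t, x)) (fun x => v' (t, x)), bmf v' &
  exists v'', (forall t, dfn (fun x => v' (t, x)) (fun x => v'' (t, x))) /\ bmf v''].
Proof.
have [r' dr [r'' dr' [r3 dr'' _]]] := sr 3%N.
have k1 := ckernel_dfn (kr mo) dr (dfn_cts dr').
have k2 := ckernel_dfn k1 dr' (dfn_cts dr'').
exists (fun z => - Mol uh r r' z); split.
- by move=> t; apply: dfn_Mol_x; [exact: ir|exact: kr| |exact: dfn_cts dr'|exact: buh].
- by apply/bmfN/bmf_Mol; [exact: ir|exact: ckernel_igr|exact: buh].
exists (Mol uh r r''); split.
  move=> t x; rewrite -[X in is_derive _ _ _ X]opprK; apply: is_deriveN.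
  by apply: dfn_Mol_x; [exact: ir| | |exact: dfn_cts dr''|exact: buh].
by apply: bmf_Mol; [exact: ir|exact: ckernel_igr|exact: buh].
Qed.

Lemma vm_cts t : continuous (fun x => vm D mo (t, x)).
Proof. by have [v' [dv _ _]] := vm_dfn_x; exact: dfn_cts (dv t). Qed.

(** The increment of [vm] has the increment of [Um] as a primitive in the kernel variable, so the
    layer-cake bound turns [Um_lip] into an estimate uniform in the mollifier. The factor 2 counts
    the two ends of the interval. *)
Lemma mm_lip t x t' x' :
  `|mm (t', x') - mm (t, x)| <= K * (2 * (MF * `|t' - t| + M * `|x' - x|)).
Proof.
rewrite /mm /convk /=.
have bv s y := bmf_section s y bvm.
rewrite -RintB; [|exact: (igrM ikap (bv _ _))..].
under eq_Rintegral do rewrite -mulrBr.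
apply: (abel_norm ikap) => //; first exact: bmfB.
move=> z z0.
have dh := dfnB (dfn_shift x' (dUm_x D mo t')) (dfn_shift x (dUm_x D mo t)).
rewrite (FTC2 z0 dh); last first.
  move=> y; apply: cvgB.
    by apply: (@continuous_comp _ _ _ (fun y => x' + y) (fun x => vm D mo (t', x)));
      [exact: (dfn_cts (dfnD (dfn_cst x') (@dfn_id R)))|exact: vm_cts].
  by apply: (@continuous_comp _ _ _ (fun y => x + y) (fun x => vm D mo (t, x)));
      [exact: (dfn_cts (dfnD (dfn_cst x) (@dfn_id R)))|exact: vm_cts].
have h1 := Um_lip D mo t (x + z) t' (x' + z).
have h2 := Um_lip D mo t (x + 0) t' (x' + 0).
have E y : x' + y - (x + y) = x' - x by ring.
rewrite !E in h1 h2.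
apply: (le_trans (ler_normB _ _)).
by rewrite mulr2n mulrDl mul1r lerD.
Qed.

Lemma mm_le z : `|mm z| <= M.
Proof.
apply: kap_avg; first exact: bmf_section bvm.
by move=> y; exact: vm_le.
Qed.

(* Replaces averaging over [x] by the Lipschitz bound in [x]. *)
Lemma mm_sub_le t x c :
  `|mm (t, x) - c| <= \int[leb]_s (r s * `|Wn D (t + s, x) - c|) + K * (2 * M * d).
Proof.
rewrite mm_avg.
have bW := bmf_shift (t, x) (bWn D).
have -> : \int[leb2]_w (r w.1 * r w.2 * Wn D ((t, x).1 + w.1, (t, x).2 + w.2)) - c =
   \int[leb2]_w (r w.1 * r w.2 * (Wn D (t + w.1, x + w.2) - c)).
  have -> : c = \int[leb2]_w (r w.1 * r w.2 * c).
    under eq_Rintegral do rewrite mulrC.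
    by rewrite RintZ ?Rint_rr ?mulr1//; exact: irr.
  rewrite -RintB; last 2 first.
  - by apply: igrM => //; exact: irr.
  - by apply: igrM (bmf_cst _ _); exact: irr.
  apply: eq_Rintegral => w _ /=; rewrite mulrBr; congr (_ - _ * _).
  under eq_Rintegral do rewrite mulrC.
  by rewrite RintZ ?Rint_rr ?mulr1//; exact: irr.
have bs : bmf (fun s => Wn D (t + s, x)).
  apply: (bmf_comp (h := fun s => (t + s, x))); last exact: bWn.
  by apply/measurable_fun_pairP; split; [exact: (measurable_shift t)|exact: measurable_cst].
have bG : bmf (fun s => `|Wn D (t + s, x) - c|).
  by apply/bmf_norm/bmfB => //; exact: bmf_cst.
have -> : K * (2 * M * d) = \int[leb]_s (r s * (K * (2 * M * d))) by rewrite avg_const.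
rewrite -RintD; last 2 first.
- exact/igrM/bG/ir.
- by apply: igrM (bmf_cst _ _); exact: ir.
under [leRHS]eq_Rintegral do rewrite -mulrDr.
apply: avg2_le.
- by apply: bmfB => //; exact: bmf_cst.
- by apply: bmfD => //; exact: bmf_cst.
move=> s p s0 sd p0 pd /=.
have h := Wn_lip_x D (t + s) x (x + p).
have E : x + p - x = p by ring.
rewrite E (gtr0_norm p0) in h.
have h2 : K * (2 * M * p) <= K * (2 * M * d).
  by rewrite ler_wpM2l ?K_ge0// ler_wpM2l ?mulr_ge0 ?M_ge0// ltW.
have -> : Wn D (t + s, x + p) - c = (Wn D (t + s, x) - c) + (Wn D (t + s, x + p) - Wn D (t + s, x)) by ring.
by apply: (le_trans (ler_normD _ _)); rewrite lerD2l; lra.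
Qed.

End averages.

Lemma addr_halves (R : realFieldType) (x e : R) : x + e = e / 2 + x + e / 2.
Proof. by rewrite addrAC -splitr addrC. Qed.

(** * Regularity in time and the commutator estimate *)

Section time_regularity.
Variable R : realType.
Notation leb := (@lebesgue_measure R).
Notation leb2 := (@lebesgue_measure R \x @lebesgue_measure R)%E.
Variable D : nldata R.
Local Notation kap := (nl_kap D).
Local Notation K := (nl_K D).
Local Notation V := (nl_V D).
Local Notation L := (nl_L D).
Local Notation uh := (nl_u D).
Local Notation M := (nl_M D).
Local Notation u0 := (nl_u0 D).
Local Notation MF := (Mf D).
Let kap0 := nl_kap0 D. Let kapK := nl_kapK D.
Let kapN := nl_kapN D. Let kapD := nl_kapD D.
Let L0 := nl_L0 D. Let VL := nl_VL D.
Let muh := nl_mu D. Let uhM := nl_uM D.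
Let u001 := nl_u001 D. Let uh0 := nl_uu0 D.

Lemma bmf_Wn_t x : bmf (fun t => Wn D (t, x)).
Proof.
apply: (bmf_comp (h := fun s => (s, x))); last exact: bWn.
by apply/measurable_fun_pairP; split; [exact: measurable_id|exact: measurable_cst].
Qed.

(** Lebesgue differentiation of [Wn] in time at fixed [x]: the bound [C / d] dominates the one-sided
    average by an average over the ball of radius [d], and [mm_sub_le] pays for the averaging in
    space. *)
Lemma Wn_lebesgue_pt x (C : R) : 0 <= C ->
  {ae leb, forall t, forall e, 0 < e -> exists2 dl, 0 < dl &
    forall mo : mollifier R, mo_d mo < dl -> (forall y, mo_r mo y <= C / mo_d mo) ->
      `|mm D mo (t, x) - Wn D (t, x)| <= e}.
Proof.
move=> C0; pose f t := Wn D (t, x).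
have [mf [N fN]] : bmf f := bmf_Wn_t x.
have lf : locally_integrable setT f.
  split => //; first exact: openT.
  move=> A _ cA.
  have := compact_finite_measure cA => fA.
  have mA := compact_measurable cA.
  have : leb.-integrable A (EFin \o f).
    apply: measurable_bounded_integrable => //; first exact: measurable_funS mf.
    exists N; split; first exact: num_real.
    by move=> y Ny s _; apply: le_trans (fN s) (ltW Ny).
  by move=> /integrableP[].
have FF := ae_filter_ringOfSetsType leb.
have := lebesgue_differentiation lf; apply: filterS => t ft e e0.
(* The ball has length [2 * d], so the time average is at most [2 * C * e'], hence at most
   [e / 2]. *)
pose e' := e / (4 * (C + 1)).
have e'0 : 0 < e' by rewrite divr_gt0// mulr_gt0//; lra.
have [dl1 /= dl10 H] : \forall rho \near (0 : R)^'+, (davg f t rho < e'%:E)%E.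
  apply: (ft [set z | (z < e'%:E)%E]).
  rewrite /nbhs/= /ereal_nbhs/=; near=> y; rewrite lte_fin.
  by near: y; exact: lt_nbhsl.
have KM : 0 <= K * (2 * M) by rewrite mulr_ge0 ?K_ge0// mulr_ge0// M_ge0.
(* Below this size the spatial error [K * (2 * M * d)] is at most [e / 2]. *)
pose dl2 := e / (2 * (K * (2 * M) + 1)).
have dl20 : 0 < dl2 by rewrite divr_gt0// mulr_gt0//; lra.
exists (Num.min dl1 dl2); first by rewrite lt_min dl10 dl20.
move=> mo; rewrite lt_min => /andP[d1 d2] rC.
have d0 := mo_d0 mo; set d := mo_d mo in d0 d1 d2 rC *.
apply: le_trans (mm_sub_le D mo t x (Wn D (t, x))) _.
have hM : K * (2 * M * d) <= e / 2.
  have -> : K * (2 * M * d) = K * (2 * M) * d by ring.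
  apply: le_trans (_ : (K * (2 * M) + 1) * d <= _).
    by rewrite ler_wpM2r ?ltW//; lra.
  rewrite mulrC -ler_pdivlMr; last lra.
  apply: le_trans (ltW d2) _; rewrite /dl2; set c := _ + 1.
  by rewrite invfM mulrA.
suff : \int[leb]_s (mo_r mo s * `|Wn D (t + s, x) - Wn D (t, x)|) <= e / 2 by rewrite -/d; lra.
have bg : bmf (fun s => `|f s - f t|).
  apply/bmf_norm/bmfB; last exact: bmf_cst.
  by split => //; exists N.
have -> : \int[leb]_s (mo_r mo s * `|Wn D (t + s, x) - Wn D (t, x)|) =
    \int[leb]_s (mo_r mo (s - t) * `|f s - f t|).
  rewrite -(@Rint_shift _ t (fun s => mo_r mo (s - t) * `|f s - f t|)); last first.
    exact/igrM/bg/krs.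
  by apply: eq_Rintegral => s _; congr (mo_r mo _ * _); ring.
have iI : igr leb (\1_(ball t d) : R -> R) by rewrite ball_itv; exact: integrable_indic_itv.
apply: (@le_trans _ _ (\int[leb]_s (C / d * (\1_(ball t d) s * `|f s - f t|)))).
  apply: Rint_le; [exact/igrM/bg/krs|exact/igrZ/igrM|].
  move=> s; rewrite mulrA ler_wpM2r//.
  rewrite ball_itv indic_itvE in_itv/=.
  have [_|h] := boolP (t - d < s < t + d); first by rewrite mulr1.
  rewrite mulr0 mo_rN// -/d.
  have [|h1] := leP (s - t) 0; first by left.
  right; rewrite leNgt; apply: contra h => h2.
  by apply/andP; split; lra.
rewrite RintZ; last exact: igrM.
have H2 : \int[leb]_s (\1_(ball t d) s * `|f s - f t|) <= e' * (2 * d).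
  rewrite Rint_indic.
  have := H d; rewrite /= sub0r normrN gtr0_norm// => /(_ d1 d0).
  rewrite /davg /iavg lebesgue_measure_ball; last exact: ltW.
  rewrite inver mulrn_eq0/= gt_eqF// => h.
  have mball : measurable (ball t d) by exact: measurable_ball.
  have ig : leb.-integrable (ball t d) (fun s => (`|f s - f t|)%:E).
    rewrite integrable_mkcond//.
    have := igrM iI bg; apply: eq_integrable => // s _.
    by rewrite /= patchE indicE; case: ifP; rewrite ?mul1r ?mul0r.
  rewrite /Rintegral -lee_fin fineK; last exact: integrable_fin_num.
  move: h; rewrite lte_pdivrMl ?mulrn_wgt0// => /ltW.
  by rewrite -EFinM mulrC mulr_natl.
apply: (@le_trans _ _ (C / d * (e' * (2 * d)))).
  by rewrite ler_wpM2l// divr_ge0// ltW.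
have -> : C / d * (e' * (2 * d)) = 2 * C * e' by field; rewrite gt_eqF.
rewrite /e' mulrA ler_pdivrMr; last by rewrite mulr_gt0//; lra.
nra.
Unshelve. all: by end_near. Qed.

Lemma KMF_le s d : s <= d -> K * (2 * (MF * s)) <= K * (2 * MF) * d.
Proof.
move=> sd; have -> : K * (2 * (MF * s)) = K * (2 * MF) * s by ring.
by rewrite ler_wpM2l// mulr_ge0 ?K_ge0// mulr_ge0// Mf_ge0.
Qed.

(** The bound [mm_lip] does not involve the mollifier, so it passes to the limit between two
    Lebesgue points. At this stage the set of times depends on [x]. *)
Lemma Wn_ae_lip_t x : exists2 G : set R, {ae leb, forall t, G t} &
  forall t t', G t -> G t' -> `|Wn D (t', x) - Wn D (t, x)| <= K * (2 * (MF * `|t' - t|)).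
Proof.
have [C0 molls] := mollifiers R.
pose C := Num.max C0 0.
have C_ge0 : 0 <= C by rewrite le_max lexx orbT.
exists [set t | forall e, 0 < e -> exists2 dl, 0 < dl &
    forall mo : mollifier R, mo_d mo < dl -> (forall y, mo_r mo y <= C / mo_d mo) ->
      `|mm D mo (t, x) - Wn D (t, x)| <= e]; first exact: Wn_lebesgue_pt.
move=> t t' Gt Gt'; apply/ler_addgt0Pr => e e0.
have e20 : 0 < e / 2 by rewrite divr_gt0.
have [d1 d10 H1] := Gt _ e20; have [d2 d20 H2] := Gt' _ e20.
pose d := Num.min d1 d2 / 2.
have m0 : 0 < Num.min d1 d2 by rewrite lt_min d10 d20.
have d0 : 0 < d by rewrite divr_gt0.
have [mo [dE rC0]] := molls d d0.
have rC y : mo_r mo y <= C / mo_d mo.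
  by rewrite dE; apply: le_trans (rC0 y) _; apply: ler_wpM2r; [by rewrite invr_ge0 ltW|by rewrite /C le_max lexx].
have dm : d < Num.min d1 d2 by rewrite /d; lra.
have dd1 : mo_d mo < d1 by rewrite dE; apply: lt_le_trans dm _; rewrite ge_min lexx.
have dd2 : mo_d mo < d2 by rewrite dE; apply: lt_le_trans dm _; rewrite ge_min lexx orbT.
have h1 := H1 mo dd1 rC; have h2 := H2 mo dd2 rC; have h3 := mm_lip D mo t x t' x.
rewrite (subrr x) normr0 mulr0 addr0 in h3.
rewrite distrC in h2.
apply: le_trans (le_trans (ler_distD (mm D mo (t, x)) _ _)
  (lerD (ler_distD (mm D mo (t', x)) _ _) (lexx _))) _.
rewrite [leRHS](addr_halves _ e).
by rewrite lerD// lerD.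
Qed.

Definition C1 := K * (2 * MF) + K * (2 * M).

Lemma C1_ge0 : 0 <= C1.
Proof. by rewrite addr_ge0// mulr_ge0 ?K_ge0// mulr_ge0// ?Mf_ge0// M_ge0. Qed.

(** Lebesgue points only give convergence; the Lipschitz bound on [G] upgrades it to the rate [d],
    with one set of times for all mollifiers. *)
Lemma mm_Wn x : exists2 G : set R, {ae leb, forall t, G t} &
  forall mo t, G t -> `|mm D mo (t, x) - Wn D (t, x)| <= C1 * mo_d mo.
Proof.
have [G aeG HG] := Wn_ae_lip_t x.
exists G => // mo t Gt; have d0 := mo_d0 mo.
apply: le_trans (mm_sub_le D mo t x (Wn D (t, x))) _.
have -> : C1 * mo_d mo = K * (2 * MF) * mo_d mo + K * (2 * M * mo_d mo) by rewrite /C1; ring.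
rewrite lerD2r.
apply: (avg_ae_le (G := fun s => `|Wn D (s, x) - Wn D (t, x)|)).
  by apply/bmf_norm/bmfB; [exact: bmf_Wn_t|exact: bmf_cst].
have FF := ae_filter_ringOfSetsType leb.
apply: filterS aeG => s Gs ts st; apply: le_trans (HG _ _ Gt Gs) _.
by apply: KMF_le; rewrite gtr0_norm ?subr_gt0// lerBlDl ltW.
Qed.

Lemma bmf_Wn_sub x c : bmf (fun s => `|Wn D (s, x) - c|).
Proof. by apply/bmf_norm/bmfB; [exact: bmf_Wn_t|exact: bmf_cst]. Qed.

(** Inside the parentheses are the distances from [Wn] to [mm] at a common point, between two times
    of [mm], and between two positions of [Wn]; [L] comes from [V] and [M] from the solution. *)
Definition C2 := L * (C1 + K * (2 * MF) + K * (2 * M)) * M.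

Lemma C2_ge0 : 0 <= C2.
Proof.
have K0 := K_ge0 D; have M0 := M_ge0 D; have F0 := Mf_ge0 D.
have h1 : 0 <= K * (2 * MF) by rewrite mulr_ge0// mulr_ge0.
have h2 : 0 <= K * (2 * M) by rewrite mulr_ge0// mulr_ge0.
have h3 := C1_ge0.
by rewrite /C2 mulr_ge0// mulr_ge0//; lra.
Qed.

Lemma commutator mo t x : 0 <= t ->
  `|gm D mo (t, x) - V (mm D mo (t, x)) * vm D mo (t, x)| <= C2 * mo_d mo.
Proof.
move=> t0; have d0 := mo_d0 mo; have K0 := K_ge0 D; have M0 := M_ge0 D.
set c := mm D mo (t, x).
have irr' := irr mo.
have bu := bmf_shift (t, x) (buh D); have bf := bmf_shift (t, x) (bfl D).
rewrite gm_avg vm_avg -RintZ; last exact: igrM.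
rewrite -RintB; [|exact: igrM|exact/igrZ/igrM].
under eq_Rintegral do rewrite [V c * _]mulrCA -mulrBr.
pose G s := L * (`|Wn D (t + s, x) - c| + K * (2 * M * mo_d mo)) * M.
have bG : bmf G.
  apply: bmfM; last exact: bmf_cst.
  apply: bmfM; first exact: bmf_cst.
  apply: bmfD; last exact: bmf_cst.
  exact: (bmf_comp (measurable_shift t) (bmf_Wn_sub x c)).
have ic : igr leb (mo_r mo) := ir mo.
apply: (@le_trans _ _ (\int[leb]_s (mo_r mo s * G s))).
  apply: avg2_le => //.
    by apply: bmfB => //; apply: bmfM => //; exact: bmf_cst.
  move=> s p s0 sd p0 pd /=.
  rewrite /fl /flux /= (_ : (0 <= t + s) = true); last by rewrite addr_ge0// ltW.
  rewrite mul1r -/(Wn D) -mulrBl normrM ler_pM//.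
  apply: le_trans (VL _ _) _; rewrite ler_wpM2l//.
  have h := Wn_lip_x D (t + s) x (x + p).
  have E : x + p - x = p by ring.
  rewrite E (gtr0_norm p0) in h.
  have h2 : K * (2 * M * p) <= K * (2 * M * mo_d mo).
    by rewrite ler_wpM2l// ler_wpM2l ?mulr_ge0// ltW.
  have -> : Wn D (t + s, x + p) - c = (Wn D (t + s, x) - c) + (Wn D (t + s, x + p) - Wn D (t + s, x)) by ring.
  by apply: (le_trans (ler_normD _ _)); rewrite lerD2l; lra.
have bGt : bmf (fun s => L * (`|Wn D (s, x) - c| + K * (2 * M * mo_d mo)) * M).
  apply: bmfM; last exact: bmf_cst.
  apply: bmfM; first exact: bmf_cst.
  apply: bmfD; last exact: bmf_cst.
  exact: bmf_Wn_sub.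
apply: (avg_ae_le bGt).
have [A aeA HA] := mm_Wn x.
have FF := ae_filter_ringOfSetsType leb.
apply: filterS aeA => s As ts st.
have -> : C2 * mo_d mo = L * ((C1 * mo_d mo + K * (2 * MF) * mo_d mo) + K * (2 * M * mo_d mo)) * M.
  by rewrite /C2; ring.
rewrite ler_wpM2r// ler_wpM2l// lerD2r.
have h1 := HA mo s As; have h2 := mm_lip D mo t x s x.
rewrite (subrr x) normr0 mulr0 addr0 in h2.
rewrite distrC in h1.
have h3 : K * (2 * (MF * `|s - t|)) <= K * (2 * MF) * mo_d mo.
  by apply: KMF_le; rewrite gtr0_norm ?subr_gt0// lerBlDl ltW.
by apply: (le_trans (ler_distD (mm D mo (s, x)) _ _)); rewrite lerD// (le_trans h2).
Qed.

Definition W0 x := \int[leb]_y (kap y * u0 (x + y)).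

Lemma Wn_neg t x : t < 0 -> Wn D (t, x) = W0 x.
Proof. by move=> t0; apply: eq_Rintegral => y _ /=; rewrite uh0. Qed.

(** At time [- d] the mollifier sees negative times only, where the extended solution is the datum;
    [mm_lip] then covers the interval from [- d] to 0. *)
Lemma mm_initial mo x : `|mm D mo (0, x) - W0 x| <= C1 * mo_d mo.
Proof.
have d0 := mo_d0 mo; set d := mo_d mo.
have h1 := mm_sub_le D mo (- d) x (W0 x).
have h2 := mm_lip D mo (- d) x 0 x.
have E : `|0 - - d| = d by rewrite sub0r opprK gtr0_norm.
rewrite E (subrr x) normr0 mulr0 addr0 in h2.
have h3 : \int[leb]_s (mo_r mo s * `|Wn D (- d + s, x) - W0 x|) <= 0.
  apply: (avg_ae_le (bmf_Wn_sub x (W0 x))); apply/aeW => s s1 s2.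
  by rewrite Wn_neg ?subrr ?normr0//; rewrite addNr in s2.
apply: (le_trans (ler_distD (mm D mo (- d, x)) _ _)).
have -> : C1 * d = K * (2 * (MF * d)) + K * (2 * M * d) by rewrite /C1; ring.
rewrite lerD//; apply: le_trans h1 _; by rewrite gerDr.
Qed.

Lemma vm_initial mo x : 0 <= vm D mo (- mo_d mo, x) <= 1.
Proof.
have d0 := mo_d0 mo; set d := mo_d mo.
rewrite vm_iter/=.
have bF s y0 : bmf (fun p : R => uh (s, y0 + p)) by exact: bmf_section (buh D).
have ic : igr leb (mo_r mo) := ir mo.
have h s : mo_r mo s * \int[leb]_p (mo_r mo p * uh (- d + s, x + p)) =
  mo_r mo s * \int[leb]_p (mo_r mo p * u0 (x + p)).
  have H s' : 0 < s' -> s' < d ->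
      \int[leb]_p (mo_r mo p * uh (- d + s', x + p)) = \int[leb]_p (mo_r mo p * u0 (x + p)).
    by move=> s0 sd; apply: eq_Rintegral => p _; rewrite uh0// addrC subr_lt0.
  by have [->|->//] := mo_int H s; rewrite !mul0r.
under eq_Rintegral do rewrite h.
rewrite avg_const.
have bu : bmf (fun p : R => u0 (x + p)).
  have -> : (fun p : R => u0 (x + p)) = (fun p : R => uh (-1, x + p)) by apply/funext => p; rewrite uh0//; lra.
  exact: bF.
apply/andP; split.
  apply: Rint_ge0 => p; rewrite mulr_ge0//; first exact: mo_r0.
  by have /andP[] := u001 (x + p).
have hr y : 0 <= mo_r mo y by exact: mo_r0.
have := Rint_wle (c := 1) ic hr bu; rewrite Rint_r mulr1; apply.
by move=> p; have /andP[] := u001 (x + p).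
Qed.

End time_regularity.

(** * The invariant region *)

Section sigma_finite_swap.
Context d d' (T : measurableType d) (S : measurableType d') (R : realType).
Variables (mu : {measure set T -> \bar R}) (nu : {measure set S -> \bar R}).
Hypotheses (sf : sigma_finite setT mu) (sf' : sigma_finite setT nu).

Let sfin := isSFinite.Build _ _ _ _ (sfinite_measure_sigma_finite sf).
Let sigfin := isSigmaFinite.Build _ _ _ _ sf.
Let mu_sf := HB.pack_for {sigma_finite_measure set T -> \bar R} (Measure.sort mu) sfin sigfin.
Let sfin' := isSFinite.Build _ _ _ _ (sfinite_measure_sigma_finite sf').
Let sigfin' := isSigmaFinite.Build _ _ _ _ sf'.
Let nu_sf := HB.pack_for {sigma_finite_measure set S -> \bar R} (Measure.sort nu) sfin' sigfin'.

(** Fubini from proofs of sigma-finiteness, so that the planar product measure can itself be a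
    factor. *)
Lemma Rint_sf_swap (p1 : T -> R) (p2 : S -> R) (F : T * S -> R) : igr mu p1 -> igr nu p2 -> bmf F ->
  \int[mu]_a (p1 a * \int[nu]_b (p2 b * F (a, b))) =
  \int[nu]_b (p2 b * \int[mu]_a (p1 a * F (a, b))).
Proof. exact: (@Rint_swap _ _ _ _ _ mu_sf nu_sf). Qed.

Lemma bmf_Rint_sf d0 (T0 : measurableType d0) (p : T -> R) (F : T0 * T -> R) :
  igr mu p -> bmf F -> bmf (fun a => \int[mu]_b (p b * F (a, b))).
Proof. by move=> ip bF; apply: (@bmf_Rint _ _ _ _ _ mu_sf) => //; exact: bF. Qed.

End sigma_finite_swap.

Section plane.
Variable R : realType.
Notation leb := (@lebesgue_measure R).
Notation leb2 := (@lebesgue_measure R \x @lebesgue_measure R)%E.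

Lemma leb2_sigma_finite : sigma_finite setT leb2.
Proof.
pose I n := [set` `[- n%:R : R, n%:R]].
exists (fun n => I n `*` I n).
  apply/seteqP; split => // -[x y] _.
  exists (Num.bound (`|x| + `|y|)) => //.
  have n0 : 0 <= `|x| + `|y| by rewrite addr_ge0.
  have := archi_boundP n0; set N := _%:R => h.
  have hx : `|x| < N by apply: le_lt_trans h; rewrite lerDl.
  have hy : `|y| < N by apply: le_lt_trans h; rewrite lerDr.
  by split; rewrite /I/= in_itv/= -ler_norml ltW.
move=> n; split; first by apply: measurableX; exact: measurable_itv.
rewrite product_measure1E; [|exact: measurable_itv..].
have fI : (leb (I n) < +oo)%E by rewrite lebesgue_measure_itv/=; case: ifP; rewrite // -EFinB ltry.
by rewrite lte_mul_pinfty// ge0_fin_numE.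
Qed.

Lemma Rint_leb2_swap (p1 p2 : R * R -> R) (F : (R * R) * (R * R) -> R) :
  igr leb2 p1 -> igr leb2 p2 -> bmf F ->
  \int[leb2]_a (p1 a * \int[leb2]_b (p2 b * F (a, b))) =
  \int[leb2]_b (p2 b * \int[leb2]_a (p1 a * F (a, b))).
Proof. exact: (Rint_sf_swap leb2_sigma_finite leb2_sigma_finite). Qed.

Lemma Rint_leb2_leb_swap (p1 : R * R -> R) (p2 : R -> R) (F : (R * R) * R -> R) :
  igr leb2 p1 -> igr leb p2 -> bmf F ->
  \int[leb2]_a (p1 a * \int[leb]_b (p2 b * F (a, b))) =
  \int[leb]_b (p2 b * \int[leb2]_a (p1 a * F (a, b))).
Proof. exact: (Rint_sf_swap leb2_sigma_finite (sigma_finiteT lebesgue_measure)). Qed.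

Lemma bmf_Rint_leb2 d (T : measurableType d) (p : R * R -> R) (F : T * (R * R) -> R) :
  igr leb2 p -> bmf F -> bmf (fun a => \int[leb2]_b (p b * F (a, b))).
Proof. by move=> ip bF; apply: (bmf_Rint_sf leb2_sigma_finite) => //; exact: bF. Qed.

End plane.

Lemma dfn_mvt_abs (R : realType) (f f' : R -> R) a b : dfn f f' ->
  exists2 c, `|c - a| <= `|b - a| & f b - f a = f' c * (b - a).
Proof.
move=> df; have [ab|/ltW ba] := leP a b.
  have [c [ac cb E]] := dfn_mvt ab df; exists c => //.
  by rewrite !ger0_norm ?subr_ge0// ?lerB// (le_trans ac).
have [c [bc ca E]] := dfn_mvt ba df; exists c.
  by rewrite !ler0_norm ?subr_le0// ?lerN2 ?lerB.
by rewrite -opprB E -mulrN opprB.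
Qed.

(** Clamping to [0, 1] moves each number by at most [e] and is monotone and 1-Lipschitz, so the
    order up to [k] survives. This brings almost admissible values to where [V] is monotone. *)
Lemma clamp_pair (R : realFieldType) (a b k e : R) : 0 <= k -> 0 <= e -> - e <= a -> a <= 1 + e ->
  - e <= b -> b <= 1 + e -> b <= a + k -> exists p q, [/\ 0 <= p, p <= 1, 0 <= q & q <= 1] /\
  [/\ `|a - p| <= e, `|b - q| <= e & q <= p + k].
Proof.
move=> k0 e0 a1 a2 b1 b2 ab.
have clamp c : - e <= c -> c <= 1 + e -> exists p, [/\ 0 <= p, p <= 1, `|c - p| <= e &
    [\/ (c <= 0 /\ p = 0), (p = c) | (1 <= c /\ p = 1)]].
  move=> c1 c2; have [c0|c0] := leP c 0.
    by exists 0; split=> //; [rewrite subr0 ler0_norm//; lra|constructor 1].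
  have [c1'|c1'] := leP 1 c.
    by exists 1; split=> //; [rewrite ger0_norm ?subr_ge0//; lra|constructor 3].
  by exists c; split; [lra|lra|rewrite subrr normr0|constructor 2].
have [p [p0 p1 ap pE]] := clamp a a1 a2; have [q [q0 q1 bq qE]] := clamp b b1 b2.
exists p, q; split; split=> //.
by case: pE => [[]|pE|[]]; case: qE => [[]|qE|[]]; lra.
Qed.

(* If the difference over [x, x + h] is far from the bound [e], it stays below it by Lipschitz continuity in time; otherwise the pair is nearly extremal, and characteristics from its ends do not separate (resp. approach) faster than [beta]. *)
Lemma transport_step (R : realType) (U0 U1 m V : R -> R) (K ms s e C beta : R) :
  0 <= s -> 0 <= e -> 0 <= ms -> 0 <= K -> 0 <= beta ->
  (forall y, `|U1 y - U0 y| <= ms) ->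
  (forall y, `|U1 y - U0 (y - s * V (m y))| <= C) ->
  (forall x h, 0 <= h -> - e <= U0 (x + h) - U0 x <= h + e) ->
  (forall x y a, (forall z, 0 <= z -> (U0 (y + z) - U0 (x + z)) - (U0 y - U0 x) <= a) ->
     m y - m x <= K * a) ->
  (forall y y', m y' - m y <= K * (2 * ms) -> V (m y) - V (m y') <= beta) ->
  forall x h, 0 <= h ->
  - (e + s * beta + 2 * C) <= U1 (x + h) - U1 x <= h + (e + s * beta + 2 * C).
Proof.
move=> s0 e0 ms0 K0 b0 U10 U1f H dm dV x h h0.
have C0 : 0 <= C := le_trans (normr_ge0 _) (U1f 0).
have sb0 : 0 <= s * beta by rewrite mulr_ge0.
have := U1f x; have := U1f (x + h).
set xf := x - _; set yf := x + h - _.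
have hE : yf - xf = h + s * (V (m x) - V (m (x + h))) by rewrite /yf /xf; ring.
have hE' : yf - xf = h - s * (V (m (x + h)) - V (m x)) by rewrite /yf /xf; ring.
have pos : xf <= yf -> - e <= U0 yf - U0 xf <= yf - xf + e.
  by move=> xy; have := H xf (yf - xf); rewrite subr_ge0 (addrC xf) subrK => /(_ xy).
have neg : yf <= xf -> - e <= U0 xf - U0 yf <= xf - yf + e.
  by move=> xy; have := H yf (xf - yf); rewrite subr_ge0 (addrC yf) subrK => /(_ xy).
(* When the upper bound is attained up to [a], translating the pair can raise the difference by at
   most [a]. By [dm] this bounds [m (x + h) - m x] from above, and by [dV] the feet are then at
   distance at most [h + s * beta]. *)
have mx a : U0 (x + h) - U0 x = h + e - a -> a < 2 * ms -> s * (V (m x) - V (m (x + h))) <= s * beta.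
  move=> ha am; rewrite ler_wpM2l//; apply: dV.
  apply: (@le_trans _ _ (K * a)); last by rewrite ler_wpM2l// ltW.
  apply: dm => z z0; rewrite ha.
  by have /andP[_] := H (x + z) h h0; rewrite addrAC; lra.
have mn a : U0 (x + h) - U0 x = - e + a -> a < 2 * ms -> s * (V (m (x + h)) - V (m x)) <= s * beta.
  move=> ha am; rewrite ler_wpM2l//; apply: dV.
  apply: (@le_trans _ _ (K * a)); last by rewrite ler_wpM2l// ltW.
  apply: dm => z z0.
  by have /andP[] := H (x + z) h h0; rewrite addrAC; lra.
move: (H x h h0) (U10 x) (U10 (x + h)) (mx (h + e - (U0 (x + h) - U0 x))) (mn (U0 (x + h) - U0 x + e)) => {mx mn}.
rewrite !ler_norml => /andP[h1 h2] /andP[h3 h4] /andP[h5 h6] mx mn /andP[h7 h8] /andP[h9 h10].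
have {}mx := mx ltac:(ring); have {}mn := mn ltac:(ring).
apply/andP; split.
  (* Far from the bound, a slack of [2 * ms] pays for the change of both end values; near it, the
     feet are compared at the earlier time, in whichever order they stand. *)
  have [big|/mn le] := leP (2 * ms) (U0 (x + h) - U0 x + e); first lra.
  have [/pos/andP[]|/ltW/neg/andP[]] := leP xf yf; lra.
have [big|/mx le] := leP (2 * ms) (h + e - (U0 (x + h) - U0 x)); first lra.
have [/pos/andP[]|/ltW/neg/andP[]] := leP xf yf; lra.
Qed.

Ltac nonneg := repeat first [assumption | done | apply: addr_ge0 | apply: mulr_ge0 | exact: ltW].

Section max_principle.
Variable R : realType.
Notation leb := (@lebesgue_measure R).
Notation leb2 := (@lebesgue_measure R \x @lebesgue_measure R)%E.
Variable D : nldata R.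
Local Notation kap := (nl_kap D).
Local Notation K := (nl_K D).
Local Notation V := (nl_V D).
Local Notation L := (nl_L D).
Local Notation uh := (nl_u D).
Local Notation M := (nl_M D).
Local Notation u0 := (nl_u0 D).
Local Notation MF := (Mf D).
Let ikap := nl_ikap D. Let kap0 := nl_kap0 D. Let kapK := nl_kapK D.
Let kapN := nl_kapN D. Let kapD := nl_kapD D. Let kap1 := nl_kap1 D.
Let L0 := nl_L0 D. Let VL := nl_VL D. Let VD := nl_VD D.
Let muh := nl_mu D. Let uhM := nl_uM D. Let mu0 := nl_mu0 D.
Let u001 := nl_u001 D. Let uh0 := nl_uu0 D. Let weak := nl_weak D.
Variable mo : mollifier R.
Local Notation d := (mo_d mo).
Local Notation r := (mo_r mo).
Local Notation B := (mo_B mo).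
Let d0 := mo_d0 mo. Let sr := mo_sr mo. Let r0 := mo_r0 mo.
Let rN := @mo_rN _ mo. Let dB := mo_dB mo. Let BE := mo_BE mo.

Local Notation U := (Um D mo).
Local Notation v := (vm D mo).
Local Notation g := (gm D mo).
Local Notation m := (mm D mo).

(** This constant depends on the mollifier, which is harmless: the time step of the scheme tends to
    0 at fixed [d]. *)
Lemma vm_lip : exists2 C, 0 <= C & forall t x t' x',
  `|v (t', x') - v (t, x)| <= C * (`|t' - t| + `|x' - x|).
Proof.
have [v' [dv [_ [A vA]] _]] := vm_dfn_x D mo.
have [r' dr [r'' dr' _]] := sr 2%N.
have kr' := ckernel_dfn (kr mo) dr (dfn_cts dr').
have dvt x := dfn_Mol_t x (ir mo) (kr mo) dr (dfn_cts dr') (buh D).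
have [_ [B' vB]] : bmf (Mol uh r' r).
  by apply: bmf_Mol; [exact: ckernel_igr|exact: ir|exact: buh].
have A0 : 0 <= A := le_trans (normr_ge0 _) (vA (0, 0)).
have B0 : 0 <= B' := le_trans (normr_ge0 _) (vB (0, 0)).
exists (A + B'); first exact: addr_ge0.
move=> t x t' x'.
have h1 := dfn_lip t t' (dvt x') (fun s => _ : `|- Mol uh r' r (s, x')| <= B').
have h2 := dfn_lip x x' (dv t) (fun x => vA (t, x)).
apply: le_trans (ler_distD (v (t, x')) _ _) _.
have h3 : B' * `|t' - t| <= (A + B') * `|t' - t| by rewrite ler_wpM2r// lerDr.
have h4 : A * `|x' - x| <= (A + B') * `|x' - x| by rewrite ler_wpM2r// lerDl.
rewrite mulrDr lerD//; last exact: le_trans h4.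
by apply: le_trans h3; apply: h1 => s; rewrite normrN.
Qed.

(** Taylor expansion along the characteristic with frozen speed [V (m (tau, x))]. The partial
    derivatives of [U] being [- g] and [v], the first-order mismatch is exactly the commutator;
    everything else is quadratic in [s]. *)
Lemma consistency : exists2 C, 0 <= C & forall tau s x, 0 <= tau -> 0 <= s ->
  `|U (tau + s, x) - U (tau, x - s * V (m (tau, x)))| <= s * (C2 D * d + C * s).
Proof.
have [Cv Cv0 vL] := vm_lip.
have K0 := K_ge0 D; have M0 := M_ge0 D; have F0 := Mf_ge0 D; have MV0 := MV_ge0 D.
exists (MV D * (Cv * (1 + MV D)) + L * (K * (2 * MF)) * M).
  by rewrite addr_ge0// mulr_ge0// mulr_ge0// ?addr_ge0// mulr_ge0// mulr_ge0.
move=> tau s x tau0 s0; set b := V (m (tau, x)).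
have bM : `|b| <= MV D by apply: V_le; exact: mm_le.
have ts : tau <= tau + s by rewrite lerDl.
have [xi [tx xs E1]] := dfn_mvt ts (dUm_t D mo x).
have [ze] := @dfn_mvt_abs _ _ _ x (x - s * b) (dUm_x D mo tau).
have -> : x - s * b - x = - (s * b) by ring.
rewrite normrN normrM (ger0_norm s0) => zs E2.
have xi0 : 0 <= xi := le_trans tau0 tx.
have -> : U (tau + s, x) - U (tau, x - s * b) = s * (b * v (tau, ze) - g (xi, x)).
  rewrite -(subrKA (U (tau, x))) E1 -[U (tau, x) - _]opprB E2.
  by set p := v _; set q := g _; ring.
rewrite normrM (ger0_norm s0) ler_wpM2l//.
have xis : `|xi - tau| <= s by rewrite ger0_norm ?subr_ge0// lerBlDl.
have zx : `|ze - x| <= s * MV D.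
  by apply: le_trans zs _; rewrite ler_wpM2l.
apply: le_trans (ler_distD (V (m (xi, x)) * v (xi, x)) _ _) _.
rewrite addrC lerD//; first by rewrite distrC; exact: commutator.
apply: le_trans (ler_distD (b * v (xi, x)) _ _) _.
rewrite mulrDl lerD//.
  rewrite -mulrBr normrM -!mulrA ler_pM//.
  apply: le_trans (vL _ _ _ _) _; rewrite ler_wpM2l// mulrDl mul1r (mulrC (MV D)) lerD//.
  by rewrite distrC.
rewrite -mulrBl normrM.
have -> : L * (K * (2 * MF)) * M * s = L * (K * (2 * (MF * s))) * M by ring.
rewrite ler_pM//; last exact: vm_le.
apply: le_trans (VL _ _) _; rewrite ler_wpM2l//.
have := mm_lip D mo xi x tau x; rewrite (subrr x) normr0 mulr0 addr0 => h.
apply: le_trans h _.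
rewrite ler_wpM2l// ler_wpM2l// ler_wpM2l//.
by rewrite distrC.
Qed.

Lemma V_nonincreasing_approx a b k e : 0 <= k -> 0 <= e ->
  - e <= a <= 1 + e -> - e <= b <= 1 + e -> b <= a + k -> V a - V b <= L * (k + 2 * e).
Proof.
move=> k0 e0 /andP[ae1 ae2] /andP[be1 be2] bak.
have [p [q [[p0 p1 q0 q1] [ap bq qpk]]]] := clamp_pair k0 e0 ae1 ae2 be1 be2 bak.
have h1 := VL a p; have h2 := VL q b.
have h3 : L * `|a - p| <= L * e by rewrite ler_wpM2l.
have h4 : L * `|q - b| <= L * e by rewrite ler_wpM2l// distrC.
have h5 : V p - V q <= L * k.
  have [qp|/ltW pq] := leP q p.
    by apply: (@le_trans _ _ 0); [rewrite subr_le0; exact: VD|rewrite mulr_ge0].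
  apply: le_trans (ler_norm _) _; apply: le_trans (VL _ _) _.
  rewrite ler_wpM2l// distrC ger0_norm ?subr_ge0//.
  by rewrite lerBlDl.
have := ler_norm (V a - V p); have := ler_norm (V q - V b).
have -> : L * (k + 2 * e) = L * e + L * k + L * e by ring.
have -> : V a - V b = (V a - V p) + (V p - V q) + (V q - V b) by ring.
by move=> h6 h7; rewrite lerD ?lerD//; [apply: le_trans (le_trans h7 h1) h3|apply: le_trans (le_trans h6 h2) h4].
Qed.

(** The bounds 0 and 1 on [v], integrated in [x] and relaxed by [e]: the form that a transport step
    preserves. *)
Definition almost_monotone t e := forall x h, 0 <= h -> - e <= U (t, x + h) - U (t, x) <= h + e.

(** [abel_dfn] for [- v] and for [v - 1], whose primitives are bounded above by [e]. *)
Lemma mm_almost t e : almost_monotone t e -> forall x, - (K * e) <= m (t, x) <= 1 + K * e.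
Proof.
move=> H x.
have bv := bmf_section t x (bvm D mo).
have cv : continuous (fun z => v (t, x + z)).
  move=> z; apply: (@continuous_comp _ _ _ (fun y => x + y) (fun x => v (t, x)));
      [exact: (dfn_cts (dfnD (dfn_cst x) (@dfn_id R)))|exact: vm_cts].
have dU := dfn_shift x (dUm_x D mo t).
have K0 := K_ge0 D.
have bM : forall y, `|v (t, x + y)| <= M by move=> y; exact: vm_le.
have iv : igr leb (fun z => kap z * v (t, x + z)) by exact: igrM.
have mE : m (t, x) = \int[leb]_z (kap z * v (t, x + z)) by [].
apply/andP; split.
  have : \int[leb]_z (kap z * (- 1 * v (t, x + z))) <= K * e.
    apply: (@abel_dfn _ _ _ ikap kap0 kapK kapN kapD _ _ M e (dfnZ (- 1) dU)).
    - by move=> z; apply: cvgM; [exact: cvg_cst|exact: cv].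
    - by move=> y; rewrite mulN1r normrN.
    move=> z z0; rewrite addr0.
    by have /andP[h _] := H x z z0; move: h; set p := U _; set q := U _; lra.
  under eq_Rintegral do rewrite mulrCA.
  by rewrite RintZ// -mE mulN1r lerNl.
have : \int[leb]_z (kap z * (v (t, x + z) - 1)) <= K * e.
  apply: (@abel_dfn _ _ _ ikap kap0 kapK kapN kapD _ _ (M + 1) e (dfnB dU (@dfn_id R))).
  - by move=> z; apply: cvgB; [exact: cv|exact: cvg_cst].
  - by move=> y; apply: le_trans (ler_normB _ _) _; rewrite normr1 lerD2r.
  move=> z z0; rewrite addr0 subr0.
  by have /andP[_ h] := H x z z0; move: h; set p := U _; set q := U _; lra.
under eq_Rintegral do rewrite mulrBr mulr1.
by rewrite RintB// -mE kap1 lerBlDl.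
Qed.

Lemma mm_diff t x y a : (forall z, 0 <= z -> (U (t, y + z) - U (t, x + z)) - (U (t, y) - U (t, x)) <= a) ->
  m (t, y) - m (t, x) <= K * a.
Proof.
move=> H.
have bv y' := bmf_section t y' (bvm D mo).
have cv y' : continuous (fun z => v (t, y' + z)).
  move=> z; apply: (@continuous_comp _ _ _ (fun z => y' + z) (fun x => v (t, x)));
      [exact: (dfn_cts (dfnD (dfn_cst y') (@dfn_id R)))|exact: vm_cts].
have dU y' := dfn_shift y' (dUm_x D mo t).
have iv y' : igr leb (fun z => kap z * v (t, y' + z)) by exact: (igrM ikap (bv y')).
have mE y' : m (t, y') = \int[leb]_z (kap z * v (t, y' + z)) by [].
have : \int[leb]_z (kap z * (v (t, y + z) - v (t, x + z))) <= K * a.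
  apply: (@abel_dfn _ _ _ ikap kap0 kapK kapN kapD _ _ (M + M) a (dfnB (dU y) (dU x))).
  - by move=> z; apply: cvgB; exact: cv.
  - by move=> z; apply: le_trans (ler_normB _ _) _; rewrite lerD// vm_le.
  by move=> z z0; rewrite !addr0; exact: H.
under eq_Rintegral do rewrite mulrBr.
by rewrite RintB.
Qed.

Lemma almost_monotone_step C tau s e :
  (forall x, `|U (tau + s, x) - U (tau, x - s * V (m (tau, x)))| <= C) ->
  0 <= s -> 0 <= e -> almost_monotone tau e ->
  almost_monotone (tau + s) (e + s * (L * (K * (2 * (MF * s)) + 2 * (K * e))) + 2 * C).
Proof.
move=> cons s0 e0 H.
have K0 := K_ge0 D; have F0 := Mf_ge0 D.
have mb := mm_almost H.
have FS0 : 0 <= MF * s by rewrite mulr_ge0.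
have k0 : 0 <= K * (2 * (MF * s)) by rewrite mulr_ge0// mulr_ge0.
have ke0 : 0 <= K * e by rewrite mulr_ge0.
apply: (@transport_step _ (fun x => U (tau, x)) (fun x => U (tau + s, x)) (fun x => m (tau, x)) V K (MF * s)) => //.
- by rewrite mulr_ge0// addr_ge0// mulr_ge0.
- move=> y; have := Um_lip D mo tau y (tau + s) y.
  by rewrite (subrr y) normr0 mulr0 addr0 (addrC tau) addrK (ger0_norm s0).
- by move=> x y a; exact: mm_diff.
move=> y y' hy; apply: V_nonincreasing_approx => //.
by rewrite addrC -lerBlDr.
Qed.

Lemma almost_monotoneW t e e' : e <= e' -> almost_monotone t e -> almost_monotone t e'.
Proof.
move=> ee H x h h0; have /andP[h1 h2] := H x h h0.
by rewrite (le_trans _ h1) ?lerN2// (le_trans h2)// lerD2l.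
Qed.

(** At time [- d] the mollified solution depends on the datum alone and the bounds are exact;
    crossing to time 0 moves each end value by at most [MF * d]. *)
Lemma almost_monotone0 : almost_monotone 0 (2 * (MF * d)).
Proof.
move=> x h h0.
have xh : x <= x + h by rewrite lerDl.
have [c [_ _ E]] := dfn_mvt xh (dUm_x D mo (- d)).
have := vm_initial D mo c; move: E; rewrite [x + h - x]addrAC subrr add0r; move: (v _) => vc E /andP[v0 v1].
have := Um_lip D mo (- d) x 0 x; have := Um_lip D mo (- d) (x + h) 0 (x + h).
rewrite sub0r opprK (gtr0_norm d0) !subrr normr0 mulr0 addr0.
rewrite !ler_norml; move: E; move: (U _) (U _) (U _) (U _) (MF * d) => a b c' d' f E /andP[h1 h2] /andP[h3 h4].
have h5 : 0 <= vc * h by rewrite mulr_ge0.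
have h6 : vc * h <= h by rewrite ler_piMl.
by apply/andP; split; lra.
Qed.

(** Discrete Gronwall constant: rate [2 * (L * K)] from the velocity error, initial error [2 * MF]
    from crossing the layer of width [d], and [2 * C2] per unit of time from the commutator at both
    feet. *)
Definition C4 t := expR (2 * (L * K) * t) * (2 * MF + t * (2 * C2 D)).

Lemma almost_monotone_n : exists2 C, 0 <= C & forall s n, 0 <= s ->
  almost_monotone (n%:R * s) ((1 + 2 * (L * K) * s) ^+ n *
    (2 * (MF * d) + n%:R * s * (2 * (C2 D * d) + C * s))).
Proof.
have [C C0 cons] := consistency.
have K0 := K_ge0 D; have F0 := Mf_ge0 D; have C20 := C2_ge0 D.
have LK0 : 0 <= L * K by rewrite mulr_ge0.
exists (2 * (L * K) * MF + 2 * C); first by nonneg.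
move=> s n s0; elim: n => [|n IH].
  by rewrite !mul0r addr0 expr0 mul1r; exact: almost_monotone0.
have lam0 : 0 <= 2 * (L * K) * s by rewrite mulr_ge0// mulr_ge0.
have P0 : 1 <= (1 + 2 * (L * K) * s) ^+ n.
  by rewrite exprn_ege1// lerDl.
have q0 : 0 <= s * (2 * (C2 D * d) + (2 * (L * K) * MF + 2 * C) * s).
  by nonneg; exact: ltW.
have Md0 : 0 <= MF * d by rewrite mulr_ge0// ltW// d0.
have e0 : 0 <= (1 + 2 * (L * K) * s) ^+ n *
    (2 * (MF * d) + n%:R * s * (2 * (C2 D * d) + (2 * (L * K) * MF + 2 * C) * s)).
  apply: mulr_ge0; first exact: le_trans ler01 P0.
  by rewrite -mulrA; nonneg.
have ns0 : 0 <= n%:R * s by rewrite mulr_ge0.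
have := almost_monotone_step (fun x => cons _ _ x ns0 s0) s0 e0 IH.
have -> : n%:R * s + s = n.+1%:R * s by rewrite -natr1 mulrDl mul1r.
apply: almost_monotoneW.
rewrite exprSr -[n.+1%:R]natr1.
move: q0 e0; move: (_ ^+ n) P0 => P P0 q0 e0.
apply: (@le_trans _ _ (P * (1 + 2 * (L * K) * s) * (2 * (MF * d) + n%:R * s * (2 * (C2 D * d) + (2 * (L * K) * MF + 2 * C) * s))
   + s * (2 * (C2 D * d) + (2 * (L * K) * MF + 2 * C) * s))).
  rewrite le_eqVlt; apply/orP; left; apply/eqP; move: (MF) (C2 D * d) (L) (K) => *; ring.
have PL : 1 <= P * (1 + 2 * (L * K) * s) by rewrite mulr_ege1// lerDl.
have -> : (n%:R + 1) * s * (2 * (C2 D * d) + (2 * (L * K) * MF + 2 * C) * s) =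
  n%:R * s * (2 * (C2 D * d) + (2 * (L * K) * MF + 2 * C) * s) + s * (2 * (C2 D * d) + (2 * (L * K) * MF + 2 * C) * s).
  by rewrite mulrDl mul1r mulrDl.
set A := 2 * (MF * d).
by rewrite [A + (_ + _)]addrA [leRHS]mulrDr lerD2l ler_peMl.
Qed.

(** With [n.+1] steps of length [t / n.+1], the quadratic consistency errors disappear as [n] grows
    while [d] stays fixed. *)
Lemma almost_monotone_t t : 0 <= t -> almost_monotone t (C4 t * d).
Proof.
move=> t0; have [C C0 H] := almost_monotone_n.
have K0 := K_ge0 D; have F0 := Mf_ge0 D; have C20 := C2_ge0 D.
have LK0 : 0 <= L * K by rewrite mulr_ge0.
have Md0 : 0 <= MF * d by rewrite mulr_ge0// ltW// d0.
have Cd0 : 0 <= C2 D * d by rewrite mulr_ge0// ltW// d0.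
have main n : almost_monotone t (C4 t * d + expR (2 * (L * K) * t) * (t * (C * t)) * n.+1%:R^-1).
  have s0 : 0 <= t / n.+1%:R by rewrite divr_ge0.
  have := H (t / n.+1%:R) n.+1 s0.
  have -> : n.+1%:R * (t / n.+1%:R) = t by rewrite mulrC divfK.
  apply: almost_monotoneW.
  have -> : C4 t * d + expR (2 * (L * K) * t) * (t * (C * t)) * n.+1%:R^-1 =
    expR (2 * (L * K) * t) * (2 * (MF * d) + t * (2 * (C2 D * d) + C * (t / n.+1%:R))).
    by rewrite /C4; move: (expR _) (MF) (C2 D) (_^-1) => *; ring.
  apply: ler_wpM2r.
    by nonneg.
  have -> : 2 * (L * K) * t = n.+1%:R * (2 * (L * K) * (t / n.+1%:R)).
    rewrite [RHS]mulrCA; congr (_ * _); by rewrite mulrC divfK.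
  rewrite expRM_natl lerXn2r ?nnegrE ?expR_ge0 ?expR_ge1Dx//.
  by rewrite addr_ge0// mulr_ge0// mulr_ge0.
move=> x h h0.
set B' := expR _ * (t * (C * t)) in main.
have B0 : 0 <= B' by rewrite mulr_ge0 ?expR_ge0// mulr_ge0// mulr_ge0.
have small e : 0 < e -> exists n, B' * n.+1%:R^-1 <= e.
  move=> e0; exists (Num.bound (B' / e)).
  have := archi_boundP (divr_ge0 B0 (ltW e0)).
  rewrite ltr_pdivrMr// mulrC => h'.
  rewrite ler_pdivrMr//; apply: le_trans (ltW h') _.
  by rewrite ler_wpM2l// ?ltW// ltr_nat.
apply/andP; split.
  rewrite lerNl; apply/ler_addgt0Pr => e /small[n ne].
  have /andP[+ _] := main n x h h0; rewrite lerNl => h'.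
  by apply: le_trans h' _; rewrite lerD2l.
apply/ler_addgt0Pr => e /small[n ne].
have /andP[_ h'] := main n x h h0.
by apply: le_trans h' _; rewrite addrA lerD2l.
Qed.

End max_principle.

Section invariant_region.
Variable R : realType.
Notation leb := (@lebesgue_measure R).
Notation leb2 := (@lebesgue_measure R \x @lebesgue_measure R)%E.
Variable D : nldata R.
Local Notation kap := (nl_kap D).
Local Notation K := (nl_K D).
Local Notation V := (nl_V D).
Local Notation L := (nl_L D).
Local Notation uh := (nl_u D).
Local Notation M := (nl_M D).
Local Notation u0 := (nl_u0 D).
Local Notation MF := (Mf D).
Let ikap := nl_ikap D. Let kap0 := nl_kap0 D. Let kapK := nl_kapK D.
Let kapN := nl_kapN D. Let kapD := nl_kapD D. Let kap1 := nl_kap1 D.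
Let L0 := nl_L0 D. Let VL := nl_VL D. Let VD := nl_VD D.
Let muh := nl_mu D. Let uhM := nl_uM D. Let mu0 := nl_mu0 D.
Let u001 := nl_u001 D. Let uh0 := nl_uu0 D. Let weak := nl_weak D.

Lemma C4_le s t : 0 <= s -> s <= t -> C4 D s <= C4 D t.
Proof.
move=> s0 st.
have K0 := K_ge0 D; have F0 := Mf_ge0 D; have C20 := C2_ge0 D.
have t0 : 0 <= t := le_trans s0 st.
apply: ler_pM; [exact: expR_ge0|by nonneg| |].
  by rewrite ler_expR ler_wpM2l//; nonneg.
by rewrite lerD2l ler_wpM2r//; nonneg.
Qed.

Lemma C4_ge0 t : 0 <= t -> 0 <= C4 D t.
Proof.
move=> t0; have F0 := Mf_ge0 D; have C20 := C2_ge0 D.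
by apply: mulr_ge0; [exact: expR_ge0|nonneg].
Qed.

Variable mo : mollifier R.
Local Notation d := (mo_d mo).
Local Notation r := (mo_r mo).
Local Notation v := (vm D mo).
Let d0 := mo_d0 mo.
Let r0 := mo_r0 mo.

Lemma avg2_sup (G : R * R -> R) c : bmf G -> (forall w, 0 < w.1 -> w.1 < d -> G w <= c) ->
  \int[leb2]_w (r w.1 * r w.2 * G w) <= c.
Proof.
move=> bG Gc.
have irr' := irr mo.
rewrite -[c]mulr1 -(Rint_rr mo) -RintZ//; apply: Rint_le; [exact: igrM|exact: igrZ|].
move=> w; have [->|h] := mo_int (mo := mo) (P := fun s => forall y, G (s, y) <= c) (fun s s0 sd y => Gc (s, y) s0 sd) w.1.
  by rewrite !mul0r mulr0.
by rewrite mulrC ler_wpM2r// ?mulr_ge0//; have := h w.2; rewrite -surjective_pairing.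
Qed.

Lemma vm_commute (mo' : mollifier R) t x :
  \int[leb2]_w (r w.1 * r w.2 * vm D mo' (t + w.1, x + w.2)) =
  \int[leb2]_w (mo_r mo' w.1 * mo_r mo' w.2 * v (t + w.1, x + w.2)).
Proof.
under eq_Rintegral do rewrite vm_avg /=.
under [RHS]eq_Rintegral do rewrite vm_avg /=.
rewrite (Rint_leb2_swap (F := fun ww : (R * R) * (R * R) => uh (t + ww.1.1 + ww.2.1, x + ww.1.2 + ww.2.2)) (irr mo) (irr mo')).
  apply: eq_Rintegral => w _; congr (_ * _).
  by apply: eq_Rintegral => w' _; rewrite (addrAC t) (addrAC x).
apply: (bmf_comp (h := fun ww : (R * R) * (R * R) => (t + ww.1.1 + ww.2.1, x + ww.1.2 + ww.2.2))); last exact: buh.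
have m1 := @measurable_fst _ _ (R * R)%type (R * R)%type; have m2 := @measurable_snd _ _ (R * R)%type (R * R)%type.
apply/measurable_fun_pairP; split; apply: measurable_funD; try apply: measurable_funD => //;
 try exact: (measurableT_comp measurable_fst measurable_fst);
 try exact: (measurableT_comp measurable_snd measurable_fst);
 try exact: (measurableT_comp measurable_fst measurable_snd);
 try exact: (measurableT_comp measurable_snd measurable_snd).
Qed.

(** The bound on increments of [Um] carries an error proportional to its own mollification scale. It
    is therefore used at a finer scale [e] and averaged again with [mo]; since the two
    mollifications commute, the result approximates [h * v (t, x)]. The time [t + d] is the furthest
    that [mo] sees. *)
Lemma vm_increment : exists2 C, 0 <= C & forall e t x h, 0 < e -> 0 <= t -> 0 <= h ->
  exists2 A, `|A - h * v (t, x)| <= h * (C * (e + h)) &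
    - (C4 D (t + d) * e) <= A <= h + C4 D (t + d) * e.
Proof.
have [C C0 vL] := vm_lip D mo.
exists (2 * C); first by nonneg.
move=> e t x h e0 t0 h0.
have [Cm molls] := mollifiers R; have [mo' [dE _]] := molls e e0.
have irr1 := irr mo; have irr2 := irr mo'; have ih := igr_itv 0 h.
have bv' := bvm D mo'; have bv := bvm D mo.
pose G (z : (R * R) * R) := vm D mo' (t + z.1.1, x + z.1.2 + z.2).
have bG : bmf G.
  apply: (bmf_comp (h := fun z : (R * R) * R => (t + z.1.1, x + z.1.2 + z.2))); last exact: bv'.
  apply/measurable_fun_pairP; split.
    apply: measurable_funD; first exact: measurable_cst.
    exact: (measurableT_comp measurable_fst measurable_fst).
  apply: measurable_funD; last exact: measurable_snd.
  apply: measurable_funD; first exact: measurable_cst.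
  exact: (measurableT_comp measurable_snd measurable_fst).
pose J w := \int[leb]_q (\1_`[0, h] q * G (w, q)).
have bJ : bmf J by exact: bmf_Rint_leb.
exists (\int[leb2]_w (r w.1 * r w.2 * J w)).
  rewrite (Rint_leb2_leb_swap irr1 ih bG) /G /=.
  under eq_Rintegral do under eq_Rintegral do rewrite (addrAC x).
  under eq_Rintegral do rewrite vm_commute.
  set Psi := fun q => \int[leb2]_w (mo_r mo' w.1 * mo_r mo' w.2 * v (t + w.1, x + q + w.2)).
  have bPsi : bmf Psi.
    apply: (bmf_Rint_leb2 (F := fun z => v (t + z.2.1, x + z.1 + z.2.2)) irr2).
    apply: (bmf_comp (h := fun z : R * (R * R) => (t + z.2.1, x + z.1 + z.2.2))); last exact: bv.
    apply/measurable_fun_pairP; split.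
      apply: measurable_funD; first exact: measurable_cst.
      exact: (measurableT_comp measurable_fst measurable_snd).
    apply: measurable_funD; last exact: (measurableT_comp measurable_snd measurable_snd).
    by apply: measurable_funD; [exact: measurable_cst|exact: measurable_fst].
  have -> : h * v (t, x) = \int[leb]_q (\1_`[0, h] q * v (t, x)).
    under eq_Rintegral do rewrite mulrC.
    by rewrite RintZ// Rint_itv// subr0 mulrC.
  rewrite -RintB; [|exact: (igrM ih bPsi)|exact: (igrM ih (bmf_cst _ _))].
  rewrite [leRHS]mulrC -[X in _ <= _ * X](subr0 h) -(Rint_itv h0).
  have -> : \int[leb]_q (\1_`[0, h] q * Psi q - \1_`[0, h] q * v (t, x)) =
      \int[leb]_q (\1_`[0, h] q * (\1_`[0, h] q * (Psi q - v (t, x)))).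
    apply: eq_Rintegral => q _; rewrite -mulrBr mulrA; congr (_ * _).
    by rewrite indic_itvE; case: (_ \in _); rewrite ?mulr1 ?mulr0.
  apply: Rint_wnorm => //.
  - apply: bmfM; first by apply: bmf_indic; exact: measurable_itv.
    by apply: bmfB => //; exact: bmf_cst.
  move=> q; rewrite indic_itvE in_itv/=.
  have [/andP[q0 qh]|_] := boolP (0 <= q <= h); last by rewrite mul0r normr0; nonneg; exact: ltW.
  rewrite mul1r.
  have -> : Psi q - v (t, x) = \int[leb2]_w (mo_r mo' w.1 * mo_r mo' w.2 * (v (t + w.1, x + q + w.2) - v (t, x))).
    under [RHS]eq_Rintegral do rewrite mulrBr.
    have bs := bmf_shift (t, x + q) bv.
    rewrite RintB; [|exact: (igrM irr2 bs)|exact: (igrM irr2 (bmf_cst _ _))].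
    congr (_ - _); under eq_Rintegral do rewrite mulrC.
    by rewrite RintZ// Rint_rr mulr1.
  have -> : 2 * C * (e + h) = \int[leb]_s (mo_r mo' s * (2 * C * (e + h))) by rewrite avg_const.
  apply: avg2_le; [|exact: bmf_cst|].
    by apply: bmfB; [exact: (bmf_shift (t, x + q) bv)|exact: bmf_cst].
  move=> s p; rewrite dE => s0 se p0 pe /=.
  apply: le_trans (vL _ _ _ _) _.
  have -> : t + s - t = s by ring.
  have -> : x + q + p - x = q + p by ring.
  have -> : 2 * C * (e + h) = C * (2 * (e + h)) by ring.
  have qp : 0 <= q + p by apply: addr_ge0 => //; exact: ltW.
  by apply: ler_wpM2l => //; rewrite (gtr0_norm s0) (ger0_norm qp); lra.
have JE w : J w = Um D mo' (t + w.1, x + w.2 + h) - Um D mo' (t + w.1, x + w.2).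
  rewrite /J (FTC2 h0 (dfn_shift (x + w.2) (dUm_x D mo' (t + w.1)))) ?addr0//.
  move=> z; apply: (@continuous_comp _ _ _ (fun y => x + w.2 + y) (fun x => vm D mo' (t + w.1, x)));
      [exact: (dfn_cts (dfnD (dfn_cst _) (@dfn_id R)))|exact: vm_cts].
have Jb w : 0 < w.1 -> w.1 < d -> - (C4 D (t + d) * e) <= J w <= h + C4 D (t + d) * e.
  move=> w0 wd; rewrite JE -dE.
  have tw0 : 0 <= t + w.1 by rewrite addr_ge0// ltW.
  apply: (almost_monotoneW _ (almost_monotone_t D mo' tw0)) => //.
  apply: ler_wpM2r; first exact/ltW/mo_d0.
  by apply: C4_le => //; rewrite lerD2l ltW.
apply/andP; split; last by apply: avg2_sup => // w w0 wd; have /andP[] := Jb w w0 wd.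
rewrite lerNl -mulN1r -RintZ; last exact: igrM.
under eq_Rintegral do rewrite mulrCA mulN1r.
by apply: avg2_sup; [exact: bmfN|move=> w w0 wd; rewrite lerNl; have /andP[] := Jb w w0 wd].
Qed.

(** [vm_increment] with inner scale [h * h], divided by [h]: both errors vanish with [h], and the
    bounds become exact at the fixed scale [d]. *)
Lemma vm_01 t x : 0 <= t -> 0 <= v (t, x) <= 1.
Proof.
move=> t0; have [C C0 H] := vm_increment.
have E0 : 0 <= C4 D (t + d) by apply: C4_ge0; rewrite addr_ge0// ltW.
set E := C4 D (t + d) in E0 H.
have small e : 0 < e -> exists2 h, 0 < h <= 1 & h * (E + 2 * C) <= e.
  move=> e0; have s0 : 0 < E + 2 * C + 1 by rewrite ltr_wpDl//; nonneg.
  exists (Num.min 1 (e / (E + 2 * C + 1))).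
    by rewrite lt_min ltr01 divr_gt0//= ge_min lexx.
  apply: (@le_trans _ _ (e / (E + 2 * C + 1) * (E + 2 * C + 1))); last by rewrite divfK ?gt_eqF.
  apply: ler_pM; [by rewrite le_min ler01 ltW// divr_gt0|by nonneg|by rewrite ge_min lexx orbT|by rewrite lerDl].
have key h : 0 < h <= 1 -> - (h * (E + 2 * C)) <= v (t, x) <= 1 + h * (E + 2 * C).
  move=> /andP[h0 h1]; have hh0 : 0 < h * h by rewrite mulr_gt0.
  have [A] := H (h * h) t x h hh0 t0 (ltW h0).
  rewrite ler_norml; move: (v _) => w /andP[a1 a2] /andP[a3 a4].
  have hh : h * h <= h by rewrite ler_piMr// ltW.
  have hC : h * (C * (h * h + h)) <= h * (h * (2 * C)).
    apply: ler_wpM2l; first exact: ltW.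
    have -> : h * (2 * C) = C * (2 * h) by ring.
    by apply: ler_wpM2l => //; lra.
  rewrite -(ler_pM2l h0) -[X in _ && X](ler_pM2l h0) mulrN !mulrDr mulr1.
  rewrite (mulrC E) -!mulrA in a3 a4.
  by apply/andP; split; lra.
apply/andP; split.
  rewrite -oppr_le0; apply/ler_addgt0Pr => e /small[h hh he]; rewrite add0r.
  by have /andP[] := key h hh; rewrite lerNl => h1 _; apply: le_trans h1 he.
apply/ler_addgt0Pr => e /small[h hh he].
by have /andP[_ h1] := key h hh; apply: le_trans h1 _; rewrite lerD2l.
Qed.

Lemma mm_01 t x : 0 <= t -> 0 <= mm D mo (t, x) <= 1.
Proof.
move=> t0; have bv := bmf_section t x (bvm D mo).
apply/andP; split.
  by apply: Rint_ge0 => z; rewrite mulr_ge0//; have /andP[] := vm_01 (x + z) t0.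
rewrite -[leRHS]mul1r -{2}kap1; apply: Rint_wle => // z.
by have /andP[] := vm_01 (x + z) t0.
Qed.

End invariant_region.

(** * Entropy production at a fixed time *)

Section slow_entropy.
Variable R : realType.
Notation leb := (@lebesgue_measure R).
Notation leb2 := (@lebesgue_measure R \x @lebesgue_measure R)%E.
Variables (kap : R -> R) (K : R).
Hypotheses (ikap : igr leb kap) (kap0 : forall z, 0 <= kap z)
  (kapK : forall z, kap z <= K) (kapN : forall z, z <= 0 -> kap z = 0)
  (kapD : forall x y, 0 < x -> x <= y -> kap y <= kap x)
  (kap1 : \int[leb]_z kap z = 1).
Variables (V : R -> R) (L : R).
Hypotheses (L0 : 0 <= L) (cV : continuous V) (VL : forall x y, `|V x - V y| <= L * `|x - y|)
  (VD : forall x y, 0 <= x -> x <= y -> y <= 1 -> V y <= V x).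
Variables (a a' Phi H : R -> R) (Ca : R).
Hypotheses (da : dfn a a') (ca' : continuous a') (a'0 : forall w, 0 <= a' w)
  (a'C : forall w, a' w <= Ca) (a1 : forall w, `|a w| <= 1)
  (dPhi : dfn Phi (fun w => a' w * V w)) (dH : dfn H (fun w => a' w * V w * w)).

(** Here [a] and [a'] are the first and second derivatives of the entropy, so this is the [G] of the
    overview; on [0, 1] it is largest at [p = b], where it vanishes. *)
Definition Gf p b := Phi p - Phi b - V b * (a p - a b).

Lemma dfn_Gf b : dfn (fun p => Gf p b) (fun p => a' p * (V p - V b)).
Proof.
apply: (dfn_ext (dfnB (dfnB dPhi (dfn_cst (Phi b))) (dfnZ (V b) (dfnB da (dfn_cst (a b)))))).
by move=> p; ring.
Qed.

Lemma Gf_diag b : Gf b b = 0.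
Proof. by rewrite /Gf !subrr mulr0 subrr. Qed.

Lemma Gf_le0 p b : 0 <= p <= 1 -> 0 <= b <= 1 -> Gf p b <= 0.
Proof.
move=> /andP[p0 p1] /andP[b0 b1].
have [pb|/ltW bp] := leP p b.
  rewrite -(Gf_diag b); apply: (dfn_le pb (dfn_Gf b)) => s /andP[ps sb].
  by rewrite mulr_ge0// subr_ge0 VD// (le_trans p0).
rewrite -oppr_ge0 -oppr0 -(Gf_diag b).
have dN := dfnZ (- 1) (dfn_Gf b).
have := dfn_le bp dN; rewrite !mulN1r; apply => s /andP[bs sp].
by rewrite mulN1r -mulrN opprB mulr_ge0// subr_ge0 VD// (le_trans sp).
Qed.

(** Comparison with [L * |p - b| * a], which is monotone. Since [|a| <= 1], the variation of [a] is
    at most 2, and the constant does not see [a'], which blows up as the entropy approaches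
    [|w - c|]. *)
Lemma Gf_ge p b : - (2 * L * `|p - b|) <= Gf p b.
Proof.
have a2 : `|a p - a b| <= 2.
  by apply: le_trans (ler_normB _ _) _; rewrite -[2]/(1 + 1) lerD.
have Vs s : `|s - b| <= `|p - b| -> `|V s - V b| <= L * `|p - b|.
  by move=> sb; apply: le_trans (VL _ _) _; rewrite ler_wpM2l.
have c0 : 0 <= L * `|p - b| by rewrite mulr_ge0.
have lb : L * `|p - b| * `|a p - a b| <= 2 * L * `|p - b|.
  by rewrite mulrC mulrA mulrC -mulrA [leRHS]mulrC -mulrA; nra.
have [pb|/ltW bp] := leP p b.
  have ab : a p <= a b by apply: (dfn_le pb da).
  have := dfn_le pb (dfnB (dfnZ (L * `|p - b|) da) (dfn_Gf b)).
  rewrite Gf_diag subr0 => h.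
  have {}h : L * `|p - b| * a p - Gf p b <= L * `|p - b| * a b.
    apply: h => s /andP[ps sb].
    have sb' : `|s - b| <= `|p - b| by rewrite !ler0_norm ?subr_le0// lerN2 lerD2r.
    have {sb'} := Vs s sb'.
    rewrite [_ * a' s]mulrC -mulrBr => h; apply: mulr_ge0 => //.
    by rewrite subr_ge0; apply: le_trans (ler_norm _) h.
  rewrite [`|a p - a b|]ler0_norm ?subr_le0// opprB mulrBr in lb.
  move: (Gf p b) h lb; move: (L * _ * a p) (L * _ * a b) (2 * L * _) => *; lra.
have ab : a b <= a p by apply: (dfn_le bp da).
have := dfn_le bp (dfnD (dfnZ (L * `|p - b|) da) (dfn_Gf b)).
rewrite Gf_diag addr0 => h.
have {}h : L * `|p - b| * a b <= L * `|p - b| * a p + Gf p b.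
  apply: h => s /andP[bs sp].
  have sb' : `|s - b| <= `|p - b| by rewrite !ger0_norm ?subr_ge0// ?lerD2r// (le_trans bs).
  have {sb'} := Vs s sb'.
  rewrite [_ * a' s]mulrC -mulrDr => h; apply: mulr_ge0 => //.
  by have := lerNnormlW h; rewrite -subr_ge0 opprK addrC.
rewrite [`|a p - a b|]ger0_norm ?subr_ge0// mulrBr in lb.
move: (Gf p b) h lb; move: (L * _ * a p) (L * _ * a b) (2 * L * _) => *; lra.
Qed.

Lemma Gf_norm p b : 0 <= p <= 1 -> 0 <= b <= 1 -> `|Gf p b| <= 2 * L * `|p - b|.
Proof. by move=> p01 b01; rewrite ler0_norm ?Gf_le0// lerNl Gf_ge. Qed.

Variables (phi phi' : R -> R) (X Cphi : R).
Hypotheses (dphi : dfn phi phi') (cphi' : continuous phi') (phi0 : forall x, 0 <= phi x)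
  (phiX : forall x, x < - X \/ X < x -> phi x = 0) (phiC : forall x, `|phi' x| <= Cphi).
Variables (m m' v : R -> R) (Cm : R).
Hypotheses (dm : dfn m m') (cm' : continuous m') (m'C : forall x, `|m' x| <= Cm)
  (mv : measurable_fun setT v) (v01 : forall x, 0 <= v x <= 1)
  (m01 : forall x, 0 <= m x <= 1)
  (mE : forall x, m x = \int[leb]_z (kap z * v (x + z))).

Let I := \1_`[- X, X] : R -> R.

Let iI : igr leb I. Proof. exact: igr_itv. Qed.

Let I0 x : 0 <= I x. Proof. exact: indic_itv_ge0. Qed.

Let phi'X x : x < - X \/ X < x -> phi' x = 0.
Proof. exact: (dfn_zero_outside dphi phiX). Qed.

Let outX x : I x = 1 \/ (phi x = 0 /\ phi' x = 0).
Proof.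
rewrite /I indic_itvE in_itv/=; case: (boolP (- X <= x <= X)) => [_|]; first by left.
by rewrite negb_and -!ltNge => h; right; split; [apply: phiX|apply: phi'X]; move/orP: h.
Qed.

Let cm : continuous m. Proof. exact: dfn_cts dm. Qed.
Let bm : bmf m.
Proof.
split; first exact: continuous_measurable_fun.
by exists 1 => x; have /andP[m0 m1] := m01 x; rewrite ger0_norm.
Qed.
Let bm' : bmf m'. Proof. by split; [exact: continuous_measurable_fun|exists Cm]. Qed.
Let bv : bmf v.
Proof. by split => //; exists 1 => x; have /andP[m0 m1] := v01 x; rewrite ger0_norm. Qed.
Let bphi' : bmf phi'. Proof. by split; [exact: continuous_measurable_fun|exists Cphi]. Qed.
Let bphi : bmf phi.
Proof.
have cphi := dfn_cts dphi.
by split; [exact: continuous_measurable_fun|exact: bounded_supp cphi phiX].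
Qed.
Let bcomp (f : R -> R) : continuous f -> bmf (fun x => f (m x)).
Proof.
move=> cf; split; first exact: (measurableT_comp (continuous_measurable_fun cf) bm.1).
have [C fC] : exists C, forall w, 0 <= w <= 1 -> `|f w| <= C.
  have [] := @EVT_max R (fun w => `|f w|) 0 1 ler01.
    by move=> w; apply: cvg_norm; apply: continuous_subspaceT.
  by move=> c _ hc; exists `|f c| => w w01; exact: hc.
by exists C => x; exact: fC.
Qed.
Let bam : bmf (fun x => a (m x)). Proof. exact/bcomp/dfn_cts/da. Qed.
Let ba'm : bmf (fun x => a' (m x)). Proof. exact: bcomp. Qed.
Let bVm : bmf (fun x => V (m x)). Proof. exact: bcomp. Qed.
Let bPm : bmf (fun x => Phi (m x)). Proof. exact/bcomp/dfn_cts/dPhi. Qed.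
Let bHm : bmf (fun x => H (m x)). Proof. exact/bcomp/dfn_cts/dH. Qed.

Let e x y := phi' x * Gf (m x) (m y) + phi x * (m' x * (a' (m x) * (V (m x) - V (m y)))).

Let dfn_e y : dfn (fun x => phi x * Gf (m x) (m y)) (fun x => e x y).
Proof.
apply: (dfn_ext (dfnM dphi (dfn_comp (dfn_Gf (m y)) dm))) => x.
by rewrite /e; congr (_ + _ * _); rewrite mulrC.
Qed.

Let bmf1 (f : R -> R) : bmf f -> bmf (fun z : R * R => f z.1).
Proof. by move=> bf; apply: (bmf_comp (h := fst)) => //; exact: measurable_fst. Qed.
Let bmf2 (f : R -> R) : bmf f -> bmf (fun z : R * R => f z.2).
Proof. by move=> bf; apply: (bmf_comp (h := snd)) => //; exact: measurable_snd. Qed.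

Let be : bmf (fun z : R * R => e z.1 z.2).
Proof.
apply: bmfD.
  apply: bmfM; first exact: bmf1.
  apply: bmfB; first by apply: bmfB; [exact: (bmf1 bPm)|exact: (bmf2 bPm)].
  apply: bmfM; first exact: (bmf2 bVm).
  by apply: bmfB; [exact: (bmf1 bam)|exact: (bmf2 bam)].
apply: bmfM; first exact: bmf1.
apply: bmfM; first exact: bmf1.
apply: bmfM; first exact: (bmf1 ba'm).
by apply: bmfB; [exact: (bmf1 bVm)|exact: (bmf2 bVm)].
Qed.

Let ce y : continuous (fun x => e x y).
Proof.
have cVm : continuous (fun x => V (m x)).
  by move=> x; apply: (@continuous_comp _ _ _ m V); [exact: cm|exact: cV].
have ca'm : continuous (fun x => a' (m x)).
  by move=> x; apply: (@continuous_comp _ _ _ m a'); [exact: cm|exact: ca'].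
have cG : continuous (fun x => Gf (m x) (m y)).
  exact: (dfn_cts (dfn_comp (dfn_Gf (m y)) dm)).
move=> x; apply: cvgD; apply: cvgM; [exact: cphi'|exact: cG|exact: (dfn_cts dphi)|].
apply: cvgM; first exact: cm'.
apply: cvgM; first exact: ca'm.
by apply: cvgB; [exact: cVm|exact: cvg_cst].
Qed.

(** The part of the entropy production that has a sign after integration against the kernel; what is
    left over is controlled by [|m (x + z) - m x|]. *)
Let j z := \int[leb]_x (I x * (v (x + z) * - e x (x + z))).

Let shiftp (F : R * R -> R) : bmf F -> bmf (fun z : R * R => F (z.2, z.2 + z.1)).
Proof.
apply: (bmf_comp (h := fun z : R * R => (z.2, z.2 + z.1))).
apply/measurable_fun_pairP; split; first exact: measurable_snd.
by apply: measurable_funD; [exact: measurable_snd|exact: measurable_fst].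
Qed.

Let bve : bmf (fun z : R * R => v z.2 * - e z.1 z.2).
Proof. by apply: bmfM; [exact: bmf2|exact: bmfN]. Qed.

Let bj : bmf j.
Proof.
apply: (bmf_Rint_leb (F := fun z => v (z.2 + z.1) * - e z.2 (z.2 + z.1)) iI).
exact: (shiftp bve).
Qed.

(* For fixed [y], [z |-> phi (y - z) * Gf (m (y - z)) (m y)] is nonpositive and vanishes at 0; its derivative is [- e (y - z) y]. *)
Let j_primitive Z : 0 <= Z -> \int[leb]_z (\1_`[0, Z] z * j z) <= 0.
Proof.
move=> Z0.
pose IZ := \1_`[- X, X + Z] : R -> R.
have iIZ : igr leb IZ by exact: igr_itv.
have bF : bmf (fun zy : R * R => v zy.2 * - e (zy.2 - zy.1) zy.2).
  apply: (bmf_comp (h := fun zy : R * R => (zy.2 - zy.1, zy.2)) _ bve).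
  apply/measurable_fun_pairP; split; last exact: measurable_snd.
  by apply: measurable_funB; [exact: measurable_snd|exact: measurable_fst].
have jE z : \1_`[0, Z] z * j z =
    \1_`[0, Z] z * \int[leb]_y (IZ y * (v y * - e (y - z) y)).
  rewrite indic_itvE in_itv/=; case: (boolP (0 <= z <= Z)) => [/andP[z0 zZ]|_]; last by rewrite !mul0r.
  (* The substitution [y = x + z] freezes the second argument of [e]; the window is enlarged to
     [[- X, X + Z]] so that it does not depend on [z]. *)
  congr (_ * _); rewrite /j -(@Rint_shift _ z (fun y => IZ y * (v y * - e (y - z) y))).
    apply: eq_Rintegral => x _; rewrite (addrC z) addrK.
    have [Ix|[p0 p'0]] := outX x; last by rewrite /e p0 p'0 !mul0r addr0 oppr0 !mulr0.
    rewrite Ix; have -> : IZ (x + z) = 1 => //.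
    move: Ix; rewrite /I /IZ !indic_itvE !in_itv/=.
    case: (boolP (- X <= x <= X)) => [/andP[x1 x2] _|_ /eqP]; last by rewrite eq_sym oner_eq0.
    by rewrite (_ : (- X <= x + z <= X + Z) = true)//; apply/andP; split; [rewrite ler_wpDr|exact: lerD].
  by apply: (igrM iIZ); apply: (bmf_comp (h := pair z) _ bF); exact: measurable_pair1.
under eq_Rintegral do rewrite jE.
rewrite (Rint_leb_swap (F := fun z y => v y * - e (y - z) y) (igr_itv 0 Z) iIZ bF).
rewrite -oppr_ge0 -mulN1r -RintZ; last first.
  apply: (igrM iIZ).
  apply: (bmf_Rint_leb (F := fun yz : R * R => v yz.1 * - e (yz.1 - yz.2) yz.1)); first exact: igr_itv.
  by apply: (bmf_comp (h := fun z : R * R => (z.2, z.1)) _ bF); exact: measurable_swap.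
apply: Rint_ge0 => y; rewrite mulN1r -mulrN; apply: mulr_ge0; first exact: indic_itv_ge0.
have dh : dfn (fun z => phi (y - z) * Gf (m (y - z)) (m y)) (fun z => - e (y - z) y).
  have dl : dfn (fun z : R => y - z) (fun=> -1).
    by apply: (dfn_ext (dfnB (dfn_cst y) (@dfn_id R))) => z; rewrite sub0r.
  by apply: (dfn_ext (dfn_comp (dfn_e y) dl)) => z; rewrite mulrN1.
under eq_Rintegral do rewrite mulrCA.
have ih : igr leb (fun z => \1_`[0, Z] z * - e (y - z) y).
  apply: (igrM (igr_itv 0 Z)).
  apply: bmfN; apply: (bmf_comp (h := fun z : R => (y - z, y)) _ be).
  apply/measurable_fun_pairP; split; last exact: measurable_cst.
  by apply: measurable_funB; [exact: measurable_cst|exact: measurable_id].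
rewrite RintZ// -mulrN; apply: mulr_ge0; first by have /andP[] := v01 y.
rewrite (FTC2 Z0 dh); last first.
  move=> z; apply: cvgN; apply: (@continuous_comp _ _ _ (fun z => y - z) (fun x => e x y)); last exact: ce.
  by apply: cvgB; [exact: cvg_cst|exact: cvg_id].
by rewrite subr0 Gf_diag mulr0 subr0 oppr_ge0 mulr_ge0_le0// Gf_le0.
Qed.

Lemma Rint_kap_j : \int[leb]_z (kap z * j z) <= 0.
Proof. by rewrite -[leRHS](mulr0 K); exact: (abel ikap kap0 kapK kapN kapD bj j_primitive). Qed.

Let Dap x := a' (m x) * m' x * phi x + a (m x) * phi' x.

Let dDap : dfn (fun x => a (m x) * phi x) Dap.
Proof. exact: (dfnM (dfn_comp da dm) dphi). Qed.

(** Entropy flux written by parts: as [H] has derivative [a' w * V w * w], the formal derivative of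
    [qf] is [a w] times that of [V w * w], and no derivative of [V] appears. *)
Definition qf w := a w * V w * w - H w.

Let bDap : bmf Dap.
Proof. by apply: bmfD; [apply: bmfM => //; exact: bmfM|exact: bmfM]. Qed.

Let Dap_I x : I x * Dap x = Dap x.
Proof. by have [->|[p0 p'0]] := outX x; rewrite ?mul1r// /Dap p0 p'0 !mulr0 addr0 mulr0. Qed.

Let iDap : igr leb Dap.
Proof.
rewrite (_ : Dap = (fun x => I x * Dap x)); last by apply/funext => x; rewrite Dap_I.
exact: igrM.
Qed.

Let iphi' : igr leb phi'.
Proof.
rewrite (_ : phi' = (fun x => I x * phi' x)); first exact: igrM.
by apply/funext => x; have [->|[_ ->]] := outX x; rewrite ?mul1r ?mulr0.
Qed.

Let bqm : bmf (fun x => qf (m x)).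
Proof. by apply: bmfB => //; apply: bmfM => //; exact: bmfM. Qed.

Let RintX f f' : dfn f f' -> continuous f' -> (forall x, x < - X \/ X < x -> f x = 0) ->
  \int[leb]_x f' x = 0.
Proof.
move=> df cf' fX; have f'X := dfn_zero_outside df fX.
pose Y := `|X| + 1.
have XY : X < Y by rewrite /Y ltr_pwDr// ler_norm.
have XY' : - Y < - X by rewrite ltrN2.
have Y0 : - Y <= Y by rewrite /Y; have := normr_ge0 X; lra.
have := FTC2 Y0 df cf'; rewrite fX; last by right.
rewrite fX; last by left.
rewrite subr0 => <-; apply: eq_Rintegral => x _; rewrite indic_itvE in_itv/=.
case: (boolP (- Y <= x <= Y)) => [_|]; first by rewrite mul1r.
rewrite negb_and -!ltNge mul0r => h; apply: f'X.
by case/orP: h => h; [left; exact: lt_trans XY'|right; exact: lt_trans h].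
Qed.

Let ccomp (f : R -> R) : continuous f -> continuous (fun x => f (m x)).
Proof. by move=> cf x; apply: (@continuous_comp _ _ _ m f); [exact: cm|exact: cf]. Qed.

(** The derivative of [H (m x) * phi x] integrates to 0, which moves all derivatives onto [phi]. *)
Let local_part : \int[leb]_x (Dap x * (V (m x) * m x)) = \int[leb]_x (phi' x * qf (m x)).
Proof.
have dHp := dfnM (dfn_comp dH dm) dphi.
have Ip : \int[leb]_x (a' (m x) * V (m x) * m x * m' x * phi x + H (m x) * phi' x) = 0.
  apply: (RintX dHp).
    have c1 := ccomp ca'; have c2 := ccomp cV; have c3 := ccomp (dfn_cts dH); have c4 := dfn_cts dphi.
    move=> x; apply: cvgD; apply: cvgM; [|exact: c4|exact: c3|exact: cphi'].
    apply: cvgM; last exact: cm'.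
    apply: cvgM; last exact: cm.
    by apply: cvgM; [exact: c1|exact: c2].
  by move=> x /phiX ->; rewrite mulr0.
have iA : igr leb (fun x => Dap x * (V (m x) * m x)) by apply: (igrM iDap); exact: bmfM.
have iB : igr leb (fun x => phi' x * qf (m x)) by exact: igrM.
apply/eqP; rewrite -subr_eq0 -RintB//; apply/eqP; rewrite -[RHS]Ip.
by apply: eq_Rintegral => x _; rewrite /Dap /qf; ring.
Qed.

Let dm2 z x := `|m (x + z) - m x|.

Let shift2 (f : R -> R) : bmf f -> bmf (fun w : R * R => f (w.1 + w.2)).
Proof.
apply: (bmf_comp (h := fun w : R * R => w.1 + w.2)).
by apply: measurable_funD; [exact: measurable_fst|exact: measurable_snd].
Qed.

(** The chain rule for [Gf] isolates [- e], whose contribution is nonpositive by [Rint_kap_j]. The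
    rest carries the factor [phi']; its constant [3 * L] is [2 * L] from [Gf_norm] plus [L] from
    [a p * (V b - V p)]. *)
Let nonlocal_part : \int[leb]_x (Dap x * \int[leb]_z (kap z * ((V (m (x + z)) - V (m x)) * v (x + z)))) <=
  3 * L * Cphi * \int[leb]_x (I x * \int[leb]_z (kap z * `|m (x + z) - m x|)).
Proof.
have C0 : 0 <= Cphi := le_trans (normr_ge0 _) (phiC 0).
pose A (w : R * R) := v (w.1 + w.2) * - e w.1 (w.1 + w.2).
pose B (w : R * R) := `|m (w.1 + w.2) - m w.1|.
pose F (w : R * R) := Dap w.1 * ((V (m (w.1 + w.2)) - V (m w.1)) * v (w.1 + w.2)).
have bA : bmf A.
  apply: bmfM; first exact: shift2.
  apply: bmfN; apply: (bmf_comp (h := fun w : R * R => (w.1, w.1 + w.2)) _ be).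
  apply/measurable_fun_pairP; split; first exact: measurable_fst.
  by apply: measurable_funD; [exact: measurable_fst|exact: measurable_snd].
have bB : bmf B by apply/bmf_norm/bmfB; [exact: shift2|exact: bmf1].
have bF : bmf F.
  apply: bmfM; first exact: bmf1.
  by apply: bmfM; [apply: bmfB; [exact: (shift2 bVm)|exact: (bmf1 bVm)]|exact: shift2].
have FAB w : I w.1 * F w <= I w.1 * (A w + 3 * L * Cphi * B w).
  have [->|[p0 p'0]] := outX w.1; last first.
    rewrite /F /A /e /Dap p0 p'0 !(mulr0, mul0r, addr0, oppr0, add0r).
    by apply: mulr_ge0 => //; apply: mulr_ge0; [nonneg|exact: normr_ge0].
  rewrite !mul1r; case: w => x z; rewrite /F /A /B /=.
  set b := m (x + z); set p := m x; set vv := v (x + z).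
  have -> : Dap x * ((V b - V p) * vv) =
      vv * - e x (x + z) + vv * (phi' x * (Gf p b + a p * (V b - V p))).
    by rewrite /Dap /e -/b -/p; ring.
  rewrite lerD2l; apply: le_trans (ler_norm _) _.
  have /andP[vv0 vv1] := v01 (x + z).
  rewrite normrM normrM (ger0_norm vv0).
  have h1 : `|Gf p b + a p * (V b - V p)| <= 3 * L * `|b - p|.
    apply: le_trans (ler_normD _ _) _.
    have -> : 3 * L * `|b - p| = 2 * L * `|p - b| + 1 * (L * `|b - p|) by rewrite (distrC p); ring.
    by apply: lerD; [exact: (Gf_norm (m01 x) (m01 (x + z)))|rewrite normrM; exact: ler_pM].
  have h2 : `|phi' x| * `|Gf p b + a p * (V b - V p)| <= Cphi * (3 * L * `|b - p|) by rewrite ler_pM.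
  rewrite -[X in _ <= X]mul1r; apply: ler_pM => //.
  by apply: le_trans h2 _; rewrite le_eqVlt; apply/orP; left; apply/eqP; ring.
have bi (G : R * R -> R) : bmf G -> bmf (fun x => \int[leb]_z (kap z * G (x, z))).
  by move=> bG; apply: bmf_Rint_leb.
have section (G : R * R -> R) x : bmf G -> igr leb (fun z => kap z * G (x, z)).
  move=> bG; apply: (igrM ikap); apply: (bmf_comp (h := pair x) _ bG); exact: measurable_pair1.
apply: (@le_trans _ _ (\int[leb]_x (I x * \int[leb]_z (kap z * F (x, z))))).
  rewrite le_eqVlt; apply/orP; left; apply/eqP; apply: eq_Rintegral => x _.
  rewrite -Dap_I -mulrA; congr (_ * _).
  rewrite -RintZ; last by apply: (section (fun w => (V (m (w.1 + w.2)) - V (m w.1)) * v (w.1 + w.2))); apply: bmfM; [apply: bmfB; [exact: (shift2 bVm)|exact: (bmf1 bVm)]|exact: shift2].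
  by apply: eq_Rintegral => z _; rewrite /F/= mulrCA.
apply: (@le_trans _ _ (\int[leb]_x (I x * \int[leb]_z (kap z * (A (x, z) + 3 * L * Cphi * B (x, z)))))).
  apply: Rint_le.
  - exact: (igrM iI (bi _ bF)).
  - apply: (igrM iI); apply: (bi (fun w => A w + 3 * L * Cphi * B w)).
    by apply: bmfD => //; apply: bmfM => //; exact: bmf_cst.
  move=> x.
  have h := FAB (x, _).
  have [E|E] : I x = 1 \/ I x = 0.
    by rewrite /I indic_itvE; case: (_ \in _); [left|right].
    rewrite E !mul1r; apply: Rint_le; [exact: (section _ _ bF)| |].
      apply: (section (fun w => A w + 3 * L * Cphi * B w)).
      by apply: bmfD => //; apply: bmfM => //; exact: bmf_cst.
    by move=> z; rewrite ler_wpM2l//; have := h z; rewrite /= E !mul1r.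
  by rewrite E !mul0r.
have -> : \int[leb]_x (I x * \int[leb]_z (kap z * (A (x, z) + 3 * L * Cphi * B (x, z)))) =
  \int[leb]_x (I x * \int[leb]_z (kap z * A (x, z))) +
  3 * L * Cphi * \int[leb]_x (I x * \int[leb]_z (kap z * B (x, z))).
  rewrite -RintZ; last exact: (igrM iI (bi _ bB)).
  rewrite -RintD; last 2 first.
  - exact: (igrM iI (bi _ bA)).
  - exact/igrZ/(igrM iI (bi _ bB)).
  apply: eq_Rintegral => x _.
  rewrite mulrCA -mulrDr; congr (_ * _).
  rewrite -RintZ; last exact: section.
  rewrite -RintD; [|exact: section|exact/igrZ/section].
  by apply: eq_Rintegral => z _; rewrite mulrDr; congr (_ + _); exact: mulrCA.
rewrite gerDr.
rewrite (Rint_leb_swap (F := fun x z => A (x, z)) iI ikap); last first.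
  by move: bA; congr bmf; apply/funext => -[].
exact: Rint_kap_j.
Qed.

(** The kernel average of [gg] splits into [V (m x) * m x], the variation of [V (m _)] across the
    kernel, and an error of size [rho]. The first two are [local_part] and [nonlocal_part]; the
    third is bounded in absolute value. *)
Lemma slow_entropy (gg : R -> R) (rho : R) : bmf gg -> (forall x, `|gg x - V (m x) * v x| <= rho) ->
  \int[leb]_x ((a' (m x) * m' x * phi x + a (m x) * phi' x) * \int[leb]_z (kap z * gg (x + z))) <=
  \int[leb]_x (phi' x * qf (m x)) +
  3 * L * Cphi * \int[leb]_x (\1_`[- X, X] x * \int[leb]_z (kap z * `|m (x + z) - m x|)) +
  rho * \int[leb]_x `|a' (m x) * m' x * phi x + a (m x) * phi' x|.
Proof.
move=> bgg ggr.
have bVv : bmf (fun x => V (m x) * v x) by exact: bmfM.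
have bs (f : R -> R) x : bmf f -> bmf (fun z : R => f (x + z)).
  by apply: (bmf_comp (h := fun z : R => x + z)); exact: measurable_shift.
have is_ (f : R -> R) x : bmf f -> igr leb (fun z => kap z * f (x + z)).
  by move=> bf; exact: (igrM ikap (bs f x bf)).
have bconv (f : R -> R) : bmf f -> bmf (fun x : R => \int[leb]_z (kap z * f (x + z))).
  by move=> bf; apply: (bmf_Rint_leb (F := fun w : R * R => f (w.1 + w.2))) => //; exact: shift2.
have bn1 := bconv _ bVv.
have bdif := bmfB bgg bVv.
have bn2 := bconv _ bdif.
have nE x : \int[leb]_z (kap z * gg (x + z)) =
   V (m x) * m x + \int[leb]_z (kap z * ((V (m (x + z)) - V (m x)) * v (x + z))) +
   \int[leb]_z (kap z * (gg (x + z) - V (m (x + z)) * v (x + z))).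
  have -> : \int[leb]_z (kap z * ((V (m (x + z)) - V (m x)) * v (x + z))) =
     \int[leb]_z (kap z * (V (m (x + z)) * v (x + z))) - V (m x) * m x.
    rewrite [X in _ - _ * X]mE -RintZ; last exact: is_.
    rewrite -RintB; [|exact: (is_ _ _ bVv)|exact/igrZ/is_].
    by apply: eq_Rintegral => z _; rewrite mulrBl mulrBr; congr (_ - _); exact: mulrCA.
  rewrite [V (m x) * m x + _]addrC subrK -RintD; [|exact: (is_ _ _ bVv)|exact: (is_ _ _ bdif)].
  by apply: eq_Rintegral => z _; rewrite -mulrDr [X in _ = _ * X]addrC subrK.
rewrite -/(Dap _).
have b0 : bmf (fun x => V (m x) * m x) by exact: bmfM.
have bn0 : bmf (fun x : R => \int[leb]_z (kap z * ((V (m (x + z)) - V (m x)) * v (x + z)))).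
  apply: (bmf_Rint_leb (F := fun w : R * R => (V (m (w.1 + w.2)) - V (m w.1)) * v (w.1 + w.2))) => //.
  by apply: bmfM; [apply: bmfB; [exact: (shift2 bVm)|exact: (bmf1 bVm)]|exact: shift2].
have -> : \int[leb]_x (Dap x * \int[leb]_z (kap z * gg (x + z))) =
   \int[leb]_x (Dap x * (V (m x) * m x)) +
   \int[leb]_x (Dap x * \int[leb]_z (kap z * ((V (m (x + z)) - V (m x)) * v (x + z)))) +
   \int[leb]_x (Dap x * \int[leb]_z (kap z * (gg (x + z) - V (m (x + z)) * v (x + z)))).
  rewrite -RintD; [|exact: igrM|exact: igrM].
  rewrite -RintD; [|by apply: igrD; exact: igrM|exact: igrM].
  by apply: eq_Rintegral => x _; rewrite nE -!mulrDr.
rewrite local_part; apply: lerD; first by rewrite lerD2l; exact: nonlocal_part.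
apply: le_trans (ler_norm _) _; apply: le_trans (Rint_norm (igrM iDap bn2)) _.
rewrite -RintZ; last exact: igr_norm.
apply: Rint_le; [exact/igr_norm/igrM|exact/igrZ/igr_norm|].
move=> x; rewrite normrM mulrC ler_wpM2r//.
rewrite -[rho]mulr1 -kap1; apply: Rint_wnorm => //.
exact: (bs _ x bdif).
Qed.

End slow_entropy.

(** * Kruzhkov's inequality for the nonlocal average *)

(** What is used of a test function: one bound [tf_C] for it and its two derivatives, and a box
    beyond which it vanishes. The sign is imposed only for [t >= 0], as in the entropy
    inequality. *)
Record testf (R : realType) := TestF {
  tf_f : R * R -> R; tf_t : R * R -> R; tf_x : R * R -> R;
  tf_T : R; tf_X : R; tf_C : R;
  tf_T0 : 0 <= tf_T; tf_X0 : 0 <= tf_X;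
  tf_dt : forall x, dfn (fun t => tf_f (t, x)) (fun t => tf_t (t, x));
  tf_dx : forall t, dfn (fun x => tf_f (t, x)) (fun x => tf_x (t, x));
  tf_ct : forall x, continuous (fun t => tf_t (t, x));
  tf_cx : forall t, continuous (fun x => tf_x (t, x));
  tf_m : measurable_fun setT tf_f; tf_mt : measurable_fun setT tf_t;
  tf_mx : measurable_fun setT tf_x;
  tf_le : forall z, `|tf_f z| <= tf_C; tf_let : forall z, `|tf_t z| <= tf_C;
  tf_lex : forall z, `|tf_x z| <= tf_C;
  tf_outT : forall t x, tf_T <= t -> tf_f (t, x) = 0;
  tf_outX : forall t x, tf_X <= `|x| -> tf_f (t, x) = 0;
  tf_ge0 : forall t x, 0 <= t -> 0 <= tf_f (t, x) }.

Lemma dfn_bound (R : realType) (f f' : R -> R) C : dfn f f' -> continuous f' ->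
  (forall x y, `|f y - f x| <= C * `|y - x|) -> forall x, `|f' x| <= C.
Proof.
move=> df cf fC x; apply/ler_addgt0Pr => e e0.
have [dl /= dl0 H] : \forall y \near x, `|f' x - f' y| < e.
  by have /cvgrPdist_lt := cf x; apply.
have xy : x <= x + dl / 2 by rewrite lerDl ltW// divr_gt0.
have [c [xc cy E]] := dfn_mvt xy df.
have cx : `|x - c| < dl by rewrite ler0_norm ?subr_le0// opprB; lra.
have := H c cx => h.
have h2 : `|f' c| <= C.
  have := fC x (x + dl / 2); rewrite E normrM ler_pM2r// normr_gt0.
  by rewrite [x + _]addrC addrK gt_eqF// divr_gt0.
rewrite -(subrK (f' c) (f' x)) addrC; apply: le_trans (ler_normD _ _) _.
by rewrite lerD// ltW.
Qed.

Section entropy_plane.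
Variable R : realType.
Notation leb := (@lebesgue_measure R).
Notation leb2 := (@lebesgue_measure R \x @lebesgue_measure R)%E.
Variables (kap : R -> R) (K : R).
Hypotheses (ikap : igr leb kap) (kap0 : forall z, 0 <= kap z)
  (kapK : forall z, kap z <= K) (kapN : forall z, z <= 0 -> kap z = 0)
  (kapD : forall x y, 0 < x -> x <= y -> kap y <= kap x)
  (kap1 : \int[leb]_z kap z = 1).
Variables (V : R -> R) (L : R).
Hypotheses (L0 : 0 <= L) (cV : continuous V) (VL : forall x y, `|V x - V y| <= L * `|x - y|)
  (VD : forall x y, 0 <= x -> x <= y -> y <= 1 -> V y <= V x).
Variables (m n mt mx nx v g : R * R -> R) (M Cm rho : R).
Hypotheses (dmt : forall x, dfn (fun t => m (t, x)) (fun t => mt (t, x)))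
  (dmx : forall t, dfn (fun x => m (t, x)) (fun x => mx (t, x)))
  (dnx : forall t, dfn (fun x => n (t, x)) (fun x => nx (t, x)))
  (mtE : forall z, mt z = - nx z)
  (cmt : forall x, continuous (fun t => mt (t, x)))
  (cmx : forall t, continuous (fun x => mx (t, x)))
  (cnx : forall t, continuous (fun x => nx (t, x)))
  (bm : bmf m) (bn : bmf n) (bmt : bmf mt) (bmx : bmf mx) (bnx : bmf nx) (bv : bmf v) (bg : bmf g)
  (mC : forall z, `|m z| <= M) (mxC : forall z, `|mx z| <= Cm)
  (v01 : forall t x, 0 <= t -> 0 <= v (t, x) <= 1)
  (m01 : forall t x, 0 <= t -> 0 <= m (t, x) <= 1)
  (mE : forall t x, m (t, x) = \int[leb]_z (kap z * v (t, x + z)))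
  (nE : forall t x, n (t, x) = \int[leb]_z (kap z * g (t, x + z)))
  (comm : forall t x, 0 <= t -> `|g (t, x) - V (m (t, x)) * v (t, x)| <= rho).

Variable P : testf R.
Local Notation f := (tf_f P). Local Notation ft := (tf_t P). Local Notation fx := (tf_x P).
Local Notation T := (tf_T P). Local Notation X := (tf_X P). Local Notation C := (tf_C P).
Variables (al a a' Phi H : R -> R) (Ca : R).
Hypotheses (dal : dfn al a) (da : dfn a a') (ca' : continuous a') (a'0 : forall w, 0 <= a' w)
  (a'C : forall w, a' w <= Ca) (a1 : forall w, `|a w| <= 1)
  (dPhi : dfn Phi (fun w => a' w * V w)) (dH : dfn H (fun w => a' w * V w * w)).

Lemma bmf_comp_m (h : R -> R) : continuous h -> bmf (fun z => h (m z)).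
Proof.
move=> ch; split; first exact: (measurableT_comp (continuous_measurable_fun ch) (bm).1).
have M0 : 0 <= M := le_trans (normr_ge0 _) (mC (0, 0)).
have MM : - M <= M by rewrite ge0_cp.
have [c _ hc] := @EVT_max R (fun w => `|h w|) (- M) M MM
  (continuous_subspaceT (fun w => cvg_norm (ch w))).
by exists `|h c| => z; apply: hc; rewrite in_itv/= -ler_norml mC.
Qed.

Let It t := \1_`[0, T] t : R.
Let Ix x := \1_`[- X, X] x : R.
Let iIt : igr leb It. Proof. exact: igr_itv. Qed.
Let iIx : igr leb Ix. Proof. exact: igr_itv. Qed.

Let bf : bmf f. Proof. by split; [exact: tf_m|exists C; exact: tf_le]. Qed.
Let bft : bmf ft. Proof. by split; [exact: tf_mt|exists C; exact: tf_let]. Qed.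
Let bfx : bmf fx. Proof. by split; [exact: tf_mx|exists C; exact: tf_lex]. Qed.

Let fX t x : x < - X \/ X < x -> f (t, x) = 0.
Proof.
by move=> h; apply: tf_outX; apply/ltW/lt_norm.
Qed.

Let outX t x : Ix x = 1 \/ (f (t, x) = 0 /\ fx (t, x) = 0).
Proof.
rewrite /Ix indic_itvE in_itv/=; case: (boolP (- X <= x <= X)) => [_|]; first by left.
rewrite negb_and -!ltNge => /orP h; right; split; first exact: fX.
exact: (dfn_zero_outside (tf_dx P t) (@fX t)).
Qed.

Let row (F : R * R -> R) t : bmf F -> bmf (fun x => F (t, x)).
Proof. by move=> bF; apply: (bmf_comp (h := pair t)) => //; exact: measurable_pair1. Qed.
Let col (F : R * R -> R) x : bmf F -> bmf (fun t => F (t, x)).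
Proof. by move=> bF; apply: (bmf_comp (h := fun t => (t, x))) => //; exact: measurable_pair2. Qed.
Let rows (F : R * R -> R) : bmf F -> bmf (fun t => \int[leb]_x (Ix x * F (t, x))).
Proof. by move=> bF; exact: bmf_Rint_leb. Qed.

Let Nt t := \int[leb]_x (Ix x * \int[leb]_z (kap z * `|m (t, x + z) - m (t, x)|)).

Let bN : bmf (fun w : R * R => \int[leb]_z (kap z * `|m (w.1, w.2 + z) - m w|)).
Proof.
apply: (bmf_Rint_leb (F := fun w : (R * R) * R => `|m (w.1.1, w.1.2 + w.2) - m w.1|)) => //.
apply/bmf_norm/bmfB.
  apply: (bmf_comp (h := fun w : (R * R) * R => (w.1.1, w.1.2 + w.2))); last exact: bm.
  apply/measurable_fun_pairP; split; first exact: (measurableT_comp measurable_fst measurable_fst).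
  apply: measurable_funD; last exact: measurable_snd.
  exact: (measurableT_comp measurable_snd measurable_fst).
by apply: (bmf_comp (h := fst)); [exact: measurable_fst|exact: bm].
Qed.

Definition defect := \int[leb]_t (\1_`[0, T] t *
  \int[leb]_x (\1_`[- X, X] x * \int[leb]_z (kap z * `|m (t, x + z) - m (t, x)|))).

(** Area of the box times a bound on the derivative of [a (m) * f] in [x]. It depends on the scale
    and on the entropy through [Cm] and [Ca], but it multiplies [rho], which tends to 0 with the
    mollifier. *)
Definition remainder := T * (2 * X * (Ca * Cm * C + C)).

(** Because [m] is classically differentiable with [mt = - nx], the entropy balance at each time
    becomes the integral of the derivative of [a (m) * f] against the flux [n], which [slow_entropy]
    estimates; the result is integrated over [[0, T]]. *)
Lemma entropy_plane :
  0 <= \int[leb]_t (\1_`[0, T] t * \int[leb]_x (\1_`[- X, X] x *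
         (al (m (t, x)) * ft (t, x) + qf V a H (m (t, x)) * fx (t, x)))) +
       \int[leb]_x (\1_`[- X, X] x * (al (m (0, x)) * f (0, x))) +
       3 * L * C * defect + remainder * rho.
Proof.
have X0 := tf_X0 P; have T0 := tf_T0 P.
have C0 : 0 <= C := le_trans (normr_ge0 _) (tf_le P (0, 0)).
have Ca0 : 0 <= Ca := le_trans (a'0 0) (a'C 0).
have cal := dfn_cts dal; have ca := dfn_cts da.
have balm := bmf_comp_m cal; have bam := bmf_comp_m ca; have ba'm := bmf_comp_m ca'.
have bqm : bmf (fun z => qf V a H (m z)).
  apply: bmfB; last exact: (bmf_comp_m (dfn_cts dH)).
  by apply: bmfM; [apply: bmfM; [exact: bam|exact: (bmf_comp_m cV)]|exact: bm].
have Cm0 : 0 <= Cm := le_trans (normr_ge0 _) (mxC (0, 0)).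
pose Dap z := a' (m z) * mx z * f z + a (m z) * fx z.
have bDap : bmf Dap by apply: bmfD; [apply: bmfM => //; exact: bmfM|exact: bmfM].
have DapC z : `|Dap z| <= Ca * Cm * C + C.
  apply: le_trans (ler_normD _ _) _; apply: lerD.
    rewrite !normrM; apply: ler_pM; [by rewrite mulr_ge0|by []| |exact: tf_le].
    by apply: ler_pM => //; rewrite ger0_norm.
  by rewrite normrM -[C]mul1r; apply: ler_pM => //; exact: tf_lex.
pose J z := a (m z) * mt z * f z + al (m z) * ft z.
have bJ : bmf J by apply: bmfD; [apply: bmfM => //; exact: bmfM|exact: bmfM].
(* Fundamental theorem in time for [al (m) * f], which vanishes at [t = T]. *)
have initial : \int[leb]_x (Ix x * (al (m (0, x)) * f (0, x))) =
    - \int[leb]_t (It t * \int[leb]_x (Ix x * J (t, x))).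
  rewrite (Rint_leb_swap (F := fun t x => J (t, x)) iIt iIx); last first.
    by move: bJ; congr bmf; apply/funext => -[].
  rewrite -mulN1r -RintZ; last first.
    apply: (igrM iIx); apply: (bmf_Rint_leb (F := fun w => J (w.2, w.1))) => //.
    by apply: (bmf_comp (h := fun z : R * R => (z.2, z.1)) _ bJ); exact: measurable_swap.
  apply: eq_Rintegral => x _; rewrite [RHS]mulrCA; congr (_ * _).
  have dd := dfnM (dfn_comp dal (dmt x)) (tf_dt P x).
  have E := FTC2 T0 dd _; rewrite tf_outT// mulr0 sub0r in E.
  rewrite mulN1r -[LHS]opprK; congr (- _); rewrite -E// => t.
  apply: cvgD; apply: cvgM.
  - apply: cvgM; last exact: cmt.
    by apply: (@continuous_comp _ _ _ (fun t => m (t, x)) a); [exact: (dfn_cts (dmt x))|exact: ca].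
  - exact: (dfn_cts (tf_dt P x)).
  - by apply: (@continuous_comp _ _ _ (fun t => m (t, x)) al); [exact: (dfn_cts (dmt x))|exact: cal].
  - exact: tf_ct.
(* Integration by parts in [x] for [a (m) * f * n], which vanishes at both ends of the window, after
   [mt] is replaced by [- nx]. *)
have byparts t : \int[leb]_x (Ix x * J (t, x)) =
    \int[leb]_x (Ix x * (Dap (t, x) * n (t, x))) + \int[leb]_x (Ix x * (al (m (t, x)) * ft (t, x))).
  have dd := dfnM (dfnM (dfn_comp da (dmx t)) (tf_dx P t)) (dnx t).
  have XX : - X <= X by rewrite ge0_cp.
  have := FTC2 XX dd; rewrite !tf_outX ?normrN ?ger0_norm// !mulr0 !mul0r subr0 => Z.
  have {}Z := Z _.
  have iz F : bmf F -> igr leb (fun x => Ix x * F (t, x)) by move=> bF; exact: (igrM iIx (row t bF)).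
  have i1 := iz _ (bmfM bDap bn); have i2 := iz _ (bmfM balm bft); have i3 := iz _ bJ.
  have i4 := iz _ (bmfM (bmfM bam bf) bnx).
  apply/eqP; rewrite -RintD// -subr_eq0 -RintB//; last exact: igrD.
  rewrite -oppr_eq0 -[X in _ == X]Z; last first.
    have ccmp (h : R -> R) : continuous h -> continuous (fun x => h (m (t, x))).
      by move=> ch x; apply: (@continuous_comp _ _ _ (fun x => m (t, x)) h); [exact: (dfn_cts (dmx t))|exact: ch].
    have c1 := ccmp _ ca'; have c2 := ccmp _ ca; have c3 := dfn_cts (tf_dx P t); have c4 := dfn_cts (dnx t).
    move=> x; apply: cvgD; apply: cvgM; [|exact: c4|apply: cvgM; [exact: c2|exact: c3]|exact: cnx].
    apply: cvgD; apply: cvgM; [|exact: c3|exact: c2|exact: tf_cx].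
    by apply: cvgM; [exact: c1|exact: cmx].
  apply/eqP; rewrite -mulN1r -RintZ; last by apply: igrB => //; exact: igrD.
  apply: eq_Rintegral => x _; rewrite /J /Dap mtE -/(Ix x).
  by move: (Ix x) (m (t, x)) (n _) (nx _) (f _) (ft _) (mx _) (fx _) => *; ring.
have bound t : 0 <= t -> \int[leb]_x (Ix x * (Dap (t, x) * n (t, x))) <=
    \int[leb]_x (Ix x * (qf V a H (m (t, x)) * fx (t, x))) + 3 * L * C * Nt t +
    rho * (2 * X * (Ca * Cm * C + C)).
  move=> t0.
  have h := slow_entropy ikap kap0 kapK kapN kapD kap1 L0 cV VL VD da ca' a'0 a1 dPhi dH
    (tf_dx P t) (@tf_cx _ P t) (fun x => tf_ge0 P x t0) (@fX t) (fun x => tf_lex P (t, x))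
    (dmx t) (@cmx t) (fun x => mxC (t, x)) (row t bv).1 (fun x => v01 x t0)
    (fun x => m01 x t0) (mE t) (row t bg) (fun x => comm x t0).
  rewrite -/(Nt t) in h.
  have iz F : bmf F -> igr leb (fun x => Ix x * F (t, x)) by move=> bF; exact: (igrM iIx (row t bF)).
  have E1 : \int[leb]_x (Ix x * (Dap (t, x) * n (t, x))) = \int[leb]_x
      ((a' (m (t, x)) * mx (t, x) * f (t, x) + a (m (t, x)) * fx (t, x)) * \int[leb]_z (kap z * g (t, x + z))).
    apply: eq_Rintegral => x _; rewrite -nE /Dap.
    by have [->|[-> ->]] := outX t x; rewrite ?mul1r// !mulr0 addr0 mul0r mulr0.
  have E2 : \int[leb]_x (Ix x * (qf V a H (m (t, x)) * fx (t, x))) =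
      \int[leb]_x (fx (t, x) * qf V a H (m (t, x))).
    apply: eq_Rintegral => x _.
    by have [->|[_ ->]] := outX t x; [rewrite mul1r mulrC|rewrite mulr0 mul0r mulr0].
  have rho0 : 0 <= rho := le_trans (normr_ge0 _) (comm 0 t0).
  rewrite E1 E2; apply: le_trans h _; rewrite lerD2l ler_wpM2l//.
  have -> : 2 * X * (Ca * Cm * C + C) = (Ca * Cm * C + C) * \int[leb]_x Ix x.
    by rewrite Rint_itv ?ge0_cp// opprK mulrC; congr (_ * _); ring.
  have -> : \int[leb]_x `|a' (m (t, x)) * mx (t, x) * f (t, x) + a (m (t, x)) * fx (t, x)| =
     \int[leb]_x (Ix x * `|Dap (t, x)|).
    apply: eq_Rintegral => x _; rewrite /Dap.
    by have [->|[-> ->]] := outX t x; rewrite ?mul1r// !mulr0 addr0 normr0 mulr0.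
  rewrite -RintZ//; apply: Rint_le; [exact: (iz (fun z => `|Dap z|) (bmf_norm bDap))|exact: igrZ|].
  by move=> x; rewrite mulrC; apply: ler_wpM2r; [exact: indic_itv_ge0|exact: DapC].
have bA := bmfD (bmfM balm bft) (bmfM bqm bfx).
have iz (t : R) (F : R * R -> R) : bmf F -> igr leb (fun x => Ix x * F (t, x)) by move=> bF; exact: (igrM iIx (row t bF)).
have bNt : bmf Nt by exact: (rows bN).
have bAt := rows bA.
set c := rho * (2 * X * (Ca * Cm * C + C)) in bound.
have step t : It t * \int[leb]_x (Ix x * J (t, x)) <=
    It t * (\int[leb]_x (Ix x * (al (m (t, x)) * ft (t, x) + qf V a H (m (t, x)) * fx (t, x))) +
     3 * L * C * Nt t + c).
  rewrite /It indic_itvE in_itv/=; case: (boolP (0 <= t <= T)) => [/andP[t0 _]|_]; last by rewrite !mul0r.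
  rewrite !mul1r byparts.
  have -> : \int[leb]_x (Ix x * (al (m (t, x)) * ft (t, x) + qf V a H (m (t, x)) * fx (t, x))) =
     \int[leb]_x (Ix x * (al (m (t, x)) * ft (t, x))) + \int[leb]_x (Ix x * (qf V a H (m (t, x)) * fx (t, x))).
    rewrite -RintD; [|exact: (iz t _ (bmfM balm bft))|exact: (iz t _ (bmfM bqm bfx))].
    by apply: eq_Rintegral => x _; rewrite mulrDr.
  by rewrite -!addrA [leLHS]addrC lerD2l addrA; exact: bound.
have b1 := rows bJ.
have bc : bmf (fun t => 3 * L * C * Nt t) by apply: bmfM => //; exact: bmf_cst.
have tot : \int[leb]_t (It t * \int[leb]_x (Ix x * J (t, x))) <=
   \int[leb]_t (It t * \int[leb]_x (Ix x * (al (m (t, x)) * ft (t, x) + qf V a H (m (t, x)) * fx (t, x)))) +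
   3 * L * C * defect + remainder * rho.
  have ic : igr leb (fun t => It t * c) by apply: (igrM iIt); exact: bmf_cst.
  apply: (@le_trans _ _ (\int[leb]_t (It t * (\int[leb]_x (Ix x * (al (m (t, x)) * ft (t, x) + qf V a H (m (t, x)) * fx (t, x))) +
     3 * L * C * Nt t + c)))).
    apply: Rint_le => //; first exact: igrM.
    apply: (igrM iIt); apply: bmfD; last exact: bmf_cst.
    exact: bmfD.
  under eq_Rintegral do rewrite 2!mulrDr (mulrCA (It _)).
  rewrite RintD//; last first.
    by apply: igrD; [exact: igrM|apply: igrZ; exact: igrM].
  rewrite RintD; [|exact: igrM|by apply: igrZ; exact: igrM].
  rewrite RintZ; last exact: igrM.
  rewrite -!addrA lerD2l lerD2l.
  under eq_Rintegral do rewrite mulrC.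
  by rewrite RintZ// Rint_itv// subr0 /c /remainder le_eqVlt; apply/orP; left; apply/eqP; ring.
have arith (p q c1 c2 : R) : p <= q + c1 + c2 -> 0 <= q - p + c1 + c2 by lra.
by rewrite initial; exact: arith.
Qed.

End entropy_plane.

Section mollified_solution.
Variable R : realType.
Notation leb := (@lebesgue_measure R).
Notation leb2 := (@lebesgue_measure R \x @lebesgue_measure R)%E.
Variable D : nldata R.
Local Notation kap := (nl_kap D).
Local Notation uh := (nl_u D).
Let ikap := nl_ikap D.
Let weak := nl_weak D.

Lemma convk_dfn_x a a_x t : bmf a -> bmf a_x -> (forall t, dfn (fun x => a (t, x)) (fun x => a_x (t, x))) ->
  dfn (fun x => convk kap a (t, x)) (fun x => convk kap a_x (t, x)).
Proof.
move=> ba [ma_x [C a_xC]] da x; rewrite /convk /=.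
apply: (@is_derive_Rint _ _ _ leb kap (fun x y => a (t, x + y)) (fun x y => a_x (t, x + y)) C) => //.
- by move=> y; exact: bmf_section ba.
- move=> y z; have := dfn_shift z (da t) y.
  by congr is_derive; try apply/funext => w; rewrite addrC.
Qed.

Lemma convk_dfn_t a a_t x : bmf a -> bmf a_t -> (forall x, dfn (fun t => a (t, x)) (fun t => a_t (t, x))) ->
  dfn (fun t => convk kap a (t, x)) (fun t => convk kap a_t (t, x)).
Proof.
move=> ba [ma_t [C a_tC]] da t; rewrite /convk /=.
apply: (@is_derive_Rint _ _ _ leb kap (fun t y => a (t, x + y)) (fun t y => a_t (t, x + y)) C) => //.
- by move=> y; exact: bmf_section ba.
- by move=> s z; exact: da.
Qed.

Variable mo : mollifier R.
Local Notation r := (mo_r mo).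
Let sr := mo_sr mo.

Local Notation g := (gm D mo).
Local Notation m := (mm D mo).

(** The flux paired with [mm]: averaging the classical law for [vm] and [gm] gives a conservation
    law for [mm] whose flux is [nm]. *)
Definition nm := convk kap (gm D mo).

Lemma bgm : bmf g.
Proof. by apply: bmf_Mol; [exact: ir|exact: ir|exact: bfl]. Qed.

Lemma mm_nm_derivatives : exists mt mx nx : R * R -> R,
  [/\ forall x, dfn (fun t => m (t, x)) (fun t => mt (t, x)),
      forall t, dfn (fun x => m (t, x)) (fun x => mx (t, x)),
      forall t, dfn (fun x => nm (t, x)) (fun x => nx (t, x)) &
      forall z, mt z = - nx z] /\
  [/\ forall x, continuous (fun t => mt (t, x)), forall t, continuous (fun x => mx (t, x)),
      forall t, continuous (fun x => nx (t, x)) & [/\ bmf mt, bmf mx & bmf nx]].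
Proof.
have [r' dr [r'' dr' [r3 dr'' _]]] := sr 3%N.
have k1 := ckernel_dfn (kr mo) dr (dfn_cts dr').
have k2 := ckernel_dfn k1 dr' (dfn_cts dr'').
have bu := buh D; have bf := bfl D.
have i0 := ir mo; have i1 := ckernel_igr k1; have i2 := ckernel_igr k2.
have vt x := dfn_Mol_t x i0 (kr mo) dr (dfn_cts dr') bu.
have vtt x := dfn_Mol_t x i0 k1 dr' (dfn_cts dr'') bu.
have vx t := dfn_Mol_x t i0 (kr mo) dr (dfn_cts dr') bu.
have vxx t := dfn_Mol_x t i0 k1 dr' (dfn_cts dr'') bu.
have gx t := dfn_Mol_x t i0 (kr mo) dr (dfn_cts dr') bf.
have gxx t := dfn_Mol_x t i0 k1 dr' (dfn_cts dr'') bf.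
have dN (f f' : R -> R) : dfn f f' -> dfn (fun x => - f x) (fun x => - f' x).
  by move=> df x; apply: is_deriveN; exact: df.
have b11 := bmf_Mol i1 i0 bu; have b12 := bmf_Mol i0 i1 bu; have b13 := bmf_Mol i0 i1 bf.
have b21 := bmf_Mol i2 i0 bu; have b22 := bmf_Mol i0 i2 bu; have b23 := bmf_Mol i0 i2 bf.
(* The weak equation tested on the translated mollifiers themselves gives the classical law for [vm]
   and [gm]. *)
have E z : - Mol uh r' r z = Mol (fl D) r r' z.
  have ss c n : smooth n (fun y => r (y - c)).
    by apply: (@smooth_ext _ _ (fun y => r (1 * y + - c))) => [y|]; [rewrite mul1r|exact: smooth_affine].
  have ds c : dfn (fun y => r (y - c)) (fun y => r' (y - c)).
    by have := dfn_shift (- c) dr; congr dfn; apply/funext => y; rewrite addrC.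
  have := weak (ss z.1) (ss z.2) (ds z.1) (ds z.2) (ckernel_shift _ (kr mo)) (ckernel_shift _ (kr mo)).
  by rewrite -/(Mol uh r' r z) -/(fl D) -/(Mol (fl D) r r' z) => /eqP; rewrite addr_eq0 => /eqP ->; rewrite opprK.
exists (convk kap (fun z => - Mol uh r' r z)), (convk kap (fun z => - Mol uh r r' z)),
  (convk kap (fun z => - Mol (fl D) r r' z)).
split; split.
- by move=> x; apply: convk_dfn_t => //; [exact: bvm|exact: bmfN].
- by move=> t; apply: convk_dfn_x => //; [exact: bvm|exact: bmfN].
- by move=> t; apply: convk_dfn_x => //; [exact: bgm|exact: bmfN].
- move=> z; rewrite /convk.
  rewrite -mulN1r -RintZ; last exact: (igrM ikap (bmf_section _ _ (bmfN b13))).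
  by apply: eq_Rintegral => y _; rewrite E mulrN mulN1r opprK.
- move=> x; apply: (@dfn_cts _ _ (fun t => convk kap (fun z => - - Mol uh r'' r z) (t, x))).
  by apply: convk_dfn_t; [exact: bmfN|exact/bmfN/bmfN|move=> y; apply: dN; exact: vtt].
- move=> t; apply: (@dfn_cts _ _ (fun x => convk kap (fun z => - - Mol uh r r'' z) (t, x))).
  by apply: convk_dfn_x; [exact: bmfN|exact/bmfN/bmfN|move=> y; apply: dN; exact: vxx].
- move=> t; apply: (@dfn_cts _ _ (fun x => convk kap (fun z => - - Mol (fl D) r r'' z) (t, x))).
  by apply: convk_dfn_x; [exact: bmfN|exact/bmfN/bmfN|move=> y; apply: dN; exact: gxx].
by split; exact/bmf_kap/bmfN.
Qed.

End mollified_solution.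

Lemma bmf_row (R : realType) (F : R * R -> R) t : bmf F -> bmf (fun x : R => F (t, x)).
Proof. by move=> bF; apply: (bmf_comp (h := pair t)) => //; exact: measurable_pair1. Qed.

Lemma lerD_increments (R : realFieldType) (b1 b2 b3 b4 x1 x2 : R) :
  b1 - b2 <= x1 -> b3 - b4 <= x2 -> b1 + b3 <= b2 + b4 + (x1 + x2).
Proof. lra. Qed.

Lemma ge0_sum_transfer (R : realFieldType) (A B C D A' B' C' x1 x2 x3 tot : R) :
  A <= A' + x1 -> B <= B' + x2 -> C <= C' + x3 ->
  x1 + x2 + x3 + D = tot -> 0 <= A + B + C + D -> 0 <= A' + B' + C' + tot.
Proof. lra. Qed.

Section lipschitz_flux.
Variable R : realType.
Variables (V : R -> R) (L : R).
Hypotheses (L0 : 0 <= L) (VL : forall x y, `|V x - V y| <= L * `|x - y|).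

Lemma flux_lip N w w' : `|w| <= N -> `|w'| <= N ->
  `|V w * w - V w' * w'| <= (`|V 0| + 2 * L * N) * `|w - w'|.
Proof.
move=> wN wN'.
have -> : V w * w - V w' * w' = V w * (w - w') + (V w - V w') * w' by ring.
apply: le_trans (ler_normD _ _) _; rewrite !normrM.
have h1 : `|V w| <= `|V 0| + L * N.
  rewrite -{1}(subrK (V 0) (V w)) addrC; apply: le_trans (ler_normD _ _) _.
  rewrite lerD2l; apply: le_trans (VL _ _) _; rewrite subr0.
  by apply: ler_wpM2l.
have h2 : `|V w| * `|w - w'| <= (`|V 0| + L * N) * `|w - w'| by apply: ler_wpM2r.
have h3 : `|V w - V w'| * `|w'| <= L * `|w - w'| * N by apply: ler_pM.
have -> : (`|V 0| + 2 * L * N) * `|w - w'| = (`|V 0| + L * N) * `|w - w'| + L * `|w - w'| * N by ring.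
exact: lerD.
Qed.

Variables (a a' H : R -> R) (Ca : R).
Hypotheses (da : dfn a a') (a'0 : forall w, 0 <= a' w) (a'C : forall w, a' w <= Ca)
  (a1 : forall w, `|a w| <= 1) (dH : dfn H (fun w => a' w * V w * w)).

Lemma qf_lip N : 0 <= N -> exists2 Cq, 0 <= Cq & forall w w', `|w| <= N -> `|w'| <= N ->
  `|qf V a H w - qf V a H w'| <= Cq * `|w - w'|.
Proof.
move=> N0; have Ca0 : 0 <= Ca := le_trans (a'0 0) (a'C 0).
pose VN := `|V 0| + L * N.
have VN0 : 0 <= VN by apply: addr_ge0 => //; exact: mulr_ge0.
have VNE w : `|w| <= N -> `|V w| <= VN.
  move=> wN; rewrite -(subrK (V 0) (V w)) addrC; apply: le_trans (ler_normD _ _) _.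
  by rewrite lerD2l; apply: le_trans (VL _ _) _; rewrite subr0; apply: ler_wpM2l.
exists (Ca * (VN * N) + (`|V 0| + 2 * L * N) + Ca * VN * N); first by nonneg.
move=> w w' wN wN'.
have Hl : `|H w - H w'| <= Ca * VN * N * `|w - w'|.
  have main w1 w2 : w1 <= w2 -> `|w1| <= N -> `|w2| <= N ->
      `|H w2 - H w1| <= Ca * VN * N * `|w2 - w1|.
    move=> w12 n1 n2; have [c [c1 c2 ->]] := dfn_mvt w12 dH.
    have cN : `|c| <= N.
      move: n1 n2; rewrite !ler_norml => /andP[n1 n2] /andP[n3 n4].
      by apply/andP; split; lra.
    rewrite !normrM; apply: ler_pM => //.
    apply: ler_pM => //; apply: ler_pM => //; last exact: VNE.
    by rewrite ger0_norm.
  by have [ww|/ltW ww] := leP w w'; [rewrite distrC (distrC w)|]; exact: main.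
rewrite /qf.
have -> : a w * V w * w - H w - (a w' * V w' * w' - H w') =
  (a w - a w') * (V w * w) + a w' * (V w * w - V w' * w') - (H w - H w') by ring.
have ha : `|a w - a w'| <= Ca * `|w - w'|.
  by apply: (dfn_lip _ _ da) => s; rewrite ger0_norm.
apply: le_trans (ler_normB _ _) _; rewrite [leRHS]mulrDl; apply: lerD => //.
apply: le_trans (ler_normD _ _) _; rewrite [leRHS]mulrDl; apply: lerD; rewrite normrM.
  have -> : Ca * (VN * N) * `|w - w'| = (Ca * `|w - w'|) * (VN * N) by ring.
  by apply: ler_pM => //; rewrite normrM; apply: ler_pM => //; exact: VNE.
rewrite -[leRHS]mul1r; apply: ler_pM => //; exact: flux_lip.
Qed.

End lipschitz_flux.

Section box.
Variable R : realType.
Notation leb := (@lebesgue_measure R).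
Variables (T X : R).
Hypotheses (T0 : 0 <= T) (X0 : 0 <= X).

Definition box (F : R * R -> R) :=
  \int[leb]_t (\1_`[0, T] t * \int[leb]_x (\1_`[- X, X] x * F (t, x))).

Lemma igr_box_row (F : R * R -> R) t : bmf F -> igr leb (fun x => \1_`[- X, X] x * F (t, x)).
Proof.
move=> bF; apply: (igrM (igr_itv _ _)).
by apply: (bmf_comp (h := pair t)) => //; exact: measurable_pair1.
Qed.

Lemma igr_box (F : R * R -> R) : bmf F ->
  igr leb (fun t => \1_`[0, T] t * \int[leb]_x (\1_`[- X, X] x * F (t, x))).
Proof.
move=> bF; apply: (igrM (igr_itv _ _)); apply: bmf_Rint_leb => //; exact: igr_itv.
Qed.

Lemma box_row_le (F G : R -> R) c : igr leb (fun x => \1_`[- X, X] x * F x) ->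
  igr leb (fun x => \1_`[- X, X] x * G x) -> (forall x, F x <= G x + c) ->
  \int[leb]_x (\1_`[- X, X] x * F x) <= \int[leb]_x (\1_`[- X, X] x * G x) + 2 * X * c.
Proof.
move=> iF iG FG.
have XX : - X <= X by rewrite ge0_cp.
have -> : 2 * X * c = \int[leb]_x (c * \1_`[- X, X] x).
  by rewrite RintZ ?Rint_itv//; [ring|exact: igr_itv].
rewrite -RintD//; last by apply: igrZ; exact: igr_itv.
apply: Rint_le => //; first by apply: igrD => //; apply: igrZ; exact: igr_itv.
by move=> x; rewrite (mulrC c) -mulrDr; apply: ler_wpM2l; [exact: indic_itv_ge0|exact: FG].
Qed.

Lemma box_le (F G : R * R -> R) c : bmf F -> bmf G ->
  {ae leb, forall t, 0 <= t -> t <= T -> forall x, F (t, x) <= G (t, x) + c} ->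
  box F <= box G + T * (2 * X * c).
Proof.
move=> bF bG FG.
have -> : T * (2 * X * c) = \int[leb]_t (2 * X * c * \1_`[0, T] t).
  by rewrite RintZ ?Rint_itv//; [ring|exact: igr_itv].
have i1 := igr_box bF; have i2 := igr_box bG.
have ic : igr leb (fun t => 2 * X * c * \1_`[0, T] t) by apply: igrZ; exact: igr_itv.
rewrite -RintD//; apply: Rint_ae_le => //; first exact: igrD.
have FF := ae_filter_ringOfSetsType leb.
apply: filterS FG => t FGt; rewrite (mulrC (2 * X * c)) -mulrDr.
rewrite indic_itvE in_itv/=; case: (boolP (0 <= t <= T)) => [/andP[t0 tT]|_]; last by rewrite !mul0r.
by rewrite !mul1r; apply: box_row_le; [exact: igr_box_row|exact: igr_box_row|exact: FGt].
Qed.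

Lemma boxD (F G : R * R -> R) : bmf F -> bmf G -> box (fun z => F z + G z) = box F + box G.
Proof.
move=> bF bG; rewrite /box -RintD; [|exact: igr_box|exact: igr_box].
apply: eq_Rintegral => t _; rewrite -mulrDr; congr (_ * _).
rewrite -RintD; [|exact: igr_box_row|exact: igr_box_row].
by apply: eq_Rintegral => x _; rewrite mulrDr.
Qed.

Lemma boxZ c (F : R * R -> R) : bmf F -> box (fun z => c * F z) = c * box F.
Proof.
move=> bF; rewrite /box -RintZ; last exact: igr_box.
apply: eq_Rintegral => t _; rewrite mulrCA; congr (_ * _).
rewrite -RintZ; last exact: igr_box_row.
by apply: eq_Rintegral => x _; rewrite mulrCA.
Qed.

End box.

(** * Removal of the mollification at a fixed scale *)

Section inviscid.
Variable R : realType.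
Notation leb := (@lebesgue_measure R).
Notation leb2 := (@lebesgue_measure R \x @lebesgue_measure R)%E.
Variable D : nldata R.
Local Notation kap := (nl_kap D).
Local Notation K := (nl_K D).
Local Notation V := (nl_V D).
Local Notation L := (nl_L D).
Local Notation M := (nl_M D).
Let ikap := nl_ikap D. Let kap0 := nl_kap0 D. Let kapK := nl_kapK D.
Let kapN := nl_kapN D. Let kapD := nl_kapD D. Let kap1 := nl_kap1 D.
Let L0 := nl_L0 D. Let VL := nl_VL D. Let VD := nl_VD D.

(** The good times of [mm_Wn] depend on [x]. Those common to all rational [x] still have full
    measure, and the Lipschitz bounds in space of [mm] and [Wn] extend the estimate to every [x]. *)
Lemma mm_Wn_uniform : exists2 G : set R, {ae leb, forall t, G t} &
  forall mo t x, G t -> `|mm D mo (t, x) - Wn D (t, x)| <= C1 D * mo_d mo.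
Proof.
have H x := mm_Wn D x.
pose Gx x := projT1 (cid2 (H x)).
have Gae x : {ae leb, forall t, Gx x t} by rewrite /Gx; case: cid2.
have GH x mo t : Gx x t -> `|mm D mo (t, x) - Wn D (t, x)| <= C1 D * mo_d mo.
  by rewrite /Gx; case: cid2 => G /= aeG HG; exact: HG.
pose q n : R := if unpickle n is Some q then ratr (q : rat) else 0.
exists [set t | forall n, Gx (q n) t]; first by apply: ae_foralln => n; exact: Gae.
move=> mo t x Gt; apply/ler_addgt0Pr => e e0.
have M0 := M_ge0 D; have K0 := K_ge0 D.
have KM0 : 0 <= K * (2 * M) by nonneg.
pose dl := e / (2 * (K * (2 * M) + 1)).
have s0 : 0 < K * (2 * M) + 1 by lra.
have dl0 : 0 < dl by rewrite divr_gt0// mulr_gt0.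
have [p] := @rat_in_itvoo R (x - dl) (x + dl) (ltac:(lra)).
rewrite in_itv/= => /andP[p1 p2].
have px : `|x - ratr p| <= dl by rewrite ler_norml; apply/andP; split; lra.
have qp : q (pickle p) = ratr p by rewrite /q pickleK.
have h1 := GH _ mo t (Gt (pickle p)); rewrite qp in h1.
have h2 := mm_lip D mo t (ratr p) t x; rewrite (subrr t) normr0 mulr0 add0r in h2.
have h3 := Wn_lip_x D t (ratr p) x.
have Ke : K * (2 * (M * `|x - ratr p|)) <= e / 2.
  have -> : K * (2 * (M * `|x - ratr p|)) = K * (2 * M) * `|x - ratr p| by ring.
  apply: (@le_trans _ _ ((K * (2 * M) + 1) * dl)).
    by apply: ler_pM => //; lra.
  by rewrite /dl; set u := _ + 1 in s0 *; rewrite le_eqVlt; apply/orP; left; apply/eqP; field; rewrite gt_eqF.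
have Ke' : K * (2 * M * `|x - ratr p|) <= e / 2 by rewrite -(mulrA 2).
apply: le_trans (ler_distD (mm D mo (t, ratr p)) _ _) _.
rewrite addrC (splitr e) addrA; apply: lerD; last exact: le_trans h2 Ke.
apply: le_trans (ler_distD (Wn D (t, ratr p)) _ _) _.
by apply: lerD => //; rewrite distrC; exact: le_trans h3 Ke'.
Qed.

Variable P : testf R.
Local Notation f := (tf_f P). Local Notation ft := (tf_t P). Local Notation fx := (tf_x P).
Local Notation T := (tf_T P). Local Notation X := (tf_X P). Local Notation C := (tf_C P).
Variables (al a a' Phi H : R -> R) (Ca : R).
Hypotheses (dal : dfn al a) (da : dfn a a') (ca' : continuous a') (a'0 : forall w, 0 <= a' w)
  (a'C : forall w, a' w <= Ca) (a1 : forall w, `|a w| <= 1)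
  (dPhi : dfn Phi (fun w => a' w * V w)) (dH : dfn H (fun w => a' w * V w * w)).

Lemma entropy_mm mo :
  0 <= box T X (fun z => al (mm D mo z) * ft z + qf V a H (mm D mo z) * fx z) +
       \int[leb]_x (\1_`[- X, X] x * (al (mm D mo (0, x)) * f (0, x))) +
       3 * L * C * box T X (fun z => \int[leb]_y (kap y * `|mm D mo (z.1, z.2 + y) - mm D mo z|)) +
       remainder (K * (2 * M)) P Ca * (C2 D * mo_d mo).
Proof.
have [mt [mx [nx [[dmt dmx dnx mtE] [cmt cmx cnx [bmt bmx bnx]]]]]] := mm_nm_derivatives D mo.
have mxC z : `|mx z| <= K * (2 * M).
  case: z => t x; apply: (dfn_bound (dmx t) (@cmx t)) => x1 x2.
  have := mm_lip D mo t x1 t x2; rewrite (subrr t) normr0 mulr0 add0r.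
  by rewrite -!mulrA.
apply: (@entropy_plane _ _ _ ikap kap0 kapK kapN kapD kap1 _ _ L0 (@V_cts _ D) VL VD
  (mm D mo) (nm D mo) mt mx nx (vm D mo) (gm D mo) M (K * (2 * M)) (C2 D * mo_d mo)) => //.
- exact: bmm.
- exact/bmf_kap/bgm.
- exact: bvm.
- exact: bgm.
- exact: mm_le.
- exact: vm_01.
- exact: mm_01.
- exact: commutator.
Qed.

Lemma bmf_comp_bounded (G : R * R -> R) (h : R -> R) N : bmf G -> (forall z, `|G z| <= N) ->
  continuous h -> bmf (fun z => h (G z)).
Proof.
move=> [mG _] GN ch; split; first exact: (measurableT_comp (continuous_measurable_fun ch) mG).
have N0 : 0 <= N := le_trans (normr_ge0 _) (GN (0, 0)).
have NN : - N <= N by rewrite ge0_cp.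
have [c _ hc] := @EVT_max R (fun w => `|h w|) (- N) N NN
  (continuous_subspaceT (fun w => cvg_norm (ch w))).
by exists `|h c| => z; apply: hc; rewrite in_itv/= -ler_norml.
Qed.

Lemma bmf_osc (G : R * R -> R) : bmf G ->
  bmf (fun z : R * R => \int[leb]_y (kap y * `|G (z.1, z.2 + y) - G z|)).
Proof.
move=> bG; apply: (bmf_Rint_leb (F := fun w : (R * R) * R => `|G (w.1.1, w.1.2 + w.2) - G w.1|)) => //.
apply/bmf_norm/bmfB.
  apply: (bmf_comp (h := fun w : (R * R) * R => (w.1.1, w.1.2 + w.2)) _ bG).
  apply/measurable_fun_pairP; split; first exact: (measurableT_comp measurable_fst measurable_fst).
  apply: measurable_funD; last exact: measurable_snd.
  exact: (measurableT_comp measurable_snd measurable_fst).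
by apply: (bmf_comp (h := fst) _ bG); exact: measurable_fst.
Qed.

Lemma osc_le (F G : R -> R) x c : bmf F -> bmf G -> (forall y, `|F y - G y| <= c) ->
  \int[leb]_y (kap y * `|F (x + y) - F x|) <= \int[leb]_y (kap y * `|G (x + y) - G x|) + 2 * c.
Proof.
move=> bF bG FG.
have bo (h : R -> R) : bmf h -> bmf (fun y : R => `|h (x + y) - h x|).
  move=> bh; apply/bmf_norm/bmfB; last exact: bmf_cst.
  by apply: (bmf_comp (h := fun y : R => x + y) _ bh); exact: measurable_shift.
have ic : igr leb (fun y => 2 * c * kap y) by exact: igrZ.
have -> : 2 * c = \int[leb]_y (2 * c * kap y) by rewrite RintZ// kap1 mulr1.
rewrite -RintD//; last exact: (igrM ikap (bo G bG)).
apply: Rint_le; [exact: (igrM ikap (bo F bF))|by apply: igrD => //; exact: (igrM ikap (bo G bG))|].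
move=> y; rewrite (mulrC (2 * c)) -mulrDr; apply: ler_wpM2l => //.
have h1 := FG (x + y); have h2 := FG x.
have -> : F (x + y) - F x = (F (x + y) - G (x + y)) + (G (x + y) - G x) - (F x - G x) by ring.
apply: le_trans (ler_normB _ _) _; have := ler_normD (F (x + y) - G (x + y)) (G (x + y) - G x); lra.
Qed.

(** Replacing [mm] by [Wn] costs a multiple of [d] in each term, and so does the commutator
    remainder; [B1] collects these costs and [d] tends to 0. The defect keeps its coefficient
    [3 * L * C]. *)
Lemma entropy_Wn :
  0 <= box T X (fun z => al (Wn D z) * ft z + qf V a H (Wn D z) * fx z) +
       \int[leb]_x (\1_`[- X, X] x * (al (W0 D x) * f (0, x))) +
       3 * L * C * box T X (fun z => \int[leb]_y (kap y * `|Wn D (z.1, z.2 + y) - Wn D z|)).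
Proof.
have K0 := K_ge0 D; have M0 := M_ge0 D; have C20 := C2_ge0 D; have C10 := C1_ge0 D.
have X0 := tf_X0 P; have T0 := tf_T0 P.
have C0 : 0 <= C := le_trans (normr_ge0 _) (tf_le P (0, 0)).
have Ca0 : 0 <= Ca := le_trans (a'0 0) (a'C 0).
have [Cq Cq0 qL] := qf_lip L0 VL da a'0 a'C a1 dH M0.
have alL w w' : `|al w - al w'| <= 1 * `|w - w'| by apply: (dfn_lip _ _ dal).
have cal := dfn_cts dal.
have cq : continuous (qf V a H).
  have cV := @V_cts _ D; have ca := dfn_cts da; have cH := dfn_cts dH.
  move=> w; apply: cvgB; last exact: cH.
  by apply: cvgM; [apply: cvgM; [exact: ca|exact: cV]|exact: cvg_id].
have bft : bmf ft by split; [exact: tf_mt|exists C; exact: tf_let].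
have bfx : bmf fx by split; [exact: tf_mx|exists C; exact: tf_lex].
have bA G : bmf G -> (forall z, `|G z| <= M) -> bmf (fun z => al (G z) * ft z + qf V a H (G z) * fx z).
  move=> bG GM; apply: bmfD; apply: bmfM => //; exact: (bmf_comp_bounded bG GM).
have bW := bWn D; have WM := @Wn_le _ D.
have [Gs aeG HG] := mm_Wn_uniform.
set E := (X in 0 <= X).
pose B1 := T * (2 * X * (C + Cq * C)) * C1 D + 2 * X * C * C1 D + 3 * L * C * (T * (2 * X * 2)) * C1 D +
  remainder (K * (2 * M)) P Ca * C2 D.
have key d : 0 < d -> 0 <= E + B1 * d.
  move=> d0; have [Cm molls] := mollifiers R; have [mo [dE _]] := molls d d0.
  have := entropy_mm mo; rewrite dE.
  have bm := bmm D mo; have mM := mm_le D mo.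
  have h1 : box T X (fun z => al (mm D mo z) * ft z + qf V a H (mm D mo z) * fx z) <=
     box T X (fun z => al (Wn D z) * ft z + qf V a H (Wn D z) * fx z) +
     T * (2 * X * ((C + Cq * C) * (C1 D * d))).
    apply: (box_le T0 X0 (bA _ bm mM) (bA _ bW WM)).
    have FF := ae_filter_ringOfSetsType leb.
    apply: filterS aeG => t Gt t0 tT x; have := HG mo t x Gt; rewrite dE.
    have := mM (t, x); have := WM (t, x).
    move: (mm _ _ _) (Wn _ _) => m w wM m_M mw.
    have e1 := alL m w; rewrite mul1r in e1; have e2 := qL m w m_M wM.
    have e3 : (al m - al w) * ft (t, x) <= C1 D * d * C.
      apply: le_trans (ler_norm _) _; rewrite normrM; apply: ler_pM => //; last exact: tf_let.
      exact: le_trans e1 mw.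
    have e4 : (qf V a H m - qf V a H w) * fx (t, x) <= Cq * (C1 D * d) * C.
      apply: le_trans (ler_norm _) _; rewrite normrM; apply: ler_pM => //; last exact: tf_lex.
      by apply: le_trans e2 _; apply: ler_wpM2l.
    rewrite mulrBl in e3; rewrite mulrBl in e4.
    have -> : (C + Cq * C) * (C1 D * d) = C1 D * d * C + Cq * (C1 D * d) * C by ring.
    exact: lerD_increments.
  have h2 : box T X (fun z => \int[leb]_y (kap y * `|mm D mo (z.1, z.2 + y) - mm D mo z|)) <=
     box T X (fun z => \int[leb]_y (kap y * `|Wn D (z.1, z.2 + y) - Wn D z|)) +
     T * (2 * X * (2 * (C1 D * d))).
    apply: (box_le T0 X0 (bmf_osc bm) (bmf_osc bW)).
    have FF := ae_filter_ringOfSetsType leb.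
    apply: filterS aeG => t Gt t0 tT x /=.
    have br (G : R * R -> R) : bmf G -> bmf (fun x => G (t, x)).
      by move=> bG; apply: (bmf_comp (h := pair t)) => //; exact: measurable_pair1.
    apply: (osc_le x (br _ bm) (br _ bW)) => y; rewrite -dE; exact: HG.
  have h3 : \int[leb]_x (\1_`[- X, X] x * (al (mm D mo (0, x)) * f (0, x))) <=
      \int[leb]_x (\1_`[- X, X] x * (al (W0 D x) * f (0, x))) + 2 * X * (C1 D * d * C).
    have bf0 : bmf (fun x => f (0, x)).
      by apply: bmf_row; split; [exact: tf_m|exists C; exact: tf_le].
    have W0M x : `|W0 D x| <= M by rewrite -(@Wn_neg _ D (-1)) ?ltrN10.
    have bW0 : bmf (W0 D).
      have -> : W0 D = (fun x => Wn D (-1, x)) by apply/funext => x; rewrite Wn_neg// ltrN10.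
      exact: bmf_row.
    have bcomp (G : R -> R) : bmf G -> (forall x, `|G x| <= M) -> bmf (fun x => al (G x) * f (0, x)).
      move=> bG GM; apply: bmfM => //.
      have bG2 : bmf (fun z : R * R => G z.1).
        by apply: (bmf_comp (h := fst) _ bG); exact: measurable_fst.
      have := bmf_comp_bounded bG2 (fun z => GM z.1) cal.
      move=> b2; apply: (bmf_comp (h := fun x : R => (x, 0 : R)) _ b2); exact: measurable_pair2.
    apply: box_row_le => //.
    - exact: (igrM (igr_itv _ _) (bcomp (fun x => mm D mo (0, x)) (bmf_row 0 bm) (fun x => mM (0, x)))).
    - exact: (igrM (igr_itv _ _) (bcomp _ bW0 W0M)).
    move=> x; have := mm_initial D mo x; rewrite dE.
    move: (mm _ _ _) (W0 _ _) => m w mw.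
    have e1 := alL m w; rewrite mul1r in e1.
    have e3 : (al m - al w) * f (0, x) <= C1 D * d * C.
      apply: le_trans (ler_norm _) _; rewrite normrM; apply: ler_pM => //; last exact: tf_le.
      exact: le_trans e1 mw.
    by move: e3; rewrite mulrBl lerBlDl.
  have LC : 0 <= 3 * L * C by nonneg.
  have h4 := ler_wpM2l LC h2.
  rewrite mulrDr in h4.
  apply: (ge0_sum_transfer h1 h3 h4); rewrite /B1.
  by move: (remainder _ _ _) (C1 D) (C2 D) => *; ring.
have B10 : 0 <= B1.
  have R0 : 0 <= remainder (K * (2 * M)) P Ca.
    by rewrite /remainder; nonneg.
  by rewrite /B1; nonneg.
rewrite -oppr_le0; apply/ler_addgt0Pr => e e0; rewrite add0r.
have s0 : 0 < B1 + 1 by lra.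
have d0 : 0 < e / (B1 + 1) by rewrite divr_gt0.
have h1 := key _ d0.
have h2 : B1 * (e / (B1 + 1)) <= e.
  rewrite mulrCA -[leRHS]mulr1; apply: ler_wpM2l; first exact: ltW.
  by rewrite ler_pdivrMr//; lra.
by rewrite -subr_ge0 opprK addrC; apply: le_trans h1 _; rewrite lerD2l.
Qed.

End inviscid.

(** * Smooth approximation of Kruzhkov's entropies *)

Section kruzhkov_flux.
Variable R : realType.
Variables (V : R -> R) (L c : R).
Hypotheses (L0 : 0 <= L) (VL : forall x y, `|V x - V y| <= L * `|x - y|).

Definition Qk w := Num.sg (w - c) * (V w * w - V c * c).

(** Maximum and minimum with [c] are 1-Lipschitz, so in this form continuity and the Lipschitz bound
    are visible in spite of the jump of the sign. *)
Lemma QkE w : Qk w = V (Num.max w c) * Num.max w c - V (Num.min w c) * Num.min w c.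
Proof.
rewrite /Qk; case: (ltgtP w c) => [wc|wc|->]; last by rewrite subrr sgr0 mul0r subrr.
  by rewrite ltr0_sg ?subr_lt0// mulN1r opprB.
by rewrite gtr0_sg ?subr_gt0// mul1r.
Qed.

Lemma continuous_Qk : continuous V -> continuous Qk.
Proof.
move=> cV; rewrite (_ : Qk = fun w => V (Num.max w c) * Num.max w c - V (Num.min w c) * Num.min w c); last first.
  by apply/funext => w; exact: QkE.
have cF : continuous (fun w => V w * w) by move=> w; apply: cvgM; [exact: cV|exact: cvg_id].
have cM : continuous (fun w : R => Num.max w c).
  by move=> w; apply: continuous_max; [exact: cvg_id|exact: cvg_cst].
have cm : continuous (fun w : R => Num.min w c).
  by move=> w; apply: continuous_min; [exact: cvg_id|exact: cvg_cst].
move=> w; apply: cvgB.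
  by apply: (@continuous_comp _ _ _ (fun w : R => Num.max w c) (fun w => V w * w)); [exact: cM|exact: cF].
by apply: (@continuous_comp _ _ _ (fun w : R => Num.min w c) (fun w => V w * w)); [exact: cm|exact: cF].
Qed.

Lemma Qk_lip N w w' : `|w| <= N -> `|w'| <= N -> `|c| <= N ->
  `|Qk w - Qk w'| <= 2 * (`|V 0| + 2 * L * N) * `|w - w'|.
Proof.
move=> wN wN' cN; rewrite !QkE.
have maxN x : `|x| <= N -> `|Num.max x c| <= N by move=> xN; case: (leP x c).
have minN x : `|x| <= N -> `|Num.min x c| <= N by move=> xN; case: (leP x c).
have N0 : 0 <= N := le_trans (normr_ge0 _) cN.
have B0 : 0 <= `|V 0| + 2 * L * N by apply: addr_ge0 => //; nonneg.
have h1 := flux_lip L0 VL (maxN _ wN) (maxN _ wN').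
have h2 := flux_lip L0 VL (minN _ wN) (minN _ wN').
have h3 : `|Num.max w c - Num.max w' c| <= `|w - w'|.
  case: (leP w c) => a; case: (leP w' c) => b; rewrite ?subrr ?normr0//; rewrite !ler_norml.
    by apply/andP; split; case: (leP 0 (w - w')) => d; rewrite ?(ger0_norm d) ?(ltr0_norm d); lra.
  by apply/andP; split; case: (leP 0 (w - w')) => d; rewrite ?(ger0_norm d) ?(ltr0_norm d); lra.
have h4 : `|Num.min w c - Num.min w' c| <= `|w - w'|.
  case: (leP w c) => a; case: (leP w' c) => b; rewrite ?subrr ?normr0//; rewrite !ler_norml.
    by apply/andP; split; case: (leP 0 (w - w')) => d; rewrite ?(ger0_norm d) ?(ltr0_norm d); lra.
  by apply/andP; split; case: (leP 0 (w - w')) => d; rewrite ?(ger0_norm d) ?(ltr0_norm d); lra.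
have {}h1 := le_trans h1 (ler_wpM2l B0 h3); have {}h2 := le_trans h2 (ler_wpM2l B0 h4).
move: h1 h2; set p := V _ * _; set q := V _ * _; set p' := V _ * _; set q' := V _ * _ => h1 h2.
have -> : p - p' - (q - q') = (p - q) - (p' - q') by ring.
apply: le_trans (ler_normB _ _) _.
have -> : 2 * (`|V 0| + 2 * L * N) * `|w - w'| = (`|V 0| + 2 * L * N) * `|w - w'| + (`|V 0| + 2 * L * N) * `|w - w'| by ring.
exact: lerD.
Qed.

Variable s : R.
Hypothesis s0 : 0 < s.

(** Smooth convex function within [s] of [|w - c|], with slope bounded by 1 and second derivative
    bounded by [s^-1]. *)
Definition als w := Num.sqrt ((w - c) ^+ 2 + s ^+ 2).

Let pos w : 0 < (w - c) ^+ 2 + s ^+ 2.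
Proof. by rewrite ltr_wpDl ?sqr_ge0// exprn_gt0. Qed.

Lemma als_gt0 w : 0 < als w. Proof. by rewrite sqrtr_gt0. Qed.

Let als0 w : als w != 0. Proof. by rewrite gt_eqF ?als_gt0. Qed.

Lemma als_sq w : als w ^+ 2 = (w - c) ^+ 2 + s ^+ 2.
Proof. by rewrite sqr_sqrtr// ltW. Qed.

Lemma als_ge_norm w : `|w - c| <= als w.
Proof.
rewrite -(@ler_pXn2r _ 2%N)// ?nnegrE ?(ltW (als_gt0 _))//.
by rewrite als_sq real_normK ?num_real// lerDl sqr_ge0.
Qed.

Lemma als_ge w : s <= als w.
Proof.
rewrite -(@ler_pXn2r _ 2%N)// ?nnegrE ?(ltW (als_gt0 _)) ?(ltW s0)//.
by rewrite als_sq lerDr sqr_ge0.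
Qed.

Lemma als_le w : als w <= `|w - c| + s.
Proof.
have h : 0 <= `|w - c| + s by rewrite addr_ge0// ltW.
rewrite -(@ler_pXn2r _ 2%N)// ?nnegrE ?(ltW (als_gt0 _))//.
rewrite als_sq [leRHS]sqrrD real_normK ?num_real// [leRHS]addrAC lerDl.
by apply/mulrn_wge0/mulr_ge0 => //; exact: ltW.
Qed.

Definition das w := (w - c) / als w.
Definition ddas w := s ^+ 2 / als w ^+ 3.

Lemma dfn_als : dfn als das.
Proof.
move=> w; have d1 : is_derive w (1 : R) (fun w => (w - c) ^+ 2 + s ^+ 2) (2 * (w - c)).
  have := dfnD (dfnM (dfnB (@dfn_id R) (dfn_cst c)) (dfnB (@dfn_id R) (dfn_cst c))) (dfn_cst (s ^+ 2)) w.
  by congr is_derive; ring.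
have d2 := is_derive1_sqrt (pos w).
have := @is_derive1_comp _ Num.sqrt (fun w => (w - c) ^+ 2 + s ^+ 2) w _ _ d2 d1.
congr is_derive; rewrite /das /als.
have h : Num.sqrt ((w - c) ^+ 2 + s ^+ 2) != 0 := als0 w.
by field.
Qed.

Lemma dfn_inv_als : dfn (fun w => (als w)^-1) (fun w => - (das w / als w ^+ 2)).
Proof.
move=> w; have := is_deriveV (als0 w) (dfn_als w).
by congr is_derive; rewrite /GRing.scale/= mulNr mulrC.
Qed.

Lemma dfn_das : dfn das ddas.
Proof.
apply: (dfn_ext (dfnM (dfnB (@dfn_id R) (dfn_cst c)) dfn_inv_als)) => w.
rewrite /ddas /das subr0 mul1r.
have h := als0 w.
have -> : s ^+ 2 = als w ^+ 2 - (w - c) ^+ 2 by rewrite als_sq; ring.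
by field.
Qed.

Lemma continuous_als : continuous als. Proof. exact: dfn_cts dfn_als. Qed.

Lemma continuous_ddas : continuous ddas.
Proof.
move=> w; apply: cvgM; first exact: cvg_cst.
apply: cvgV; first by rewrite expf_neq0.
have h : als x @[x --> w] --> als w := @continuous_als w.
rewrite (_ : (fun x => als x ^+ 3) = (fun x => als x * als x * als x)); last first.
  by apply/funext => x; rewrite exprSr expr2.
by rewrite exprSr expr2; exact: (cvgM (cvgM h h) h).
Qed.

Lemma ddas_ge0 w : 0 <= ddas w.
Proof. by rewrite divr_ge0// ?sqr_ge0// exprn_ge0// ltW// als_gt0. Qed.

Lemma ddas_le w : ddas w <= s^-1.
Proof.
rewrite /ddas ler_pdivrMr ?exprn_gt0 ?als_gt0//.
have -> : s ^+ 2 = s^-1 * s ^+ 3 by rewrite exprS mulKf// gt_eqF.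
rewrite ler_wpM2l ?invr_ge0 ?(ltW s0)// lerXn2r ?nnegrE ?(ltW s0) ?(ltW (als_gt0 _))//.
exact: als_ge.
Qed.

Lemma das_le1 w : `|das w| <= 1.
Proof.
rewrite normrM normfV (gtr0_norm (als_gt0 w)) ler_pdivrMr ?als_gt0// mul1r.
exact: als_ge_norm.
Qed.

Lemma als_norm w : `|als w - `|w - c| | <= s.
Proof. by rewrite ger0_norm ?subr_ge0 ?als_ge_norm// lerBlDl als_le. Qed.

(** The slope is far from the sign only where [|w - c|] is comparable with [s], so the product stays
    of order [s]. *)
Lemma das_sg w : `|(das w - Num.sg (w - c)) * (w - c)| <= s.
Proof.
have h := als0 w.
have -> : (das w - Num.sg (w - c)) * (w - c) = - (`|w - c| / als w * (als w - `|w - c|)).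
  rewrite mulrBl -normrEsg /das.
  have -> : (w - c) / als w * (w - c) = `|w - c| ^+ 2 / als w by rewrite real_normK ?num_real//; ring.
  by field.
rewrite normrN normrM -[leRHS]mul1r; apply: ler_pM => //; last exact: als_norm.
rewrite ger0_norm ?divr_ge0 ?(ltW (als_gt0 _))//.
by rewrite ler_pdivrMr ?als_gt0// mul1r als_ge_norm.
Qed.

Variable H : R -> R.
Hypotheses (dH : dfn H (fun w => ddas w * V w * w)) (Hc : H c = 0).

(** With [H] normalized at [c], the difference consists of the slope error times
    [V w * w - V c * c], controlled by [das_sg], and of the term [E], which accumulates the second
    derivative of the entropy near [c]. Each contributes at most [Lq * s]. *)
Lemma qf_Qk N w : `|w| <= N -> `|c| <= N ->
  `|qf V das H w - Qk w| <= 2 * (`|V 0| + 2 * L * N) * s.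
Proof.
move=> wN cN; set Lq := `|V 0| + 2 * L * N.
have N0 : 0 <= N := le_trans (normr_ge0 _) cN.
have Lq0 : 0 <= Lq by apply: addr_ge0 => //; nonneg.
pose E w := H w - V c * c * das w.
have dE : dfn E (fun w => ddas w * (V w * w - V c * c)).
  by apply: (dfn_ext (dfnB dH (dfnZ (V c * c) dfn_das))) => y; ring.
have Ec : E c = 0 by rewrite /E Hc /das subrr mul0r mulr0 subrr.
(* Explicit primitive of [ddas w * (w - c)], with total variation at most [s] on either side of [c];
   it dominates [E] because the flux is Lipschitz. *)
pose k w := - s ^+ 2 * (als w)^-1.
have dk : dfn k (fun w => ddas w * (w - c)).
  apply: (dfn_ext (dfnZ (- s ^+ 2) dfn_inv_als)) => y; rewrite /ddas /das.
  by have h := als0 y; field.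
have kc : k w - k c <= s.
  have -> : k c = - s.
    by rewrite /k /als subrr expr0n add0r sqrtr_sqr gtr0_norm// expr2 mulNr mulfK// gt_eqF.
  by rewrite opprK -[leRHS]add0r lerD2r /k mulNr oppr_le0 divr_ge0 ?sqr_ge0// ltW// als_gt0.
have Elow : `|E w| <= Lq * (k w - k c).
  have FL y : `|y| <= N -> `|V y * y - V c * c| <= Lq * `|y - c| by move=> yN; exact: flux_lip.
  have sgn b y : `|b| <= 1 -> `|y| <= N -> `|b * (V y * y - V c * c)| <= Lq * `|y - c|.
    by move=> b1 yN; rewrite normrM -[leRHS]mul1r; apply: ler_pM => //; exact: FL.
  suff main b : `|b| <= 1 -> b * E w <= Lq * (k w - k c).
    rewrite ler_norml; apply/andP; split; last by have := main 1; rewrite normr1 mul1r; apply.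
    by rewrite lerNl; have := main (-1); rewrite normrN normr1 mulN1r; apply.
  move=> b1; rewrite [Lq * (_ - _)]mulrBr; have [cw|/ltW wc] := leP c w.
    have := dfn_le cw (dfnB (dfnZ Lq dk) (dfnZ b dE)); rewrite Ec mulr0 subr0 => h.
    have {h} : Lq * k c <= Lq * k w - b * E w.
      apply: h => y /andP[cy yw]; rewrite [b * _]mulrCA [Lq * _]mulrCA -mulrBr; apply: mulr_ge0; first exact: ddas_ge0.
      have yN : `|y| <= N.
        by move: wN cN; rewrite !ler_norml => /andP[? ?] /andP[? ?]; apply/andP; split; lra.
      have := sgn b y b1 yN; rewrite [`|y - c|]ger0_norm ?subr_ge0// ler_norml => /andP[_].
      by [].
    by move: (Lq * k w) (Lq * k c) (b * E w) => p q r'; lra.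
  have := dfn_le wc (dfnB (dfnZ b dE) (dfnZ Lq dk)); rewrite Ec mulr0 sub0r => h.
  have {h} : b * E w - Lq * k w <= - (Lq * k c).
    apply: h => y /andP[wy yc]; rewrite [b * _]mulrCA [Lq * _]mulrCA -mulrBr; apply: mulr_ge0; first exact: ddas_ge0.
    have yN : `|y| <= N.
      by move: wN cN; rewrite !ler_norml => /andP[? ?] /andP[? ?]; apply/andP; split; lra.
    have := sgn b y b1 yN; rewrite [`|y - c|]ler0_norm ?subr_le0// ler_norml => /andP[h _].
    by rewrite subr_ge0; apply: le_trans h; rewrite mulrN opprK.
  by move: (Lq * k w) (Lq * k c) (b * E w) => p q r'; lra.
have h1 : `|E w| <= Lq * s by apply: le_trans Elow _; apply: ler_wpM2l.
have -> : qf V das H w - Qk w = (das w - Num.sg (w - c)) * (V w * w - V c * c) - E w.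
  by rewrite /qf /Qk /E; ring.
apply: le_trans (ler_normB _ _) _.
have -> : 2 * Lq * s = Lq * s + Lq * s by ring.
apply: lerD => //.
rewrite normrM; apply: (@le_trans _ _ (`|das w - Num.sg (w - c)| * (Lq * `|w - c|))).
  by apply: ler_wpM2l => //; exact: flux_lip.
by rewrite mulrCA -normrM; apply: ler_wpM2l => //; exact: das_sg.
Qed.

End kruzhkov_flux.

Section kruzhkov_inequality.
Variable R : realType.
Notation leb := (@lebesgue_measure R).
Notation leb2 := (@lebesgue_measure R \x @lebesgue_measure R)%E.
Variable D : nldata R.
Local Notation kap := (nl_kap D).
Local Notation V := (nl_V D).
Local Notation L := (nl_L D).
Local Notation M := (nl_M D).
Let L0 := nl_L0 D. Let VL := nl_VL D.

Variables (P : testf R) (c : R).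
Local Notation f := (tf_f P). Local Notation ft := (tf_t P). Local Notation fx := (tf_x P).
Local Notation T := (tf_T P). Local Notation X := (tf_X P). Local Notation C := (tf_C P).

Lemma bW0 : bmf (W0 D).
Proof.
have -> : W0 D = (fun x => Wn D (-1, x)) by apply/funext => x; rewrite Wn_neg// ltrN10.
exact/bmf_row/bWn.
Qed.

(** The smoothing parameter [s] tends to 0 in [entropy_Wn] applied to [als]; the passage succeeds
    since the coefficient of the defect is independent of [s]. *)
Lemma kruzhkov_Wn :
  0 <= box T X (fun z => `|Wn D z - c| * ft z + Qk V c (Wn D z) * fx z) +
       \int[leb]_x (\1_`[- X, X] x * (`|W0 D x - c| * f (0, x))) +
       3 * L * C * box T X (fun z => \int[leb]_y (kap y * `|Wn D (z.1, z.2 + y) - Wn D z|)).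
Proof.
have X0 := tf_X0 P; have T0 := tf_T0 P; have M0 := M_ge0 D.
have C0 : 0 <= C := le_trans (normr_ge0 _) (tf_le P (0, 0)).
have cV := @V_cts _ D.
pose N := Num.max M `|c|.
have cN : `|c| <= N by rewrite le_max lexx orbT.
have MN : M <= N by rewrite le_max lexx.
have WN z : `|Wn D z| <= N := le_trans (Wn_le D z) MN.
pose Lq := `|V 0| + 2 * L * N.
have N0 : 0 <= N := le_trans M0 MN.
have Lq0 : 0 <= Lq by apply: addr_ge0 => //; nonneg.
have bft : bmf ft by split; [exact: tf_mt|exists C; exact: tf_let].
have bfx : bmf fx by split; [exact: tf_mx|exists C; exact: tf_lex].
have bf0 : bmf (fun x => f (0, x)) by apply: bmf_row; split; [exact: tf_m|exists C; exact: tf_le].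
have bW := bWn D; have bW0' := bW0.
have bcomp (h : R -> R) : continuous h -> bmf (fun z => h (Wn D z)).
  by move=> ch; exact: (bmf_comp_bounded bW (@Wn_le _ D)).
have cQ : continuous (Qk V c) by exact: continuous_Qk.
have bQ := bcomp _ cQ.
have bA : bmf (fun z => `|Wn D z - c|) by apply/bmf_norm/bmfB => //; exact: bmf_cst.
have bB : bmf (fun z => `|Wn D z - c| * ft z + Qk V c (Wn D z) * fx z) by apply: bmfD; exact: bmfM.
set E := (X in 0 <= X).
pose B1 := T * (2 * X * (C + 2 * Lq * C)) + 2 * X * C.
have key s : 0 < s -> 0 <= E + B1 * s.
  move=> s0.
  have cdd : continuous (ddas c s) by exact: continuous_ddas.
  have [Phi dPhi] := @antiderivative R (fun w => ddas c s w * V w) (fun w => cvgM (cdd w) (cV w)).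
  have [H0 dH0] := @antiderivative R (fun w => ddas c s w * V w * w)
    (fun w => cvgM (cvgM (cdd w) (cV w)) cvg_id).
  have dH : dfn (fun w => H0 w - H0 c) (fun w => ddas c s w * V w * w).
    by apply: (dfn_ext (dfnB dH0 (dfn_cst (H0 c)))) => w; rewrite subr0.
  have Hc : H0 c - H0 c = 0 by rewrite subrr.
  have := @entropy_Wn _ D P _ _ _ _ _ _ (dfn_als c s0) (dfn_das c s0) cdd (ddas_ge0 c s0)
    (ddas_le c s0) (das_le1 c s0) dPhi dH.
  have cq : continuous (qf V (das c s) (fun w => H0 w - H0 c)).
    move=> w; apply: cvgB; last exact: (dfn_cts dH).
    by apply: cvgM; [apply: cvgM; [exact: (dfn_cts (dfn_das c s0))|exact: cV]|exact: cvg_id].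
  have bq := bcomp _ cq; have cal : continuous (als c s) by exact: continuous_als.
  have bal := bcomp _ cal.
  have h1 : box T X (fun z => als c s (Wn D z) * ft z + qf V (das c s) (fun w => H0 w - H0 c) (Wn D z) * fx z) <=
     box T X (fun z => `|Wn D z - c| * ft z + Qk V c (Wn D z) * fx z) + T * (2 * X * (s * C + 2 * Lq * s * C)).
    have bB' := bmfD (bmfM bal bft) (bmfM bq bfx).
    apply: (box_le T0 X0 bB' bB); apply/aeW => t _ _ x.
    have e1 := als_norm c s0 (Wn D (t, x)).
    have e2 := qf_Qk L0 VL s0 dH Hc (WN (t, x)) cN.
    have e3 : (als c s (Wn D (t, x)) - `|Wn D (t, x) - c|) * ft (t, x) <= s * C.
      by apply: le_trans (ler_norm _) _; rewrite normrM; apply: ler_pM => //; exact: tf_let.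
    have e4 : (qf V (das c s) (fun w => H0 w - H0 c) (Wn D (t, x)) - Qk V c (Wn D (t, x))) * fx (t, x) <= 2 * Lq * s * C.
      by apply: le_trans (ler_norm _) _; rewrite normrM; apply: ler_pM => //; exact: tf_lex.
    rewrite mulrBl in e3; rewrite mulrBl in e4.
    exact: lerD_increments.
  have h2 : \int[leb]_x (\1_`[- X, X] x * (als c s (W0 D x) * f (0, x))) <=
      \int[leb]_x (\1_`[- X, X] x * (`|W0 D x - c| * f (0, x))) + 2 * X * (s * C).
    have bal0 : bmf (fun x => als c s (W0 D x)).
      have -> : (fun x => als c s (W0 D x)) = (fun x => als c s (Wn D (-1, x))).
        by apply/funext => x; rewrite Wn_neg// ltrN10.
      exact: (bmf_row (-1) bal).
    have bA0 : bmf (fun x => `|W0 D x - c|) by apply/bmf_norm/bmfB => //; exact: bmf_cst.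
    apply: (box_row_le X0 (igrM (igr_itv _ _) (bmfM bal0 bf0)) (igrM (igr_itv _ _) (bmfM bA0 bf0))) => x.
    have e1 := als_norm c s0 (W0 D x).
    have e3 : (als c s (W0 D x) - `|W0 D x - c|) * f (0, x) <= s * C.
      by apply: le_trans (ler_norm _) _; rewrite normrM; apply: ler_pM => //; exact: tf_le.
    by rewrite mulrBl lerBlDl in e3.
  set G3 := 3 * L * C * _.
  have h3 : G3 <= G3 + 0 by rewrite addr0.
  move=> h; apply: (ge0_sum_transfer h1 h2 h3 (D := 0)); last by rewrite addr0.
  by rewrite /B1; ring.
have B10 : 0 <= B1 by rewrite /B1; nonneg.
rewrite -oppr_le0; apply/ler_addgt0Pr => e e0; rewrite add0r.
have s0 : 0 < B1 + 1 by apply: ltr_wpDl.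
have d0 : 0 < e / (B1 + 1) by rewrite divr_gt0.
have h1 := key _ d0.
have h2 : B1 * (e / (B1 + 1)) <= e.
  rewrite mulrCA -[leRHS]mulr1; apply: ler_wpM2l; first exact: ltW.
  by rewrite ler_pdivrMr// mul1r lerDl.
by rewrite -subr_ge0 opprK addrC; apply: le_trans h1 _; rewrite lerD2l.
Qed.

End kruzhkov_inequality.

(** * The vanishing scale limit *)

Section lebesgue_scaling.
Variable R : realType.
Notation leb := (@lebesgue_measure R).
Variable a : R.
Hypothesis a0 : 0 < a.

Lemma measurable_scale : measurable_fun setT (fun x : R => a * x).
Proof. by apply: measurable_funM. Qed.

Let mf : @measurable_fun _ _ (measurableTypeR R) (measurableTypeR R) setT (fun x : R => a * x).
Proof. exact: measurable_scale. Qed.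

Let pf : {measure set (measurableTypeR R) -> \bar R} :=
  measure_function_pushforward__canonical__measure_function_Measure leb mf.

Let na : {nonneg R} := NngNum (ltW a0).

Lemma lebesgue_scale (A : set R) : measurable A ->
  leb ((fun x : R => a * x) @^-1` A) = (a^-1%:E * leb A)%E.
Proof.
move=> mA.
have -> : leb A = mscale na pf A.
  apply: (lebesgue_measure_unique (mu := mscale na pf)) => //= _ [[b c]] _ <-.
  rewrite /mscale /pf/= /pushforward (_ : _ @^-1` `]b, c] = `]b / a, c / a]%classic); last first.
    apply/seteqP; split => x; rewrite /= !in_itv/=.
      by rewrite ltr_pdivrMr// ler_pdivlMr// !(mulrC x).
    by rewrite ltr_pdivrMr// ler_pdivlMr// !(mulrC x).
  rewrite !lebesgue_measure_itv/= !lte_fin ltr_pM2r ?invr_gt0//; case: ifP => // _; last by rewrite mule0.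
  by rewrite -!EFinB -EFinM mulrBr !(mulrC a) !divfK ?gt_eqF.
by rewrite /mscale muleA -EFinM mulVf ?gt_eqF// mul1e.
Qed.

Let nb : {nonneg R} := NngNum (ltW (etrans (invr_gt0 a) a0)).

Lemma igr_scale F : igr leb F -> igr leb (fun x => F (a * x)).
Proof.
move=> iF; apply/integrableP; split.
  by apply/measurable_EFinP; apply: (measurableT_comp (igr_meas iF) measurable_scale).
have /integrableP[mF] := iF.
rewrite (_ : (\int[leb]_x `|(F (a * x))%:E|)%E = (\int[pf]_x `|(F x)%:E|)%E); last first.
  rewrite /pf ge0_integral_pushforward//; last exact: measurableT_comp.
rewrite (_ : (\int[pf]_x `|(F x)%:E|)%E = (\int[mscale nb leb]_x `|(F x)%:E|)%E); last first.
  by apply: eq_measure_integral => A mA _; exact: lebesgue_scale.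
rewrite ge0_integral_mscale//; last exact: measurableT_comp.
by move=> h; rewrite lte_mul_pinfty// lee_fin invr_ge0 ltW.
Qed.

Lemma Rint_scale F : igr leb F -> \int[leb]_x F (a * x) = a^-1 * \int[leb]_x F x.
Proof.
move=> iF; have iF' := igr_scale iF; rewrite /Rintegral.
have -> : (\int[leb]_x (F (a * x))%:E)%E = (\int[pf]_x (F x)%:E)%E.
  by rewrite /pf (integral_pushforward mf)//; have /integrableP[] := iF.
have -> : (\int[pf]_x (F x)%:E)%E = (\int[mscale nb leb]_x (F x)%:E)%E.
  by apply: eq_measure_integral => A mA _; exact: lebesgue_scale.
have mF : measurable_fun setT (EFin \o F) by have /integrableP[] := iF.
rewrite [in LHS]integralE [X in _ = _ * fine X]integralE.
rewrite ge0_integral_mscale//; last exact: measurable_funepos.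
rewrite ge0_integral_mscale//; last exact: measurable_funeneg.
rewrite -muleBr//; last first.
  apply: fin_num_adde_defr.
  by apply: integrable_fin_num => //; exact: integrable_funepos.
rewrite fineM// -integralE; exact: integrable_fin_num.
Qed.

End lebesgue_scaling.

Section small_mass.
Variable R : realType.
Notation leb := (@lebesgue_measure R).

(* The test weight [min 1 |y|] controls every bounded modulus of continuity at 0. *)
Lemma scaled_mass_cvg (kap : R -> R) (eps : nat -> R) : igr leb kap -> (forall z, 0 <= kap z) ->
  (forall k, 0 < eps k) -> eps k @[k --> \oo] --> (0 : R) ->
  forall e, 0 < e -> exists N, forall k, (N <= k)%N ->
    \int[leb]_z (kap z * Num.min 1 `|eps k * z|) <= e.
Proof.
move=> ik k0 eps0 epsc e e0.
pose F k z := kap z * Num.min 1 `|eps k * z|.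
have mmin k : measurable_fun setT (fun z : R => Num.min 1 `|eps k * z|).
  apply: measurable_minr; first exact: measurable_cst.
  by apply: measurableT_comp => //; exact: measurable_funM.
have min01 k z : 0 <= Num.min 1 `|eps k * z| <= 1 by rewrite le_min ler01 normr_ge0 ge_min lexx.
have bmin k : bmf (fun z : R => Num.min 1 `|eps k * z|).
  by split=> //; exists 1 => z; have /andP[h1 h2] := min01 k z; rewrite ger0_norm.
have iF k : igr leb (F k) by exact: (igrM ik (bmin k)).
have cF : (\int[leb]_z (F k z)%:E)%E @[k --> \oo] --> (\int[leb]_z (cst 0 z))%E.
  apply: (@dominated_cvg _ _ _ leb setT measurableT (fun k z => (F k z)%:E) (cst 0%E) (fun z => (kap z)%:E)) => //.
  - by move=> k; have /integrableP[] := iF k.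
  - move=> z _ /=; rewrite /cst; apply/fine_cvgP; split; first exact: nearW.
    rewrite /comp/= /F -[X in _ --> X](mulr0 (kap z)).
    apply: cvgM; first exact: cvg_cst.
    have h : `|eps k * z| @[k --> \oo] --> (0 : R).
      by rewrite -(normr0 R) -(mul0r z); apply: cvg_norm; apply: cvgM => //; exact: cvg_cst.
    apply: (@squeeze_cvgr _ _ _ _ (cst 0) (fun k => `|eps k * z|)) => //; last exact: cvg_cst.
    by apply: nearW => k; have /andP[-> _] := min01 k z; rewrite ge_min lexx orbT.
  - move=> k z _ /=; rewrite lee_fin /F; have /andP[h1 h2] := min01 k z.
    by rewrite ger0_norm ?mulr_ge0// ler_piMr.
rewrite integral0 in cF.
have := cF; move/fine_cvgP => [_].
rewrite /comp/= => /cvgrPdist_lt /(_ e e0) [N _ HN].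
exists N => k Nk; have := HN k Nk; rewrite sub0r normrN => h.
by apply: le_trans (ltW h); exact: ler_norm.
Qed.

End small_mass.

(** * Estimates uniform in the scale *)

Section one_scale.
Variable R : realType.
Notation leb := (@lebesgue_measure R).
Notation leb2 := (@lebesgue_measure R \x @lebesgue_measure R)%E.
Variable D : nldata R.
Local Notation kap := (nl_kap D).
Let ikap := nl_ikap D.

(** Limit of [mm_01] as [d] tends to 0, at the times supplied by [mm_Wn_uniform]. *)
Lemma Wn_01 : {ae leb, forall t, 0 <= t -> forall x, 0 <= Wn D (t, x) <= 1}.
Proof.
have [G aeG HG] := mm_Wn_uniform D.
have FF := ae_filter_ringOfSetsType leb.
have C10 := C1_ge0 D.
apply: filterS aeG => t Gt t0 x.
have key e : 0 < e -> - e <= Wn D (t, x) <= 1 + e.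
  move=> e0; have s0 : 0 < C1 D + 1 by apply: ltr_wpDl.
  have [Cm molls] := mollifiers R.
  have [mo [dE _]] := molls (e / (C1 D + 1)) (divr_gt0 e0 s0).
  have := HG mo t x Gt; rewrite dE.
  have h : C1 D * (e / (C1 D + 1)) <= e.
    rewrite mulrCA -[leRHS]mulr1; apply: ler_wpM2l; first exact: ltW.
    by rewrite ler_pdivrMr// mul1r lerDl.
  move=> /le_trans /(_ h); rewrite ler_norml => /andP[h1 h2].
  have /andP[m0 m1] := mm_01 D mo x t0.
  move: h1 h2 m0 m1; move: (mm _ _ _) (Wn _ _) => m w h1 h2 m0 m1.
  by apply/andP; split; lra.
apply/andP; split.
  rewrite -oppr_le0; apply/ler_addgt0Pr => e /key/andP[h _].
  by rewrite add0r lerNl.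
by apply/ler_addgt0Pr => e /key/andP[].
Qed.

Lemma box_swap T X (G : (R * R) * R -> R) : bmf G ->
  box T X (fun z => \int[leb]_y (kap y * G (z, y))) = \int[leb]_y (kap y * box T X (fun z => G (z, y))).
Proof.
move=> bG; have iT := igr_itv 0 T; have iX := igr_itv (- X) X.
rewrite /box.
under eq_Rintegral => t _.
  rewrite (Rint_leb_swap (F := fun x y => G ((t, x), y)) iX ikap); last first.
    apply: (bmf_comp (h := fun w : R * R => ((t, w.1), w.2)) _ bG).
    apply/measurable_fun_pairP; split; last exact: measurable_snd.
    by apply/measurable_fun_pairP; split; [exact: measurable_cst|exact: measurable_fst].
  over.
rewrite (Rint_leb_swap (F := fun t y => \int[leb]_x (\1_`[- X, X] x * G ((t, x), y))) iT ikap)//.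
apply: (bmf_Rint_leb (F := fun w : (R * R) * R => G ((w.1.1, w.2), w.1.2)) iX).
apply: (bmf_comp (h := fun w : (R * R) * R => ((w.1.1, w.2), w.1.2)) _ bG).
apply/measurable_fun_pairP; split; last exact: (measurableT_comp measurable_snd measurable_fst).
by apply/measurable_fun_pairP; split; [exact: (measurableT_comp measurable_fst measurable_fst)|exact: measurable_snd].
Qed.

End one_scale.

Section box_shift.
Variable R : realType.
Notation leb := (@lebesgue_measure R).
Variables (T X : R).
Hypotheses (T0 : 0 <= T) (X0 : 0 <= X).

Lemma bmf_shift_x (F : R * R -> R) h : bmf F -> bmf (fun z : R * R => F (z.1, z.2 + h)).
Proof.
move=> bF; apply: (bmf_comp (h := fun z : R * R => (z.1, z.2 + h)) _ bF).
apply/measurable_fun_pairP; split; first exact: measurable_fst.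
by apply: measurable_funD; [exact: measurable_snd|exact: measurable_cst].
Qed.

Lemma box_ae_le (F G : R * R -> R) : bmf F -> bmf G ->
  {ae leb, forall t, 0 <= t -> forall x, F (t, x) <= G (t, x)} -> box T X F <= box T X G.
Proof.
move=> bF bG FG.
have := box_le (c := 0) T0 X0 bF bG; rewrite !mulr0 addr0; apply.
have FF := ae_filter_ringOfSetsType leb.
by apply: filterS FG => t FGt t0 _ x; rewrite addr0; exact: FGt.
Qed.

Lemma box_cst c : box T X (fun=> c) = T * (2 * X * c).
Proof.
have XX : - X <= X by rewrite ge0_cp.
have E (k a b : R) : a <= b -> \int[leb]_x (\1_`[a, b] x * k) = k * (b - a).
  move=> ab; under eq_Rintegral do rewrite mulrC.
  by rewrite RintZ ?Rint_itv//; exact: igr_itv.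
rewrite /box; under eq_Rintegral do rewrite (E _ _ _ XX).
by rewrite (E _ _ _ T0); ring.
Qed.

(** The unit margin absorbs translations by at most 1; longer ones are estimated trivially, at the
    cost of kernel mass counted by [Num.min 1]. *)
Lemma box_widen (F : R * R -> R) h : bmf F -> (forall z, 0 <= F z) -> 0 <= h -> h <= 1 ->
  box T X (fun z => F (z.1, z.2 + h)) <= box T (X + 1) F.
Proof.
move=> bF F0 h0 h1.
have bFh := bmf_shift_x h bF.
apply: Rint_le; [exact: (igr_box T X bFh)|exact: (igr_box T (X + 1) bF)|].
move=> t; apply: ler_wpM2l; first exact: indic_itv_ge0.
have bI : bmf (\1_`[- X, X] : R -> R) by apply: bmf_indic; exact: measurable_itv.
have i2 : igr leb (fun x => \1_`[- (X + 1), X + 1] x * F (t, x)) by exact: igr_box_row.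
have i1 : igr leb (fun x => \1_`[- X, X] (x - h) * F (t, x)).
  have iX := igr_shift (- h) (igr_itv (- X) X).
  have -> : (fun x => \1_`[- X, X] (x - h) * F (t, x)) = (fun x => \1_`[- X, X] (- h + x) * F (t, x)).
    by apply/funext => x; rewrite addrC.
  exact: (igrM iX (bmf_row t bF)).
rewrite [leLHS](_ : _ = \int[leb]_x (\1_`[- X, X] (x - h) * F (t, x))); last first.
  rewrite -(@Rint_shift _ h (fun x => \1_`[- X, X] (x - h) * F (t, x)))//.
  by apply: eq_Rintegral => x _ /=; rewrite (addrC h) addrK.
apply: Rint_le => // x; apply: ler_wpM2r => //.
rewrite !indic_itvE !in_itv/= ler_nat.
case: (boolP (- X <= x - h <= X)) => // /andP[x1 x2].
by rewrite (_ : (- (X + 1) <= x <= X + 1) = true)//; apply/andP; split; lra.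
Qed.

Lemma box_ge0 (F : R * R -> R) : (forall z, 0 <= F z) -> 0 <= box T X F.
Proof.
move=> F0; apply: Rint_ge0 => t; apply: mulr_ge0; first exact: indic_itv_ge0.
by apply: Rint_ge0 => x; apply: mulr_ge0; first exact: indic_itv_ge0.
Qed.

End box_shift.

Section one_scale_estimate.
Variable R : realType.
Notation leb := (@lebesgue_measure R).
Notation leb2 := (@lebesgue_measure R \x @lebesgue_measure R)%E.
Variable D : nldata R.
Local Notation kap := (nl_kap D).
Local Notation V := (nl_V D).
Local Notation L := (nl_L D).
Local Notation u0 := (nl_u0 D).
Let ikap := nl_ikap D. Let kap0 := nl_kap0 D.
Let kapN := nl_kapN D. Let kap1 := nl_kap1 D.
Let L0 := nl_L0 D. Let VL := nl_VL D.
Let mu0 := nl_mu0 D.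
Let u001 := nl_u001 D.

Variables (P : testf R) (c : R).
Local Notation f := (tf_f P). Local Notation ft := (tf_t P). Local Notation fx := (tf_x P).
Local Notation T := (tf_T P). Local Notation X := (tf_X P). Local Notation C := (tf_C P).
Variables (u : R * R -> R) (N e e' Cj mu : R).
Hypotheses (bu : bmf u) (uN : forall z, `|u z| <= N) (N1 : 1 <= N) (cN : `|c| <= N).
Hypotheses (We : box T (X + 1) (fun z => `|Wn D z - u z|) <= e) (e'0 : 0 <= e') (Cj0 : 0 <= Cj)
  (umod : forall h, 0 <= h -> h <= 1 ->
     box T X (fun z => `|u (z.1, z.2 + h) - u z|) <= 2 * e' + Cj * h)
  (kmu : \int[leb]_y (kap y * Num.min 1 `|y|) <= mu).

Let X0 := tf_X0 P. Let T0 := tf_T0 P.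
Let C0 : 0 <= C. Proof. exact: le_trans (normr_ge0 _) (tf_le P (0, 0)). Qed.
Let N0 : 0 <= N. Proof. exact: le_trans ler01 N1. Qed.
Let Lq := 2 * (`|V 0| + 2 * L * N).
Let Lq0 : 0 <= Lq.
Proof. by rewrite /Lq; apply: mulr_ge0 => //; apply: addr_ge0 => //; nonneg. Qed.
Let bW := bWn D.
Let bdif : bmf (fun z => `|Wn D z - u z|). Proof. exact/bmf_norm/bmfB. Qed.
Let bft : bmf ft. Proof. by split; [exact: tf_mt|exists C; exact: tf_let]. Qed.
Let bfx : bmf fx. Proof. by split; [exact: tf_mx|exists C; exact: tf_lex]. Qed.
Let min01 (y : R) : 0 <= Num.min 1 `|y| <= 1.
Proof. by rewrite le_min ler01 normr_ge0 ge_min lexx. Qed.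
Let bmin : bmf (fun y : R => Num.min 1 `|y|).
Proof.
split; first by apply: measurable_minr; [exact: measurable_cst|exact: normr_measurable].
by exists 1 => y; have /andP[h1 h2] := min01 y; rewrite ger0_norm.
Qed.
Let imin : igr leb (fun y => kap y * Num.min 1 `|y|). Proof. exact: (igrM ikap bmin). Qed.
Let mu0' : 0 <= mu.
Proof.
apply: le_trans kmu; by apply: Rint_ge0 => y; apply: mulr_ge0 => //; have /andP[] := min01 y.
Qed.
Let e0 : 0 <= e. Proof. by apply: le_trans We; apply: box_ge0 => z. Qed.

Let box_We : box T X (fun z => `|Wn D z - u z|) <= e.
Proof.
apply: le_trans We.
have := @box_widen _ T X _ _ bdif (fun z => normr_ge0 _) (lexx (0 : R)) ler01.
by apply: le_trans; rewrite le_eqVlt; apply/orP; left; apply/eqP; congr box; apply/funext => -[t x]/=; rewrite addr0.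
Qed.

Let bcompV (G : R * R -> R) (h : R -> R) : bmf G -> (exists B, forall z, `|G z| <= B) ->
  continuous h -> bmf (fun z => h (G z)).
Proof. by move=> bG [B GB] ch; exact: (bmf_comp_bounded bG GB). Qed.

Let cQ : continuous (Qk V c). Proof. by apply: continuous_Qk; exact: V_cts. Qed.

Let bentropy (G : R * R -> R) : bmf G -> bmf (fun z => `|G z - c| * ft z + Qk V c (G z) * fx z).
Proof.
move=> bG; apply: bmfD; apply: bmfM => //.
  by apply/bmf_norm/bmfB => //; exact: bmf_cst.
by apply: bcompV => //; case: bG.
Qed.

Let flux_part : box T X (fun z => `|Wn D z - c| * ft z + Qk V c (Wn D z) * fx z) <=
  box T X (fun z => `|u z - c| * ft z + Qk V c (u z) * fx z) + (1 + Lq) * C * e.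
Proof.
have bWe := bentropy bW; have bue := bentropy bu.
have bs : bmf (fun z => (1 + Lq) * C * `|Wn D z - u z|) by apply: bmfM => //; exact: bmf_cst.
apply: (@le_trans _ _ (box T X (fun z => (`|u z - c| * ft z + Qk V c (u z) * fx z) + (1 + Lq) * C * `|Wn D z - u z|))).
  apply: box_ae_le => //; first exact: bmfD.
  have FF := ae_filter_ringOfSetsType leb.
  apply: filterS (Wn_01 D) => t Wt t0 x; have /andP[w0 w1] := Wt t0 x.
  have wN : `|Wn D (t, x)| <= N by rewrite ger0_norm// (le_trans w1).
  move: (Wn D (t, x)) wN => w wN {w0 w1}.
  have h1 : `|w - c| - `|u (t, x) - c| <= `|w - u (t, x)|.
    by apply: le_trans (lerB_dist _ _) _; rewrite opprB addrA subrK.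
  have h1' : `| `|w - c| - `|u (t, x) - c| | <= `|w - u (t, x)|.
    by apply: le_trans (ler_dist_dist _ _) _; rewrite opprB addrA subrK.
  have h2 := Qk_lip L0 VL wN (uN (t, x)) cN; rewrite -/Lq in h2.
  have e3 : (`|w - c| - `|u (t, x) - c|) * ft (t, x) <= `|w - u (t, x)| * C.
    by apply: le_trans (ler_norm _) _; rewrite normrM; apply: ler_pM => //; exact: tf_let.
  have e4 : (Qk V c w - Qk V c (u (t, x))) * fx (t, x) <= Lq * `|w - u (t, x)| * C.
    by apply: le_trans (ler_norm _) _; rewrite normrM; apply: ler_pM => //; exact: tf_lex.
  rewrite mulrBl in e3; rewrite mulrBl in e4.
  have -> : (1 + Lq) * C * `|w - u (t, x)| = `|w - u (t, x)| * C + Lq * `|w - u (t, x)| * C by ring.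
  exact: lerD_increments.
rewrite boxD// lerD2l boxZ//; apply: ler_wpM2l => //; nonneg.
Qed.

Let bf0 : bmf (fun x => f (0, x)).
Proof. by apply: bmf_row; split; [exact: tf_m|exists C; exact: tf_le]. Qed.
Let f0X x : \1_`[- X, X] x * f (0, x) = f (0, x).
Proof.
rewrite indic_itvE in_itv/= -ler_norml; case: leP => h; first by rewrite mul1r.
by rewrite mul0r tf_outX// ltW.
Qed.
Let if0 : igr leb (fun x => f (0, x)).
Proof.
have -> : (fun x => f (0, x)) = (fun x => \1_`[- X, X] x * f (0, x)) by apply/funext => x; rewrite f0X.
exact: (igrM (igr_itv _ _) bf0).
Qed.

Let C6 := C * (1 + N) * (2 * (X + 1)).

(** The inequality of Jensen bounds [|W0 - c|] by the kernel average of [|u0 - c|]. The translation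
    is then moved onto the test function, which is Lipschitz, so that the error is governed by
    [Num.min 1 |y|]. *)
Let initial_part : \int[leb]_x (\1_`[- X, X] x * (`|W0 D x - c| * f (0, x))) <=
  \int[leb]_x (\1_`[- X, X] x * (`|u0 x - c| * f (0, x))) + C6 * mu.
Proof.
pose gg x := `|u0 x - c|.
have bu0 : bmf u0.
  by split; [exact: mu0|exists 1 => x; have /andP[h1 h2] := u001 x; rewrite ger0_norm].
have bgg : bmf gg by apply/bmf_norm/bmfB => //; exact: bmf_cst.
have ggN x : gg x <= 1 + N.
  apply: le_trans (ler_normB _ _) _; apply: lerD => //.
  by have /andP[h1 h2] := u001 x; rewrite ger0_norm.
have gg0 x : 0 <= gg x by rewrite /gg.
have f00 x : 0 <= f (0, x) by exact: tf_ge0.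
pose J y := \int[leb]_x (f (0, x) * gg (x + y)).
have bsh y : bmf (fun x : R => gg (x + y)).
  by apply: (bmf_comp (h := fun x : R => x + y) _ bgg); apply: measurable_funD.
have bsh2 : bmf (fun w : R * R => gg (w.1 + w.2)).
  apply: (bmf_comp (h := fun w : R * R => w.1 + w.2) _ bgg).
  by apply: measurable_funD; [exact: measurable_fst|exact: measurable_snd].
have E1 : \int[leb]_x (\1_`[- X, X] x * (`|u0 x - c| * f (0, x))) = J 0.
  by apply: eq_Rintegral => x _; rewrite mulrCA f0X addr0 mulrC.
have bW0c : bmf (fun x => `|W0 D x - c|).
  by apply/bmf_norm/bmfB; [exact: bW0|exact: bmf_cst].
have bK : bmf (fun x : R => \int[leb]_y (kap y * gg (x + y))).
  by apply: (bmf_Rint_leb (F := fun w : R * R => gg (w.1 + w.2))).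
have bsh' x : bmf (fun y : R => gg (x + y)).
  by apply: (bmf_comp (h := fun y : R => x + y) _ bgg); exact: measurable_shift.
have bJ : bmf J.
  apply: (bmf_Rint_leb (F := fun w : R * R => gg (w.2 + w.1)) if0).
  apply: (bmf_comp (h := fun w : R * R => w.2 + w.1) _ bgg).
  by apply: measurable_funD; [exact: measurable_snd|exact: measurable_fst].
have E2 : \int[leb]_x (\1_`[- X, X] x * (`|W0 D x - c| * f (0, x))) <= \int[leb]_y (kap y * J y).
  rewrite -(Rint_leb_swap (F := fun x y => gg (x + y)) if0 ikap)//.
  apply: Rint_le.
  - exact: (igrM (igr_itv _ _) (bmfM bW0c bf0)).
  - exact: (igrM if0 bK).
  move=> x; rewrite mulrCA f0X mulrC; apply: ler_wpM2l => //.
  have -> : W0 D x - c = \int[leb]_y (kap y * (u0 (x + y) - c)).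
    have bs : bmf (fun y : R => u0 (x + y)).
      by apply: (bmf_comp (h := fun y : R => x + y) _ bu0); exact: measurable_shift.
    under [RHS]eq_Rintegral do rewrite mulrBr.
    rewrite RintB; [|exact: (igrM ikap bs)|exact: (igrM ikap (bmf_cst _ _))].
    congr (_ - _); under eq_Rintegral do rewrite mulrC.
    by rewrite RintZ// kap1 mulr1.
  have bs : bmf (fun y : R => u0 (x + y) - c).
    apply: bmfB; last exact: bmf_cst.
    by apply: (bmf_comp (h := fun y : R => x + y) _ bu0); exact: measurable_shift.
  apply: le_trans (Rint_norm (igrM ikap bs)) _.
  apply: Rint_le; [exact/igr_norm/(igrM ikap bs)|exact: (igrM ikap (bsh' x))|].
  by move=> y; rewrite normrM ger0_norm.
apply: le_trans E2 _; rewrite E1.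
have C60 : 0 <= C6 by rewrite /C6; nonneg.
have XX : - X <= X by rewrite ge0_cp.
have Jb y : 0 < y -> J y <= J 0 + C6 * Num.min 1 `|y|.
  move=> y0.
  have [y1|y1] := leP 1 `|y|.
    rewrite mulr1; have J00 : 0 <= J 0 by apply: Rint_ge0 => x; exact: mulr_ge0.
    apply: (@le_trans _ _ C6); last by rewrite lerDr.
    have -> : C6 = C * (1 + N) * (2 * X) + C * (1 + N) * 2 by rewrite /C6; ring.
    apply: (@le_trans _ _ (C * (1 + N) * (2 * X))); last by rewrite lerDl; nonneg.
    have -> : C * (1 + N) * (2 * X) = \int[leb]_x (C * (1 + N) * \1_`[- X, X] x).
      by rewrite RintZ ?Rint_itv//; [ring|exact: igr_itv].
    apply: Rint_le; [exact: (igrM if0 (bsh y))|by apply: igrZ; exact: igr_itv|].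
    move=> x; rewrite -f0X -[leLHS]mulrA [leRHS]mulrC; apply: ler_wpM2l; first exact: indic_itv_ge0.
    by apply: ler_pM => //; apply: le_trans (ler_norm _) (tf_le P _).
  have iff : igr leb (fun x => f (0, x - y)).
    by have := igr_shift (- y) if0; congr (igr leb); apply/funext => x; rewrite addrC.
  have -> : J y = \int[leb]_x (f (0, x - y) * gg x).
    rewrite -(@Rint_shift _ y (fun x => f (0, x - y) * gg x)); last exact: (igrM iff bgg).
    by apply: eq_Rintegral => x _; rewrite (addrC y) addrK.
  have -> : J 0 = \int[leb]_x (f (0, x) * gg x) by apply: eq_Rintegral => x _; rewrite addr0.
  rewrite -lerBlDl -RintB; [|exact: (igrM iff bgg)|exact: (igrM if0 bgg)].
  have XX1 : - (X + 1) <= X + 1 by rewrite ge0_cp; nonneg.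
  have -> : C6 * `|y| = \int[leb]_x (C * (1 + N) * `|y| * \1_`[- (X + 1), X + 1] x).
    by rewrite RintZ ?Rint_itv//; [rewrite /C6; ring|exact: igr_itv].
  apply: Rint_le; [by apply: igrB; [exact: (igrM iff bgg)|exact: (igrM if0 bgg)]|by apply: igrZ; exact: igr_itv|].
  move=> x; rewrite -mulrBl indic_itvE in_itv/= -ler_norml.
  rewrite (gtr0_norm y0) in y1 *.
  case: (leP `|x| (X + 1)) => hx.
    rewrite mulr1; apply: le_trans (ler_norm _) _; rewrite normrM (ger0_norm (gg0 x)).
    have := dfn_lip x (x - y) (tf_dx P 0) (fun x => tf_lex P (0, x)).
    have -> : x - y - x = - y by ring.
    rewrite normrN (gtr0_norm y0) => h.
    have -> : C * (1 + N) * y = C * y * (1 + N) by ring.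
    exact: ler_pM.
  have hx1 : X <= `|x| by apply: ltW; apply: le_lt_trans hx; rewrite lerDl.
  have hx2 : X <= `|x - y|.
    have := lerB_dist x y; rewrite (gtr0_norm y0) => h.
    by apply: le_trans h; rewrite lerBrDr; apply: le_trans (ltW hx); rewrite lerD2l ltW.
  by rewrite !tf_outX// subr0 mul0r mulr0.
have -> : J 0 + C6 * mu = J 0 * \int[leb]_y kap y + C6 * mu by rewrite kap1 mulr1.
apply: (@le_trans _ _ (J 0 * \int[leb]_y kap y + C6 * \int[leb]_y (kap y * Num.min 1 `|y|))); last first.
  by rewrite lerD2l; apply: ler_wpM2l.
rewrite -RintZ// -RintZ// -RintD; [|exact: igrZ|exact: igrZ].
apply: Rint_le; [exact: (igrM ikap bJ)|by apply: igrD; exact: igrZ|].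
move=> y; have [y0|y0] := leP y 0; first by rewrite kapN// !mul0r !mulr0 addr0.
have -> : J 0 * kap y + C6 * (kap y * Num.min 1 `|y|) = kap y * (J 0 + C6 * Num.min 1 `|y|) by ring.
by apply: ler_wpM2l => //; exact: Jb.
Qed.

Let bosc (G : R * R -> R) : bmf G -> bmf (fun z : (R * R) * R => `|G (z.1.1, z.1.2 + z.2) - G z.1|).
Proof.
move=> bG; apply/bmf_norm/bmfB.
  apply: (bmf_comp (h := fun w : (R * R) * R => (w.1.1, w.1.2 + w.2)) _ bG).
  apply/measurable_fun_pairP; split; first exact: (measurableT_comp measurable_fst measurable_fst).
  apply: measurable_funD; last exact: measurable_snd.
  exact: (measurableT_comp measurable_snd measurable_fst).
by apply: (bmf_comp (h := fst) _ bG); exact: measurable_fst.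
Qed.

(** For translations shorter than 1 the increment of [Wn] is compared with that of [u], at the cost
    of two distances [e]. For longer ones it is at most 1, as [Wn] takes values in [0, 1]. *)
Let osc_part : box T X (fun z => \int[leb]_y (kap y * `|Wn D (z.1, z.2 + y) - Wn D z|)) <=
  2 * e + 2 * e' + (Cj + 2 * T * X) * mu.
Proof.
have bo := bosc bW.
rewrite (box_swap D T X bo) /=.
pose Nf y := box T X (fun z => `|Wn D (z.1, z.2 + y) - Wn D z|).
have bd (G : R * R -> R) h : bmf G -> bmf (fun z : R * R => `|G (z.1, z.2 + h) - G z|).
  by move=> bG; apply/bmf_norm/bmfB => //; exact: bmf_shift_x.
have bNf : bmf Nf.
  rewrite /Nf /box.
  apply: (bmf_Rint_leb (F := fun w : R * R => \int[leb]_x (\1_`[- X, X] x * `|Wn D (w.2, x + w.1) - Wn D (w.2, x)|)) (igr_itv 0 T)).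
  apply: (bmf_Rint_leb (F := fun w : (R * R) * R => `|Wn D (w.1.2, w.2 + w.1.1) - Wn D (w.1.2, w.2)|) (igr_itv (- X) X)).
  apply: (bmf_comp (h := fun w : (R * R) * R => ((w.1.2, w.2), w.1.1)) _ bo).
  apply/measurable_fun_pairP; split; last exact: (measurableT_comp measurable_fst measurable_fst).
  by apply/measurable_fun_pairP; split; [exact: (measurableT_comp measurable_snd measurable_fst)|exact: measurable_snd].
have TX0 : 0 <= 2 * T * X by nonneg.
have Nfb y : 0 < y -> Nf y <= 2 * e + 2 * e' + (Cj + 2 * T * X) * Num.min 1 `|y|.
  move=> y0; rewrite (gtr0_norm y0); have [y1|/ltW y1] := leP 1 y.
    rewrite mulr1.
    apply: (@le_trans _ _ (box T X (fun=> 1))).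
      apply: box_ae_le => //; [exact: bd|exact: bmf_cst|].
      have FF := ae_filter_ringOfSetsType leb.
      apply: filterS (Wn_01 D) => t Wt t0 x /=.
      have /andP[a0 a1] := Wt t0 (x + y); have /andP[b0 b1] := Wt t0 x.
      by rewrite ler_norml; apply/andP; split; lra.
    rewrite box_cst//; have -> : T * (2 * X * 1) = 2 * T * X by ring.
    by move: (2 * T * X) TX0 e0 e'0 Cj0 => p *; lra.
  have yy := ltW y0.
  have b1 := bmf_shift_x y bdif.
  have b2 := bd u y bu.
  apply: (@le_trans _ _ (box T X (fun z => `|Wn D (z.1, z.2 + y) - u (z.1, z.2 + y)| +
      `|u (z.1, z.2 + y) - u z| + `|Wn D z - u z|))).
    apply: box_ae_le => //; [exact: bd|by apply: bmfD => //; exact: bmfD|].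
    apply/aeW => t t0 x /=; rewrite (distrC (Wn D (t, x))).
    apply: le_trans (ler_distD (u (t, x)) _ _) _; rewrite lerD2r.
    exact: ler_distD.
  rewrite boxD//; last exact: bmfD.
  rewrite boxD//.
  have h1 := le_trans (box_widen T X bdif (fun z => normr_ge0 _) yy y1) We.
  have h2 := umod yy y1; have h3 := box_We.
  have h4 : Cj * y <= (Cj + 2 * T * X) * y by apply: ler_wpM2r => //; rewrite lerDl.
  move: h1 h2 h3 h4; move: (box _ _ _) (box _ _ _) (box _ _ _) (Cj * y) (_ * y) => p q r' s t h1 h2 h3 h4.
  lra.
apply: (@le_trans _ _ (\int[leb]_y ((2 * e + 2 * e') * kap y + (Cj + 2 * T * X) * (kap y * Num.min 1 `|y|)))).
  apply: Rint_le; [exact: (igrM ikap bNf)|by apply: igrD; exact: igrZ|].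
  move=> y; have [y0|y0] := leP y 0; first by rewrite kapN// !mul0r !mulr0 addr0.
  have -> : (2 * e + 2 * e') * kap y + (Cj + 2 * T * X) * (kap y * Num.min 1 `|y|) =
    kap y * (2 * e + 2 * e' + (Cj + 2 * T * X) * Num.min 1 `|y|) by ring.
  by apply: ler_wpM2l => //; exact: Nfb.
rewrite RintD; [|exact: igrZ|exact: igrZ].
rewrite RintZ// RintZ// kap1 mulr1 lerD2l; apply: ler_wpM2l => //.
exact: addr_ge0.
Qed.

(** The data enter only through [V] and [L], never through the kernel or its bound: this is what
    survives when the scale vanishes. *)
Definition Cscale := (1 + Lq) * C + C6 + 3 * L * C * (2 + 2 * T * X).

Lemma Cscale_ge0 : 0 <= Cscale.
Proof. by rewrite /Cscale /C6; nonneg. Qed.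

(** Three independent small quantities: [e] is the distance from [Wn] to [u] at this scale, [e'] and
    [Cj] describe a modulus of continuity of [u] obtained elsewhere, and [mu] measures the
    concentration of the kernel. *)
Lemma one_scale : 0 <= box T X (fun z => `|u z - c| * ft z + Qk V c (u z) * fx z) +
  \int[leb]_x (\1_`[- X, X] x * (`|u0 x - c| * f (0, x))) + Cscale * (e + e' + (1 + Cj) * mu).
Proof.
have h := kruzhkov_Wn D P c.
have h1 := flux_part; have h2 := initial_part; have h3 := osc_part.
have LC : 0 <= 3 * L * C by nonneg.
have h4 := ler_wpM2l LC h3.
have k1 : (1 + Lq) * C * e + C6 * mu + 3 * L * C * (2 * e + 2 * e' + (Cj + 2 * T * X) * mu) <=
    Cscale * (e + e' + (1 + Cj) * mu).
  rewrite /Cscale -subr_ge0.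
  have -> : ((1 + Lq) * C + C6 + 3 * L * C * (2 + 2 * T * X)) * (e + e' + (1 + Cj) * mu) -
    ((1 + Lq) * C * e + C6 * mu + 3 * L * C * (2 * e + 2 * e' + (Cj + 2 * T * X) * mu)) =
    (1 + Lq) * C * (e' + (1 + Cj) * mu) + C6 * (e + e' + Cj * mu) +
    3 * L * C * (2 * mu + Cj * mu + 2 * T * X * (e + e' + Cj * mu)) by ring.
  by rewrite /C6; nonneg.
move: h h1 h2 h4 k1.
move: (box _ _ _) (box _ _ _) (box _ _ _) (\int[leb]_x _) (\int[leb]_x _) => a b c' i j h h1 h2 h4 k1.
lra.
Qed.

End one_scale_estimate.

Section vanishing_scale.
Variable R : realType.
Notation leb := (@lebesgue_measure R).

(** [u] is within [e] of one [Wn], which is Lipschitz in [x]; the slope depends on that one scale,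
    and [2 * e] is the price of the two comparisons. *)
Lemma box_modulus (D : nldata R) (T X e : R) (u : R * R -> R) : 0 <= T -> 0 <= X -> bmf u ->
  box T (X + 1) (fun z => `|Wn D z - u z|) <= e -> forall h, 0 <= h -> h <= 1 ->
  box T X (fun z => `|u (z.1, z.2 + h) - u z|) <=
    2 * e + T * (2 * X * (nl_K D * (2 * nl_M D))) * h.
Proof.
move=> T0 X0 bu We h h0 h1.
have bW := bWn D.
have bdif : bmf (fun z => `|Wn D z - u z|) by exact/bmf_norm/bmfB.
have b1 := bmf_shift_x h bdif.
have bS (F : R * R -> R) : bmf F -> bmf (fun z : R * R => `|F (z.1, z.2 + h) - F z|).
  by move=> bF; apply/bmf_norm/bmfB => //; exact: bmf_shift_x.
apply: (@le_trans _ _ (box T X (fun z => `|Wn D (z.1, z.2 + h) - u (z.1, z.2 + h)| +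
    `|Wn D (z.1, z.2 + h) - Wn D z| + `|Wn D z - u z|))).
  apply: box_ae_le => //; [exact: bS|by apply: bmfD => //; apply: bmfD => //; exact: bS|].
  apply/aeW => t t0 x /=; rewrite (distrC (Wn D _) (u (t, x + h))).
  apply: le_trans (ler_distD (Wn D (t, x)) _ _) _; rewrite lerD2r.
  exact: ler_distD.
rewrite boxD//; last by apply: bmfD => //; exact: bS.
rewrite boxD//; last exact: bS.
have k1 := le_trans (box_widen T X bdif (fun z => normr_ge0 _) h0 h1) We.
have k2 : box T X (fun z => `|Wn D (z.1, z.2 + h) - Wn D z|) <= T * (2 * X * (nl_K D * (2 * nl_M D))) * h.
  apply: (@le_trans _ _ (box T X (fun=> nl_K D * (2 * nl_M D * h)))).
    apply: box_ae_le => //; [exact: bS|exact: bmf_cst|].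
    apply/aeW => t t0 x /=; apply: le_trans (Wn_lip_x D t x (x + h)) _.
    by rewrite (addrC x) addrK (ger0_norm h0).
  rewrite box_cst// le_eqVlt; apply/orP; left; apply/eqP; ring.
have k3 : box T X (fun z => `|Wn D z - u z|) <= e.
  apply: le_trans We.
  have := @box_widen _ T X _ _ bdif (fun z => normr_ge0 _) (lexx (0 : R)) ler01.
  by apply: le_trans; rewrite le_eqVlt; apply/orP; left; apply/eqP; congr box; apply/funext => -[t x]/=; rewrite addr0.
move: k1 k2 k3; move: (box _ _ _) (box _ _ _) (box _ _ _) (_ * h) => p q r s; lra.
Qed.

Lemma ge0_of_small (a b : R) : 0 <= b -> (forall e, 0 < e -> 0 <= a + b * e) -> 0 <= a.
Proof.
move=> b0 h; rewrite leNgt; apply/negP => a0.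
have p : 0 < - a / (2 * (b + 1)) by apply: divr_gt0; nra.
have := h _ p; apply/negP; rewrite -ltNge.
have b1 : b / (2 * (b + 1)) < 1 by rewrite ltr_pdivrMr; nra.
have -> : a + b * (- a / (2 * (b + 1))) = a * (1 - b / (2 * (b + 1))) by rewrite mulrBr; ring.
by rewrite pmulr_llt0// subr_gt0.
Qed.

Lemma kruzhkov_limit (D : nat -> nldata R) (V u0 : R -> R) (L c : R) (P : testf R)
    (u : R * R -> R) :
  (forall k, nl_V (D k) = V) -> (forall k, nl_L (D k) = L) -> (forall k, nl_u0 (D k) = u0) ->
  bmf u ->
  (forall e, 0 < e -> exists n, forall k, (n <= k)%N ->
     box (tf_T P) (tf_X P + 1) (fun z => `|Wn (D k) z - u z|) <= e) ->
  (forall e, 0 < e -> exists n, forall k, (n <= k)%N ->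
     \int[leb]_y (nl_kap (D k) y * Num.min 1 `|y|) <= e) ->
  0 <= box (tf_T P) (tf_X P) (fun z => `|u z - c| * tf_t P z + Qk V c (u z) * tf_x P z) +
    \int[leb]_x (\1_`[- tf_X P, tf_X P] x * (`|u0 x - c| * tf_f P (0, x))).
Proof.
move=> DV DL Du bu cvgu cvgk.
have [_ [N' uN']] := bu.
pose N := Num.max N' (Num.max 1 `|c|).
have uN z : `|u z| <= N by apply: le_trans (uN' z) _; rewrite le_max lexx.
have N1 : 1 <= N by rewrite !le_max lexx orbT.
have cN : `|c| <= N by rewrite !le_max lexx !orbT.
have CE k : Cscale (D k) P N = Cscale (D 0%N) P N by rewrite /Cscale !DV !DL.
have C0 := Cscale_ge0 (D 0%N) P N1.
apply: (@ge0_of_small _ (Cscale (D 0%N) P N * 3)); first exact: mulr_ge0.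
move=> e e0.
(* An index [j] is fixed first, and with it the slope [Cj] of the modulus of [u]; only then is the
   kernel made concentrated enough compared with [1 + Cj]. *)
have [j hj] := cvgu e e0.
have hj1 := box_modulus (tf_T0 P) (tf_X0 P) bu (hj j (leqnn j)).
set Cj := tf_T P * _ in hj1.
have M0 : 0 <= nl_M (D j) by exact: le_trans (normr_ge0 _) (nl_uM (D j) (0, 0)).
have K0 : 0 <= nl_K (D j) by exact: le_trans (nl_kap0 (D j) 0) (nl_kapK (D j) 0).
have Cj0 : 0 <= Cj.
  have T0 := tf_T0 P; have X0 := tf_X0 P; rewrite /Cj; nonneg.
have Cj1 : 0 < 1 + Cj by apply: ltr_wpDr.
have [n hn] := cvgk _ (divr_gt0 e0 Cj1).
have hk := hj (maxn n j) (leq_maxr n j); have hm := hn (maxn n j) (leq_maxl n j).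
have := one_scale bu uN N1 cN hk (ltW e0) Cj0 hj1 hm.
rewrite DV Du CE (mulrC (1 + Cj)) divfK ?gt_eqF//.
move: (box _ _ _ + _) (Cscale _ _ _) => p q.
by have -> : p + q * (e + e + e) = p + q * 3 * e by ring.
Qed.

End vanishing_scale.

(** * Representatives of the data *)

(** Truncation at an essential bound gives an everywhere bounded function without changing the
    class. If the whole space is null, the zero function serves. *)
Lemma Lfun_oo_representative d (T : measurableType d) (R : realType)
    (mu : {measure set T -> \bar R}) (f : T -> R) : f \in Lfun mu +oo%E ->
  measurable_fun setT f /\ exists2 g, bmf g & {ae mu, forall x, f x = g x}.
Proof.
rewrite inE => /andP[]; rewrite inE/= => mf; rewrite inE/= /finite_norm.
rewrite unlock /Lnorm => fM; split => //.
have [muT0|muT0] := leP (mu setT) 0%E.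
  exists (fun=> 0); first exact: bmf_cst.
  have muT : mu setT = 0%E by apply/eqP; rewrite eq_le muT0 measure_ge0.
  by exists setT; split.
move: fM; rewrite muT0 => fM.
have [M hM] := ess_supr_bounded fM.
exists (fun x => Num.max (- `|M|) (Num.min `|M| (f x))).
  split.
    apply: measurable_maxr; first exact: measurable_cst.
    by apply: measurable_minr => //; exact: measurable_cst.
  exists `|M| => x; rewrite ler_norml le_max lexx/= ge_max ge_min lexx/= andbT.
  by rewrite ge0_cp.
have FF := ae_filter_ringOfSetsType mu.
apply: filterS hM => x /= fxM.
have : `|f x| <= `|M| by apply: le_trans fxM _; exact: ler_norm.
rewrite ler_norml => /andP[h1 h2].
by rewrite (min_idPr h2) (max_idPr h1).
Qed.

Section null_sets.
Variable R : realType.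
Notation leb := (@lebesgue_measure R).
Notation leb2 := (@lebesgue_measure R \x @lebesgue_measure R)%E.

Lemma ae_neq (a : R) : {ae leb, forall x, x != a}.
Proof.
exists [set a]; split; [exact: measurable_set1|exact: lebesgue_measure_set1|].
by move=> x /= /negP/negPn/eqP.
Qed.

Lemma ae_sections (Q : R * R -> Prop) : {ae leb2, forall z, Q z} ->
  {ae leb, forall t, {ae leb, forall x, Q (t, x)}}.
Proof.
move=> [N [mN N0 QN]].
have ms := measurable_fun_xsection leb mN.
have : (\int[leb]_t `|(leb \o xsection N) t| = 0)%E.
  rewrite -N0 /product_measure1; apply: eq_integral => t _.
  by rewrite gee0_abs// measure_ge0.
move/(ae_eq_integral_abs leb measurableT ms).
have FF := ae_filter_ringOfSetsType leb.
apply: filterS => t /= /(_ I) h; exists (xsection N t); split => //.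
  exact: measurable_xsection.
by move=> x /= nQ; rewrite /xsection/= inE; apply: QN.
Qed.

Lemma ae_fst (Q : R -> Prop) : {ae leb, forall t, Q t} -> {ae leb2, forall z, Q z.1}.
Proof.
move=> [N [mN N0 QN]]; exists (N `*` setT); split => /=; first exact: measurableX.
  by rewrite product_measure1E//; transitivity (0 * leb setT)%E; [by congr (_ * _)%E|rewrite mul0e].
by move=> z nQ; split => //; exact: QN.
Qed.

(** For the product sigma-algebra: rounding [t] down to a multiple of [n.+1%:R^-1] makes preimages
    countable unions of rectangles, and continuity gives convergence as [n] grows. *)
Lemma measurable_continuous2 (f : R * R -> R) : continuous f -> measurable_fun setT f.
Proof.
move=> cf.
pose q n (z : R * R) := ((Num.floor (n.+1%:R * z.1))%:~R / n.+1%:R : R, z.2).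
apply: (@measurable_fun_cvg _ _ _ setT (fun n z => f (q n z))) => //.
  move=> n _ A mA; rewrite setTI.
  rewrite (_ : _ @^-1` _ = \bigcup_(k : int)
     ((fun t : R => Num.floor (n.+1%:R * t)) @^-1` [set k] `*` (fun x => f (k%:~R / n.+1%:R, x)) @^-1` A)); last first.
    apply/seteqP; split => [[t x]|[t x]]/=.
      by move=> Az; exists (Num.floor (n.+1%:R * t)).
    by move=> [k _ [/= <-]].
  apply: countable_bigcupT_measurable; first exact: countableP.
  move=> k; apply: measurableX.
    rewrite (_ : _ @^-1` _ = `[k%:~R / n.+1%:R, (k + 1)%:~R / n.+1%:R[%classic); first exact: measurable_itv.
    apply/seteqP; split => t/=; rewrite in_itv/= ler_pdivrMr ?ltr_pdivlMr// (mulrC t).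
      by move=> <-; rewrite floor_le/= floorD1_gt.
    by move/floor_def.
  have cfk : continuous (fun x => f (k%:~R / n.+1%:R, x)).
    move=> x; have cp : (k%:~R / n.+1%:R : R, y) @[y --> x] --> (k%:~R / n.+1%:R : R, x).
      by apply: (@cvg_pair _ _ _ (nbhs x) (nbhs (k%:~R / n.+1%:R : R)) (nbhs x)); [exact: cvg_cst|exact: cvg_id].
    exact: (cvg_comp _ _ cp (cf _)).
  by rewrite -[X in measurable X]setTI; exact: (continuous_measurable_fun cfk).
move=> z _; suff cq : q n z @[n --> \oo] --> z by exact: (cvg_comp _ _ cq (cf z)).
rewrite {2}(surjective_pairing z); apply: (@cvg_pair _ _ _ \oo (nbhs z.1) (nbhs z.2)); last exact: cvg_cst.
apply/cvgrPdist_le => e e0.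
have [n _ hn] := near_infty_natSinv_lt (PosNum e0).
exists n => // m /= nm.
have m0 : 0 < m.+1%:R :> R by [].
have h1 := floor_le (m.+1%:R * z.1); have h2 := floorD1_gt (m.+1%:R * z.1).
have hm := hn m nm; rewrite /= in hm.
have E : z.1 - (Num.floor (m.+1%:R * z.1))%:~R / m.+1%:R = (m.+1%:R * z.1 - (Num.floor (m.+1%:R * z.1))%:~R) / m.+1%:R.
  by rewrite mulrBl mulrAC mulfV ?mul1r// gt_eqF.
rewrite E ger0_norm; last by rewrite divr_ge0// subr_ge0.
apply: le_trans (ltW hm); rewrite ler_pdivrMr// mulVf ?gt_eqF//.
by rewrite intrD in h2; lra.
Qed.

End null_sets.

(** * The reflected kernel *)

Section kernel.
Variable R : realType.
Notation leb := (@lebesgue_measure R).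
Variable eta : R -> R.
Hypotheses (eta_L1 : eta \in Lfun leb 1%E) (eta_Linfty : eta \in Lfun leb +oo%E)
  (eta_supp : closure [set x | eta x != 0] `<=` `]-oo, 0])
  (eta_ge0 : forall x, 0 <= eta x)
  (eta_ndecr : {in `]-oo, 0[ &, {homo eta : x y / x <= y}})
  (eta_mass : \int[leb]_(x in `]-oo, 0]) eta x = 1).

Lemma igr_eta : igr leb eta. Proof. exact/Lfun1_integrable. Qed.

Lemma eta_pos0 x : 0 < x -> eta x = 0.
Proof.
move=> x0; apply/eqP/negPn/negP => ex.
have := eta_supp (@subset_closure _ [set x | eta x != 0] x ex); rewrite /= in_itv/= => h.
by have := le_lt_trans h x0; rewrite ltxx.
Qed.

(** A value at [x] above the essential bound would persist on all of []x, 0[] by monotonicity, a set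
    of positive measure. *)
Lemma eta_bounded_neg : exists2 K, 0 <= K & forall x, x < 0 -> eta x <= K.
Proof.
have [_ [g [mg [K gK]] eg]] := Lfun_oo_representative eta_Linfty.
exists `|K| => // x x0; rewrite leNgt; apply/negP => Kx.
have [N [mN N0 NE]] := eg.
have : `]x, 0[%classic `<=` N.
  move=> y /=; rewrite in_itv/= => /andP[xy y0]; apply: NE => /= ey.
  have : eta x <= eta y by apply: eta_ndecr; rewrite ?in_itv//= ltW.
  rewrite leNgt; apply/negP; rewrite negbK ey; apply: le_lt_trans Kx.
  by apply: le_trans (ler_norm _) _; apply: le_trans (gK y) (ler_norm _).
move/(le_measure leb); rewrite !inE => /(_ (measurable_itv _) mN).
move=> h; have : (leb `]x, 0%R[%classic <= 0)%E.
  by apply: le_trans h _; rewrite le_eqVlt; apply/orP; left; exact/eqP.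
by rewrite lebesgue_measure_itv/= lte_fin x0 -EFinB lee_fin sub0r oppr_le0 leNgt x0.
Qed.

(** Reflection to the positive half line, with value 0 at the origin whatever [eta 0] is; this
    convention makes the kernel vanish at every [z <= 0]. *)
Definition half_kernel (z : R) := (0 < z)%R%:R * eta (- z).

Lemma half_kernel_ge0 z : 0 <= half_kernel z.
Proof. exact: mulr_ge0. Qed.

Lemma half_kernel_npos z : z <= 0 -> half_kernel z = 0.
Proof. by move=> z0; rewrite /half_kernel ltNge z0 mul0r. Qed.

Lemma half_kernel_noninc x y : 0 < x -> x <= y -> half_kernel y <= half_kernel x.
Proof.
move=> x0 xy; have y0 := lt_le_trans x0 xy.
rewrite /half_kernel x0 y0 !mul1r.
by apply: eta_ndecr; rewrite ?in_itv/= ?oppr_lt0// lerN2.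
Qed.

Lemma half_kernel_bounded : exists2 K, 0 <= K & forall z, half_kernel z <= K.
Proof.
have [K K0 hK] := eta_bounded_neg; exists K => // z.
have [z0|z0] := leP z 0; first by rewrite half_kernel_npos.
by rewrite /half_kernel z0 mul1r; apply: hK; rewrite oppr_lt0.
Qed.

Lemma half_kernelE0 z : z != 0 -> half_kernel z = eta (- z).
Proof.
move=> z0; rewrite /half_kernel.
case: (ltgtP z 0) z0 => // z0 _; last by rewrite mul1r.
by rewrite mul0r eta_pos0// oppr_gt0.
Qed.

Lemma half_kernelE : half_kernel = fun z => eta (- z) * \1_`]0, +oo[ z.
Proof.
by apply/funext => z; rewrite /half_kernel mulrC indic_itvE in_itv/= andbT.
Qed.

Lemma igr_half_kernel : igr leb half_kernel.
Proof.
rewrite half_kernelE; apply: igrM; first exact/igr_opp/igr_eta.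
by apply: bmf_indic; exact: measurable_itv.
Qed.

Lemma half_kernel_mass : \int[leb]_z half_kernel z = 1.
Proof.
rewrite -eta_mass [RHS]Rintegral_mkcond -(Rint_opp igr_half_kernel).
have bI : bmf (\1_`]-oo, 0] : R -> R) by apply: bmf_indic; exact: measurable_itv.
have E : eta \_ `]-oo, 0] = fun x => eta x * \1_`]-oo, 0] x.
  apply/funext => x; rewrite patchE indicE; case: ifP => _; [by rewrite mulr1|by rewrite mulr0].
have mp := igr_meas (igrM igr_eta bI).
rewrite E; apply: Rint_ae_eq => //; first exact: (igr_meas (igr_opp igr_half_kernel)).
have FF := ae_filter_ringOfSetsType leb.
apply: filterS (ae_neq 0) => x x0; rewrite /half_kernel opprK oppr_gt0 indic_itvE in_itv/=.
by case: (ltgtP x 0) x0 => // _ _; rewrite mulrC.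
Qed.

End kernel.

(** * From a nonlocal solution to data on the whole plane *)

Section representation.
Variable R : realType.
Notation leb := (@lebesgue_measure R).
Notation leb2 := (@lebesgue_measure R \x @lebesgue_measure R)%E.

Lemma bmf_convk (kap : R -> R) (a : R * R -> R) : igr leb kap -> bmf a -> bmf (convk kap a).
Proof.
move=> ik ba; apply: (bmf_Rint_leb (F := fun w : (R * R) * R => a (w.1.1, w.1.2 + w.2)) ik).
apply: (bmf_comp (h := fun w : (R * R) * R => (w.1.1, w.1.2 + w.2)) _ ba).
apply/measurable_fun_pairP; split; first exact: (measurableT_comp measurable_fst measurable_fst).
by apply: measurable_funD; [exact: (measurableT_comp measurable_snd measurable_fst)|exact: measurable_snd].
Qed.

Lemma measurable_Qplus : measurable (Qplus : set (R * R)).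
Proof.
rewrite (_ : Qplus = `[0, +oo[%classic `*` setT); first by apply: measurableX => //; exact: measurable_itv.
by apply/seteqP; split => z; rewrite /Qplus/= in_itv/= andbT; [|case].
Qed.

Lemma indic_Qplus (z : R * R) : \1_Qplus z = (0 <= z.1)%R%:R :> R.
Proof.
rewrite indicE; congr (nat_of_bool _)%:R; apply/idP/idP; first by rewrite inE.
by move=> h; rewrite inE.
Qed.

Lemma smooth_dfn_ckernel (f f' : R -> R) : (forall n, smooth n f) -> dfn f f' -> ckernel f -> ckernel f'.
Proof.
move=> sf df kf; apply: (ckernel_dfn kf df).
have [g dg cg] := sf 1%N.
suff -> : f' = g by [].
by apply/funext => x; have [_ <-] := df x; have [_ <-] := dg x.
Qed.

(** At negative times the extended solution does not depend on [t], and this integral of the time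
    derivative of a test function produces the initial term of the weak formulation. *)
Lemma Rint_neg_half (f f' : R -> R) : dfn f f' -> ckernel f -> ckernel f' ->
  \int[leb]_t (f' t * (1 - \1_`[0, +oo[ t)) = f 0.
Proof.
move=> df kf kf'; have [_ [b fb]] := kf; have [_ [b' fb']] := kf'.
pose a := Num.max (Num.max b b') 0 + 1.
have a0 : 0 < a by rewrite /a ltr_wpDl// le_max lexx orbT.
have ab : b < a by rewrite /a ltr_pwDr// !le_max lexx.
have ab' : b' < a by rewrite /a ltr_pwDr// !le_max lexx orbT.
have -> : f 0 = f 0 - f (- a) by rewrite (fb (- a)) ?subr0// normrN gtr0_norm.
have cf' : continuous f' by case: kf'.
rewrite -(FTC2 _ df cf'); last by rewrite oppr_le0 ltW.
have b1 : bmf (fun t : R => 1 - \1_`[0, +oo[ t : R).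
  by apply: bmfB; [exact: bmf_cst|apply: bmf_indic; exact: measurable_itv].
apply: Rint_ae_eq.
- exact: (igr_meas (igrM (ckernel_igr kf') b1)).
- exact: (igr_meas (continuous_igr_itv _ _ cf')).
have FF := ae_filter_ringOfSetsType leb.
apply: filterS (ae_neq 0) => t t0; rewrite !indic_itvE !in_itv/= andbT mulrC.
case: (ltgtP 0 t) t0 => // t0 _.
  by rewrite subrr mul0r andbF mul0r.
rewrite subr0 andbT; case: (leP (- a) t) => // ta.
by rewrite fb' ?mulr0 ?mul0r// (lt_trans ab')// ltr0_norm// ltrNr.
Qed.

Variables (V eta u0 : R -> R) (L : R).
Hypotheses (eta_L1 : eta \in Lfun leb 1%E) (eta_Linfty : eta \in Lfun leb +oo%E)
  (eta_supp : closure [set x | eta x != 0] `<=` `]-oo, 0])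
  (eta_ge0 : forall x, 0 <= eta x)
  (eta_ndecr : {in `]-oo, 0[ &, {homo eta : x y / x <= y}})
  (eta_mass : \int[leb]_(x in `]-oo, 0]) eta x = 1)
  (u0_Linfty : u0 \in Lfun leb +oo%E) (u0_01 : {ae leb, forall x, 0 <= u0 x <= 1})
  (L0 : 0 <= L) (VL : forall x y, `|V x - V y| <= L * `|x - y|)
  (VD : forall x y, 0 <= x -> x <= y -> y <= 1 -> V y <= V x).

(** Representative of the datum with values in [0, 1] at every point, as [nldata] demands. *)
Definition clamp01 (x : R) := Num.max 0 (Num.min 1 (u0 x)).

Lemma clamp01_01 x : 0 <= clamp01 x <= 1.
Proof. by rewrite /clamp01 le_max lexx ge_max ler01 ge_min lexx. Qed.

Lemma mu0 : measurable_fun setT u0.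
Proof. by have [] := Lfun_oo_representative u0_Linfty. Qed.

Lemma measurable_clamp01 : measurable_fun setT clamp01.
Proof.
apply: measurable_maxr; first exact: measurable_cst.
by apply: measurable_minr; [exact: measurable_cst|exact: mu0].
Qed.

Lemma clamp01_ae : {ae leb, forall x, u0 x = clamp01 x}.
Proof.
have FF := ae_filter_ringOfSetsType leb.
apply: filterS u0_01 => x /andP[x0 x1].
by rewrite /clamp01 (min_idPr x1) (max_idPr x0).
Qed.

Lemma bmf_clamp01 : bmf clamp01.
Proof.
split; first exact: measurable_clamp01.
by exists 1 => x; have /andP[x0 x1] := clamp01_01 x; rewrite ger0_norm.
Qed.

Variables (eps : R) (u : R * R -> R).
Hypotheses (eps0 : 0 < eps) (sol : nonlocal_solution V eta u0 eps u).

Definition scaled_kernel (z : R) := eps^-1 * half_kernel eta (eps^-1 * z).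
Local Notation kap := scaled_kernel.
Local Notation k := (rescale eta eps).

Let epsV : 0 < eps^-1. Proof. by rewrite invr_gt0. Qed.

Let igr_hk := igr_half_kernel eta_L1.

Lemma igr_scaled_kernel : igr leb kap.
Proof. by apply: igrZ; exact: (igr_scale epsV igr_hk). Qed.

Lemma scaled_kernel_ge0 z : 0 <= kap z.
Proof. by apply: mulr_ge0; [exact: ltW|exact: half_kernel_ge0]. Qed.

Lemma scaled_kernel_bounded : exists K, forall z, kap z <= K.
Proof.
have [K _ hK] := half_kernel_bounded eta_Linfty eta_ndecr.
by exists (eps^-1 * K) => z; apply: ler_wpM2l; [exact: ltW|exact: hK].
Qed.

Lemma scaled_kernel_npos z : z <= 0 -> kap z = 0.
Proof. by move=> z0; rewrite /kap half_kernel_npos ?mulr0// pmulr_rle0. Qed.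

Lemma scaled_kernel_noninc x y : 0 < x -> x <= y -> kap y <= kap x.
Proof.
move=> x0 xy; apply: ler_wpM2l; first exact: ltW.
by apply: half_kernel_noninc => //; [exact: mulr_gt0|rewrite ler_pM2l].
Qed.

Lemma scaled_kernel_mass : \int[leb]_z kap z = 1.
Proof.
rewrite /scaled_kernel RintZ; last exact: (igr_scale epsV igr_hk).
rewrite (Rint_scale epsV igr_hk) half_kernel_mass// mulr1 invrK mulVf//.
exact: lt0r_neq0.
Qed.

Lemma scaled_kernelE z : z != 0 -> kap z = k (- z).
Proof.
move=> z0; rewrite /scaled_kernel /rescale half_kernelE0//; last first.
  by rewrite mulf_eq0 invr_eq0 (negbTE z0) orbF lt0r_neq0.
by rewrite (mulrC (- z)) mulrN.
Qed.

(** The hypotheses on [u] concern this restriction only, so measurability arguments are run on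
    [ub]. *)
Let ub := u \_ Qplus.
Let mub : measurable_fun setT ub.
Proof. by case: sol => /Lfun_oo_representative[]. Qed.

Let measurable_rescale : measurable_fun setT (fun y : R => k y).
Proof.
apply: measurable_funM; first exact: measurable_cst.
have h := igr_scale epsV (igr_eta eta_L1).
by have := igr_meas h; apply: eq_measurable_fun => y _; rewrite mulrC.
Qed.

Let meas_conv : measurable_fun setT (fun w : (R * R) * R => k (w.1.2 - w.2) * ub (w.1.1, w.2)).
Proof.
apply: measurable_funM.
  apply: (measurableT_comp measurable_rescale); apply: measurable_funB.
    exact: (measurableT_comp measurable_snd measurable_fst).
  exact: measurable_snd.
apply: (measurableT_comp mub).
apply/measurable_fun_pairP; split; first exact: (measurableT_comp measurable_fst measurable_fst).
exact: measurable_snd.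
Qed.

Let measurable_convx : measurable_fun setT (convx ub k).
Proof. exact: (measurable_Rint leb meas_conv). Qed.

Let convx_patch z : Qplus z -> convx u k z = convx ub k z.
Proof.
move=> Qz; apply: eq_Rintegral => y _; rewrite /ub patchE ifT//.
by rewrite inE.
Qed.

(** For almost every time the sections of [u] and [a] agree almost everywhere in [y], and then the
    convolutions agree at every [x]: the exceptional set of times does not depend on [x]. *)
Lemma convx_convk (a : R * R -> R) : bmf a ->
  {ae leb2, forall z, Qplus z -> u z = a z} ->
  {ae leb, forall t, 0 <= t -> forall x, convx u k (t, x) = convk kap a (t, x)}.
Proof.
move=> ba ua; have FF := ae_filter_ringOfSetsType leb.
apply: filterS (ae_sections ua) => t aet t0 x.
rewrite convx_patch//.
have bat : bmf (fun y => a (t, y)) by exact: bmf_row.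
have ik := igr_shift (- x) igr_scaled_kernel.
have -> : convk kap a (t, x) = \int[leb]_y (kap (- x + y) * a (t, y)).
  rewrite -(@Rint_shift _ x (fun y => kap (- x + y) * a (t, y))); last exact: (igrM ik bat).
  by apply: eq_Rintegral => y _ /=; rewrite addKr.
apply: Rint_ae_eq.
- exact: (measurableT_comp meas_conv (measurable_pair1 (t, x))).
- exact: (igr_meas (igrM ik bat)).
have aex := ae_neq x.
apply: filterS2 aet aex => y uy yx /=.
rewrite scaled_kernelE; last by rewrite addrC subr_eq0.
rewrite opprD opprK /ub patchE ifT ?inE// uy//.
Qed.

Let neg_half (z : R * R) : R := 1 - \1_`[0, +oo[ z.1.

Let neg_halfE z : neg_half z = 1 - \1_Qplus z.
Proof. by rewrite /neg_half indic_itvE in_itv/= andbT indic_Qplus. Qed.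

Let bneg : bmf neg_half.
Proof.
apply: bmfB; first exact: bmf_cst.
apply: (bmf_comp measurable_fst); apply: bmf_indic; exact: measurable_itv.
Qed.

Let bQ : bmf (\1_Qplus : R * R -> R). Proof. by apply: bmf_indic; exact: measurable_Qplus. Qed.

Let bneg_clamp : bmf (fun z : R * R => neg_half z * clamp01 z.2).
Proof. by apply: bmfM => //; exact: (bmf_comp measurable_snd bmf_clamp01). Qed.

(** The flux is 0 at negative times, and the datum, constant in time there, contributes [th 0] times
    its integral against [ps]. This is exactly the initial term of the half-plane formulation. *)
Lemma extended_weak (g : R * R -> R) (th th' ps ps' : R -> R) : bmf g ->
  {ae leb2, forall z, Qplus z -> u z = g z} ->
  let a := fun z => \1_Qplus z * g z + neg_half z * clamp01 z.2 in
  (forall n, smooth n th) -> (forall n, smooth n ps) -> dfn th th' -> dfn ps ps' ->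
  ckernel th -> ckernel ps ->
  \int[leb2]_w (th' w.1 * ps w.2 * a w) + \int[leb2]_w (th w.1 * ps' w.2 * flux kap V a w) = 0.
Proof.
move=> bg ug a sth sps dth dps kth kps.
have FF := ae_filter_ringOfSetsType leb2.
have kth' := smooth_dfn_ckernel sth dth kth; have kps' := smooth_dfn_ckernel sps dps kps.
have ith := ckernel_igr kth; have ips := ckernel_igr kps.
have ith' := ckernel_igr kth'; have ips' := ckernel_igr kps'.
have i1 := igr_leb2 ith' ips; have i2 := igr_leb2 ith ips'.
have bg1 : bmf (fun z => \1_Qplus z * g z) by exact: bmfM.
have ba : bmf a by exact: bmfD.
have aQ z : Qplus z -> a z = g z.
  by move=> Qz; rewrite /a neg_halfE indic_Qplus Qz mul1r subrr mul0r addr0.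
have ua : {ae leb2, forall z, Qplus z -> u z = a z}.
  by apply: filterS ug => z uz Qz; rewrite aQ// uz.
have bconv : bmf (convk kap a) by exact: bmf_convk igr_scaled_kernel ba.
have cV : continuous V := lipschitz_cts L0 VL.
have bVc : bmf (fun z => V (convk kap a z)).
  by have [N hN] := bconv.2; exact: (bmf_comp_bounded bconv hN).
have bfl : bmf (flux kap V a).
  have -> : flux kap V a = fun z => \1_Qplus z * (V (convk kap a z) * a z).
    by apply/funext => z; rewrite /flux indic_Qplus.
  by apply: bmfM => //; exact: bmfM.
have [_ [bt hbt]] := kth; have [_ [bx hbx]] := kps.
have testphi : test_function (fun z : R * R => th z.1 * ps z.2).
  apply: (@test_function_tensor _ th ps (- bt) bt (- bx) bx) => // y /lt_norm h; [exact: hbt|exact: hbx].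
have [_ /(_ _ testphi)] := sol.
rewrite (Dt_tensor _ dth) (Dx_tensor _ dps) => wk.
have cps := kps.1; have cth := kth.1.
have E2 : \int[leb]_x (u0 x * (th 0 * ps x)) = th 0 * \int[leb]_x (ps x * clamp01 x).
  rewrite -RintZ; last exact: (igrM ips bmf_clamp01).
  apply: Rint_ae_eq.
  - apply: measurable_funM; first exact: mu0.
    by apply: measurable_funM; [exact: measurable_cst|exact: (igr_meas ips)].
  - exact: (igr_meas (igrZ _ (igrM ips bmf_clamp01))).
  have FF1 := ae_filter_ringOfSetsType leb.
  by apply: filterS clamp01_ae => x <-; ring.
have E1 : \int[leb2]_(z in Qplus) (u z * (th' z.1 * ps z.2 + V (convx u k z) * (th z.1 * ps' z.2))) =
    \int[leb2]_w (th' w.1 * ps w.2 * (\1_Qplus w * g w)) + \int[leb2]_w (th w.1 * ps' w.2 * flux kap V a w).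
  rewrite -RintD; [|exact: (igrM i1 bg1)|exact: (igrM i2 bfl)].
  rewrite Rintegral_mkcond.
  have -> : (fun z => u z * (th' z.1 * ps z.2 + V (convx u k z) * (th z.1 * ps' z.2))) \_ Qplus =
    fun z => ub z * (th' z.1 * ps z.2 + V (convx ub k z) * (th z.1 * ps' z.2)).
    apply/funext => z; rewrite /ub !patchE; case: ifPn => Qz; last by rewrite mul0r.
    by rewrite convx_patch//; rewrite inE in Qz.
  apply: Rint_ae_eq.
  - apply: measurable_funM => //; apply: measurable_funD; first exact: (igr_meas i1).
    apply: measurable_funM; last exact: (igr_meas i2).
    exact: (measurableT_comp (continuous_measurable_fun cV) measurable_convx).
  - by apply: measurable_funD; [exact: (igr_meas (igrM i1 bg1))|exact: (igr_meas (igrM i2 bfl))].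
  have cc := ae_fst (convx_convk ba ua).
  apply: filterS2 cc ug => -[t x] /= cc ug'.
  rewrite indic_Qplus /flux /=; have [t0|t0] := leP 0 t.
    rewrite -convx_patch// cc// /ub patchE ifT ?inE//.
    by rewrite ug'// aQ//=; ring.
  by rewrite /ub patchE ifF ?mul0r ?mulr0 ?addr0// /Qplus; apply/negbTE/negP; rewrite inE/= leNgt t0.
have E3 : \int[leb2]_w (th' w.1 * ps w.2 * a w) =
    \int[leb2]_w (th' w.1 * ps w.2 * (\1_Qplus w * g w)) + th 0 * \int[leb]_x (ps x * clamp01 x).
  have -> : th 0 * \int[leb]_x (ps x * clamp01 x) =
      \int[leb2]_w (th' w.1 * ps w.2 * (neg_half w * clamp01 w.2)).
    rewrite (Rint_leb2 ith' ips bneg_clamp) -(Rint_neg_half dth kth kth') mulrC -RintZ; last first.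
      by apply: igrM => //; apply: bmfB; [exact: bmf_cst|apply: bmf_indic; exact: measurable_itv].
    apply: eq_Rintegral => t _; rewrite mulrC -mulrA; congr (_ * _).
    rewrite -RintZ; last exact: (igrM ips bmf_clamp01).
    by apply: eq_Rintegral => x _; rewrite /neg_half/=; ring.
  rewrite -RintD; [|exact: (igrM i1 bg1)|exact: (igrM i1 bneg_clamp)].
  by apply: eq_Rintegral => w _; rewrite mulrDr.
rewrite E1 E2 in wk; rewrite E3 -[RHS]wk.
by rewrite addrAC.
Qed.

Lemma measurable_convx_Qplus : measurable_fun Qplus (convx u k).
Proof.
apply: (@eq_measurable_fun _ _ _ _ _ (convx ub k)).
  by move=> z; rewrite inE => Qz; rewrite convx_patch.
exact: (measurable_funS measurableT _ measurable_convx).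
Qed.

Lemma nonlocal_data : exists D : nldata R,
  [/\ nl_V D = V, nl_L D = L, nl_u0 D = clamp01, nl_kap D = kap &
   {ae leb, forall t, 0 <= t -> forall x, convx u k (t, x) = Wn D (t, x)}].
Proof.
have FF := ae_filter_ringOfSetsType leb2.
have [_ [g bg eg]] := Lfun_oo_representative sol.1.
have ug : {ae leb2, forall z, Qplus z -> u z = g z}.
  by apply: filterS eg => z <- Qz; rewrite patchE ifT// inE.
pose a z := \1_Qplus z * g z + neg_half z * clamp01 z.2.
have ba : bmf a by apply: bmfD => //; exact: bmfM.
have [ma [M aM]] := ba.
have [K hK] := scaled_kernel_bounded.
have aneg t x : t < 0 -> a (t, x) = clamp01 x.
  by move=> t0; rewrite /a neg_halfE indic_Qplus/= leNgt t0 mul0r subr0 mul1r add0r.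
have wk th th' ps ps' := @extended_weak g th th' ps ps' bg ug.
exists (NLData igr_scaled_kernel scaled_kernel_ge0 hK scaled_kernel_npos scaled_kernel_noninc
  scaled_kernel_mass L0 VL VD ma aM measurable_clamp01 clamp01_01 aneg wk); split => //=.
apply: convx_convk => //; apply: filterS ug => z uz Qz.
by rewrite /= /a neg_halfE indic_Qplus Qz mul1r subrr mul0r addr0 uz.
Qed.

End representation.

Section box_convergence.
Variable R : realType.
Notation leb := (@lebesgue_measure R).
Notation leb2 := (@lebesgue_measure R \x @lebesgue_measure R)%E.

Lemma igr_oo (a b : R) : igr leb (\1_`]a, b[ : R -> R).
Proof.
have bI : bmf (\1_`]a, b[ : R -> R) by apply: bmf_indic; exact: measurable_itv.
have := igrM (igr_itv a b) bI; congr (igr leb); apply/funext => x.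
rewrite !indic_itvE !in_itv/=; case: (boolP (a < x < b)) => [/andP[h1 h2]|_]; last by rewrite mulr0.
by rewrite !ltW// mulr1.
Qed.

Variables (T X : R).

(** An open set inside [Qplus] reaching down to initial time; it contains the closed box except for
    the null line [t = 0]. *)
Let I1 : set R := `]0, T + 1[%classic.
Let I2 : set R := `]- (X + 1), X + 1[%classic.
Let Omega : set (R * R) := I1 `*` I2.

Let Omega_open : open Omega.
Proof.
rewrite openE => -[t x] /= [tI xI]; exists (I1, I2) => //=.
by split; apply: open_nbhs_nbhs; split => //; exact: itv_open.
Qed.

Let Omega_bounded : bounded_set Omega.
Proof.
exists (T + 1 + (X + 1)); split; first exact: num_real.
move=> B hB [t x] []; rewrite /I1 /I2/= !in_itv/= => /andP[t0 tT] /andP[x1 x2].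
apply: le_trans (ltW hB).
rewrite prod_normE/= ge_max; apply/andP; split.
  by rewrite gtr0_norm//; lra.
by rewrite ler_norml; apply/andP; split; lra.
Qed.

Let Omega_Qplus : Omega `<=` Qplus.
Proof. by move=> [t x] []; rewrite /I1/= in_itv/= => /andP[t0 _] _; exact: ltW. Qed.

Let mOmega : measurable Omega.
Proof. by apply: measurableX; exact: measurable_itv. Qed.

Lemma box_le_Omega (w u F : R * R -> R) : bmf F -> (forall z, 0 <= F z) ->
  measurable_fun Qplus w -> measurable_fun Qplus u ->
  {ae leb2, forall z, Qplus z -> `|w z - u z| = F z} ->
  box T X F <= \int[leb2]_(z in Omega) `|w z - u z|.
Proof.
move=> bF F0 mw mu wuF.
have b1 : bmf (\1_I1 : R -> R) by apply: bmf_indic; exact: measurable_itv.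
have i1 : igr leb (\1_I1 : R -> R).
  exact: igr_oo.
have i2 : igr leb (\1_I2 : R -> R).
  exact: igr_oo.
have -> : \int[leb2]_(z in Omega) `|w z - u z| = \int[leb2]_z (\1_I1 z.1 * \1_I2 z.2 * F z).
  rewrite Rintegral_mkcond; apply: Rint_ae_eq.
  - apply/(measurable_restrictT _ mOmega); apply: measurableT_comp => //.
    by apply: measurable_funB; apply: measurable_funS Omega_Qplus _ => //; exact: measurable_Qplus.
  - exact: (igr_meas (igrM (igr_leb2 i1 i2) bF)).
  have FF := ae_filter_ringOfSetsType leb2.
  apply: filterS wuF => z wuz; rewrite patchE; case: ifPn => hz.
    have Oz : Omega z by rewrite inE in hz.
    have [h1 h2] := Oz.
    by rewrite wuz; [rewrite !indicE !mem_set// !mul1r|exact: Omega_Qplus].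
  rewrite !indicE -natrM mulnb -in_setX.
  by rewrite (negbTE hz) mul0r.
rewrite (Rint_leb2 i1 i2 bF) /box.
apply: Rint_ae_le; first exact: igr_box.
  by apply: (igrM i1); apply: bmf_Rint_leb.
have FF := ae_filter_ringOfSetsType leb.
apply: filterS (ae_neq 0) => t t0.
have ir : igr leb (fun x => \1_I2 x * F (t, x)) by apply: (igrM i2); exact: bmf_row.
apply: ler_pM.
- exact: indic_itv_ge0.
- by apply: Rint_ge0 => x; apply: mulr_ge0 => //; exact: indic_itv_ge0.
- rewrite /I1 !indic_itvE !in_itv/= ler_nat; case: (boolP (0 <= t <= T)) => // /andP[h1 h2].
  by rewrite (_ : (0 < t < T + 1) = true)//; apply/andP; split; [rewrite lt_neqAle eq_sym t0|lra].
apply: Rint_le => //; first exact: igr_box_row.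
move=> x; apply: ler_wpM2r => //.
rewrite /I2 !indic_itvE !in_itv/= ler_nat; case: (boolP (- X <= x <= X)) => // /andP[h1 h2].
by rewrite (_ : (- (X + 1) < x < X + 1) = true)//; apply/andP; split; lra.
Qed.

Lemma box_cvg (D : nat -> nldata R) (w : nat -> R * R -> R) (u a : R * R -> R) : bmf a ->
  measurable_fun Qplus u -> (forall k, measurable_fun Qplus (w k)) ->
  {ae leb2, forall z, Qplus z -> u z = a z} ->
  (forall k, {ae leb, forall t, 0 <= t -> forall x, w k (t, x) = Wn (D k) (t, x)}) ->
  cvg_L1loc_Qplus w u ->
  forall e, 0 < e -> exists n, forall k, (n <= k)%N -> box T X (fun z => `|Wn (D k) z - a z|) <= e.
Proof.
move=> ba mu mw ua wW /(_ _ Omega_open Omega_bounded Omega_Qplus) /fine_cvgP[_ cw] e e0.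
have /cvgrPdist_le /(_ _ e0) [n _ hn] := cw.
exists n => k nk; have := hn k nk.
rewrite /= sub0r normrN => h; apply: le_trans h; apply: le_trans (ler_norm _).
apply: box_le_Omega => //; first by apply/bmf_norm/bmfB => //; exact: bWn.
have FF := ae_filter_ringOfSetsType leb2.
apply: filterS2 ua (ae_fst (wW k)) => -[t x] /= uz wz t0.
by rewrite wz// uz.
Qed.

End box_convergence.

(** * Test functions: bounds and supports *)

Section test_function_bounds.
Variable R : realType.

Lemma continuous_bounded_supp (f : R * R -> R) B : continuous f ->
  (forall z, B < `|z| -> f z = 0) -> exists C, forall z, `|f z| <= C.
Proof.
move=> cf fB.
have cK : compact (`[- B, B]%classic `*` `[- B, B]%classic : set (R * R)).
  by apply: compact_setX; exact: segment_compact.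
have cfK : compact (f @` (`[- B, B]%classic `*` `[- B, B]%classic)).
  by apply: continuous_compact => //; exact: continuous_subspaceT.
have [M [_ hM]] := compact_bounded cfK.
exists (`|M| + 1) => z; have [zB|Bz] := leP `|z| B.
  apply: (hM (`|M| + 1)); first by apply: le_lt_trans (ler_norm M) _; rewrite ltrDl.
  exists z => //; move: zB; rewrite prod_normE ge_max => /andP[h1 h2].
  by split; rewrite /= in_itv/= -ler_norml.
by rewrite fB// normr0 addr_ge0.
Qed.

Lemma test_function_testf (phi : R * R -> R) : test_function phi ->
  (forall z, Qplus z -> 0 <= phi z) ->
  exists P : testf R, [/\ tf_f P = phi, tf_t P = Dt phi, tf_x P = Dx phi &
    forall z, tf_T P < z.1 \/ tf_X P < `|z.2| -> Dt phi z = 0 /\ Dx phi z = 0].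
Proof.
move=> [Cphi cK] phi0.
have [dphi [cDt cDx]] := Cphi 1%N.
have cphi : continuous phi := Cphi 0%N.
have [M [_ hM]] := compact_bounded cK.
pose B := `|M| + 1.
have B0 : 0 <= B by apply: addr_ge0.
have phiB z : B < `|z| -> phi z = 0.
  move=> hz; apply/eqP/negPn/negP => pz.
  have MB : M < B by apply: le_lt_trans (ler_norm M) _; rewrite ltrDl.
  have := hM B MB z (@subset_closure _ [set z | phi z != 0] z pz).
  by rewrite /= leNgt hz.
have zB t x : (B < `|t|) || (B < `|x|) -> B < `|(t, x)|.
  by rewrite prod_normE/= lt_max.
have Dt0 z : B < `|z| -> Dt phi z = 0.
  case: z => t x; rewrite prod_normE/= lt_max => /orP[h|h].
    apply: (dfn_zero_outside (a := - B) (b := B) (dfn_Dt x dphi)); last exact/lt_norm.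
    by move=> s hs; apply/phiB/zB; rewrite (_ : _ < _)//; exact/lt_norm.
  (* On this line [phi] vanishes identically; the endpoint [t + 1] only serves to place [t] in the
     region considered. *)
  apply: (dfn_zero_outside (a := t + 1) (b := 0) (dfn_Dt x dphi)); last by left; rewrite ltrDl.
  by move=> s _; apply/phiB/zB; rewrite h orbT.
have Dx0 z : B < `|z| -> Dx phi z = 0.
  case: z => t x; rewrite prod_normE/= lt_max => /orP[h|h]; last first.
    apply: (dfn_zero_outside (a := - B) (b := B) (dfn_Dx t dphi)); last exact/lt_norm.
    by move=> s hs; apply/phiB/zB; rewrite orbC (_ : _ < _)//; exact/lt_norm.
  apply: (dfn_zero_outside (a := x + 1) (b := 0) (dfn_Dx t dphi)); last by left; rewrite ltrDl.
  by move=> s _; apply/phiB/zB; rewrite h.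
have [C1 hC1] := continuous_bounded_supp cphi phiB.
have [C2 hC2] := continuous_bounded_supp cDt Dt0.
have [C3 hC3] := continuous_bounded_supp cDx Dx0.
pose C := Num.max C1 (Num.max C2 C3).
have h1 z : `|phi z| <= C by apply: le_trans (hC1 z) _; rewrite le_max lexx.
have h2 z : `|Dt phi z| <= C by apply: le_trans (hC2 z) _; rewrite !le_max lexx orbT.
have h3 z : `|Dx phi z| <= C by apply: le_trans (hC3 z) _; rewrite !le_max lexx !orbT.
have sec1 (f : R * R -> R) x : continuous f -> continuous (fun t => f (t, x)).
  move=> cf t; have cp : (s, x) @[s --> t] --> (t, x).
    by apply: (@cvg_pair _ _ _ (nbhs t) (nbhs t) (nbhs x)); [exact: cvg_id|exact: cvg_cst].
  exact: (cvg_comp _ _ cp (cf _)).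
have sec2 (f : R * R -> R) t : continuous f -> continuous (fun x => f (t, x)).
  move=> cf x; have cp : (t, y) @[y --> x] --> (t, x).
    by apply: (@cvg_pair _ _ _ (nbhs x) (nbhs t) (nbhs x)); [exact: cvg_cst|exact: cvg_id].
  exact: (cvg_comp _ _ cp (cf _)).
(* The box uses [B + 1] because [phi] vanishes where the norm is strictly above [B], whereas [testf]
   asks for it from the edge of the box onwards. *)
have B1 : 0 <= B + 1 by apply: addr_ge0.
have o1 t x : B + 1 <= t -> phi (t, x) = 0.
  move=> h; apply/phiB/zB; rewrite (_ : B < `|t|)//; apply: lt_le_trans (ler_norm t).
  by apply: lt_le_trans h; rewrite ltrDl.
have o2 t x : B + 1 <= `|x| -> phi (t, x) = 0.
  by move=> h; apply/phiB/zB; rewrite (lt_le_trans _ h) ?orbT// ltrDl.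
have g0 t x : 0 <= t -> 0 <= phi (t, x) by move=> t0; exact: phi0.
exists (TestF B1 B1 (fun x => dfn_Dt x dphi) (fun t => dfn_Dx t dphi)
  (fun x => sec1 _ x cDt) (fun t => sec2 _ t cDx) (measurable_continuous2 cphi)
  (measurable_continuous2 cDt) (measurable_continuous2 cDx) h1 h2 h3 o1 o2 g0); split => //= -[t x] /= tx.
have Bz : B < `|(t, x)|.
  apply: zB; case: tx => h; apply/orP; [left|right].
    by apply: lt_le_trans (ler_norm t); apply: lt_trans h; rewrite ltrDl.
  by apply: lt_trans h; rewrite ltrDl.
by split; [exact: Dt0|exact: Dx0].
Qed.

End test_function_bounds.

Section entropy_solution_box.
Variable R : realType.
Notation leb := (@lebesgue_measure R).
Notation leb2 := (@lebesgue_measure R \x @lebesgue_measure R)%E.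

(** The substitution [y = eps * z] moves the scale from the kernel to the weight, where
    [scaled_mass_cvg] applies. *)
Lemma scaled_kernel_min (eta : R -> R) eps : eta \in Lfun leb 1%E -> 0 < eps ->
  \int[leb]_y (scaled_kernel eta eps y * Num.min 1 `|y|) =
  \int[leb]_z (half_kernel eta z * Num.min 1 `|eps * z|).
Proof.
move=> eL1 eps0; have ih := igr_half_kernel eL1.
have bm : bmf (fun z : R => Num.min 1 `|eps * z|).
  split.
    apply: measurable_minr; first exact: measurable_cst.
    apply: measurableT_comp; first exact: normr_measurable.
    exact: measurable_funM.
  by exists 1 => z; rewrite ger0_norm ?ge_min ?lexx// le_min ler01 normr_ge0.
have epsV : 0 < eps^-1 by rewrite invr_gt0.
have i1 := igrM ih bm; have := Rint_scale epsV i1; rewrite invrK => E.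
have -> : \int[leb]_y (scaled_kernel eta eps y * Num.min 1 `|y|) =
    \int[leb]_y (eps^-1 * (half_kernel eta (eps^-1 * y) * Num.min 1 `|eps * (eps^-1 * y)|)).
  by apply: eq_Rintegral => y _; rewrite mulVKf ?gt_eqF// mulrA.
by rewrite RintZ ?E ?mulKf ?gt_eqF//; exact: (igr_scale epsV i1).
Qed.

Lemma Rint_Qplus_box (G F : R * R -> R) (T X : R) : bmf F -> measurable_fun Qplus G ->
  {ae leb2, forall z, Qplus z -> G z = F z} ->
  (forall z, T < z.1 \/ X < `|z.2| -> F z = 0) ->
  \int[leb2]_(z in Qplus) G z = box T X F.
Proof.
move=> bF mG GF F0.
rewrite /box -(Rint_leb2 (igr_itv 0 T) (igr_itv (- X) X) bF) Rintegral_mkcond.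
apply: Rint_ae_eq.
- exact: (iffLR (measurable_restrictT G (@measurable_Qplus R)) mG).
- exact: (igr_meas (igrM (igr_leb2 (igr_itv 0 T) (igr_itv (- X) X)) bF)).
have FF := ae_filter_ringOfSetsType leb2.
apply: filterS GF => z Gz; rewrite patchE; case: ifPn => hz.
  have Qz : Qplus z by rewrite inE in hz.
  rewrite (Gz Qz) !indic_itvE !in_itv/= -ler_norml (_ : (0 <= z.1) = true)//=.
  have [zT|zT] := leP z.1 T; last by rewrite F0 ?mulr0//; left.
  have [zX|zX] := leP `|z.2| X; last by rewrite F0 ?mulr0//; right.
  by rewrite !mul1r.
have nz : (0 <= z.1) = false by apply/negbTE/negP => h; move/negP: hz; apply; rewrite inE.
by rewrite !indic_itvE !in_itv/= nz !mul0r.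
Qed.

End entropy_solution_box.

Theorem theorem1p2 (R : realType) (u0 V eta : R -> R)
    (u0_Linfty : u0 \in Lfun leb +oo%E)
    (u0_01 : {ae leb, forall x, 0 <= u0 x <= 1})
    (V_lip : lipschitz V)
    (V_decr : {ae leb, forall x : R, x \in `[0, 1] ->
                derivable V x 1 /\ V^`()%classic x <= 0})
    (eta_L1 : eta \in Lfun leb 1%E)
    (eta_Linfty : eta \in Lfun leb +oo%E)
    (eta_supp : closure [set x | eta x != 0] `<=` `]-oo, 0])
    (eta_ge0 : forall x, 0 <= eta x)
    (* [eta] is a class in L^1 and L^oo: its value at 0 is immaterial *)
    (eta_ndecr : {in `]-oo, 0[ &, {homo eta : x y / x <= y}})
    (eta_mass : \int[leb]_(x in `]-oo, 0]) eta x = 1)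
    (u_ : R -> R * R -> R)
    (u_sol : forall eps, 0 < eps -> nonlocal_solution V eta u0 eps (u_ eps))
    (eps_ : nat -> R)
    (eps_gt0 : forall k, 0 < eps_ k)
    (eps_cvg0 : eps_ k @[k --> \oo] --> (0 : R))
    (u : R * R -> R)
    (u_Linfty : Linfty_Qplus u)
    (w_cvg : cvg_L1loc_Qplus
               (fun k => convx (u_ (eps_ k)) (rescale eta (eps_ k))) u) :
  entropy_solution V u0 u.
Proof.
have [L L0 VL] : exists2 L, 0 <= L & forall x y, `|V x - V y| <= L * `|x - y|.
  have [M [_ hM]] := V_lip.
  exists (`|M| + 1); first exact: addr_ge0.
  move=> x y; have M1 : M < `|M| + 1 by apply: le_lt_trans (ler_norm M) _; rewrite ltrDl.
  exact: (hM _ M1 (x, y)).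
have cV := lipschitz_cts L0 VL.
(* The assumption on the derivative holds almost everywhere; the Lipschitz bound turns it into
   monotonicity of [V] on [0, 1]. *)
have VD x y : 0 <= x -> x <= y -> y <= 1 -> V y <= V x.
  move=> x0 xy y1; apply: (lipschitz_ae_nonincreasing L0 VL) => //.
  have FF := ae_filter_ringOfSetsType (@lebesgue_measure R).
  apply: filterS V_decr => z h; rewrite in_itv/= => /andP[xz zy].
  by apply: h; rewrite in_itv/= (le_trans x0 xz) (le_trans zy y1).
have data k := nonlocal_data eta_L1 eta_Linfty eta_supp eta_ge0 eta_ndecr eta_mass
  u0_Linfty u0_01 L0 VL VD (eps_gt0 k) (u_sol _ (eps_gt0 k)).
have [D HD] := choice data.
(* The limit is replaced by a bounded representative [a]; the integrals over [Qplus] see no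
   difference. *)
have [mu [a ba ua]] := Lfun_oo_representative u_Linfty.
have FF := ae_filter_ringOfSetsType (@lebesgue_measure R \x @lebesgue_measure R)%E.
have {}ua : {ae (@lebesgue_measure R \x @lebesgue_measure R)%E, forall z, Qplus z -> u z = a z}.
  by apply: filterS ua => z <- Qz; rewrite patchE ifT// inE.
have muQ : measurable_fun Qplus u by exact: (iffRL (measurable_restrictT u (@measurable_Qplus R)) mu).
split => // c phi tphi phi0.
have [P [Pf Pt Px Pout]] := test_function_testf tphi phi0.
have mphi : measurable_fun setT phi by rewrite -Pf; exact: tf_m.
have bt : bmf (Dt phi) by rewrite -Pt; split; [exact: tf_mt|exists (tf_C P); exact: tf_let].
have bx : bmf (Dx phi) by rewrite -Px; split; [exact: tf_mx|exists (tf_C P); exact: tf_lex].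
have cQ : continuous (Qk V c) by exact: continuous_Qk.
have bF : bmf (fun z => `|a z - c| * Dt phi z + Qk V c (a z) * Dx phi z).
  have [N hN] := ba.2; apply: bmfD; apply: bmfM => //.
    by apply/bmf_norm/bmfB => //; exact: bmf_cst.
  exact: (bmf_comp_bounded ba hN).
have E1 : \int[(@lebesgue_measure R \x @lebesgue_measure R)%E]_(z in Qplus)
    (`|u z - c| * Dt phi z + Num.sg (u z - c) * (V (u z) * u z - V c * c) * Dx phi z) =
    box (tf_T P) (tf_X P) (fun z => `|a z - c| * tf_t P z + Qk V c (a z) * tf_x P z).
  rewrite Pt Px; apply: Rint_Qplus_box => //.
  - have mQ := @measurable_Qplus R.
    apply: measurable_funD; apply: measurable_funM.
    + apply: measurableT_comp => //; apply: measurable_funB => //; exact: measurable_cst.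
    + by apply: measurable_funS measurableT _ _ => //; case: bt.
    + exact: (measurableT_comp (continuous_measurable_fun cQ) muQ).
    + by apply: measurable_funS measurableT _ _ => //; case: bx.
  - by apply: filterS ua => z uz Qz; rewrite uz.
  - by move=> z /Pout[-> ->]; rewrite !mulr0 addr0.
have E2 : \int[@lebesgue_measure R]_x (`|u0 x - c| * phi (0, x)) =
    \int[@lebesgue_measure R]_x (\1_`[- tf_X P, tf_X P] x * (`|clamp01 u0 x - c| * tf_f P (0, x))).
  have mp : measurable_fun setT (fun x : R => phi (0, x)).
    exact: (measurableT_comp mphi (measurable_pair1 (0 : R))).
  rewrite Pf; apply: Rint_ae_eq.
  - apply: measurable_funM => //; apply: measurableT_comp => //.
    by apply: measurable_funB; [exact: (mu0 u0_Linfty)|exact: measurable_cst].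
  - apply: measurable_funM; first exact: mindic_itv.
    apply: measurable_funM => //; apply: measurableT_comp => //.
    by apply: measurable_funB; [exact: (measurable_clamp01 u0_Linfty)|exact: measurable_cst].
  have FF1 := ae_filter_ringOfSetsType (@lebesgue_measure R).
  apply: filterS (clamp01_ae u0_01) => x <-; rewrite indic_itvE in_itv/= -ler_norml.
  have [xX|xX] := leP `|x| (tf_X P); first by rewrite mul1r.
  by rewrite -Pf tf_outX ?mulr0// ltW.
(* What remains is the convergence of [Wn (D k)] on the box enlarged by 1, supplied by the
   hypothesis on [w_cvg], and the concentration of the rescaled kernels at 0. *)
rewrite E1 E2; apply: (@kruzhkov_limit _ D V (clamp01 u0) L c P a) => //.
- by move=> k; have [[]] := HD k.
- by move=> k; have [[]] := HD k.
- by move=> k; have [[]] := HD k.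
- have mw k : measurable_fun Qplus (convx (u_ (eps_ k)) (rescale eta (eps_ k))).
    exact: (measurable_convx_Qplus eta_L1 (eps_gt0 k) (u_sol _ (eps_gt0 k))).
  have wW k : {ae @lebesgue_measure R, forall t, 0 <= t -> forall x,
      convx (u_ (eps_ k)) (rescale eta (eps_ k)) (t, x) = Wn (D k) (t, x)} by have [] := HD k.
  exact: (box_cvg _ _ ba muQ mw ua wW w_cvg).
have ih := igr_half_kernel eta_L1.
move=> e e0; have [n hn] := scaled_mass_cvg ih (half_kernel_ge0 eta_ge0) eps_gt0 eps_cvg0 e0.
exists n => k nk; have [_ _ _ -> _] := HD k.
by rewrite scaled_kernel_min//; exact: hn.
Qed.
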